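(* Let $p\in\left(\frac{2n}{n+\alpha},\infty\right]$, let $M\subset\mathbb{R}^m$ be nonempty, compact and convex, and let $\mathcal{W}=\{w\in L^p(\Omega,\mathbb{R}^m): w(x)\in M \text{ for a.e. } x\in\Omega\}$. Let $$G(x,u,v,w)=G^1(x,u,v)+G^2(x,u,v)\,w,\qquad G^1:\Omega\times\mathbb{R}^2\to\mathbb{R},\quad G^2:\Omega\times\mathbb{R}^2\to\mathbb{R}^m,\quad w\in\mathbb{R}^m,$$ and for $w\in\mathcal{W}$ define on $\mathbb{H}_0^{\alpha/2}=H_0^{\alpha/2}(\Omega)\times H_0^{\alpha/2}(\Omega)$ $$F_w(u,v)=\int_\Omega\Big(\tfrac12|(-\Delta)^{\alpha/4}v(x)|^2-\tfrac12|(-\Delta)^{\alpha/4}u(x)|^2+G(x,u(x),v(x),w(x))\Big)dx .$$ Assume: (A1') $G^1,G^1_u,G^1_v,G^2,G^2_u,G^2_v$ are measurable in $x$ for every $(u,v)\in\mathbb{R}^2$ and continuous in $(u,v)$ for a.e. $x\in\Omega$. (A2') If $p<\infty$: there are $s\in\left(1+\frac1{p-1},2^*_\alpha\right)$ and $c>0$ such that, for $z\in\{u,v\}$, $|G^1_z(x,u,v)|\le c(1+|u|^{s-1}+|v|^{s-1})$ and $|G^2_z(x,u,v)|\le c(1+|u|^{s-1-s/p}+|v|^{s-1-s/p})$ for a.e. $x\in\Omega$ and all $u,v\in\mathbb{R}$. If $p=\infty$: there are $s\in(1,2^*_\alpha)$ and $c>0$ such that, for $z\in\{u,v\}$ and $i\in\{1,2\}$,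 $|G^i_z(x,u,v)|\le c(1+|u|^{s-1}+|v|^{s-1})$ for a.e. $x\in\Omega$ and all $u,v\in\mathbb{R}$. (A3) For every $u\in H_0^{\alpha/2}(\Omega)$ there exist $b\in\mathbb{R}$ with $\rho_1^{\alpha/2}>2b$, $\beta_1\in L^2(\Omega)$, $\gamma_1\in L^1(\Omega)$ such that $G(x,u(x),v,w)\ge -b|v|^2-\beta_1(x)v-\gamma_1(x)$ for all $v\in\mathbb{R}$, $w\in M$ and a.e. $x\in\Omega$. (A4) For every $v\in H_0^{\alpha/2}(\Omega)$ there exist $B\in\mathbb{R}$ with $\rho_1^{\alpha/2}>2B$, $\beta_2\in L^2(\Omega)$, $\gamma_2\in L^1(\Omega)$ such that $G(x,u,v(x),w)\le B|u|^2+\beta_2(x)u+\gamma_2(x)$ for all $u\in\mathbb{R}$, $w\in M$ and a.e. $x\in\Omega$. (A5) For every $w\in\mathcal{W}$, $F_w(\cdot,v)$ is concave for every $v\in H_0^{\alpha/2}(\Omega)$ and $F_w(u,\cdot)$ is convex for every $u\in H_0^{\alpha/2}(\Omega)$. Let $\theta:\Omega\times\mathbb{R}^{4+m}\to\mathbb{R}$, $\theta=\theta(x,u,\xi,v,\zeta,w)$, satisfy: (A6) $\theta$ is measurable in $x$ for all $(u,\xi,v,\zeta,w)\in\mathbb{R}^4\times M$, continuous in $(u,\xi,v,\zeta,w)$ for a.e. $x\in\Omega$, and convex in $w$ for all $(u,\xi,v,\zeta)\in\mathbb{R}^4$ and a.e. $x\in\Omega$; moreover there are $c>0$ and some $s\in(1,2^*_\alpha)$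 such that $|\theta(x,u,\xi,v,\zeta,w)|\le c(1+|u|^s+|\xi|^2+|v|^s+|\zeta|^2)$ for a.e. $x\in\Omega$, all $u,\xi,v,\zeta\in\mathbb{R}$ and $w\in M$. (A7) There are $\eta\in L^1(\Omega)$ and $C>0$ such that $\theta(x,u,\xi,v,\zeta,w)\ge\eta(x)-C(|u|+|\xi|+|v|+|\zeta|+|w|)$ for all $u,\xi,v,\zeta\in\mathbb{R}$, $w\in M$ and a.e. $x\in\Omega$. Let $$J(u,v,w)=\int_\Omega\theta\big(x,u(x),(-\Delta)^{\alpha/4}u(x),v(x),(-\Delta)^{\alpha/4}v(x),w(x)\big)dx$$ and let $\mathcal{D}$ be the set of all $(u,v,w)\in\mathbb{H}_0^{\alpha/2}\times\mathcal{W}$ such that $(u,v)$ is a weak solution, for the control $w$, of the system $$-(-\Delta)^{\alpha/2}u+G_u(x,u,v,w)=0,\qquad (-\Delta)^{\alpha/2}v+G_v(x,u,v,w)=0\ \text{ in }\Omega,\qquad u=v=0\ \text{ on }\partial\Omega .$$ Then there exists $(u_{w^*},v_{w^*},w^* )\in\mathcal{D}$ such that $J(u_{w^*},v_{w^*},w^* )=\min_{(u,v,w)\in\mathcal{D}}J(u,v,w)$.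
   Context: Standing assumptions: $n\ge 3$, $\Omega\subset\mathbb{R}^n$ is a bounded domain with Lipschitz boundary, $\alpha\in(1,2)$, $2^*_\alpha=\frac{2n}{n-\alpha}$. Subscripts $u,v$ on $G,G^1,G^2$ denote partial derivatives. Let $(z_k,\rho_k)_{k\in\mathbb{N}}$ be the system of ($L^2(\Omega)$-orthonormal) eigenfunctions and eigenvalues of $-\Delta$ on $\Omega$ with homogeneous Dirichlet boundary condition; $\rho_1$ is the principal (smallest) eigenvalue. $H_0^{\alpha/2}(\Omega)$ is the space of functions $z=\sum_k a_kz_k$ with $\sum_k a_k^2\rho_k^{\alpha/2}<\infty$, with norm $\|z\|^2_{H_0^{\alpha/2}(\Omega)}=\sum_k a_k^2\rho_k^{\alpha/2}=\|(-\Delta)^{\alpha/4}z\|^2_{L^2(\Omega)}$, where the (spectral Dirichlet) fractional powers are $(-\Delta)^{\alpha/2}z=\sum_k a_k\rho_k^{\alpha/2}z_k$ and $(-\Delta)^{\alpha/4}z=\sum_k a_k\rho_k^{\alpha/4}z_k$. The space $\mathbb{H}_0^{\alpha/2}$ carries the norm $\|(u,v)\|^2=\|u\|^2_{H_0^{\alpha/2}(\Omega)}+\|v\|^2_{H_0^{\alpha/2}(\Omega)}$. A pair $(u,v)\in\mathbb{H}_0^{\alpha/2}$ is a weak solution of the system for the control $w$ if for all $(g,h)\in\mathbb{H}_0^{\alpha/2}$ $$-\int_\Omega(-\Delta)^{\alpha/4}u\,(-\Delta)^{\alpha/4}g\,dx+\int_\Omega G_u(x,u(x),v(x),w(x))\,g(x)\,dx=0,$$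 $$\int_\Omega(-\Delta)^{\alpha/4}v\,(-\Delta)^{\alpha/4}h\,dx+\int_\Omega G_v(x,u(x),v(x),w(x))\,h(x)\,dx=0 .$$ *)

(* Defs.v *)
From HB Require Import structures.
From mathcomp Require Import all_boot all_order all_algebra.
From mathcomp Require Import all_classical all_reals all_analysis.

Set Implicit Arguments.
Unset Strict Implicit.
Unset Printing Implicit Defensive.

Import Order.TTheory GRing.Theory Num.Theory.
Import numFieldNormedType.Exports.

Local Open Scope classical_set_scope.
Local Open Scope ring_scope.

Section lebesgue_measure_on_Rn.
Context {R : realType} {n : nat}.
Local Open Scope ereal_scope.
Implicit Types (c : option ('rV[R]_n * 'rV[R]_n)) (A : set 'rV[R]_n).

(* Half-open boxes; [None] is the empty box, so that the countable covers below
   may be finite in any dimension. *)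
Definition box c : set 'rV[R]_n :=
  if c is Some (a, b)
  then [set x | forall i, (a ord0 i < x ord0 i <= b ord0 i)%R] else set0.

Definition box_volume c : R :=
  if c is Some (a, b) then (\prod_i Num.max 0 (b ord0 i - a ord0 i))%R else 0%R.

Definition lebesgue_outer A : \bar R :=
  ereal_inf [set \sum_(k <oo) (box_volume (C k))%:E |
             C in [set C : nat -> _ | A `<=` \bigcup_k box (C k)]].

Lemma box_volume_ge0 c : 0 <= (box_volume c)%:E.
Proof.
rewrite lee_fin; case: c => [[a b]|//].
by apply: prodr_ge0 => i _; rewrite le_max lexx.
Qed.
Hint Resolve box_volume_ge0 : core.

Lemma lebesgue_outer_ge0 A : 0 <= lebesgue_outer A.
Proof. by apply: le_ereal_inf_tmp => x [C _ <-]; exact: nneseries_ge0. Qed.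

Lemma lebesgue_outer0 : lebesgue_outer set0 = 0.
Proof.
apply/eqP; rewrite eq_le lebesgue_outer_ge0 andbT.
apply: ereal_inf_lbound; exists (fun=> None) => //=.
by apply: lim_near_cst => //; near=> k => /=; rewrite big1.
Unshelve. all: by end_near. Qed.

Lemma le_lebesgue_outer : {homo lebesgue_outer : A B / A `<=` B >-> A <= B}.
Proof.
move=> A B AB; apply/ereal_inf_le_tmp => x [C BC <-].
by exists C => //; exact: subset_trans BC.
Qed.

Lemma lebesgue_outer_sigma_subadditive : sigma_subadditive lebesgue_outer.
Proof.
move=> A; have [[i ioo]|] := pselect (exists i, lebesgue_outer (A i) = +oo).
  rewrite (eseries_pinfty _ _ ioo) ?leey// => k _.
  by rewrite -ltNye (lt_le_trans _ (lebesgue_outer_ge0 _)).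
rewrite -forallNE => Aoo.
suff add2e (e : {posnum R}) : lebesgue_outer (\bigcup_k A k) <=
    \sum_(i <oo) lebesgue_outer (A i) + e%:num%:E.
  by apply/lee_addgt0Pr => _/posnumP[].
rewrite (le_trans _ (epsilon_trick _ _ _))//; last first.
  by move=> k; exact: lebesgue_outer_ge0.
pose P k (C : nat -> option ('rV[R]_n * 'rV[R]_n)) :=
  A k `<=` \bigcup_j box (C j) /\
  \sum_(j <oo) (box_volume (C j))%:E <=
    lebesgue_outer (A k) + (e%:num / (2 ^ k.+1)%:R)%:E.
have [G PG] : {G : nat -> nat -> option ('rV[R]_n * 'rV[R]_n) &
    forall k, P k (G k)}.
  apply: (@choice _ _ P) => k; rewrite /P /lebesgue_outer.
  set S := (X in ereal_inf X); move infS : (ereal_inf S) => iS.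
  case: iS infS => [r Sr|Soo|Soo].
  - have en1 : (0 < e%:num / (2 ^ k.+1)%:R)%R by [].
    have /(lb_ereal_inf_adherent en1) : ereal_inf S \is a fin_num by rewrite Sr.
    move=> [x [B AB muBx] xS].
    by exists B; split => //; rewrite muBx -Sr; exact/ltW.
  - by have := Aoo k; rewrite /lebesgue_outer Soo.
  - suff : lbound S 0 by move/le_ereal_inf_tmp; rewrite Soo.
    by move=> /= _ [B _ <-]; exact: nneseries_ge0.
pose v (ij : nat * nat) : \bar R := (box_volume (G ij.1 ij.2))%:E.
have v_ge0 ij : 0 <= v ij by exact: box_volume_ge0.
apply: (@le_trans _ _ (\esum_(i in setT) v i)).
  rewrite /lebesgue_outer; apply: ereal_inf_lbound => /=.
  have /card_esym/ppcard_eqP[f] := card_nat2.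
  exists (fun k => G (f k).1 (f k).2).
    move=> t [i _ /((PG i).1 t)[j _ tGij]].
    by exists (f^-1%FUN (i, j)) => //=; rewrite invK ?inE.
  rewrite -(esum_pred_image v _ xpredT) ?[fun=> _]set_true//.
  by rewrite image_eq.
rewrite (_ : esum _ _ =
    \sum_(i <oo) \sum_(j <oo) (box_volume (G i j))%:E); last first.
  pose J : nat -> set (nat * nat) := fun i => [set (i, j) | j in setT].
  rewrite (_ : setT = \bigcup_k J k); last first.
    by rewrite predeqE => -[a b]; split => // _; exists a => //; exists b.
  rewrite esum_bigcupT //=; last first.
    apply/trivIsetP => i j _ _ ij.
    rewrite predeqE => -[k m] /=; split => //= -[] [_] _ [<-{k} _].
    by move=> [m' _] [] /esym/eqP; rewrite (negbTE ij).
  rewrite -(image_id [set: nat]) -fun_true esum_pred_image//; last first.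
    by move=> k _; exact: esum_ge0.
  apply: eq_eseriesr => /= j _.
  rewrite -(esum_pred_image v (pair j) predT)//=; last first.
    by move=> ? ? _ _; exact: (@can_inj _ _ _ snd).
  by congr esum; rewrite predeqE => -[a b]; split; move=> [i _ <-]; exists i.
apply: lee_lim.
- by apply: is_cvg_nneseries => k *; exact: nneseries_ge0.
- apply: is_cvg_nneseries => k *; apply: adde_ge0 => //.
  exact: lebesgue_outer_ge0.
- by near=> k; apply: lee_sum => i _; exact: (PG i).2.
Unshelve. all: by end_near. Qed.

HB.instance Definition _ := isOuterMeasure.Build R 'rV[R]_n lebesgue_outer
  lebesgue_outer0 lebesgue_outer_ge0 le_lebesgue_outer
  lebesgue_outer_sigma_subadditive.

End lebesgue_measure_on_Rn.

(* 'rV[R]_n as a measurable space, with the sigma-algebra of all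
   Lebesgue-measurable (and not only Borel) sets. *)
Definition Rn (R : realType) (n : nat) : measurableType _ :=
  caratheodory_type (@lebesgue_outer R n).

Definition leb (R : realType) (n : nat) : set (Rn R n) -> \bar R :=
  @lebesgue_outer R n.
HB.instance Definition _ (R : realType) (n : nat) :=
  isMeasure.Build _ (Rn R n) R (@leb R n)
    (@caratheodory_measure0 R _ _) (@caratheodory_measure_ge0 R _ _)
    (@caratheodory_measure_sigma_additive R _ _).

Section euclidean.
Context {R : realType} {n : nat}.
Implicit Types (v w : 'rV[R]_n) (Omega : set 'rV[R]_n).

Definition dot v w : R := \sum_i v ord0 i * w ord0 i.
Definition enorm v : R := Num.sqrt (dot v v).

Definition bounded_domain Omega :=
  [/\ Omega !=set0, open Omega, connected Omega & bounded_set Omega].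

(* Near every boundary point, in suitable orthogonal coordinates, Omega is the
   strict epigraph of a Lipschitz function of the first n-1 coordinates. Here e
   is the unit vector of the last coordinate axis and [y - dot y e *: e] stands
   for the remaining coordinates of y; the values of gamma off the hyperplane
   orthogonal to e are not used. *)
Definition lipschitz_boundary Omega :=
  forall x, (closure Omega `\` Omega) x ->
  exists (e : 'rV[R]_n) (gamma : 'rV[R]_n -> R),
    [/\ dot e e = 1, lipschitz gamma &
        \forall y \near x, Omega y <-> gamma (y - dot y e *: e) < dot y e].

End euclidean.

Section function_spaces.
Context {R : realType} {n : nat}.
Variable Omega : set 'rV[R]_n.
Implicit Types (f g phi : 'rV[R]_n -> R) (p : \bar R).

Definition measurable_on f :=
  measurable_fun (Omega : set (Rn R n)) (f : Rn R n -> R).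

Definition ae_on (P : 'rV[R]_n -> Prop) :=
  {ae @leb R n, forall x : Rn R n, Omega x -> P x}.

Definition Lp p f := ((f \_ Omega : Rn R n -> R) \in Lfun (@leb R n) p).

Definition integ f : R := \int[@leb R n]_(x in Omega) f x.

Definition L2_cvg (F : nat -> 'rV[R]_n -> R) f :=
  (fun N => \int[@leb R n]_(x in Omega) ((F N x - f x) ^+ 2)%:E)%E @ \oo --> 0%E.

Definition partial (i : 'I_n) f : 'rV[R]_n -> R := 'D_(delta_mx ord0 i) f.

Definition test_function phi :=
  (forall s : seq 'I_n, continuous (foldr partial phi s) /\
     forall x i, derivable (foldr partial phi s) x (delta_mx ord0 i)) /\
  exists K, [/\ compact K, K `<=` Omega & forall x, ~ K x -> phi x = 0].

(* f belongs to the closure H^1_0 of the test functions in the H^1 norm, and D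
   is its weak gradient. *)
Definition H10 f (D : 'I_n -> 'rV[R]_n -> R) :=
  [/\ Lp 2%:E f, forall i, Lp 2%:E (D i) &
      exists phi : nat -> 'rV[R]_n -> R,
        [/\ forall k, test_function (phi k), L2_cvg phi f &
            forall i, L2_cvg (fun k => partial i (phi k)) (D i)]].

(* - Delta f = lambda f in Omega, f = 0 on the boundary, in the weak sense. *)
Definition dirichlet_eigenfunction (lambda : R) f :=
  exists2 D, H10 f D & forall phi, test_function phi ->
    \sum_i integ (fun x => D i x * partial i phi x) =
    lambda * integ (fun x => f x * phi x).

(* The last clause says that no eigenfunction is missing from the system: one
   that is orthogonal to all the z_k vanishes. *)
Definition dirichlet_eigensystem (z : nat -> 'rV[R]_n -> R) (rho : nat -> R) :=
  [/\ forall k, dirichlet_eigenfunction (rho k) (z k),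
      forall j k, integ (fun x => z j x * z k x) = (j == k)%:R,
      forall k, rho k <= rho k.+1 &
      forall lambda f, dirichlet_eigenfunction lambda f ->
        (forall k, integ (fun x => f x * z k x) = 0) -> ae_on (fun x => f x = 0)].

End function_spaces.

Section fractional.
Context {R : realType} {n : nat}.
Variables (Omega : set 'rV[R]_n) (z : nat -> 'rV[R]_n -> R) (rho : nat -> R).
Implicit Types (a : nat -> R) (f g : 'rV[R]_n -> R) (alpha s : R).

(* f = \sum_k a_k z_k in L^2(Omega) *)
Definition eigen_expansion a f :=
  Lp Omega 2%:E f /\ L2_cvg Omega (fun N x => \sum_(k < N) a k * z k x) f.

Definition Hfrac alpha f := exists a,
  eigen_expansion a f /\ cvgn (series (fun k => a k ^+ 2 * rho k `^ (alpha / 2))).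

(* A representative of the L^2 class (-Delta)^s f = \sum_k a_k rho_k^s z_k, where
   f = \sum_k a_k z_k. *)
Definition frac_laplacian s f : 'rV[R]_n -> R :=
  xget (fun=> 0) [set g | exists a,
    eigen_expansion a f /\ eigen_expansion (fun k => a k * rho k `^ s) g].

End fractional.

Section partial_derivatives.
Context {R : realType} {n : nat} {V : normedModType R}.
Variables (Omega : set 'rV[R]_n) (g : 'rV[R]_n -> R -> R -> V).

Definition d_u x u v : V := derive1 (fun t => g x t v) u.
Definition d_v x u v : V := derive1 (g x u) v.

Definition differentiable_uv := ae_on Omega (fun x => forall u v : R,
  derivable (fun t => g x t v : V) u 1 /\ derivable (g x u) v 1).

Definition growth_uv (N : V -> R) (c e : R) := ae_on Omega (fun x => forall u v : R,
  N (d_u x u v) <= c * (1 + `|u| `^ e + `|v| `^ e) /\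
  N (d_v x u v) <= c * (1 + `|u| `^ e + `|v| `^ e)).

End partial_derivatives.

Definition caratheodory_uv {R : realType} {n : nat} (Omega : set 'rV[R]_n)
    (g : 'rV[R]_n -> R -> R -> R) :=
  (forall u v, measurable_on Omega (fun x => g x u v)) /\
  ae_on Omega (fun x => continuous (fun q : R * R => g x q.1 q.2)).

(* A map into R^m is handled coordinatewise. *)
Definition caratheodory_uv_vec {R : realType} {n m : nat} (Omega : set 'rV[R]_n)
    (g : 'rV[R]_n -> R -> R -> 'rV[R]_m) :=
  forall i, caratheodory_uv Omega (fun x u v => g x u v ord0 i).

Section control_problem.
Context {R : realType} {n m : nat}.
Variables (Omega : set 'rV[R]_n) (z : nat -> 'rV[R]_n -> R) (rho : nat -> R).
Variables (alpha : R) (p : \bar R) (M : set 'rV[R]_m).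
Variables (G1 : 'rV[R]_n -> R -> R -> R) (G2 : 'rV[R]_n -> R -> R -> 'rV[R]_m).
Variable theta : 'rV[R]_n -> R -> R -> R -> R -> 'rV[R]_m -> R.

Local Notation H := (Hfrac Omega z rho alpha).
Local Notation fl := (frac_laplacian Omega z rho (alpha / 4)).

Definition critical_exponent : R := 2 * n%:R / (n%:R - alpha).

Definition controls : set ('rV[R]_n -> 'rV[R]_m) :=
  [set w : 'rV[R]_n -> 'rV[R]_m | (forall i, Lp Omega p (fun x => w x ord0 i))
                                  /\ ae_on Omega (fun x => M (w x))].

Definition G x u v (w : 'rV[R]_m) : R := G1 x u v + dot (G2 x u v) w.

Definition F (u v : 'rV[R]_n -> R) (w : 'rV[R]_n -> 'rV[R]_m) : R :=
  integ Omega (fun x => 2^-1 * `|fl v x| ^+ 2 - 2^-1 * `|fl u x| ^+ 2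
                        + G x (u x) (v x) (w x)).

Definition weak_solution (u v : 'rV[R]_n -> R) (w : 'rV[R]_n -> 'rV[R]_m) :=
  [/\ H u, H v & forall g h, H g -> H h ->
    - integ Omega (fun x => fl u x * fl g x)
      + integ Omega (fun x => derive1 (fun t => G x t (v x) (w x)) (u x) * g x) = 0 /\
    integ Omega (fun x => fl v x * fl h x)
      + integ Omega (fun x => derive1 (fun t => G x (u x) t (w x)) (v x) * h x) = 0].

Definition admissible (u v : 'rV[R]_n -> R) (w : 'rV[R]_n -> 'rV[R]_m) :=
  controls w /\ weak_solution u v w.

Definition J (u v : 'rV[R]_n -> R) (w : 'rV[R]_n -> 'rV[R]_m) : R :=
  integ Omega (fun x => theta x (u x) (fl u x) (v x) (fl v x) (w x)).

Definition A1 :=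
  [/\ differentiable_uv Omega G1, differentiable_uv Omega G2,
      [/\ caratheodory_uv Omega G1, caratheodory_uv Omega (d_u G1)
        & caratheodory_uv Omega (d_v G1)]
    & [/\ caratheodory_uv_vec Omega G2, caratheodory_uv_vec Omega (d_u G2)
        & caratheodory_uv_vec Omega (d_v G2)]].

(* [r] is the exponent p when it is finite. *)
Definition A2 :=
  (forall r : R, p = r%:E -> exists s c : R,
     [/\ 1 + (r - 1)^-1 < s < critical_exponent, 0 < c,
         growth_uv Omega G1 Num.norm c (s - 1)
       & growth_uv Omega G2 enorm c (s - 1 - s / r)]) /\
  (p = +oo%E -> exists s c : R,
     [/\ 1 < s < critical_exponent, 0 < c,
         growth_uv Omega G1 Num.norm c (s - 1)
       & growth_uv Omega G2 enorm c (s - 1)]).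

Definition A3 := forall u, H u ->
  exists (b : R) (beta gamma : 'rV[R]_n -> R),
    [/\ rho 0 `^ (alpha / 2) > 2 * b, Lp Omega 2%:E beta, Lp Omega 1%:E gamma &
        forall (v : R) w, M w -> ae_on Omega (fun x =>
          G x (u x) v w >= - b * `|v| ^+ 2 - beta x * v - gamma x)].

Definition A4 := forall v, H v ->
  exists (B : R) (beta gamma : 'rV[R]_n -> R),
    [/\ rho 0 `^ (alpha / 2) > 2 * B, Lp Omega 2%:E beta, Lp Omega 1%:E gamma &
        forall (u : R) w, M w -> ae_on Omega (fun x =>
          G x u (v x) w <= B * `|u| ^+ 2 + beta x * u + gamma x)].

Definition A5 := forall w, controls w ->
  (forall v, H v ->
     @convex_function R ('rV[R]_n -> R^o) H (fun u => - F u v w)) /\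
  (forall u, H u ->
     @convex_function R ('rV[R]_n -> R^o) H (fun v => F u v w)).

Definition A6 :=
  [/\ forall u xi v zeta w, M w ->
        measurable_on Omega (fun x => theta x u xi v zeta w),
      ae_on Omega (fun x =>
        {within [set q : R * R * R * R * 'rV[R]_m | M q.2],
         continuous (fun q => theta x q.1.1.1.1 q.1.1.1.2 q.1.1.2 q.1.2 q.2)}),
      forall u xi v zeta, ae_on Omega (fun x =>
        @convex_function R 'rV[R]_m M (theta x u xi v zeta))
    & exists s c : R, [/\ 1 < s < critical_exponent, 0 < c
      & ae_on Omega (fun x => forall u xi v zeta w, M w ->
          `|theta x u xi v zeta w| <=
          c * (1 + `|u| `^ s + `|xi| ^+ 2 + `|v| `^ s + `|zeta| ^+ 2))]].

Definition A7 := exists (eta : 'rV[R]_n -> R) (C : R),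
  [/\ Lp Omega 1%:E eta, 0 < C
    & forall u xi v zeta w, M w -> ae_on Omega (fun x =>
        theta x u xi v zeta w >=
        eta x - C * (`|u| + `|xi| + `|v| + `|zeta| + enorm w))].

End control_problem.

(* Main.v *)
(* Expanding u in the eigenfunctions and putting x_k = a_k rho_k^(alpha/4)
   identifies H_0^(alpha/2) with l^2, the norm of (-Delta)^(alpha/4) u being that
   of x; weak convergence is bounded coordinatewise convergence. Translates of
   finite sums of eigenfunctions (extended by zero) satisfy
   |f(. + t) - f|_2^2 <= C |t|^alpha |x|^2, and comparing f with its averages over
   dyadic cubes turns this into the compact embedding into L^r for subcritical r.
   Hence the integral of G(x, u, v, w) is weakly continuous in (u, v), uniformly
   in w, and by (A5) the weak solutions are exactly the saddle points of F_w.

   Along a minimizing sequence the saddle points (u_k, v_k) converge weakly to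
   some (u, v), and convex combinations of the controls converge a.e. to some w.
   The saddle inequality is affine in the control, so it survives the passage to
   these combinations and to the limit, and (u, v) is a saddle point of F_w.
   Testing it with (u, v) itself shows that the norms converge. So
   (-Delta)^(alpha/4) u_k and (-Delta)^(alpha/4) v_k converge strongly, and the
   convexity of theta in w gives J(u, v, w) <= lim J(u_k, v_k, w_k). *)

Require Import Defs.
From mathcomp Require Import all_boot all_order all_algebra.
From mathcomp Require Import all_classical all_reals all_analysis.
From mathcomp Require Import measurable_realfun.
From mathcomp Require Import ring lra zify.
Import Order.TTheory GRing.Theory Num.Theory.
Import numFieldNormedType.Exports.
Local Open Scope classical_set_scope.
Local Open Scope ring_scope.
Set Implicit Arguments.
Unset Strict Implicit.
Unset Printing Implicit Defensive.

(** * Integrals of real functions *)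

(** The spectral norm involves no difference quotients, so translates are estimated through the
    gradients of the eigenfunctions: a shift of size tau costs rho_k tau^2 for frequencies with
    rho_k tau^2 <= 1 and a constant for the others, and both are at most a constant times (rho_k
    tau^2)^(alpha/2). When the side of the cubes is halved, the averages then change in L^r by
    amounts bounded by a geometric sequence, whose ratio is below 1 exactly for r < 2n/(n - alpha).
    Concavity and convexity in (A5) are not strict, so maximizers of F_w(., v) need not be unique; a
    small multiple of the squared norm of u is subtracted to obtain a saddle point and then sent to
    0. Nothing forces the controls themselves to converge, so every estimate on the states must be
    uniform in the control. The states are replaced by their limit while the controls are still the
    original ones; convex combinations are formed only afterwards, at a fixed state. They are chosen
    with almost minimal L^2 norm among combinations of a tail, which makes them a Cauchy
    sequence. *)

Lemma cvg_EFin_seq (R : realType) (u : nat -> R) (l : R) :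
  u @ \oo --> l -> (fun n => (u n)%:E) @ \oo --> l%:E.
Proof. by move=> h; apply/fine_cvgP; split; first exact: nearW. Qed.

Section real_integral.
Context d (T : measurableType d) (R : realType).
Variables (mu : {measure set T -> \bar R}) (D : set T) (mD : measurable D).
Implicit Types (f g h : T -> R) (P Q : T -> Prop).

Definition L1 f := mu.-integrable D (EFin \o f).
(** [Int] is the [fine] of the extended integral and so takes the value 0 when that integral is
    infinite; the linear rules below therefore ask for [L1]. *)
Definition Int f := Rintegral mu D f.
Definition ae P := {ae mu, forall x, D x -> P x}.

Lemma ae_mp P Q : (forall x, D x -> P x -> Q x) -> ae P -> ae Q.
Proof. by rewrite /ae => PQ; apply: filterS => x Px Dx; apply: PQ => //; apply: Px. Qed.

Lemma ae_mp2 P P' Q : (forall x, D x -> P x -> P' x -> Q x) ->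
  ae P -> ae P' -> ae Q.
Proof.
by rewrite /ae => PQ; apply: filterS2 => x Px Px' Dx; apply: PQ => //; [apply: Px|apply: Px'].
Qed.

Lemma aeP P : (forall x, D x -> P x) -> ae P.
Proof. by move=> h; rewrite /ae; apply: aeW => x; apply: h. Qed.

Lemma ae_all (P : nat -> T -> Prop) : (forall n, ae (P n)) -> ae (fun x => forall n, P n x).
Proof.
rewrite /ae => h; have := @ae_foralln _ _ _ mu (fun n x => D x -> P n x) h.
by apply: filterS => x hx Dx n; apply: hx.
Qed.

(** Countably many null sets are merged through [pickle]. This is how hypotheses whose null set
    depends on real arguments get a common one: the arguments are restricted to dyadic values and
    recovered by continuity. *)
Lemma ae_allc (I : countType) (P : I -> T -> Prop) :
  (forall i, ae (P i)) -> ae (fun x => forall i, P i x).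
Proof.
move=> h.
have : ae (fun x => forall n, if unpickle n is Some i then P i x else True).
  by apply: ae_all => n; case: unpickle => [i|]; [exact: h|exact: aeP].
by apply: ae_mp => x _ hx i; have := hx (pickle i); rewrite pickleK.
Qed.

Lemma L1_meas f : L1 f -> measurable_fun D f.
Proof. by move=> /integrableP[/measurable_EFinP]. Qed.

Lemma L1_EFin f : L1 f -> (\int[mu]_(x in D) (f x)%:E)%E = (Int f)%:E.
Proof. by move=> lf; rewrite /Int /Rintegral fineK//; exact: (integrable_fin_num mD lf). Qed.

Lemma L1_fin f : measurable_fun D f -> (forall x, D x -> 0 <= f x) ->
  (\int[mu]_(x in D) (f x)%:E < +oo)%E -> L1 f.
Proof.
move=> mf f0 fi; apply/integrableP; split; first exact/measurable_EFinP.
rewrite (_ : (\int[mu]_(x in D) _)%E = (\int[mu]_(x in D) (f x)%:E)%E)//.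
by apply: eq_integral => x /set_mem Dx /=; rewrite ger0_norm ?f0.
Qed.

Lemma L1D f g : L1 f -> L1 g -> L1 (fun x => f x + g x).
Proof. by move=> lf lg; have := integrableD mD lf lg; apply: eq_integrable. Qed.

Lemma L1Z k f : L1 f -> L1 (fun x => k * f x).
Proof. by move=> lf; have := integrableZl mD k lf; apply: eq_integrable. Qed.

Lemma L1N f : L1 f -> L1 (fun x => - f x).
Proof.
move=> lf; have := L1Z (-1) lf; rewrite /L1; apply: eq_integrable => //= x _.
by rewrite mulN1r.
Qed.

Lemma L1B f g : L1 f -> L1 g -> L1 (fun x => f x - g x).
Proof. by move=> lf lg; apply: L1D => //; apply: L1N. Qed.

Lemma L10 : L1 (fun=> 0).
Proof. exact: integrable0. Qed.

Lemma L1_sum (I : Type) (s : seq I) (F : I -> T -> R) :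
  (forall i, L1 (F i)) -> L1 (fun x => \sum_(i <- s) F i x).
Proof.
move=> h; elim: s => [|i s ih].
  by rewrite (_ : (fun _ => _) = fun=> 0) ?funeqE//; [exact: L10|move=> x; rewrite big_nil].
rewrite (_ : (fun _ => _) = fun x => F i x + \sum_(j <- s) F j x).
  exact: L1D.
by rewrite funeqE => x; rewrite big_cons.
Qed.

Lemma L1_dom f g : measurable_fun D f -> L1 g -> ae (fun x => `|f x| <= g x) -> L1 f.
Proof.
move=> mf lg fg; apply/integrableP; split; first exact/measurable_EFinP.
have lg' := integrable_abse lg.
apply: (@le_lt_trans _ _ (\int[mu]_(x in D) `|(g x)%:E|)%E); last first.
  by case/integrableP : lg.
apply: ae_ge0_le_integral => //.
- by apply/measurableT_comp => //; exact/measurable_EFinP.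
- by apply/measurableT_comp => //; apply/measurable_EFinP; exact: L1_meas.
- by apply: ae_mp fg => x _ /= h; rewrite lee_fin (le_trans h)// ler_norm.
Qed.

Lemma L1_abs f : L1 f -> L1 (fun x => `|f x|).
Proof. by move=> lf; have := integrable_abse lf; apply: eq_integrable. Qed.

Lemma intD f g : L1 f -> L1 g -> Int (fun x => f x + g x) = Int f + Int g.
Proof. exact: RintegralD. Qed.

Lemma intB f g : L1 f -> L1 g -> Int (fun x => f x - g x) = Int f - Int g.
Proof. exact: RintegralB. Qed.

Lemma intZ k f : L1 f -> Int (fun x => k * f x) = k * Int f.
Proof. exact: RintegralZl. Qed.

Lemma intN f : L1 f -> Int (fun x => - f x) = - Int f.
Proof.
move=> lf; rewrite -mulN1r -intZ//; congr Int.
by rewrite funeqE => x; rewrite mulN1r.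
Qed.

Lemma int0 : Int (fun=> 0) = 0.
Proof. by rewrite /Int /Rintegral integral0_eq. Qed.

Lemma int_sum (I : Type) (s : seq I) (F : I -> T -> R) :
  (forall i, L1 (F i)) -> Int (fun x => \sum_(i <- s) F i x) = \sum_(i <- s) Int (F i).
Proof.
move=> h; elim: s => [|i s ih].
  rewrite big_nil -[RHS]int0; congr Int; rewrite funeqE => x; exact: big_nil.
rewrite big_cons -ih -intD//; last exact: L1_sum.
by congr Int; rewrite funeqE => x; rewrite big_cons.
Qed.

Lemma int_ge0_ae f : measurable_fun D f -> ae (fun x => 0 <= f x) -> 0 <= Int f.
Proof.
move=> mf f0; have -> : Int f = Int (fun x => `|f x|).
  rewrite /Int /Rintegral; congr fine; apply: ae_eq_integral => //.
  - exact/measurable_EFinP.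
  - by apply/measurable_EFinP; exact: measurableT_comp.
  - by apply: ae_mp f0 => x _ h; rewrite ger0_norm.
exact: Rintegral_ge0.
Qed.

Lemma le_int_ae f g : L1 f -> L1 g -> ae (fun x => f x <= g x) -> Int f <= Int g.
Proof.
move=> lf lg fg; rewrite -subr_ge0 -intB//; apply: int_ge0_ae.
  exact: L1_meas (L1B lg lf).
by apply: ae_mp fg => x _; rewrite subr_ge0.
Qed.

Lemma le_int f g : L1 f -> L1 g -> (forall x, D x -> f x <= g x) -> Int f <= Int g.
Proof. by move=> lf lg fg; apply: le_int_ae => //; exact: aeP. Qed.

Lemma eq_int_ae f g : measurable_fun D f -> measurable_fun D g ->
  ae (fun x => f x = g x) -> Int f = Int g.
Proof.
move=> mf mg fg; rewrite /Int /Rintegral; congr fine; apply: ae_eq_integral => //.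
- exact/measurable_EFinP.
- exact/measurable_EFinP.
- by apply: ae_mp fg => x _ ->.
Qed.

Lemma eq_int f g : (forall x, D x -> f x = g x) -> Int f = Int g.
Proof. by move=> fg; apply: eq_Rintegral => x /set_mem; exact: fg. Qed.

Lemma eq_L1 f g : (forall x, D x -> f x = g x) -> L1 f -> L1 g.
Proof. by move=> fg; apply: eq_integrable => //= x /set_mem Dx; rewrite fg. Qed.

Lemma abs_int f : L1 f -> `|Int f| <= Int (fun x => `|f x|).
Proof. exact: le_normr_Rintegral. Qed.

Lemma int_abs_le f g : L1 f -> L1 g -> ae (fun x => `|f x| <= g x) -> `|Int f| <= Int g.
Proof.
move=> lf lg fg; apply: (le_trans (abs_int lf)).
by apply: le_int_ae => //; exact: L1_abs.
Qed.

Lemma dct (F : nat -> T -> R) f g : (forall n, measurable_fun D (F n)) ->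
  measurable_fun D f -> L1 g -> ae (fun x => F ^~ x @ \oo --> f x) ->
  (forall n, ae (fun x => `|F n x| <= g x)) ->
  L1 f /\ (fun n => Int (F n)) @ \oo --> Int f.
Proof.
move=> mF mf lg Ff Fg.
have [] := @dominated_convergence _ _ _ mu D mD (fun n => EFin \o F n) (EFin \o f) (EFin \o g).
- by move=> n; exact/measurable_EFinP.
- exact/measurable_EFinP.
- by apply: ae_mp Ff => x Dx h; exact: (cvg_EFin_seq h).
- exact: lg.
- by have := ae_all Fg; rewrite /ae; apply: filterS => x h n Dx; rewrite lee_fin h.
move=> lf _ c; split => //; apply: fine_cvg.
rewrite /Int /Rintegral fineK//; exact: integrable_fin_num.
Qed.

(** Fatou's lemma with the limit in place of the lower limit. Integrability of the limit is part of
    the conclusion: its integral is bounded by C as an extended real before it is read as a real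
    number. *)
Lemma fatou_bound (F : nat -> T -> R) f (C : R) : (forall n, L1 (F n)) ->
  measurable_fun D f -> (forall n x, D x -> 0 <= F n x) -> (forall x, D x -> 0 <= f x) ->
  ae (fun x => F ^~ x @ \oo --> f x) -> (forall n, Int (F n) <= C) ->
  L1 f /\ Int f <= C.
Proof.
move=> lF mf F0 f0 Ff FC.
have : (\int[mu]_(x in D) (f x)%:E <= C%:E)%E.
  rewrite (@ae_eq_integral _ _ _ _ _ (fun x => limn_einf (fun n => (F n x)%:E)))//.
  - apply: le_trans.
      apply: (@fatou _ _ _ mu D mD (fun n x => (F n x)%:E)); last by move=> n x Dx; rewrite lee_fin F0.
      by move=> n; apply/measurable_EFinP; exact: L1_meas.
    have -> : (fun n => \int[mu]_(x in D) (F n x)%:E)%E = (fun n => (Int (F n))%:E).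
      by rewrite funeqE => n; rewrite L1_EFin.
    apply: le_trans (limn_einf_sup _) _.
    rewrite limn_esup_lim.
    apply: lime_le.
      exact: is_cvg_esups.
    by apply: nearW => n; apply: ge_ereal_sup => _ [m /= _ <-]; rewrite lee_fin.
  - exact/measurable_EFinP.
  - rewrite /limn_einf; apply/measurableT_comp => //.
    apply: (@measurable_fun_limn_esup _ _ _ _ (fun n x => - (F n x)%:E)%E) => n.
    by apply/measurableT_comp => //; apply/measurable_EFinP; exact: L1_meas.
  - apply: ae_mp Ff => x Dx h.
    have /cvg_limn_einf_sup[-> _]// : (fun n => (F n x)%:E) @ \oo --> (f x)%:E.
    by exact: (cvg_EFin_seq h).
move=> h; have lf : L1 f by apply: L1_fin => //; rewrite (le_lt_trans h)// ltry.
by split => //; rewrite -lee_fin -L1_EFin.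
Qed.
End real_integral.

(** * Subsequences *)

Section subsequences.

Definition strictly_inc (s : nat -> nat) := forall n, (s n < s n.+1)%N.

Lemma strictly_inc_ge s : strictly_inc s -> forall n, (n <= s n)%N.
Proof. by move=> h; elim=> [//|n ih]; exact: leq_ltn_trans ih (h n). Qed.

Lemma strictly_inc_comp s t : strictly_inc s -> strictly_inc t -> strictly_inc (s \o t).
Proof.
move=> hs ht n /=; have : forall k j, (j <= k)%N -> (s j <= s k)%N.
  elim=> [j|k ih j]; first by rewrite leqn0 => /eqP ->.
  rewrite leq_eqVlt => /predU1P[->//|jk]; exact: leq_trans (ih j jk) (ltnW (hs k)).
by move=> mono; apply: leq_trans (hs (t n)) _; apply: mono.
Qed.

Lemma strictly_inc_cvg s : strictly_inc s -> s @ \oo --> \oo.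
Proof.
move=> h A [N _ NA]; exists N => // n /= Nn; apply: NA => /=.
exact: leq_trans Nn (strictly_inc_ge h n).
Qed.

Lemma cvg_sub (T : topologicalType) (u : nat -> T) s (l : T) : strictly_inc s ->
  u @ \oo --> l -> (fun n => u (s n)) @ \oo --> l.
Proof. by move=> /strictly_inc_cvg hs hu; apply: cvg_comp hs hu. Qed.

(** Each index is taken beyond both the previous one and the threshold of its own property. *)
Lemma subseq_choice (P : nat -> nat -> Prop) :
  (forall n, exists N, forall k, (N <= k)%N -> P n k) ->
  exists s, strictly_inc s /\ forall n, P n (s n).
Proof.
move=> /choice[N hN].
pose s := fix s n := if n is m.+1 then maxn (s m).+1 (N n) else N 0%N.
exists s; split=> [n|[|n]] /=; first by rewrite leq_max leqnn.
  exact: hN.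
by apply: hN; rewrite leq_maxr.
Qed.

Lemma cvg0_eps (R : realType) (u : nat -> R) : u @ \oo --> (0 : R) ->
  forall e, 0 < e -> exists N, forall k, (N <= k)%N -> `|u k| < e.
Proof.
move=> /cvgrPdist_lt h e e0; have [N _ hN] := h e e0; exists N => k Nk.
by have := hN k Nk; rewrite sub0r normrN.
Qed.

Lemma eps_cvg (R : realType) (u : nat -> R) (l : R) :
  (forall e, 0 < e -> exists N, forall k, (N <= k)%N -> `|u k - l| <= e) -> u @ \oo --> l.
Proof.
move=> h; apply/cvgrPdist_le => e e0; have [N hN] := h e e0.
by exists N => // k /= /hN; rewrite distrC.
Qed.

Lemma cvg_eps (R : realType) (u : nat -> R) (l : R) : u @ \oo --> l ->
  forall e, 0 < e -> exists N, forall k, (N <= k)%N -> `|u k - l| < e.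
Proof.
move=> /cvgrPdist_lt h e e0; have [N _ hN] := h e e0; exists N => k Nk.
by have := hN k Nk; rewrite distrC.
Qed.

(** If the sequence failed to converge, some subsequence would keep a distance e from l, and none of
    its subsequences could converge to l. Used where only subsequences are under control: a.e.
    convergence extracted from L^1 convergence, and controls in the compact set M. *)
Lemma cvg_subsub (R : realType) (u : nat -> R) (l : R) :
  (forall s, strictly_inc s -> exists t, strictly_inc t /\
     (fun n => u (s (t n))) @ \oo --> l) -> u @ \oo --> l.
Proof.
move=> h; apply: contrapT => nc.
have [e [e0 he]] : exists e : R, 0 < e /\ forall N, exists k, (N <= k)%N /\ e < `|u k - l|.
  apply: contrapT => ne; apply: nc; apply: eps_cvg => e e0.
  apply: contrapT => nN; apply: ne; exists e; split => // N.
  apply: contrapT => nk; apply: nN; exists N => k Nk.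
  by rewrite leNgt; apply/negP => ek; apply: nk; exists k.
have [f hf] := choice he.
pose s := fix s n := if n is m.+1 then f (s m).+1 else f 0%N.
have sinc : strictly_inc s by move=> n /=; exact: (hf _).1.
have su n : e < `|u (s n) - l| by case: n => [|n] /=; exact: (hf _).2.
have [t [_ ht]] := h _ sinc.
have [N hN] := cvg_eps ht e0.
by have := hN N (leqnn _); rewrite ltNge (ltW (su _)).
Qed.

Lemma geo_sum_le (R : realType) N : \sum_(n < N) (2^-1 : R) ^+ n <= 2.
Proof.
have h : forall M, \sum_(n < M) (2^-1 : R) ^+ n = 2 - 2 * 2^-1 ^+ M.
  elim=> [|M ih]; first by rewrite big_ord0 expr0 mulr1 subrr.
  by rewrite big_ord_recr /= ih exprS; lra.
by rewrite h gerBl mulr_ge0// exprn_ge0// invr_ge0.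
Qed.

Lemma bounded_sum_cvg (R : realType) (a : nat -> R) C : (forall n, 0 <= a n) ->
  (forall N, \sum_(n < N) a n <= C) -> cvgn (series a).
Proof.
move=> a0 aC; apply: nondecreasing_is_cvgn.
  exact/nondecreasing_series.
by exists C => _ [N _ <-]; rewrite /series /= big_mkord.
Qed.

Lemma bounded_sum_cvg0 (R : realType) (a : nat -> R) C : (forall n, 0 <= a n) ->
  (forall N, \sum_(n < N) a n <= C) -> a @ \oo --> (0 : R).
Proof. by move=> a0 /(bounded_sum_cvg a0) /cvg_series_cvg_0. Qed.

Lemma exp_half_cvg0 (R : realType) : (fun n => (2^-1 : R) ^+ n) @ \oo --> (0 : R).
Proof. by apply: cvg_expr; rewrite ger0_norm; lra. Qed.

Lemma geo_cauchy_cvg (R : realType) (u : nat -> R) C (q : R) : 0 <= q < 1 ->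
  (forall n, `|u n.+1 - u n| <= C * q ^+ n) -> cvgn u.
Proof.
move=> /andP[q0 q1] h.
have c : cvgn (series (fun n => u n.+1 - u n)).
  apply: normed_cvg.
  apply: (@series_le_cvg _ _ (fun n => C * q ^+ n)) => //.
  - by move=> n; exact: normr_ge0.
  - by move=> n; apply: mulr_ge0; rewrite ?exprn_ge0//; have := h 0%N; rewrite expr0 mulr1; exact: le_trans.
  - have := @is_cvg_geometric_series _ C q; rewrite ger0_norm// => /(_ q1).
    by [].
have -> : u = fun n => u 0%N + series (fun n => u n.+1 - u n) n.
  rewrite funeqE; elim=> [|n ih]; first by rewrite /series /= big_geq// addr0.
  by rewrite seriesSr; move: ih; lra.
by apply: is_cvgD => //; exact: is_cvg_cst.
Qed.
End subsequences.

(** * Subsequences converging almost everywhere, and completeness of L^2 *)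

Section extraction.
Context d (T : measurableType d) (R : realType).
Variables (mu : {measure set T -> \bar R}) (D : set T) (mD : measurable D).
Implicit Types (f g : T -> R).
Local Notation L1 := (L1 mu D).
Local Notation Int := (Int mu D).
Local Notation ae := (ae mu D).

(** By monotone convergence the series has integral at most C, hence is finite almost everywhere.
    The [fine] makes the majorant real everywhere; it is 0 on the null set where the series
    diverges. *)
Lemma beppo_levi (F : nat -> T -> R) (C : R) : (forall n, L1 (F n)) ->
  (forall n x, D x -> 0 <= F n x) -> (forall N, \sum_(n < N) Int (F n) <= C) ->
  exists g, [/\ L1 g, forall x, 0 <= g x & ae (fun x => forall N, \sum_(n < N) F n x <= g x)].
Proof.
move=> lF F0 FC.
pose ge x := (\sum_(n <oo) (F n x)%:E)%E.
have mF n : measurable_fun D (fun x => (F n x)%:E).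
  by apply/measurable_EFinP; exact: L1_meas (lF n).
have F0' n x : D x -> (0 <= (F n x)%:E)%E by move=> Dx; rewrite lee_fin F0.
have ige : mu.-integrable D ge.
  apply/integrableP; split.
    by apply: ge0_emeasurable_sum => // n x Dx _; exact: F0'.
  rewrite (_ : (\int[mu]_(x in D) _)%E = (\int[mu]_(x in D) ge x)%E); last first.
    apply: eq_integral => x /set_mem Dx; rewrite gee0_abs//.
    by apply: nneseries_ge0 => n _ _; exact: F0'.
  rewrite /ge integral_nneseries//; apply: (@le_lt_trans _ _ C%:E); last exact: ltry.
  apply: lime_le; first by apply: is_cvg_nneseries => n _ _; apply: integral_ge0 => x; exact: F0'.
  apply: nearW => N; rewrite big_mkord.
  rewrite (eq_bigr (fun n : 'I_N => (Int (F n))%:E)); last by move=> i _; exact: L1_EFin.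
  rewrite (_ : (\sum_(i < N) _)%E = (\sum_(i < N) Int (F i))%:E); last by rewrite sumEFin.
  by rewrite lee_fin.
exists (fun x => `|fine (ge x)|); split => //.
  apply: (le_integrable mD _ _ ige).
    apply/measurable_EFinP; apply: measurableT_comp => //.
    by apply: measurableT_comp => //; exact: measurable_int ige.
  by move=> x Dx /=; case: (ge x) => [r| |] /=; rewrite ?normr_id ?normr0 ?leey.
have := integrable_ae mD ige; apply: filterS => x h Dx N.
have gf := h Dx.
rewrite -lee_fin (le_trans _ (_ : ge x <= _)%E)//; last first.
  by rewrite -(fineK gf) lee_fin ler_norm.
have -> : (\sum_(n < N) F n x)%:E = (\sum_(0 <= n < N) (F n x)%:E)%E.
  by rewrite big_mkord -sumEFin.
by apply: nneseries_lim_ge => n _ _; exact: F0'.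
Qed.

(** Choosing [Int (Q (s n))] at most 2^-n makes the series of the [Q (s n)] integrable. Its sum
    dominates every term, and the terms tend to 0 wherever it is finite. *)
Lemma extract_ae (Q : nat -> T -> R) : (forall n, L1 (Q n)) ->
  (forall n x, D x -> 0 <= Q n x) -> (fun n => Int (Q n)) @ \oo --> (0 : R) ->
  exists s g, [/\ strictly_inc s, L1 g, forall x, 0 <= g x,
    ae (fun x => forall n, Q (s n) x <= g x) &
    ae (fun x => (fun n => Q (s n) x) @ \oo --> (0 : R))].
Proof.
move=> lQ Q0 cQ.
have [s [sinc hs]] : exists s, strictly_inc s /\ forall n, Int (Q (s n)) <= 2^-1 ^+ n.
  apply: (@subseq_choice (fun n k => Int (Q k) <= 2^-1 ^+ n)) => n.
  have e0 : 0 < (2^-1 : R) ^+ n by apply: exprn_gt0; rewrite invr_gt0.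
  have [N hN] := cvg0_eps cQ e0; exists N => k /hN /ltW.
  by apply: le_trans; exact: ler_norm.
have [g [lg g0 hg]] : exists g, [/\ L1 g, forall x, 0 <= g x &
    ae (fun x => forall N, \sum_(n < N) Q (s n) x <= g x)].
  apply: (@beppo_levi (fun n => Q (s n)) 2) => // [n x Dx|N]; first exact: Q0.
  by apply: le_trans (geo_sum_le _ N); apply: ler_sum.
exists s, g; split => //; apply: ae_mp hg => x Dx hg.
  move=> n; apply: le_trans (hg n.+1); rewrite big_ord_recr /= lerDr.
  by apply: sumr_ge0 => i _; exact: Q0.
by apply: (@bounded_sum_cvg0 _ _ (g x)) => // n; exact: Q0.
Qed.

Lemma sqrD_le2 (a b : R) : (a + b) ^+ 2 <= 2 * a ^+ 2 + 2 * b ^+ 2.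
Proof. by have := sqr_ge0 (a - b); rewrite sqrrB sqrrD; lra. Qed.

Lemma L1_sqrD f g : measurable_fun D f -> measurable_fun D g ->
  L1 (fun x => f x ^+ 2) -> L1 (fun x => g x ^+ 2) -> L1 (fun x => (f x + g x) ^+ 2).
Proof.
move=> mf mg lf lg; apply: (L1_dom mD (g := fun x => 2 * f x ^+ 2 + 2 * g x ^+ 2)).
- by apply: measurable_funX; exact: measurable_funD.
- by apply: L1D => //; exact: L1Z.
- by apply: aeP => x _; rewrite ger0_norm ?sqr_ge0// sqrD_le2.
Qed.

Lemma L1_sqrB f g : measurable_fun D f -> measurable_fun D g ->
  L1 (fun x => f x ^+ 2) -> L1 (fun x => g x ^+ 2) -> L1 (fun x => (f x - g x) ^+ 2).
Proof.
move=> mf mg lf lg; apply: L1_sqrD => //; first exact: measurable_funN.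
by apply: (eq_L1 mD _ lg) => x _; rewrite sqrrN.
Qed.

Lemma L1_mul f g : measurable_fun D f -> measurable_fun D g ->
  L1 (fun x => f x ^+ 2) -> L1 (fun x => g x ^+ 2) -> L1 (fun x => f x * g x).
Proof.
move=> mf mg lf lg; apply: (L1_dom mD (g := fun x => f x ^+ 2 + g x ^+ 2)).
- exact: measurable_funM.
- exact: L1D.
- apply: aeP => x _; rewrite normrM -(real_normK (num_real (f x))) -(real_normK (num_real (g x))).
  by have := sqr_ge0 (`|f x| - `|g x|); rewrite sqrrB;
     have := sqr_ge0 (`|f x|); have := sqr_ge0 (`|g x|); lra.
Qed.

Lemma L2_complete (f : nat -> T -> R) :
  (forall n, measurable_fun D (f n)) -> (forall n, L1 (fun x => f n x ^+ 2)) ->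
  (forall e, 0 < e -> exists N, forall m n, (N <= m)%N -> (N <= n)%N ->
     Int (fun x => (f m x - f n x) ^+ 2) <= e) ->
  exists g, [/\ measurable_fun D g, L1 (fun x => g x ^+ 2) &
     (fun n => Int (fun x => (f n x - g x) ^+ 2)) @ \oo --> (0 : R)].
Proof.
move=> mf lf cf.
have lB m n := L1_sqrB (mf m) (mf n) (lf m) (lf n).
have [s [sinc hs]] : exists s, strictly_inc s /\ forall n m, (s n <= m)%N ->
    Int (fun x => (f m x - f (s n) x) ^+ 2) <= 2^-1 ^+ n * 2^-1 ^+ n.
  apply: (@subseq_choice (fun n k => forall m, (k <= m)%N ->
    Int (fun x => (f m x - f k x) ^+ 2) <= 2^-1 ^+ n * 2^-1 ^+ n)) => n.
  have e0 : 0 < (2^-1 : R) ^+ n * 2^-1 ^+ n by apply: mulr_gt0; apply: exprn_gt0; rewrite invr_gt0.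
  have [N hN] := cf _ e0; exists N => k Nk m km; apply: hN => //; exact: leq_trans km.
(* The increments have squared norm at most 4^-n. The weight 2^n keeps the series summable and gives
   |f (s n.+1) x - f (s n) x| <= sqrt(G x) sqrt(1/2)^n, hence pointwise convergence at a geometric
   rate. *)
have [G [lG G0 hG]] : exists G, [/\ L1 G, forall x, 0 <= G x &
    ae (fun x => forall N, \sum_(n < N) 2 ^+ n * (f (s n.+1) x - f (s n) x) ^+ 2 <= G x)].
  apply: (@beppo_levi (fun n x => 2 ^+ n * (f (s n.+1) x - f (s n) x) ^+ 2) 2).
  - by move=> n; apply: L1Z => //; exact: lB.
  - by move=> n x _; apply: mulr_ge0; rewrite ?sqr_ge0// exprn_ge0.
  - move=> N; apply: le_trans (geo_sum_le _ N); apply: ler_sum => i _.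
    rewrite intZ//; apply: le_trans (ler_wpM2l _ (hs i _ (ltnW (sinc i)))) _.
      by rewrite exprn_ge0.
    by rewrite mulrA -exprMn divff ?expr1n ?mul1r.
(* The upper limit is measurable whatever happens at the points where the subsequence diverges. *)
pose g x := fine (limn_esup (fun n => (f (s n) x)%:E)).
have mg : measurable_fun D g.
  rewrite /g; apply: measurableT_comp => //.
  apply: (@measurable_fun_limn_esup _ _ _ _ (fun n x => (f (s n) x)%:E)) => n.
  by apply/measurable_EFinP.
have sg : ae (fun x => (fun n => f (s n) x) @ \oo --> g x).
  apply: ae_mp hG => x Dx hG.
  have /cvg_ex[l cl] : cvgn (fun n => f (s n) x).
    apply: (@geo_cauchy_cvg _ _ (Num.sqrt (G x)) (Num.sqrt 2^-1)).
      rewrite sqrtr_ge0/= -[X in _ < X]sqrtr1 ltr_sqrt//; lra.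
    move=> n; rewrite -ler_sqr ?nnegrE ?mulr_ge0 ?exprn_ge0 ?sqrtr_ge0//.
    rewrite exprMn sqr_sqrtr// -exprM mulnC exprM sqr_sqrtr ?invr_ge0// real_normK ?num_real//.
    have h : 2 ^+ n * (f (s n.+1) x - f (s n) x) ^+ 2 <= G x.
      apply: le_trans (hG n.+1); rewrite big_ord_recr /= lerDr.
      by apply: sumr_ge0 => i _; apply: mulr_ge0; rewrite ?sqr_ge0// exprn_ge0.
    by rewrite exprVn ler_pdivlMr ?exprn_gt0// mulrC.
  have -> // : g x = l.
  by rewrite /g (cvg_limn_einf_sup (cvg_EFin_seq cl)).2.
have key e : 0 < e -> exists N, forall n, (N <= n)%N ->
   L1 (fun x => (f n x - g x) ^+ 2) /\ Int (fun x => (f n x - g x) ^+ 2) <= e.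
  move=> e0; have [N hN] := cf _ e0; exists N => n Nn.
  apply: (@fatou_bound _ _ _ _ _ mD (fun k x => (f n x - f (s (N + k)%N) x) ^+ 2)).
  - by move=> k; exact: lB.
  - by apply: measurable_funX; exact: measurable_funB.
  - by move=> k x _; exact: sqr_ge0.
  - by move=> x _; exact: sqr_ge0.
  - apply: ae_mp sg => x Dx h; rewrite !expr2.
    have c : (fun k => f n x - f (s (N + k)%N) x) @ \oo --> f n x - g x.
      apply: cvgB; first exact: cvg_cst.
      by apply: (@cvg_sub _ (fun k => f (s k) x) (addn N)) => // k; rewrite addnS.
    by apply: cvgM.
  - move=> k; apply: hN => //.
    exact: leq_trans (leq_addr _ _) (strictly_inc_ge sinc _).
exists g; split => //.
  have [N hN] := key 1 ltr01.
  have [lN _] := hN N (leqnn _).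
  have := L1_sqrB (mf N) (measurable_funB (mf N) mg) (lf N) lN.
  by apply: (eq_L1 mD) => x _; rewrite subKr.
apply: eps_cvg => e e0; have [N hN] := key e e0; exists N => k Nk.
by rewrite subr0 ger0_norm ?(hN k Nk).2// Rintegral_ge0// => x _; exact: sqr_ge0.
Qed.
End extraction.

(** * Lebesgue measure under translations *)

Section measure_preserving.
Context d (X : measurableType d) (R : realType).
Variables (mu : {measure set X -> \bar R}) (phi : X -> X).
Hypothesis mphi : measurable_fun setT phi.
Hypothesis muphi : forall A, measurable A -> mu (phi @^-1` A) = mu A.

Lemma ge0_integral_mp (D : set X) (f : X -> \bar R) :
  measurable D -> measurable_fun D f -> (forall x, D x -> 0 <= f x)%E ->
  (\int[mu]_(x in phi @^-1` D) f (phi x) = \int[mu]_(x in D) f x)%E.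
Proof.
move=> mD mf f0.
transitivity (\int[pushforward mu phi]_(x in D) f x)%E; last first.
  apply: eq_measure_integral.
  by move=> A mA _; exact: muphi.
rewrite ge0_integral_pushforward// => y /set_mem; exact: f0.
Qed.

Lemma int_mp (D : set X) (f : X -> R) : measurable D -> L1 mu D f ->
  L1 mu (phi @^-1` D) (fun x => f (phi x)) /\
  Int mu (phi @^-1` D) (fun x => f (phi x)) = Int mu D f.
Proof.
move=> mD lf.
have mD' : measurable (phi @^-1` D) by rewrite -[_ @^-1` _]setTI; exact: mphi.
have mf := L1_meas lf.
have mft : measurable_fun (phi @^-1` D) (fun x => f (phi x)).
  apply: (measurable_comp (F := D)) mf _ => //; first by move=> _ [y hy <-].
  by apply: measurable_funTS.
split.
  case/integrableP : (lf) => _ h; apply/integrableP; split; first exact/measurable_EFinP.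
  rewrite (@ge0_integral_mp _ (fun x => `|(f x)%:E|%E))//.
  by apply/measurableT_comp => //; exact/measurable_EFinP.
rewrite /Int /Rintegral; congr fine; rewrite integralE [RHS]integralE.
rewrite -(@ge0_integral_mp _ ((EFin \o f)^\-)%E)//; last first.
  by apply: measurable_funeneg; exact/measurable_EFinP.
rewrite -(@ge0_integral_mp _ ((EFin \o f)^\+)%E)//; last first.
by apply: measurable_funepos; exact/measurable_EFinP.
  by congr (_ - _)%E; apply: eq_integral => x _; rewrite ?funeposE ?funenegE.
Qed.
End measure_preserving.

Lemma measurable_lt_cst d (X : measurableType d) (R : realType) (f : X -> R) (c e : R) :
  measurable_fun setT f -> measurable [set x | `|f x - c| < e].
Proof.
move=> mf0; have mf : measurable_fun setT (fun x => `|f x - c|).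
  by apply: measurableT_comp => //; exact: measurable_funB.
rewrite (_ : [set x | _] = setT `&` (fun x => `|f x - c|) @^-1` `]-oo, e[); first exact: mf.
by apply/seteqP; split => x /=; rewrite in_itv //= => -[].
Qed.

Section lebesgue_geometry.
Context {R : realType} {n : nat}.
Local Notation V := 'rV[R]_n.
Local Notation mu := (@leb R n).
Local Notation lo := (@lebesgue_outer R n).
Implicit Types (A : set V) (t : V).

Definition translate t A : set V := [set x | A (x - t)].

Definition box_translate t (c : option (V * V)) :=
  if c is Some (a, b) then Some (a + t, b + t) else None.

Lemma box_translateE t c : box (box_translate t c) = translate t (box c).
Proof.
case: c => [[a b]|]; rewrite /translate /=; last by apply/seteqP; split => x.
apply/seteqP; split => x /= h i; have := h i; rewrite !mxE.
  by rewrite ltrBrDr lerBlDr.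
by rewrite ltrBrDr lerBlDr.
Qed.

Lemma box_volume_translate t c : box_volume (box_translate t c) = box_volume c.
Proof.
case: c => [[a b]|]//=; apply: eq_bigr => i _; rewrite !mxE; congr (Num.max _ _).
by rewrite opprD addrACA subrr addr0.
Qed.

Lemma lebesgue_outer_translate_le t A : (lo (translate t A) <= lo A)%E.
Proof.
apply: le_ereal_inf_tmp => _ [C AC <-]; apply: ereal_inf_lbound => /=.
exists (fun k => box_translate t (C k)).
  move=> x Ax; have [k _ h] := AC _ Ax; exists k => //.
  by rewrite box_translateE.
by apply: eq_eseriesr => k _; rewrite box_volume_translate.
Qed.

Lemma translateK t A : translate (- t) (translate t A) = A.
Proof. by apply/seteqP; split => x; rewrite /translate /= opprK addrK. Qed.

Lemma lebesgue_outer_translate t A : lo (translate t A) = lo A.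
Proof.
apply/eqP; rewrite eq_le lebesgue_outer_translate_le /=.
by rewrite -{1}(translateK t A) lebesgue_outer_translate_le.
Qed.

(** The Caratheodory criterion for the translated set, tested on X, is the criterion for A tested on
    X translated back, since the outer measure is translation invariant. *)
Lemma measurable_translate t (A : set (Rn R n)) : measurable A ->
  measurable (translate t A : set (Rn R n)).
Proof.
move=> mA; change (caratheodory_measurable lo (translate t A)) => X.
have mA' : caratheodory_measurable lo A by exact: mA.
rewrite -(lebesgue_outer_translate (- t) X) mA'.
rewrite -(lebesgue_outer_translate t (_ `&` A)) -(lebesgue_outer_translate t (_ `&` ~` A)).
have e B : translate t (translate (- t) X `&` B) = X `&` translate t B.
  by apply/seteqP; split => x; rewrite /translate /= opprK subrK.
by rewrite !e.
Qed.

Lemma measurable_shift t : measurable_fun setT ((fun x => x + t) : Rn R n -> Rn R n).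
Proof.
move=> _ B mB; rewrite setTI; have := measurable_translate (- t) mB.
by congr (measurable _); apply/seteqP; split => x; rewrite /translate /= opprK.
Qed.

(* Splitting a box along the hyperplane x_i = c. *)
Lemma measurable_halfspace (i : 'I_n) (c : R) :
  measurable ([set x : V | x ord0 i <= c] : set (Rn R n)).
Proof.
change (caratheodory_measurable lo [set x : V | x ord0 i <= c]).
apply: le_caratheodory_measurable => X; apply: le_ereal_inf_tmp => _ [C XC <-].
set L := [set x : V | _].
pose lower (b : option (V * V)) : option (V * V) := if b is Some (a, b) then
  Some (a, \row_j if j == i then Num.min (b ord0 j) c else b ord0 j) else None.
pose upper (b : option (V * V)) : option (V * V) := if b is Some (a, b) then
  Some (\row_j if j == i then Num.max (a ord0 j) c else a ord0 j, b) else None.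
have vol b : box_volume (lower b) + box_volume (upper b) = box_volume b.
  case: b => [[a b]|] /=; last by rewrite addr0.
  rewrite (bigD1 i) //= [X in _ + X](bigD1 i) //= [RHS](bigD1 i) //= !mxE eqxx.
  under eq_bigr => j ji do rewrite !mxE (negbTE ji).
  under [X in _ + _ * X]eq_bigr => j ji do rewrite !mxE (negbTE ji).
  rewrite -mulrDl; congr (_ * _).
  by case: (lerP (b ord0 i) c) => h1; case: (lerP c (a ord0 i)) => h2;
    do ?[rewrite maxEle; case: ifPn; rewrite -?ltNge => ?]; lra.
have low x b : L x -> box b x -> box (lower b) x.
  case: b => [[a b]|]//= Lx h j; have /andP[h1 h2] := h j.
  rewrite !mxE h1 /=; case: eqP => [ji|]//.
  by rewrite le_min h2 ji.
have up x b : ~ L x -> box b x -> box (upper b) x.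
  case: b => [[a b]|]//= Lx h j; have /andP[h1 h2] := h j.
  rewrite !mxE h2 andbT; case: eqP => [ji|]//.
  by rewrite gt_max h1 ji ltNge; apply/negP.
apply: (@le_trans _ _ (\sum_(k <oo) (box_volume (lower (C k)))%:E +
   \sum_(k <oo) (box_volume (upper (C k)))%:E)%E).
  apply: leeD; apply: ereal_inf_lbound => /=.
    exists (fun k => lower (C k)) => // x [Xx Lx].
    by have [k _ h] := XC _ Xx; exists k => //; exact: low.
  exists (fun k => upper (C k)) => // x [Xx Lx].
  by have [k _ h] := XC _ Xx; exists k => //; exact: up.
rewrite -nneseriesD//; try by move=> k _ _; exact: box_volume_ge0.
rewrite le_eqVlt; apply/orP; left; apply/eqP; apply: eq_eseriesr => k _.
by rewrite -EFinD vol.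
Qed.

Lemma measurable_coord (i : 'I_n) :
  measurable_fun setT ((fun x : V => x ord0 i) : Rn R n -> R).
Proof.
apply: (measurability _ (RGenOInfty.measurableE R)) => // _ [_ [c ->] <-].
rewrite setTI (_ : _ @^-1` _ = ~` [set x : V | x ord0 i <= c]).
  by apply: measurableC; exact: measurable_halfspace.
apply/seteqP; split => x /=; rewrite in_itv /= andbT ltNge; first by move/negP.
by move=> h; apply/negP.
Qed.

Lemma measurable_cube (c : V) (e : R) :
  measurable ([set x : V | forall i, `|x ord0 i - c ord0 i| < e] : set (Rn R n)).
Proof.
rewrite (_ : [set x : V | _] = \bigcap_(i in [set: 'I_n]) [set x : V | `|x ord0 i - c ord0 i| < e]).
  apply: (@fin_bigcap_measurable _ (Rn R n)) => // i _.
  apply: (@measurable_lt_cst _ (Rn R n) _ (fun x : V => x ord0 i)); exact: measurable_coord.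
by apply/seteqP; split => x /= h i; [move=> _; exact: h|exact: (h i I)].
Qed.

Lemma rat_approx (x e : R) : 0 < e -> exists q : rat, `|x - ratr q| < e.
Proof.
move=> e0; have [q] := @rat_in_itvoo _ (x - e) (x + e) ltac:(lra).
by rewrite in_itv /= => /andP[h1 h2]; exists q; rewrite distrC ltr_distl h1 h2.
Qed.

(** U is the union of the countably many cubes with rational centre and radius 1/(k+1) that it
    contains. Around x in U, with a ball of radius e inside U, such a cube exists as soon as 1/(k+1)
    < e/2. *)
Lemma open_Rn_measurable (U : set V) : open U -> measurable (U : set (Rn R n)).
Proof.
move=> oU.
pose B (ck : {ffun 'I_n -> rat} * nat) : set V :=
  [set x | forall i, `|x ord0 i - (\row_j ratr (ck.1 j)) ord0 i| < ck.2.+1%:R^-1].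
pose F ck : set (Rn R n) := if `[< B ck `<=` U >] then B ck else set0.
rewrite (_ : U = \bigcup_ck F ck).
  apply: countable_bigcupT_measurable => // ck; rewrite /F; case: ifP => _ //.
  exact: measurable_cube.
apply/seteqP; split => x; last by move=> [ck _]; rewrite /F; case: asboolP => // h; exact: h.
move=> Ux; have := open_nbhs_nbhs (conj oU Ux) => /nbhs_ballP[e /= e0 he].
have [k hk] : exists k : nat, k.+1%:R^-1 < e / 2.
  have [N _ hN] := @near_infty_natSinv_lt R (PosNum (divr_gt0 e0 (ltr0n _ 2))).
  by exists N; apply: hN => /=.
have /choice[q hq] : forall i : 'I_n, exists q : rat, `|x ord0 i - ratr q| < k.+1%:R^-1.
  by move=> i; apply: rat_approx; rewrite invr_gt0 ltr0n.
exists ([ffun i => q i], k) => //; rewrite /F.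
have Bx : B ([ffun i => q i], k) x by move=> i /=; rewrite mxE ffunE.
case: asboolP => //; case => y By; apply: he; split => // i j; have -> : i = ord0 by exact: ord1.
rewrite /ball /=; have := By j; have := Bx j; rewrite /= !mxE !ffunE.
rewrite [`|y _ _ - _|]distrC => h1 h2; rewrite -(subrKA (ratr (q j))).
apply: le_lt_trans (ler_normD _ _) _.
by rewrite [ltRHS]splitr; apply: ltrD; [exact: lt_trans h1 hk|exact: lt_trans h2 hk].
Qed.

Lemma continuous_Rn_measurable (f : V -> R) : continuous f ->
  measurable_fun setT (f : Rn R n -> R).
Proof.
move=> cf; apply: (measurability _ (RGenOInfty.measurableE R)) => // _ [_ [c ->] <-].
rewrite setTI; apply: open_Rn_measurable; apply: open_comp => [x _|]; first exact: cf.
exact: rray_open.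
Qed.

Lemma ler_coord_norm (x : V) i : `|x ord0 i| <= `|x|.
Proof.
rewrite [leRHS](_ : _ = mx_norm x)// mx_normrE.
by apply: (@le_bigmax _ _ _ _ (fun ij : 'I_1 * 'I_n => `|x ij.1 ij.2|) (ord0, i)).
Qed.

Lemma leb_bounded A : bounded_set A -> (mu A < +oo)%E.
Proof.
move=> [M [_ hM]].
have hA : A `<=` box (Some (\row__ (- (`|M| + 2)), \row__ (`|M| + 2))).
  move=> x Ax i; rewrite !mxE.
  have : `|x ord0 i| <= `|M| + 1.
    apply: le_trans (ler_coord_norm x i) _; apply: (hM (`|M| + 1)) => //.
    by have := ler_norm M; lra.
  by rewrite ler_norml => /andP[h1 h2]; apply/andP; split; lra.
apply: (@le_lt_trans _ _ (lo (box (Some (\row__ (- (`|M| + 2)), \row__ (`|M| + 2)))))).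
  exact: le_lebesgue_outer.
(* One box followed by the empty boxes [None], so that the series reduces to its first term. *)
apply: (@le_lt_trans _ _ (\sum_(k <oo) (box_volume ((fun k => if k is 0%N then
    Some (\row__ (- (`|M| + 2)), \row__ (`|M| + 2)) else None) k : option (V * V)))%:E)%E).
  by apply: ereal_inf_lbound => /=; eexists; last reflexivity; move=> x h; exists 0%N.
rewrite (@nneseries_split _ _ 0 1)//; last by move=> k _; exact: box_volume_ge0.
rewrite eseries0 ?adde0; first by rewrite big_nat1 ltry.
by move=> [|k].
Qed.

Lemma leb_translate t A : mu (translate t A) = mu A.
Proof. exact: lebesgue_outer_translate. Qed.

Lemma translate_preimage t A : translate (- t) A = (fun x => x + t) @^-1` A.
Proof. by apply/seteqP; split => x; rewrite /translate /= opprK. Qed.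

Lemma int_translate t (D : set (Rn R n)) (f : Rn R n -> R) :
  measurable D -> L1 mu D f ->
  L1 mu (translate (- t) D) (fun x => f (x + t)) /\
  Int mu (translate (- t) D) (fun x => f (x + t)) = Int mu D f.
Proof.
rewrite translate_preimage; apply: (@int_mp _ (Rn R n) _ mu (fun x : V => x + t)).
  exact: measurable_shift.
by move=> A _; rewrite -translate_preimage; exact: leb_translate.
Qed.

Lemma int_translateT t (f : Rn R n -> R) : L1 mu setT f ->
  L1 mu setT (fun x => f (x + t)) /\ Int mu setT (fun x => f (x + t)) = Int mu setT f.
Proof. by move=> /(@int_translate t setT _ measurableT). Qed.

End lebesgue_geometry.

Lemma L1_cst d (T : measurableType d) (R : realType) (mu : {measure set T -> \bar R})
  (D : set T) (k : R) : measurable D -> (mu D < +oo)%E -> L1 mu D (fun=> k).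
Proof.
move=> mD Dfin; apply/integrableP; split; first exact: measurable_cst.
rewrite (_ : (\int[mu]_(x in D) _)%E = (\int[mu]_(x in D) cst `|k|%:E x)%E)//.
by rewrite integral_cst// lte_mul_pinfty.
Qed.

(** * Averages over dyadic cubes *)

Section averaging.
Context d (T : measurableType d) (R : realType).
Variables (mu : {measure set T -> \bar R}) (I : countType) (idx : T -> I) (v : R).
Local Notation cell c := (idx @^-1` [set c]).
Hypothesis mcell : forall c, measurable (cell c).
Hypothesis mucell : forall c, mu (cell c) = v%:E.
Hypothesis v0 : 0 < v.
Implicit Types f g : T -> R.
Local Notation L1T := (L1 mu setT).
Local Notation intT := (Int mu setT).

(** The conditional expectation of f with respect to the countable partition into the cells of
    [idx], all of measure v. *)
Definition avg f x := v^-1 * Int mu (cell (idx x)) f.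

Lemma measurable_idx (phi : I -> R) : measurable_fun setT (fun x => phi (idx x)).
Proof.
move=> _ B mB; rewrite setTI.
rewrite (_ : _ @^-1` _ = \bigcup_c (if `[< B (phi c) >] then cell c else set0)).
  by apply: countable_bigcupT_measurable => // c; case: ifP => _.
apply/seteqP; split => x /=.
  by move=> h; exists (idx x) => //; case: asboolP.
by move=> [c _]; case: asboolP => // h /= ->.
Qed.

Lemma L1_cell f c : L1T f -> L1 mu (cell c) f.
Proof. by apply: integrableS. Qed.

Lemma L1_cell_cst c (k : R) : L1 mu (cell c) (fun=> k).
Proof.
by apply: L1_cst; rewrite ?mucell ?ltry.
Qed.

Lemma L1_cell_sqr f c : measurable_fun setT f -> L1T (fun x => f x ^+ 2) -> L1 mu (cell c) f.
Proof.
move=> mf lf; apply: (L1_dom (mcell c) (g := fun x => 1 + f x ^+ 2)).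
- exact: measurable_funTS.
- by apply: L1D => //; [exact: L1_cell_cst|exact: L1_cell lf].
- apply: aeP => x _; rewrite -(real_normK (num_real (f x))).
  by have := sqr_ge0 (`|f x| - 1); rewrite sqrrB1; have := normr_ge0 (f x); lra.
Qed.

Lemma int_cell_cst c (k : R) : Int mu (cell c) (fun=> k) = k * v.
Proof. by rewrite /Int Rintegral_cst// mucell. Qed.

Lemma avgB f g x : L1 mu (cell (idx x)) f -> L1 mu (cell (idx x)) g ->
  avg (fun y => f y - g y) x = avg f x - avg g x.
Proof. by move=> lf lg; rewrite /avg intB// mulrBr. Qed.

(** Jensen's inequality, read off from the integral of (f - a)^2 over the cell being nonnegative,
    where a is the average of f there. *)
Lemma avg_sqr_le f x : measurable_fun setT f -> L1T (fun y => f y ^+ 2) ->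
  avg f x ^+ 2 <= avg (fun y => f y ^+ 2) x.
Proof.
move=> mf lf; set c := idx x; set a := avg f x.
have lc := L1_cell_sqr c mf lf; have lc2 := L1_cell c lf.
have h : 0 <= Int mu (cell c) (fun y => (f y - a) ^+ 2).
  by apply: Rintegral_ge0 => y _; exact: sqr_ge0.
have e : Int mu (cell c) (fun y => (f y - a) ^+ 2) =
    Int mu (cell c) (fun y => f y ^+ 2) - 2 * a * Int mu (cell c) f + a ^+ 2 * v.
  rewrite -(int_cell_cst c (a ^+ 2)) -intZ// -intB//; last exact: L1Z.
  rewrite -intD//; [|by apply: L1B => //; exact: L1Z|exact: L1_cell_cst].
  by apply: eq_int => y _; ring.
have ia : Int mu (cell c) f = v * a by rewrite /a /avg mulrA divff ?mul1r ?gt_eqF.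
move: h; rewrite e ia /avg -/c => h.
rewrite -(ler_pM2l v0) mulVKf ?gt_eqF// -subr_ge0.
by apply: le_trans h _; rewrite le_eqVlt; apply/orP; left; apply/eqP; ring.
Qed.

Lemma avg_le g x : (forall y, 0 <= g y) -> L1T g -> avg g x <= v^-1 * intT g.
Proof.
move=> g0 lg; rewrite /avg ler_pM2l ?invr_gt0// -lee_fin -!L1_EFin//; last exact: L1_cell.
apply: ge0_subset_integral => //; first by apply/measurable_EFinP; exact: L1_meas lg.
by move=> y _; rewrite lee_fin.
Qed.

Lemma avg_ge0 g x : (forall y, 0 <= g y) -> 0 <= avg g x.
Proof.
by move=> g0; rewrite mulr_ge0 ?invr_ge0 ?(ltW v0)//; apply: Rintegral_ge0 => y _; exact: g0.
Qed.

Lemma measurable_avg f : measurable_fun setT (avg f).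
Proof. exact: (measurable_idx (fun c => v^-1 * Int mu (cell c) f)). Qed.

(** On each cell the average is constant and has the same integral as g. The space is the countable
    union of the cells, enumerated by [pickle_inv], with the empty set for a number that codes no
    index. *)
Lemma avg_tower g : (forall y, 0 <= g y) -> L1T g -> L1T (avg g) /\ intT (avg g) = intT g.
Proof.
move=> g0 lg; have ag0 x := avg_ge0 x g0.
pose F k : set T := if pickle_inv k is Some c then cell c else set0.
have mF k : measurable (F k) by rewrite /F; case: pickle_inv.
have UF : \bigcup_k F k = setT.
  apply/seteqP; split => // x _; exists (pickle (idx x)) => //.
  by rewrite /F pickleK_inv.
have tF : trivIset setT F.
  move=> i j _ _ [x []]; rewrite /F.
  have := @pickle_invK I i; have := @pickle_invK I j.
  by case: pickle_inv => [c|]//= <-; case: pickle_inv => [c'|]//= <- <- <-.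
have key : (\int[mu]_x (avg g x)%:E = \int[mu]_x (g x)%:E)%E.
  rewrite -UF ge0_integral_bigcup//=; last 2 first.
  - by rewrite UF; apply/measurable_EFinP; exact: measurable_avg.
  - by move=> x _; rewrite lee_fin.
  rewrite ge0_integral_bigcup//=; last 2 first.
  - by rewrite UF; apply/measurable_EFinP; exact: L1_meas lg.
  - by move=> x _; rewrite lee_fin.
  apply: eq_eseriesr => k _; rewrite /F; case: pickle_inv => [c|]; last by rewrite !integral_set0.
  transitivity (\int[mu]_(x in cell c) (cst (v^-1 * Int mu (cell c) g)%:E) x)%E.
    by apply: eq_integral => x /set_mem /= xc; rewrite /avg xc.
  rewrite integral_cst// mucell -EFinM L1_EFin//; last exact: L1_cell.
  by congr (_%:E); rewrite mulrAC mulVf ?mul1r ?gt_eqF.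
have lag : L1T (avg g).
  apply: L1_fin => //; first exact: measurable_avg.
  by rewrite key L1_EFin// ltry.
by split => //; apply: EFin_inj; rewrite -!L1_EFin.
Qed.

Lemma avg_contract f : measurable_fun setT f -> L1T (fun y => f y ^+ 2) ->
  L1T (fun x => avg f x ^+ 2) /\ intT (fun x => avg f x ^+ 2) <= intT (fun x => f x ^+ 2).
Proof.
move=> mf lf; have [la ia] := avg_tower (fun y => sqr_ge0 (f y)) lf.
have l : L1T (fun x => avg f x ^+ 2).
  apply: (L1_dom measurableT _ la).
    by apply: measurable_funX; exact: measurable_avg.
  by apply: aeP => x _; rewrite ger0_norm ?sqr_ge0// avg_sqr_le.
by split => //; rewrite -ia; apply: le_int => // x _; exact: avg_sqr_le.
Qed.
End averaging.

(** * Inequalities for real powers *)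

Section real_powers.
Context {R : realType}.
Implicit Types a b x y r : R.

Lemma powRX_nat (x r : R) (k : nat) : 0 <= x -> (x ^+ k) `^ r = (x `^ r) ^+ k.
Proof.
by move=> x0; elim: k => [|k ih]; rewrite ?expr0 ?powR1// !exprS powRM ?ih// exprn_ge0.
Qed.

Lemma powR2 (x : R) : 0 <= x -> x `^ 2 = x ^+ 2.
Proof. by move=> x0; rewrite powR_mulrn. Qed.

(** Interpolation: with a bound on x, an integral of x^r is controlled by an integral of x^2. *)
Lemma powR_split2 (x r : R) : 2 <= r -> 0 <= x -> x `^ r = x ^+ 2 * (x ^+ 2) `^ ((r - 2) / 2).
Proof.
move=> r2 x0; rewrite -powR2// -powRrM mulrCA divff// mulr1 -powRD; last first.
  by apply/implyP => /eqP; lra.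
by congr (_ `^ _); lra.
Qed.

Lemma powRD_le x y r : 1 <= r -> 0 <= x -> 0 <= y -> (x + y) `^ r <= 2 `^ r * (x `^ r + y `^ r).
Proof.
move=> r1 x0 y0; have r0 : 0 <= r by lra.
wlog xy : x y x0 y0 / x <= y => [h|].
  by have [/h|/ltW /h] := leP x y; [apply|rewrite addrC [X in _ * X]addrC; apply].
apply: (@le_trans _ _ ((2 * y) `^ r)); first by apply: ge0_ler_powR; rewrite ?nnegrE; lra.
rewrite powRM//; apply: ler_wpM2l; first exact: powR_ge0.
by rewrite lerDr powR_ge0.
Qed.

(** Monotonicity of powers in two cases: if b <= l a the first term on the right dominates,
    otherwise the second. The constants are those of this argument, not the optimal ones of Young's
    inequality. *)
Lemma young_eps (a b r l : R) : 1 < r -> 0 <= a -> 0 <= b -> 0 < l ->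
  a `^ (r - 1) * b <= l * a `^ r + (l `^ (r - 1))^-1 * b `^ r.
Proof.
move=> r1 a0 b0 l0.
have e x : 0 <= x -> x `^ (r - 1) * x = x `^ r.
  move=> x0; have [->|xn] := eqVneq x 0; first by rewrite mulr0 powR0//; lra.
  rewrite -[X in _ * X]powRr1// -powRD ?xn ?implybT//; congr (_ `^ _); lra.
have p1 := powR_ge0 a r; have p2 := powR_ge0 b r; have p3 := powR_gt0 (r - 1) l0.
have [bl|lb] := leP b (l * a).
  apply: (@le_trans _ _ (l * a `^ r)); last by rewrite lerDl mulr_ge0// invr_ge0 ltW.
  rewrite -(e a)// mulrCA; apply: ler_wpM2l => //; exact: powR_ge0.
apply: (@le_trans _ _ ((l `^ (r - 1))^-1 * b `^ r)); last by rewrite lerDr mulr_ge0// ltW.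
rewrite ler_pdivlMl// -(e b)// mulrA; apply: ler_wpM2r => //.
rewrite -powRM ?(ltW l0)//; apply: ge0_ler_powR; rewrite ?nnegrE ?mulr_ge0 ?(ltW l0)//; last exact: ltW.
lra.
Qed.

Lemma powRV_le (x r B : R) : 0 < r -> 0 <= x -> 0 <= B -> x `^ r <= B `^ r -> x <= B.
Proof.
move=> r0 x0 B0 h; rewrite leNgt; apply/negP => Bx.
have := @gt0_ltr_powR _ _ r0 B x; rewrite !nnegrE => /(_ B0 x0 Bx).
by rewrite ltNge h.
Qed.

Lemma geo_le (l : R) N : 0 <= l < 1 -> \sum_(i < N) l ^+ i <= (1 - l)^-1.
Proof.
move=> /andP[l0 l1]; rewrite -[leRHS]mul1r ler_pdivlMr ?subr_gt0//.
have -> : (\sum_(i < N) l ^+ i) * (1 - l) = 1 - l ^+ N.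
  elim: N => [|N ih]; first by rewrite big_ord0 expr0 mul0r subrr.
  by rewrite big_ord_recr mulrDl ih exprS; ring.
by rewrite gerBl exprn_ge0.
Qed.

(* Hoelder's inequality with geometric weights. *)
Lemma geo_sum_powR (l r : R) (d : nat -> R) N : 0 < l < 1 -> 0 < r ->
  `|\sum_(i < N) d i| `^ r <=
    ((1 - l)^-1) `^ r * \sum_(i < N) (l^-1 `^ r) ^+ i * `|d i| `^ r.
Proof.
move=> /andP[l0 l1] r0.
set S := \sum_(i < N) (l^-1 `^ r) ^+ i * `|d i| `^ r.
have t0 i : 0 <= (l^-1 `^ r) ^+ i * `|d i| `^ r.
  by apply: mulr_ge0; rewrite ?exprn_ge0 ?powR_ge0.
have S0 : 0 <= S by apply: sumr_ge0 => i _.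
pose B := S `^ r^-1.
have Br : B `^ r = S by rewrite /B -powRrM mulVf ?gt_eqF// powRr1.
have B0 : 0 <= B by exact: powR_ge0.
have dB (i : 'I_N) : `|d i| <= l ^+ i * B.
  rewrite -ler_pdivrMl ?exprn_gt0//.
  apply: (@powRV_le _ r) => //.
    by rewrite mulr_ge0// invr_ge0 exprn_ge0// ltW.
  rewrite Br powRM ?invr_ge0 ?exprn_ge0 ?(ltW l0)// -exprVn powRX_nat ?invr_ge0 ?(ltW l0)//.
  by rewrite /S (bigD1 i) //= lerDl; apply: sumr_ge0 => k _.
have l' : 0 <= (1 - l)^-1 by rewrite invr_ge0; lra.
rewrite -Br -powRM//; apply: ge0_ler_powR; rewrite ?nnegrE ?mulr_ge0//; first lra.
apply: le_trans (ler_norm_sum _ _ _) _.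
apply: (@le_trans _ _ (\sum_(i < N) l ^+ i * B)); first exact: ler_sum.
by rewrite -mulr_suml; apply: ler_wpM2r => //; apply: geo_le; rewrite (ltW l0) l1.
Qed.
End real_powers.

Lemma L1_patch d (T : measurableType d) (R : realType) (mu : {measure set T -> \bar R})
  (D : set T) (f : T -> R) : measurable D -> L1 mu D f -> L1 mu setT (f \_ D).
Proof. by move=> mD; rewrite /L1 (integrable_mkcond _ mD) restrict_EFin. Qed.

Lemma int_patch d (T : measurableType d) (R : realType) (mu : {measure set T -> \bar R})
  (D : set T) (f : T -> R) : Int mu setT (f \_ D) = Int mu D f.
Proof. by rewrite /Int [RHS]Rintegral_mkcond. Qed.

(** Every term is at most the square root of the right-hand side, hence so is the mean. The factor
    that Jensen's inequality would keep is given away, as it only affects constants. *)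
Lemma sqr_mean_le (R : realType) (I : finType) (a : I -> R) :
  (#|I|%:R^-1 * \sum_i a i) ^+ 2 <= \sum_i a i ^+ 2.
Proof.
have [I0|I0] := eqVneq #|I| 0%N.
  by rewrite I0 invr0 mul0r expr0n /=; apply: sumr_ge0 => i _; exact: sqr_ge0.
set S := \sum_i a i ^+ 2.
have S0 : 0 <= S by apply: sumr_ge0 => i _; exact: sqr_ge0.
have aS i : `|a i| <= Num.sqrt S.
  rewrite -sqrtr_sqr; apply: ler_wsqrtr; rewrite /S (bigD1 i) //= lerDl.
  by apply: sumr_ge0 => k _; exact: sqr_ge0.
have h : `|#|I|%:R^-1 * \sum_i a i| <= Num.sqrt S.
  rewrite normrM ger0_norm ?invr_ge0// ler_pdivrMl ?ltr0n ?lt0n//.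
  apply: le_trans (ler_norm_sum _ _ _) _.
  apply: le_trans (ler_sum _ (fun i _ => aS i)) _.
  by rewrite sumr_const mulr_natl.
rewrite -[leLHS]real_normK ?num_real// -[leRHS](sqr_sqrtr S0).
by rewrite ler_sqr ?nnegrE ?sqrtr_ge0.
Qed.

(** * Dyadic cubes and the increments of dyadic averages *)

Section dyadic.
Context {R : realType} {n : nat}.
Local Notation V := 'rV[R]_n.
Local Notation mu := (@leb R n).
Local Notation index := {ffun 'I_n -> int}.
Local Notation bits := {ffun 'I_n -> bool}.

(** Rounding up makes the cell of index c the half-open cube with upper corner c / 2^j, in the
    convention of [box]. *)
Definition dyidx (j : nat) (x : Rn R n) : index := [ffun i => Num.ceil (2 ^+ j * x ord0 i)].
Local Notation cell j c := (dyidx j @^-1` [set c]).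

Definition dyvec (j : nat) (k : index) : V := \row_i ((k i)%:~R / 2 ^+ j).

Lemma dyidx_shift j x k : dyidx j (x + dyvec j k) = dyidx j x + k.
Proof.
apply/ffunP => i; rewrite !ffunE !mxE mulrDr mulrCA divff ?mulr1 ?expf_neq0//.
by rewrite ceilDrz ?intr_int// intrKceil.
Qed.

Lemma cell_translate j c k : cell j c = translate (- dyvec j k) (cell j (c + k)).
Proof.
apply/seteqP; split => x; rewrite /translate /= opprK dyidx_shift; first by move=> ->.
exact: addIr.
Qed.

Lemma cellP j (c : index) x : dyidx j x = c <->
  forall i, ((c i)%:~R - 1) / 2 ^+ j < x ord0 i <= (c i)%:~R / 2 ^+ j.
Proof.
have p2 : 0 < 2 ^+ j :> R by rewrite exprn_gt0.
split=> [<- i|h].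
  rewrite ffunE; have := ceil_itv (2 ^+ j * x ord0 i); rewrite rmorphB /= => h.
  by rewrite ltr_pdivrMr// ler_pdivlMr// [x ord0 i * _]mulrC.
apply/ffunP => i; rewrite ffunE; apply: ceil_def; rewrite rmorphB /=.
by have := h i; rewrite ltr_pdivrMr// ler_pdivlMr// mulrC.
Qed.

Lemma measurable_cell j c : measurable (cell j c : set (Rn R n)).
Proof.
rewrite (_ : cell j c = \bigcap_(i in [set: 'I_n]) ([set x : V | x ord0 i <= (c i)%:~R / 2 ^+ j] `\`
   [set x : V | x ord0 i <= ((c i)%:~R - 1) / 2 ^+ j])).
  apply: (@fin_bigcap_measurable _ (Rn R n)) => // i _.
  by apply: measurableD; exact: measurable_halfspace.
apply/seteqP; split => x.
  move=> /cellP h i _ /=; have /andP[h1 h2] := h i; split => //.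
  by apply/negP; rewrite -ltNge.
move=> h; apply/cellP => i; have [/= h1 /negP] := h i I.
by rewrite -ltNge => h2; rewrite h1 h2.
Qed.

(** The value of this volume is never computed: cells of one scale are translates of each other, a
    cell consists of 2^n children, and positivity follows from [leb_neq0]. *)
Definition dyvol j : R := fine (mu (cell j 0)).

Lemma leb_cell j c : mu (cell j c) = (dyvol j)%:E.
Proof.
rewrite (cell_translate j c (- c)) leb_translate subrr /dyvol fineK// ge0_fin_numE//.
apply: leb_bounded; exists 1; split => // M M1 x /cellP h.
change (mx_norm x <= M); rewrite mx_normrE; apply/bigmax_leP; split; first lra.
move=> [i0 i] _ /=; have -> : i0 = ord0 by exact: ord1.
have := h i; rewrite ffunE /= !mul0r sub0r => /andP[h1 h2].
rewrite ler_norml; apply/andP; split; last lra.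
apply: le_trans (ltW h1); rewrite mulN1r lerN2.
by apply: (@le_trans _ _ 1); [rewrite invf_le1 ?exprn_gt0// exprn_ege1//; lra|lra].
Qed.

Lemma leb_cell_fin j c : (mu (cell j c) < +oo)%E.
Proof. by rewrite leb_cell ltry. Qed.

Hypothesis leb_neq0 : mu setT != 0%E.

(** Otherwise all cells of scale j would be null, and countably many of them cover the space. *)
Lemma dyvol_gt0 j : 0 < dyvol j.
Proof.
have : 0 <= dyvol j by rewrite fine_ge0.
rewrite le_eqVlt => /predU1P[e|//]; exfalso; move/negP: leb_neq0; apply; apply/eqP.
have cellN k : mu.-negligible (if pickle_inv k is Some c then cell j c else set0).
  case: pickle_inv => [c|]; last exact: negligible_set0.
  have c0 : mu (cell j c) = 0%E by rewrite leb_cell -e.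
  by apply/negligibleP; [exact: measurable_cell|exact: c0].
apply: measure_negligible => //.
apply: negligibleS (negligible_bigcup cellN) => x _.
by exists (pickle (dyidx j x)) => //; rewrite pickleK_inv.
Qed.

(** Indices denote upper corners, so in every coordinate the two halves have upper corner 2c or 2c -
    1 on the finer grid. *)
Definition child (c : index) (e : bits) : index := [ffun i => c i * 2 - (e i : nat)%:Z].

Lemma child_inj c : injective (child c).
Proof.
move=> e e' /ffunP h; apply/ffunP => i; have := h i; rewrite !ffunE => /addrI /oppr_inj [].
by case: (e i); case: (e' i).
Qed.

Lemma childP j c x : dyidx j x = c <-> exists e, dyidx j.+1 x = child c e.
Proof.
have p2 : 0 < 2 ^+ j :> R by rewrite exprn_gt0.
split=> [|[e]].
  move=> h.
  (* The bit records whether x lies in the lower half in that coordinate. *)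
  exists [ffun i => dyidx j.+1 x i != c i * 2]; apply/ffunP => i.
  rewrite [RHS]ffunE [in RHS]ffunE; case: eqVneq => [->|ne]; first by rewrite subr0.
  have := ceil_itv (2 ^+ j * x ord0 i); rewrite -/(dyidx j x i) => h1.
  have e : Num.ceil (2 ^+ j * x ord0 i) = c i by rewrite -h ffunE.
  move: h1; rewrite e => /andP[h1 h2].
  have h3 := ceil_itv (2 ^+ j.+1 * x ord0 i).
  move: ne h3; rewrite ffunE; set k := Num.ceil _ => ne /andP[h3 h4].
  move: h1 h3 h4; rewrite exprS -mulrA; set y := 2 ^+ j * _ in h2 * => h1 h3 h4.
  have a : (k < c i * 2 + 1)%R.
    rewrite -(@ltr_int R) rmorphD rmorphM /=; move: h3; rewrite rmorphB /= => h3; lra.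
  have b : (c i * 2 - 2 < k)%R.
    rewrite -(@ltr_int R) rmorphB rmorphM /=; move: h1; rewrite rmorphB /= => h1; lra.
  move: a b ne => a b /eqP ne; lia.
move=> /cellP h; apply/cellP => i; have := h i; rewrite !ffunE rmorphB rmorphM /=.
rewrite !ltr_pdivrMr ?exprn_gt0// !ler_pdivlMr ?exprn_gt0// exprS.
have : 0 <= ((e i)%:R : R) <= 1 by case: (e i); rewrite ?lexx ?ler01.
rewrite -pmulrn => /andP[e0 e1] /andP[h1 h2]; apply/andP; split; lra.
Qed.

Lemma int_cell_child j c (f : Rn R n -> R) : L1 mu (cell j c) f ->
  Int mu (cell j c) f = \sum_(e : bits) Int mu (cell j.+1 (child c e)) f.
Proof.
move=> lf.
have sub e : cell j.+1 (child c e) `<=` cell j c.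
  by move=> x h; apply/childP; exists e.
have lfe e : L1 mu (cell j.+1 (child c e)) f.
  by apply: integrableS lf => //; exact: measurable_cell.
rewrite -int_patch.
under eq_bigr => e _ do rewrite -int_patch.
rewrite -int_sum//; last by move=> e; apply: L1_patch => //; exact: measurable_cell.
congr Int; rewrite funeqE => x; rewrite /patch.
case: ifPn => [/set_mem /childP [e0 he0]|/negP h].
  rewrite (bigD1 e0)//= mem_set//= big1 ?addr0// => e ee0.
  case: ifPn => // /set_mem /= he; move: ee0; rewrite he0 in he.
  by rewrite (child_inj he) eqxx.
rewrite big1// => e _; case: ifPn => // /set_mem /sub hx; exfalso; apply: h; exact: mem_set.
Qed.

Lemma dyvolS j : dyvol j = (2 ^+ n) * dyvol j.+1.
Proof.
have l1 : L1 mu (cell j 0) (fun=> 1).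
  by apply: L1_cst; [exact: measurable_cell|exact: leb_cell_fin].
have i1 k c : Int mu (cell k c) (fun=> 1) = dyvol k.
  by rewrite (int_cell_cst (measurable_cell k) (leb_cell k)) mul1r.
rewrite -(i1 j 0) int_cell_child// (eq_bigr (fun=> dyvol j.+1)); last by move=> e _; exact: i1.
by rewrite sumr_const card_ffun card_bool card_ord -[dyvol _ *+ _]mulr_natl natrX.
Qed.

Definition dyavg j := avg mu (dyidx j) (dyvol j).

(** The vector carrying the child p.1 of a cube onto its sibling p.2, when the children have scale
    j; its coordinates are 0 or plus or minus 2^-j. *)
Definition dyshift j (p : bits * bits) : V :=
  dyvec j [ffun i => (p.1 i : nat)%:Z - (p.2 i : nat)%:Z].

Local Notation L1T := (L1 mu setT).
Local Notation intT := (Int mu setT).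

Section differences.
Variables (f : Rn R n -> R) (mf : measurable_fun setT f) (lf : L1T (fun x => f x ^+ 2)).

Lemma measurable_translated t : measurable_fun setT ((fun x => f (x + t)) : Rn R n -> R).
Proof. apply: (measurableT_comp mf); exact: measurable_shift. Qed.

Lemma L1_translated t : L1T (fun x => f (x + t) ^+ 2).
Proof. exact: (int_translateT t lf).1. Qed.

Lemma L1_diff t : L1T (fun x => (f x - f (x + t)) ^+ 2).
Proof.
exact: (L1_sqrB measurableT mf (measurable_translated t) lf (L1_translated t)).
Qed.

(** The average over the parent is the mean of the averages over its children, and each child is a
    translate of the one that contains x. The increment is thus a mean of averages of f - f(. + t)
    over sibling shifts t, which translation estimates control. *)
Lemma dyavg_diff j x : exists e0 : bits, dyavg j.+1 f x - dyavg j f x =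
  #|{: bits}|%:R^-1 * \sum_(e : bits) dyavg j.+1 (fun y => f y - f (y + dyshift j.+1 (e0, e))) x.
Proof.
have [e0 he0] := (@childP j _ x).1 erefl; exists e0.
have lc k c : L1 mu (cell k c) f.
  by apply: L1_cell_sqr => //; [exact: measurable_cell|exact: leb_cell].
have lct k c t : L1 mu (cell k c) (fun y => f (y + t)).
  apply: L1_cell_sqr; [exact: measurable_cell|exact: leb_cell|exact: measurable_translated|exact: L1_translated].
have N0 : #|{: bits}|%:R != 0 :> R.
  by rewrite card_ffun card_bool card_ord natrX expf_neq0.
have tr e : Int mu (cell j.+1 (child (dyidx j x) e)) f =
    Int mu (cell j.+1 (dyidx j.+1 x)) (fun y => f (y + dyshift j.+1 (e0, e))).
  rewrite -(int_translate (dyshift j.+1 (e0, e)) (measurable_cell _ _) (lc _ _)).2.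
  congr (Int mu _ _); rewrite he0 (cell_translate j.+1 (child (dyidx j x) e0) [ffun i => (e0 i : nat)%:Z - (e i : nat)%:Z]).
  congr (translate _ (_ @^-1` [set _])); apply/ffunP => i; rewrite !ffunE; ring.
have -> : dyavg j f x = #|{: bits}|%:R^-1 * \sum_(e : bits) dyavg j.+1 (fun y => f (y + dyshift j.+1 (e0, e))) x.
  rewrite /dyavg /avg int_cell_child// dyvolS invfM -mulrA.
  rewrite card_ffun card_bool card_ord natrX; congr (_ * _).
  by rewrite mulr_sumr; apply: eq_bigr => e _; rewrite tr.
have -> : dyavg j.+1 f x = #|{: bits}|%:R^-1 * \sum_(e : bits) dyavg j.+1 f x.
  by rewrite sumr_const -[dyavg _ _ _ *+ _]mulr_natl mulrA mulVf ?mul1r.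
rewrite -mulrBr -sumrB; congr (_ * _); apply: eq_bigr => e _.
by symmetry; apply: avgB => //; exact: measurable_cell.
Qed.

Variables (j : nat) (W : R).
Hypothesis hW : forall p, intT (fun x => (f x - f (x + dyshift j.+1 p)) ^+ 2) <= W.

Local Notation P := (#|{: bits * bits}|%:R : R).
Let Dif x := dyavg j.+1 f x - dyavg j f x.
(** Summing over all pairs of siblings removes the dependence of [e0] on x in [dyavg_diff]. *)
Let B x := \sum_(p : bits * bits) dyavg j.+1 (fun y => (f y - f (y + dyshift j.+1 p)) ^+ 2) x.

Let W0 : 0 <= W.
Proof.
apply: le_trans (hW ([ffun=> true], [ffun=> true])).
by apply: Rintegral_ge0 => x _; exact: sqr_ge0.
Qed.

Let DifB x : Dif x ^+ 2 <= B x.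
Proof.
have [e0 h] := dyavg_diff j x; rewrite /Dif h; apply: le_trans (sqr_mean_le _) _.
apply: (@le_trans _ _ (\sum_(e : bits) dyavg j.+1 (fun y => (f y - f (y + dyshift j.+1 (e0, e))) ^+ 2) x)).
  apply: ler_sum => e _; apply: (avg_sqr_le (measurable_cell _) (leb_cell _) (dyvol_gt0 _)).
    exact: (measurable_funB mf (measurable_translated _)).
  exact: L1_diff.
rewrite /B -(pair_bigA _ (fun a b => dyavg j.+1 (fun y => (f y - f (y + dyshift j.+1 (a, b))) ^+ 2) x)) /=.
rewrite [leRHS](bigD1 e0) //= lerDl; apply: sumr_ge0 => e _; apply: sumr_ge0 => e' _.
by apply: avg_ge0; [exact: dyvol_gt0|move=> y; exact: sqr_ge0].
Qed.

Lemma dydiff_sup x : Dif x ^+ 2 <= P * W / dyvol j.+1.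
Proof.
apply: le_trans (DifB x) _; rewrite -mulrA mulr_natl -sumr_const; apply: ler_sum => p _.
apply: le_trans (avg_le _ _ _ _ (L1_diff _)) _.
- exact: measurable_cell.
- exact: dyvol_gt0.
- by move=> y; exact: sqr_ge0.
- by rewrite mulrC ler_pM2r ?hW// invr_gt0 dyvol_gt0.
Qed.

Lemma measurable_dyavg k (g : Rn R n -> R) : measurable_fun setT (dyavg k g).
Proof. by apply: measurable_avg; exact: measurable_cell. Qed.

Lemma dydiff_int : L1T (fun x => Dif x ^+ 2) /\ intT (fun x => Dif x ^+ 2) <= P * W.
Proof.
have tow p := @avg_tower _ _ _ mu _ (dyidx j.+1) (dyvol j.+1) (measurable_cell j.+1)
  (leb_cell j.+1) (dyvol_gt0 j.+1) _ (fun y => sqr_ge0 (f y - f (y + dyshift j.+1 p))) (L1_diff _).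
have lB : L1T B by apply: L1_sum => // p; exact: (tow p).1.
have lD : L1T (fun x => Dif x ^+ 2).
  apply: (L1_dom measurableT _ lB).
    by apply: measurable_funX; apply: measurable_funB; exact: measurable_dyavg.
  by apply: aeP => x _; rewrite ger0_norm ?sqr_ge0.
split => //; apply: le_trans (le_int measurableT lD lB (fun x _ => DifB x)) _.
rewrite /B int_sum//; last by move=> p; exact: (tow p).1.
rewrite mulr_natl -sumr_const; apply: ler_sum => p _.
by rewrite (tow p).2.
Qed.

(** |Dif|^r is Dif^2 times a power of Dif^2, and that power is bounded by [dydiff_sup]. The negative
    power of the cell volume is the price of raising the exponent from 2 to r. *)
Lemma dydiff_pow r : 2 <= r -> L1T (fun x => `|Dif x| `^ r) /\
  intT (fun x => `|Dif x| `^ r) <= (P * W / dyvol j.+1) `^ ((r - 2) / 2) * (P * W).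
Proof.
move=> r2; have [lD iD] := dydiff_int.
set S := (P * W / dyvol j.+1) `^ ((r - 2) / 2).
have bd x : `|Dif x| `^ r <= S * Dif x ^+ 2.
  rewrite powR_split2// real_normK ?num_real// mulrC; apply: ler_wpM2r; first exact: sqr_ge0.
  apply: ge0_ler_powR; rewrite ?nnegrE ?sqr_ge0 ?dydiff_sup//; first lra.
  by rewrite divr_ge0 ?(ltW (dyvol_gt0 _))// mulr_ge0.
have lS := L1Z measurableT S lD.
have l : L1T (fun x => `|Dif x| `^ r).
  apply: (L1_dom measurableT _ lS).
    apply: (@measurableT_comp _ _ _ _ _ _ (fun y : R => `|y| `^ r)).
      by apply: (@measurableT_comp _ _ _ _ _ _ (@powR R ^~ r)); [exact: measurable_powR|exact: normr_measurable].
    exact: (measurable_funB (measurable_dyavg _ _) (measurable_dyavg _ _)).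
  by apply: aeP => x _; rewrite ger0_norm ?powR_ge0.
split => //; apply: le_trans (le_int measurableT l lS (fun x _ => bd x)) _.
by rewrite intZ//; apply: ler_wpM2l => //; exact: powR_ge0.
Qed.
End differences.
End dyadic.

Lemma powR_cvg (R : realType) (u : nat -> R) (l r : R) : 0 < r -> (forall n, 0 <= u n) ->
  u @ \oo --> l -> (fun n => u n `^ r) @ \oo --> l `^ r.
Proof.
move=> r0 u0 ul.
have l0 : 0 <= l by rewrite -(cvg_lim _ ul)//; apply: limr_ge; [apply/cvg_ex; exists l|exact: nearW].
have [l_eq|l_pos] := eqVneq l 0.
  rewrite l_eq powR0 ?gt_eqF//; apply: eps_cvg => e e0.
  have e'0 : 0 < e `^ r^-1 by exact: powR_gt0.
  have [N hN] := cvg_eps ul e'0; exists N => k /hN.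
  rewrite l_eq !subr0 !ger0_norm ?powR_ge0// => /ltW h.
  rewrite -[e]powRr1 ?(ltW e0)// -[1](@mulVf _ r) ?gt_eqF// powRrM.
  by apply: ge0_ler_powR; rewrite ?nnegrE ?powR_ge0// ltW.
have lp : 0 < l by rewrite lt_neqAle eq_sym l_pos.
rewrite /powR (negbTE l_pos).
apply: (@cvg_trans _ ((fun n => expR (r * ln (u n))) @ \oo)); last first.
  apply: continuous_cvg; first exact: continuous_expR.
  by apply: cvgMr; apply: continuous_cvg => //; exact: continuous_ln.
apply: near_eq_cvg.
have [N hN] := cvg_eps ul lp; exists N => // k /= /hN; rewrite ltr_distl => /andP[h _].
by rewrite ifF// gt_eqF//; move: h; rewrite subrr.
Qed.

(** * Summation of geometrically decaying increments in L^r *)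

Section geometric_Lr.
Context d (T : measurableType d) (R : realType).
Variables (mu : {measure set T -> \bar R}) (D : set T) (mD : measurable D).
Variables (r q A : R) (r0 : 0 < r) (q01 : 0 < q < 1) (A0 : 0 <= A).
Variables (g : nat -> T -> R) (f : T -> R).
Hypothesis mg : forall j, measurable_fun D (g j).
Hypothesis mf : measurable_fun D f.
Hypothesis ldif : forall j, L1 mu D (fun x => `|g j.+1 x - g j x| `^ r).
Hypothesis idif : forall j, Int mu D (fun x => `|g j.+1 x - g j x| `^ r) <= A * q ^+ j.
Hypothesis lgf : forall j, L1 mu D (fun x => (g j x - f x) ^+ 2).
Hypothesis gf : (fun j => Int mu D (fun x => (g j x - f x) ^+ 2)) @ \oo --> (0 : R).

Let l := q `^ (2 * r)^-1.
(** In [geo_sum_powR] the weight l = q^(1/(2r)) gives l^(-r) = q^(-1/2): half of the decay q^i pays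
    for the weights, and the other half, sqrt(q)^i, is summed. *)
Definition geo_const := ((1 - q `^ (2 * r)^-1)^-1) `^ r * (1 - Num.sqrt q)^-1.

Let l01 : 0 < l < 1.
Proof.
move: q01 => /andP[q0 q1]; rewrite powR_gt0//=.
have -> : 1 = 1 `^ (2 * r)^-1 :> R by rewrite powR1.
by rewrite gt0_ltr_powR ?nnegrE ?invr_gt0 ?mulr_gt0// ltW.
Qed.

Let lr : l^-1 `^ r = (Num.sqrt q)^-1.
Proof.
move: q01 => /andP[q0 q1].
have -> : l^-1 = q `^ - (2 * r)^-1 by rewrite powRN.
rewrite -powRrM -powR12_sqrt ?(ltW q0)// -powRN; congr (_ `^ _).
by field; rewrite gt_eqF.
Qed.

Let sq01 : 0 < Num.sqrt q < 1.
Proof.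
move: q01 => /andP[q0 q1]; rewrite sqrtr_gt0 q0 /=.
by rewrite -[ltRHS]sqrtr1 ltr_sqrt.
Qed.

Let measurable_powdif k j : measurable_fun D (fun x => `|g k x - g j x| `^ r).
Proof.
apply: (measurableT_comp (measurable_powR _)); apply: measurableT_comp => //.
exact: measurable_funB.
Qed.

Let partial j N : L1 mu D (fun x => `|g (j + N)%N x - g j x| `^ r) /\
  Int mu D (fun x => `|g (j + N)%N x - g j x| `^ r) <= geo_const * A * q ^+ j.
Proof.
move: (sq01) (l01) => /andP[s0 s1] /andP[l0 l1].
pose K := ((1 - l)^-1) `^ r.
have K0 : 0 <= K by exact: powR_ge0.
pose w x := K * \sum_(i < N) (l^-1 `^ r) ^+ i * `|g (j + i).+1 x - g (j + i)%N x| `^ r.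
have lw : L1 mu D w.
  by apply: L1Z => //; apply: L1_sum => // i; apply: L1Z.
have bd x : `|g (j + N)%N x - g j x| `^ r <= w x.
  have -> : g (j + N)%N x - g j x = \sum_(i < N) (g (j + i).+1 x - g (j + i)%N x).
    elim: (N) => [|M ih]; first by rewrite big_ord0 addn0 subrr.
    by rewrite big_ord_recr /= -ih addnS; ring.
  exact: (@geo_sum_powR _ l r (fun i => g (j + i).+1 x - g (j + i)%N x) N).
have lN : L1 mu D (fun x => `|g (j + N)%N x - g j x| `^ r).
  apply: (L1_dom mD _ lw) => //; apply: aeP => x _.
  by rewrite ger0_norm ?powR_ge0.
split => //; apply: le_trans (le_int mD lN lw (fun x _ => bd x)) _.
rewrite /w intZ//; last by apply: L1_sum => // i; apply: L1Z.
rewrite int_sum//; last by move=> i; apply: L1Z.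
rewrite /geo_const -/l -/K -!mulrA; apply: ler_wpM2l => //.
apply: (@le_trans _ _ (\sum_(i < N) A * q ^+ j * Num.sqrt q ^+ i)).
  apply: ler_sum => i _; rewrite intZ// lr.
  apply: (@le_trans _ _ ((Num.sqrt q)^-1 ^+ i * (A * q ^+ (j + i)))).
    by apply: ler_wpM2l => //; rewrite exprn_ge0// invr_ge0 ltW.
  have qs : q ^+ i = Num.sqrt q ^+ i * Num.sqrt q ^+ i.
    by rewrite -exprMn -expr2 sqr_sqrtr//; case/andP: q01 => /ltW.
  rewrite le_eqVlt; apply/orP; left; apply/eqP; rewrite exprD qs exprVn; field.
  by rewrite expf_neq0// gt_eqF.
rewrite -mulr_sumr [leRHS]mulrC.
apply: ler_wpM2l; last by apply: geo_le; rewrite (ltW s0) s1.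
by rewrite mulr_ge0// exprn_ge0//; case/andP: q01 => /ltW.
Qed.

(** The bound on g (j + N) - g j is uniform in N and passes to f by Fatou's lemma along an a.e.
    convergent subsequence. *)
Lemma geometric_Lr j : L1 mu D (fun x => `|f x - g j x| `^ r) /\
  Int mu D (fun x => `|f x - g j x| `^ r) <= geo_const * A * q ^+ j.
Proof.
have [s [G [sinc _ _ _ sG]]] := extract_ae mD lgf (fun n x _ => sqr_ge0 (g n x - f x)) gf.
(* Shifting by j before applying s keeps all indices at least j. *)
apply: (@fatou_bound _ _ _ _ _ mD (fun N x => `|g (s (j + N)%N) x - g j x| `^ r)).
- move=> N; have h := strictly_inc_ge sinc (j + N)%N.
  have := (partial j (s (j + N)%N - j)).1; rewrite subnKC//; exact: leq_trans (leq_addr _ _) h.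
- apply: (measurableT_comp (measurable_powR _)); apply: measurableT_comp => //.
  exact: measurable_funB.
- by move=> N x _; exact: powR_ge0.
- by move=> x _; exact: powR_ge0.
- apply: ae_mp sG => x Dx h.
  have h1 : (fun N => g (s N) x) @ \oo --> f x.
    apply/cvgrPdist_lt => e e0.
    have [M hM] := cvg_eps h (exprn_gt0 2 e0).
    exists M => // k /= /hM; rewrite subr0 ger0_norm ?sqr_ge0// => hk.
    by rewrite distrC -ltr_sqr ?nnegrE ?(ltW e0)// real_normK ?num_real.
  have h2 : (fun N => `|g (s (j + N)%N) x - g j x|) @ \oo --> `|f x - g j x|.
    apply: cvg_norm; apply: cvgB; last exact: cvg_cst.
    by apply: (@cvg_sub _ (fun k => g (s k) x) (addn j)) => // k; rewrite addnS.
  by apply: powR_cvg h2 => // k; exact: normr_ge0.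
- move=> N; have h := strictly_inc_ge sinc (j + N)%N.
  have := (partial j (s (j + N)%N - j)).2; rewrite subnKC//; exact: leq_trans (leq_addr _ _) h.
Qed.
End geometric_Lr.

(** * The dyadic embedding into L^r *)

Section dyadic_embedding.
Context {R : realType} {n : nat}.
Local Notation mu := (@leb R n).
Hypothesis leb_neq0 : mu setT != 0%E.
Local Notation L1T := (L1 mu setT).
Local Notation intT := (Int mu setT).
Local Notation P := (#|{: {ffun 'I_n -> bool} * {ffun 'I_n -> bool}}|%:R : R).

Lemma dyvolE j : (@dyvol R n j) = @dyvol R n 0 / (2 ^+ n) ^+ j.
Proof.
elim: j => [|j ih]; first by rewrite expr0 divr1.
have := dyvolS leb_neq0 j; rewrite ih exprS => e.
have p : (2 ^+ n : R) != 0 by rewrite expf_neq0.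
apply: (mulfI p); rewrite -e; field; by rewrite !expf_neq0.
Qed.

Variables (r b : Real.sort R) (r2 : 2 <= r) (b0 : 0 < b).
(** With W = k b^j, the bound of [dydiff_pow] is a power of P k b^j / dyvol j.+1 times P k b^j. As
    the volumes decay like 2^(-nj), it equals [dyA k * dyq ^+ j]; the factor 2^n in [dyA] comes from
    the volume being taken at scale j + 1. *)
Definition dyq := b * (b * 2 ^+ n) `^ ((r - 2) / 2).
Hypothesis q1 : dyq < 1.

Definition dyA (k : R) := (P * k * 2 ^+ n / @dyvol R n 0) `^ ((r - 2) / 2) * (P * k).

Variables (f : Rn R n -> R) (mf : measurable_fun setT f) (lf : L1T (fun x => f x ^+ 2)).
Variable k : R.
Hypothesis k0 : 0 <= k.
Hypothesis hk : forall j p, intT (fun x => (f x - f (x + dyshift j.+1 p)) ^+ 2) <= k * b ^+ j.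

Lemma dyadic_embedding : (fun j => intT (fun x => (dyavg j f x - f x) ^+ 2)) @ \oo --> (0 : R) ->
  forall j, L1T (fun x => `|f x - dyavg j f x| `^ r) /\
    intT (fun x => `|f x - dyavg j f x| `^ r) <= geo_const r dyq * dyA k * dyq ^+ j.
Proof.
move=> cf j.
have c2 i : L1T (fun x => dyavg i f x ^+ 2).
  by have [] := avg_contract (measurable_cell i) (leb_cell i) (dyvol_gt0 leb_neq0 i) mf lf.
have p2 : (0 : R) < 2 ^+ n by rewrite exprn_gt0.
have v0 := dyvol_gt0 leb_neq0 0.
have P0 : 0 <= P by exact: ler0n.
have r0 : 0 < r by exact: lt_le_trans r2.
have q01 : 0 < dyq < 1 by rewrite q1 andbT /dyq mulr_gt0// powR_gt0// mulr_gt0.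
have A0 : 0 <= dyA k by rewrite mulr_ge0 ?powR_ge0// mulr_ge0.
apply: (@geometric_Lr _ _ _ mu setT measurableT r dyq (dyA k) r0 q01 A0 (fun j => dyavg j f) f
  (fun i => measurable_dyavg i f) mf (fun i => (dydiff_pow leb_neq0 mf lf (hk i) r2).1) _
  (fun i => L1_sqrB measurableT (measurable_dyavg i f) mf (c2 i) lf) cf).
move=> i; apply: le_trans (dydiff_pow leb_neq0 mf lf (hk i) r2).2 _.
rewrite le_eqVlt; apply/orP; left; apply/eqP.
have -> : P * (k * b ^+ i) / @dyvol R n i.+1 = P * k * 2 ^+ n / @dyvol R n 0 * (b * 2 ^+ n) ^+ i.
  rewrite (dyvolE i.+1) exprS exprMn; field.
  by rewrite !expf_neq0 ?gt_eqF.
rewrite powRM ?exprn_ge0 ?divr_ge0 ?mulr_ge0 ?(ltW v0) ?(ltW p2) ?(ltW b0)//.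
rewrite powRX_nat ?mulr_ge0 ?(ltW p2) ?(ltW b0)//.
rewrite /dyA /dyq exprMn; ring.
Qed.
End dyadic_embedding.

(** * Square-integrable functions *)

Section square_integrable.
Context d (T : measurableType d) (R : realType).
Variables (mu : {measure set T -> \bar R}) (D : set T) (mD : measurable D).
Implicit Types f g h : T -> R.
Local Notation L1 := (L1 mu D).
Local Notation Int := (Int mu D).

Definition L2 f := measurable_fun D f /\ L1 (fun x => f x ^+ 2).
Definition ip f g := Int (fun x => f x * g x).
Definition sqn f := Int (fun x => f x ^+ 2).

Lemma L2D f g : L2 f -> L2 g -> L2 (fun x => f x + g x).
Proof. by move=> [mf lf] [mg lg]; split; [exact: measurable_funD|exact: L1_sqrD]. Qed.

Lemma L2Z k f : L2 f -> L2 (fun x => k * f x).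
Proof.
move=> [mf lf]; split; first exact: measurable_funM.
by apply: (eq_L1 mD _ (L1Z mD (k ^+ 2) lf)) => x _; rewrite exprMn.
Qed.

Lemma L2B f g : L2 f -> L2 g -> L2 (fun x => f x - g x).
Proof. by move=> [mf lf] [mg lg]; split; [exact: measurable_funB|exact: L1_sqrB]. Qed.

Lemma L20 : L2 (fun=> 0).
Proof. by split => //; apply: (eq_L1 mD _ (L10 _ _)) => x _; rewrite expr0n. Qed.

Lemma L2_sum (I : Type) (s : seq I) (F : I -> T -> R) :
  (forall i, L2 (F i)) -> L2 (fun x => \sum_(i <- s) F i x).
Proof.
move=> h; elim: s => [|i s ih].
  by rewrite (_ : (fun _ => _) = fun=> 0) ?funeqE//; [exact: L20|move=> x; rewrite big_nil].
rewrite (_ : (fun _ => _) = fun x => F i x + \sum_(j <- s) F j x); first exact: L2D.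
by rewrite funeqE => x; rewrite big_cons.
Qed.

Lemma L2M f g : L2 f -> L2 g -> L1 (fun x => f x * g x).
Proof. by move=> [mf lf] [mg lg]; exact: L1_mul. Qed.

Lemma sqn_ge0 f : 0 <= sqn f.
Proof. by apply: Rintegral_ge0 => x _; exact: sqr_ge0. Qed.

Lemma ipC f g : ip f g = ip g f.
Proof. by apply: eq_int => x _; rewrite mulrC. Qed.

Lemma ipZl k f h : L2 f -> L2 h -> ip (fun x => k * f x) h = k * ip f h.
Proof.
by move=> lf lh; rewrite -intZ//; [apply: eq_int => x _; rewrite mulrA|exact: L2M].
Qed.

Lemma ip_suml (I : Type) (s : seq I) (F : I -> T -> R) h : (forall i, L2 (F i)) -> L2 h ->
  ip (fun x => \sum_(i <- s) F i x) h = \sum_(i <- s) ip (F i) h.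
Proof.
move=> lF lh; rewrite /ip -int_sum//; last by move=> i; exact: L2M.
by apply: eq_int => x _; rewrite mulr_suml.
Qed.

Lemma ip_self f : ip f f = sqn f.
Proof. by apply: eq_int => x _; rewrite expr2. Qed.

Lemma sqnZ k f : L2 f -> sqn (fun x => k * f x) = k ^+ 2 * sqn f.
Proof. by move=> [_ lf]; rewrite /sqn -intZ//; apply: eq_int => x _; rewrite exprMn. Qed.

Lemma sqnD f g : L2 f -> L2 g -> sqn (fun x => f x + g x) = sqn f + 2 * ip f g + sqn g.
Proof.
move=> lf lg; rewrite /sqn /ip -intZ//; last exact: L2M.
rewrite -intD//; [|exact: lf.2|by apply: L1Z => //; exact: L2M].
rewrite -intD//; [|by apply: L1D => //; [exact: lf.2|apply: L1Z => //; exact: L2M]|exact: lg.2].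
by apply: eq_int => x _; ring.
Qed.

Lemma sqnD_le f g : L2 f -> L2 g -> sqn (fun x => f x + g x) <= 2 * sqn f + 2 * sqn g.
Proof.
move=> lf lg; rewrite /sqn -!intZ//; try by [exact: lf.2|exact: lg.2].
rewrite -intD//; try by [apply: L1Z => //; [exact: lf.2|exact: lg.2]].
  apply: le_int => //; first exact: (L2D lf lg).2.
  - by apply: L1D => //; apply: L1Z => //; [exact: lf.2|exact: lg.2].
  - by move=> x _; exact: sqrD_le2.
all: by apply: L1Z => //; [exact: lf.2||exact: lg.2].
Qed.

Lemma sqnB_sym f g : sqn (fun x => f x - g x) = sqn (fun x => g x - f x).
Proof. by apply: eq_int => x _; rewrite -sqrrN opprB. Qed.

Lemma cauchy_schwarz f g : L2 f -> L2 g -> `|ip f g| <= Num.sqrt (sqn f) * Num.sqrt (sqn g).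
Proof.
move=> lf lg; rewrite -sqrtrM ?sqn_ge0// -sqrtr_sqr; apply: ler_wsqrtr.
have h t : 0 <= sqn f + 2 * t * ip f g + t ^+ 2 * sqn g.
  have := sqn_ge0 (fun x => f x + t * g x); rewrite sqnD//; last exact: L2Z.
  by rewrite sqnZ// (ipC f) ipZl// (ipC g) mulrA.
have g0 := sqn_ge0 g; have f0 := sqn_ge0 f.
have [gz|gn] := eqVneq (sqn g) 0.
  rewrite gz mulr0; have [->|ipn] := eqVneq (ip f g) 0; first by rewrite expr0n.
  (* With sqn g = 0 the expression is affine in t, and this t would give it the value -1. *)
  have := h (- (sqn f + 1) / (2 * ip f g)); rewrite gz mulr0 addr0.
  have -> : sqn f + 2 * (- (sqn f + 1) / (2 * ip f g)) * ip f g = - 1 by field.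
  by rewrite oppr_ge0 ler10.
have gp : 0 < sqn g by rewrite lt_neqAle eq_sym gn.
have := h (- ip f g / sqn g).
have -> : sqn f + 2 * (- ip f g / sqn g) * ip f g + (- ip f g / sqn g) ^+ 2 * sqn g =
  (sqn f * sqn g - ip f g ^+ 2) / sqn g by field.
by rewrite pmulr_lge0 ?invr_gt0// subr_ge0.
Qed.

Section limits.
Variables (F G : nat -> T -> R) (f g : T -> R).
Hypotheses (lF : forall n, L2 (F n)) (lG : forall n, L2 (G n)) (lf : L2 f) (lg : L2 g).
Hypothesis Ff : (fun n => sqn (fun x => F n x - f x)) @ \oo --> (0 : R).
Hypothesis Gg : (fun n => sqn (fun x => G n x - g x)) @ \oo --> (0 : R).

Let sqrt_cvg0 (u : nat -> R) : u @ \oo --> (0 : R) -> (fun n => Num.sqrt (u n)) @ \oo --> (0 : R).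
Proof.
move=> h; rewrite -[X in _ --> X]sqrtr0; apply: continuous_cvg h; exact: sqrt_continuous.
Qed.

Lemma ip_cvg : (fun n => ip (F n) (G n)) @ \oo --> ip f g.
Proof.
pose a n := Num.sqrt (sqn (fun x => F n x - f x)).
pose b n := Num.sqrt (sqn (fun x => G n x - g x)).
have a0 : a @ \oo --> (0 : R) by exact: sqrt_cvg0.
have b0 : b @ \oo --> (0 : R) by exact: sqrt_cvg0.
pose B n := a n * b n + a n * Num.sqrt (sqn g) + Num.sqrt (sqn f) * b n.
have B0 : B @ \oo --> (0 : R).
  rewrite (_ : 0 = 0 * 0 + 0 * Num.sqrt (sqn g) + Num.sqrt (sqn f) * 0); last by rewrite !(mul0r, mulr0) !addr0.
  apply: cvgD; first apply: cvgD; first exact: cvgM.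
    by apply: cvgMl.
  by apply: cvgMr.
have bd n : `|ip (F n) (G n) - ip f g| <= B n.
  have l1 := L2B (lF n) lf; have l2 := L2B (lG n) lg.
  have -> : ip (F n) (G n) - ip f g = ip (fun x => F n x - f x) (fun x => G n x - g x)
     + ip (fun x => F n x - f x) g + ip f (fun x => G n x - g x).
    rewrite /ip -intB//; try exact: L2M.
    rewrite -intD//; try exact: L2M.
    rewrite -intD//; try by [exact: L2M|apply: L1D => //; exact: L2M].
    by apply: eq_int => x _; ring.
  apply: le_trans (ler_normD _ _) _; apply: lerD; last exact: cauchy_schwarz.
  by apply: le_trans (ler_normD _ _) _; apply: lerD; exact: cauchy_schwarz.
apply: eps_cvg => e e0; have [N hN] := cvg0_eps B0 e0; exists N => k /hN /ltW.
by move=> h; apply: le_trans (bd k) _; apply: le_trans (ler_norm _) h.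
Qed.
End limits.

Lemma sqn_cvg (F : nat -> T -> R) f : (forall n, L2 (F n)) -> L2 f ->
  (fun n => sqn (fun x => F n x - f x)) @ \oo --> (0 : R) -> (fun n => sqn (F n)) @ \oo --> sqn f.
Proof.
move=> lF lf h; rewrite -ip_self; under eq_fun do rewrite -ip_self.
exact: ip_cvg.
Qed.

Lemma sqnD_cvg0 (F G : nat -> T -> R) f g : (forall n, L2 (F n)) -> (forall n, L2 (G n)) ->
  L2 f -> L2 g ->
  (fun n => sqn (fun x => F n x - f x)) @ \oo --> (0 : R) ->
  (fun n => sqn (fun x => G n x - g x)) @ \oo --> (0 : R) ->
  (fun n => sqn (fun x => (F n x + G n x) - (f x + g x))) @ \oo --> (0 : R).
Proof.
move=> lF lG lf lg hF hG.
apply: (@squeeze_cvgr _ _ _ _ (cst 0) (fun n => 2 * sqn (fun x => F n x - f x) + 2 * sqn (fun x => G n x - g x))).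
- apply: nearW => n /=; rewrite sqn_ge0 /=.
  apply: le_trans (sqnD_le (L2B (lF n) lf) (L2B (lG n) lg)).
  by rewrite le_eqVlt; apply/orP; left; apply/eqP; apply: eq_int => x _; congr (_ ^+ 2); ring.
- exact: cvg_cst.
- rewrite (_ : 0 = 2 * 0 + 2 * 0); last by rewrite !mulr0 addr0.
  by apply: cvgD; apply: cvgMr.
Qed.

Lemma sqnZ_cvg0 k (F : nat -> T -> R) f : (forall n, L2 (F n)) -> L2 f ->
  (fun n => sqn (fun x => F n x - f x)) @ \oo --> (0 : R) ->
  (fun n => sqn (fun x => k * F n x - k * f x)) @ \oo --> (0 : R).
Proof.
move=> lF lf h.
have -> : (fun n => sqn (fun x => k * F n x - k * f x)) = fun n => k ^+ 2 * sqn (fun x => F n x - f x).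
  rewrite funeqE => n; rewrite -sqnZ; last exact: L2B.
  by apply: eq_int => x _; rewrite mulrBr.
by rewrite -(mulr0 (k ^+ 2)); apply: cvgMr.
Qed.

Lemma sqnB_cvg (F G : nat -> T -> R) f g : (forall n, L2 (F n)) -> (forall n, L2 (G n)) ->
  L2 f -> L2 g ->
  (fun n => sqn (fun x => F n x - f x)) @ \oo --> (0 : R) ->
  (fun n => sqn (fun x => G n x - g x)) @ \oo --> (0 : R) ->
  (fun n => sqn (fun x => F n x - G n x)) @ \oo --> sqn (fun x => f x - g x).
Proof.
move=> lF lG lf lg hF hG; apply: sqn_cvg; [by move=> n; exact: L2B|exact: L2B|].
have lN h : L2 h -> L2 (fun x => -1 * h x) by exact: L2Z.
have := sqnD_cvg0 lF (fun n => lN _ (lG n)) lf (lN _ lg) hF (@sqnZ_cvg0 (-1) _ _ lG lg hG).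
apply: cvg_trans; apply: near_eq_cvg; apply: nearW => n.
by apply: eq_int => x _; congr (_ ^+ 2); ring.
Qed.

Lemma sqn_sum_cvg0 (I : Type) (s : seq I) (c : I -> R) (F : I -> nat -> T -> R) (f : I -> T -> R) :
  (forall i n, L2 (F i n)) -> (forall i, L2 (f i)) ->
  (forall i, (fun n => sqn (fun x => F i n x - f i x)) @ \oo --> (0 : R)) ->
  (fun n => sqn (fun x => \sum_(i <- s) c i * F i n x - \sum_(i <- s) c i * f i x)) @ \oo --> (0 : R).
Proof.
move=> lF lf h; elim: s => [|i s ih].
  rewrite (_ : (fun n => _) = cst 0); first exact: cvg_cst.
  rewrite funeqE => n /=; rewrite /sqn -[RHS](int0 mu D); apply: eq_int => x _.
  by rewrite !big_nil subrr expr0n.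
under eq_fun => n.
  rewrite (_ : (fun x => _) = (fun x => (c i * F i n x + \sum_(j <- s) c j * F j n x) -
    (c i * f i x + \sum_(j <- s) c j * f j x))); last by rewrite funeqE => x; rewrite !big_cons.
  over.
apply: (@sqnD_cvg0 (fun n x => c i * F i n x) (fun n x => \sum_(j <- s) c j * F j n x)) => //.
- by move=> n; exact: L2Z.
- by move=> n; apply: L2_sum => j; exact: L2Z.
- exact: L2Z.
- by apply: L2_sum => j; exact: L2Z.
- exact: sqnZ_cvg0.
Qed.
End square_integrable.

(** * Translates of functions with square-integrable gradient *)

Section translation_estimate.
Context {R : realType} {n : nat}.
Local Notation V := 'rV[R]_n.
Local Notation mu := (@leb R n).
Implicit Types (phi psi : V -> R).
Local Notation e_ i := (delta_mx ord0 i : V).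
Local Notation L1T := (L1 mu setT).
Local Notation L2T := (L2 mu setT).
Local Notation sqT := (sqn mu setT).

(** What the translation estimates use of a test function: one derivative, and some compact set
    outside which it vanishes. *)
Definition C1c phi := [/\ continuous phi, forall x i, derivable phi x (e_ i),
  forall i, continuous (partial i phi) & exists K, compact K /\ forall x, ~ K x -> phi x = 0].

Lemma test_C1c Omega phi : test_function Omega phi -> C1c phi.
Proof.
move=> [h [K [cK _ K0]]]; split.
- exact: (h [::]).1.
- exact: (h [::]).2.
- by move=> i; exact: (h [:: i]).1.
- by exists K.
Qed.

Lemma partialD i phi psi x : derivable phi x (e_ i) -> derivable psi x (e_ i) ->
  partial i (fun y => phi y + psi y) x = partial i phi x + partial i psi x.
Proof. exact: deriveD. Qed.

Lemma partialZ i k phi x : derivable phi x (e_ i) ->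
  partial i (fun y => k * phi y) x = k * partial i phi x.
Proof. exact: deriveZ. Qed.

Lemma C1cD phi psi : C1c phi -> C1c psi -> C1c (fun y => phi y + psi y).
Proof.
move=> [c1 d1 p1 [K [cK K0]]] [c2 d2 p2 [L [cL L0]]]; split.
- by move=> x; apply: (@continuousD _ _ _ phi psi x); [exact: c1|exact: c2].
- by move=> x i; exact: derivableD.
- move=> i; rewrite (_ : partial i _ = fun x => partial i phi x + partial i psi x).
    by move=> x; apply: (@continuousD _ _ _ (partial i phi) (partial i psi) x); [exact: p1|exact: p2].
  by rewrite funeqE => x; exact: partialD.
- exists (K `|` L); split; first exact: compactU.
  by move=> x h; rewrite K0 ?L0 ?addr0// => hx; apply: h; [right|left].
Qed.

Lemma C1cZ k phi : C1c phi -> C1c (fun y => k * phi y).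
Proof.
move=> [c1 d1 p1 [K [cK K0]]]; split.
- by move=> x; apply: (@continuousM _ _ (cst k) phi x); [exact: cst_continuous|exact: c1].
- by move=> x i; exact: derivableZ.
- move=> i; rewrite (_ : partial i _ = fun x => k * partial i phi x).
    by move=> x; apply: (@continuousM _ _ (cst k) (partial i phi) x); [exact: cst_continuous|exact: p1].
  by rewrite funeqE => x; exact: partialZ.
- by exists K; split => // x /K0 ->; rewrite mulr0.
Qed.

Lemma C1c0 : C1c (fun=> 0).
Proof.
split.
- exact: cst_continuous.
- by move=> x i; exact: derivable_cst.
- move=> i; rewrite (_ : partial i _ = fun=> 0); first exact: cst_continuous.
  by rewrite funeqE => x; exact: derive_cst.
- by exists set0; split; first exact: compact0.
Qed.

Lemma C1c_sum (I : Type) (s : seq I) (a : I -> R) (phi : I -> V -> R) : (forall i, C1c (phi i)) ->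
  C1c (fun x => \sum_(j <- s) a j * phi j x) /\
  forall i x, partial i (fun x => \sum_(j <- s) a j * phi j x) x = \sum_(j <- s) a j * partial i (phi j) x.
Proof.
move=> h; elim: s => [|k s [ih1 ih2]].
  rewrite (_ : (fun x => _) = fun=> 0); last by rewrite funeqE => x; rewrite big_nil.
  by split; [exact: C1c0|move=> i x; rewrite big_nil; exact: derive_cst].
rewrite (_ : (fun x => _) = fun x => a k * phi k x + \sum_(j <- s) a j * phi j x); last first.
  by rewrite funeqE => x; rewrite big_cons.
have hk := C1cZ (a k) (h k); split; first exact: C1cD.
move=> i x; rewrite partialD; last 2 first.
- by case: hk.
- by case: ih1.
by rewrite ih2 big_cons partialZ//; case: (h k).
Qed.

Lemma leb_compact (K : set V) : compact K -> measurable (K : set (Rn R n)) /\ (mu K < +oo)%E.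
Proof.
move=> cK; split; last by apply: leb_bounded; exact: compact_bounded.
rewrite -[K]setCK; apply: measurableC; apply: open_Rn_measurable.
by apply: closed_openC; apply: compact_closed => //; exact: norm_hausdorff.
Qed.

Lemma bounded_csupp_L2 (f : Rn R n -> R) K C : measurable_fun setT f -> compact (K : set V) ->
  (forall x, ~ K x -> f x = 0) -> (forall x, `|f x| <= C) -> L2T f.
Proof.
move=> mf cK K0 fC; split => //; have [mK Kfin] := leb_compact cK.
have l : L1 mu K (fun=> C ^+ 2) by exact: L1_cst.
apply: (L1_dom measurableT _ (L1_patch mK l)); first exact: measurable_funX.
apply: aeP => x _; rewrite ger0_norm ?sqr_ge0// /patch; case: ifPn => [_|/negP xK].
  rewrite -real_normK ?num_real// ler_sqr ?nnegrE//; exact: le_trans (fC x).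
by rewrite K0 ?expr0n// => h; apply: xK; exact: mem_set.
Qed.

Lemma partial_csupp phi (K : set V) i : compact K -> (forall x, ~ K x -> phi x = 0) ->
  forall x, ~ K x -> partial i phi x = 0.
Proof.
move=> cK K0 x Kx; rewrite /partial (@near_eq_derive _ _ _ _ (cst 0)) ?derive_cst//.
have : open (~` K) by apply: closed_openC; apply: compact_closed => //; exact: norm_hausdorff.
move=> oK; have := open_nbhs_nbhs (conj oK Kx); apply: filterS => y; exact: K0.
Qed.

Lemma continuous_csupp_bounded (f : V -> R) (K : set V) : compact K -> continuous f ->
  (forall x, ~ K x -> f x = 0) -> exists2 C, 0 <= C & forall x, `|f x| <= C.
Proof.
move=> cK cf K0.
have /compact_bounded[M [_ hM]] : compact (f @` K).
  by apply: continuous_compact => //; exact: continuous_subspaceT.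
exists (`|M| + 1); first by rewrite addr_ge0.
move=> x; have [Kx|nKx] := pselect (K x); last by rewrite K0// normr0 addr_ge0.
by apply: (hM (`|M| + 1)); [rewrite ltr_pwDr// ler_norm|exists x].
Qed.

Lemma C1c_L2 phi : C1c phi -> L2T phi /\ forall i, L2T (partial i phi).
Proof.
move=> [c d p [K [cK K0]]]; split.
  have [C _ hC] := continuous_csupp_bounded cK c K0.
  by apply: bounded_csupp_L2 cK K0 hC; exact: continuous_Rn_measurable.
move=> i; have pK := partial_csupp i cK K0.
have [C _ hC] := continuous_csupp_bounded cK (p i) pK.
by apply: bounded_csupp_L2 cK pK hC; exact: continuous_Rn_measurable.
Qed.

Lemma L2_translate t (f : Rn R n -> R) : L2T f ->
  L2T (fun x => f (x + t)) /\ sqT (fun x => f (x + t)) = sqT f.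
Proof.
move=> [mf lf]; split; first by split; [exact: measurable_translated|exact: L1_translated].
exact: (int_translateT t lf).2.
Qed.

Lemma sqr_sum_le N (a : 'I_N -> R) : (\sum_i a i) ^+ 2 <= N%:R * \sum_i a i ^+ 2.
Proof.
elim: N a => [|N ih] a; first by rewrite !big_ord0 expr0n mulr0.
rewrite !big_ord_recr /=; set S := \sum_(i < N) a _; set Q := \sum_(i < N) a _ ^+ 2.
have h : S ^+ 2 <= N%:R * Q by exact: ih.
set b := a ord_max.
have N0 : 0 <= N%:R :> R by exact: ler0n.
have Q0 : 0 <= Q by apply: sumr_ge0 => i _; exact: sqr_ge0.
have key : 2 * S * b <= Q + N%:R * b ^+ 2.
  have [N_0|Np] := eqVneq (N%:R : R) 0.
    have S0 : S = 0 by apply/eqP; rewrite -sqrf_eq0 eq_le sqr_ge0 andbT; apply: le_trans h _; rewrite N_0 mul0r.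
    by rewrite S0 mulr0 mul0r addr_ge0// mulr_ge0// sqr_ge0.
  have Npos : 0 < N%:R :> R by rewrite lt_neqAle eq_sym Np.
  rewrite -(ler_pM2l Npos) mulrDr; have := sqr_ge0 (S - N%:R * b); lra.
by rewrite -[N.+1%:R]natr1; move: h key; rewrite sqrrD; lra.
Qed.

Lemma sqn_sum_le N (a : 'I_N -> Rn R n -> R) : (forall i, L2T (a i)) ->
  sqT (fun x => \sum_i a i x) <= N%:R * \sum_i sqT (a i).
Proof.
move=> la; rewrite /sqn -int_sum//; last by move=> i; exact: (la i).2.
have lS : L1T (fun x => \sum_i a i x ^+ 2) by apply: L1_sum => // i; exact: (la i).2.
rewrite -intZ//; apply: le_int => //; [exact: (L2_sum _ _ la).2|exact: L1Z|].
by move=> x _; exact: sqr_sum_le.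
Qed.

(* Cutting the segment into N pieces: by translation invariance each piece contributes equally. *)
Lemma sqn_translate_pieces (f : Rn R n -> R) (t : V) N : L2T f ->
  sqT (fun x => f (x + N%:R *: t) - f x) <= N%:R ^+ 2 * sqT (fun x => f (x + t) - f x).
Proof.
move=> lf; have lt s := (L2_translate s lf).1.
have ld : L2T (fun x => f (x + t) - f x) by exact: L2B.
have e k : (fun x => f (x + k%:R *: t + t) - f (x + k%:R *: t)) =
    fun x => (fun y => f (y + t) - f y) (x + k%:R *: t) by [].
have -> : sqT (fun x => f (x + N%:R *: t) - f x) =
    sqT (fun x => \sum_(k < N) (f (x + k%:R *: t + t) - f (x + k%:R *: t))).
  congr (sqn _ _ _); rewrite funeqE => x; elim: (N) => [|M ih].
    by rewrite big_ord0 scale0r addr0 subrr.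
  rewrite big_ord_recr /= -ih -[M.+1%:R]natr1 scalerDl scale1r addrA; ring.
apply: le_trans (@sqn_sum_le N (fun k x => f (x + k%:R *: t + t) - f (x + k%:R *: t)) _) _.
  by move=> k; rewrite e; exact: (L2_translate _ ld).1.
rewrite (eq_bigr (fun=> sqT (fun x => f (x + t) - f x))); last first.
  by move=> k _; rewrite e (L2_translate _ ld).2.
by rewrite sumr_const card_ord -[sqT _ *+ _]mulr_natl mulrA expr2.
Qed.
End translation_estimate.

Lemma cvg_sum_seq (R : realType) (I : Type) (s : seq I) (u : I -> nat -> R) (l : I -> R) :
  (forall i, u i @ \oo --> l i) -> (fun n => \sum_(i <- s) u i n) @ \oo --> \sum_(i <- s) l i.
Proof.
move=> h; elim: s => [|i s ih].
  by rewrite big_nil; under eq_fun do rewrite big_nil; exact: cvg_cst.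
by rewrite big_cons; under eq_fun do rewrite big_cons; apply: cvgD.
Qed.

Lemma lipschitz_of_derive (R : realType) (g dg : R -> R) (L : R) :
  (forall x, is_derive x (1:R) g (dg x)) -> (forall x, `|dg x| <= L) ->
  forall a b, `|g b - g a| <= L * `|b - a|.
Proof.
move=> dgx dL.
have cg : continuous g.
  by move=> x; apply/differentiable_continuous/derivable1_diffP; exact: (@ex_derive _ _ _ _ _ _ _ (dgx x)).
have key a b : a <= b -> `|g b - g a| <= L * `|b - a|.
  move=> ab; have [c _ ->] := @MVT_segment R g dg a b ab (fun x _ => dgx x) (continuous_subspaceT cg).
  by rewrite normrM; apply: ler_wpM2r.
move=> a b; have [/key//|/ltW /key] := leP a b.
by rewrite distrC [`|a - b|]distrC.
Qed.

Section translation_bounds.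
Context {R : realType} {n : nat}.
Local Notation V := 'rV[R]_n.
Local Notation mu := (@leb R n).
Implicit Types (phi psi : V -> R).
Local Notation e_ i := (delta_mx ord0 i : V).
Local Notation L1T := (L1 mu setT).
Local Notation L2T := (L2 mu setT).
Local Notation sqT := (sqn mu setT).

Lemma L2_translateB (t : V) (f : Rn R n -> R) : L2T f -> L2T (fun x => f (x + t) - f x).
Proof. by move=> lf; exact: (L2B measurableT (L2_translate t lf).1 lf). Qed.

Lemma is_derive_line phi (x : V) i (s : R) : (forall y, derivable phi y (e_ i)) ->
  is_derive s (1:R) (fun s => phi (x + s *: e_ i)) (partial i phi (x + s *: e_ i)).
Proof.
move=> d.
have e : (fun h : R => h^-1 *: (((fun s : R => phi (x + s *: e_ i)) \o shift s) (h *: 1) - phi (x + s *: e_ i))) =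
    (fun h => h^-1 *: ((phi \o shift (x + s *: e_ i)) (h *: e_ i) - phi (x + s *: e_ i))).
  rewrite funeqE => h; congr (_ *: (phi _ - _)).
  by rewrite /= [h *: 1]mulr1 scalerDl addrCA.
split; first by rewrite /derivable e; exact: d.
by rewrite /derive e.
Qed.

Lemma coord_bump (x : V) i (h : R) j : `|x ord0 j| <= `|(x + h *: e_ i) ord0 j| + `|h|.
Proof.
have -> : x ord0 j = (x + h *: e_ i) ord0 j - h * (e_ i) ord0 j by rewrite !mxE addrK.
apply: le_trans (ler_normB _ _) _; apply: lerD => //.
by rewrite normrM mxE; case: (_ && _); rewrite ?normr1 ?mulr1// normr0 mulr0.
Qed.

Lemma measurable_ball0 (M : R) : let S := [set x : V | forall i, `|x ord0 i - (0 : V) ord0 i| < M] in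
  measurable (S : set (Rn R n)) /\ (mu S < +oo)%E.
Proof.
split; first exact: measurable_cube.
apply: leb_bounded; exists (`|M| + 1); split => // B MB x h.
change (mx_norm x <= B); rewrite mx_normrE; apply/bigmax_leP.
have B0 : 0 <= B by apply: ltW (le_lt_trans _ MB); rewrite addr_ge0.
split => // -[i0 i] _ /=; have -> : i0 = ord0 by exact: ord1.
have := h i; rewrite mxE subr0 => /ltW hi; apply: le_trans hi _.
by apply: le_trans (ler_norm M) _; apply: ltW; apply: lt_trans MB; rewrite ltrDl.
Qed.

(** By [sqn_translate_pieces] with N + 1 pieces, the left-hand side is at most t^2 times the squared
    norm of a difference quotient of step t/(N+1), which tends to the partial derivative by
    dominated convergence. *)
Lemma translate_axis phi i (t : R) : C1c phi ->
  sqT (fun x => phi (x + t *: e_ i) - phi x) <= t ^+ 2 * sqT (partial i phi).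
Proof.
move=> cphi; have [lphi lpart] := C1c_L2 cphi.
have [c dphi p [K [cK K0]]] := cphi.
have [->|t0] := eqVneq t 0.
  rewrite expr0n mul0r (_ : sqn _ _ _ = 0)//.
  transitivity (Int mu setT (fun=> 0)); last exact: int0.
  by apply: eq_int => x _; rewrite scale0r addr0 subrr expr0n.
pose h N : R := t / N.+1%:R.
have h0 N : h N != 0 by rewrite mulf_neq0// invr_neq0// pnatr_eq0.
have ht N : `|h N| <= `|t|.
  rewrite /h normrM normfV [`|_%:R|]ger0_norm// ler_pdivrMr ?ltr0n// ler_peMr// ler1n.
  done.
have hcvg : h @ \oo --> (0 : R).
  by rewrite -(mulr0 t); apply: cvgMr; exact: cvg_harmonic.
pose q N (x : V) := (h N)^-1 * (phi (x + h N *: e_ i) - phi x).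
have step N : sqT (fun x => phi (x + t *: e_ i) - phi x) <= t ^+ 2 * sqT (q N).
  have := sqn_translate_pieces (h N *: e_ i) N.+1 lphi.
  have -> : N.+1%:R *: (h N *: e_ i) = t *: e_ i.
    by rewrite scalerA /h mulrCA divff ?mulr1// pnatr_eq0.
  move=> H; apply: le_trans H _; rewrite [sqT (q N)]sqnZ; [|exact: measurableT|]; last first.
    exact: L2_translateB.
  rewrite mulrA le_eqVlt; apply/orP; left; apply/eqP; congr (_ * _).
  have : N.+1%:R != 0 :> R by rewrite pnatr_eq0.
  by rewrite /h; move: (N.+1%:R : R) => M M0; field; rewrite t0 M0.
have [L L0 hL] := continuous_csupp_bounded cK (p i) (partial_csupp i cK K0).
have lip x (s : R) : `|phi (x + s *: e_ i) - phi x| <= L * `|s|.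
  have := @lipschitz_of_derive R (fun s => phi (x + s *: e_ i)) _ L
    (fun s => is_derive_line x s (fun y => dphi y i)) (fun s => hL _) 0 s.
  by rewrite scale0r addr0 subr0.
have [B [_ hB]] := compact_bounded cK.
(* The cube of this size contains K and every point that a shift of length at most |t| along the
   axis moves into K, so all difference quotients vanish outside it. *)
pose M := `|B| + 1 + `|t| + 1.
have [mS Sfin] := measurable_ball0 M.
set S := [set x : V | _] in mS Sfin.
have qS N x : ~ S x -> q N x = 0.
  move=> Sx.
  have Kx (s : R) : `|s| <= `|t| -> phi (x + s *: e_ i) = 0.
    move=> st; apply: K0 => Kx; apply: Sx => j; rewrite mxE subr0.
    apply: le_lt_trans (coord_bump x i s j) _.
    have : `|x + s *: e_ i| <= `|B| + 1.
      by apply: (hB (`|B| + 1)) => //; rewrite ltr_pwDr// ler_norm.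
    have := ler_coord_norm (x + s *: e_ i) j; rewrite /M; lra.
  have phix : phi x = 0 by have := Kx 0; rewrite normr0 scale0r addr0; exact.
  by rewrite /q (Kx _ (ht N)) phix subrr mulr0.
have qL N x : q N x ^+ 2 <= ((fun=> L ^+ 2) \_ S) x.
  rewrite /patch; case: ifPn => [_|/negP xS]; last first.
    by rewrite qS ?expr0n// => Sx; apply: xS; exact: mem_set.
  rewrite -real_normK ?num_real// ler_sqr ?nnegrE// normrM normfV.
  by rewrite ler_pdivrMl ?normr_gt0// mulrC; exact: lip.
have qcvg x : (fun N => q N x) @ \oo --> partial i phi x.
  have hd : h @ \oo --> (0 : R)^'.
    move=> A [e e0 hA]; have [N hN] := cvg0_eps hcvg e0.
    by exists N => // k /= /hN hk; apply: hA => //; rewrite /ball /= sub0r normrN.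
  have := @cvg_comp _ _ _ h _ _ _ _ hd (dphi x i).
  apply: cvg_trans; apply: near_eq_cvg; apply: nearW => N /=.
  by rewrite /q [x + _]addrC.
have lq N : L2T (q N).
  exact: (L2Z measurableT _ (L2_translateB _ lphi)).
have [_ lim] : L1T (fun x => partial i phi x ^+ 2) /\
    (fun N => Int mu setT (fun x => q N x ^+ 2)) @ \oo --> Int mu setT (fun x => partial i phi x ^+ 2).
  apply: (@dct _ (Rn R n) R mu setT measurableT (fun N x => q N x ^+ 2) (fun x => partial i phi x ^+ 2) ((fun=> L ^+ 2) \_ S)).
  - by move=> N; have := L1_meas (lq N).2.
  - by have := L1_meas (lpart i).2.
  - by apply: L1_patch => //; exact: L1_cst.
  - by apply: aeP => x _; rewrite expr2; under eq_fun do rewrite expr2; apply: cvgM; exact: qcvg.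
  - by move=> N; apply: aeP => x _; rewrite ger0_norm ?sqr_ge0.
have lim2 : (fun N => t ^+ 2 * sqT (q N)) @ \oo --> t ^+ 2 * sqT (partial i phi) by apply: cvgMr.
rewrite -(cvg_lim _ lim2)//; apply: limr_ge; first by apply/cvg_ex; eexists; exact: lim2.
exact: nearW.
Qed.

(** The path from 0 to t along the axes has n legs; the factor n comes from squaring a sum of n
    terms. *)
Lemma translate_vec phi (t : V) : C1c phi ->
  sqT (fun x => phi (x + t) - phi x) <= n%:R * \sum_i (t ord0 i) ^+ 2 * sqT (partial i phi).
Proof.
move=> cphi; have [lphi _] := C1c_L2 cphi.
pose s k : V := \row_i (if (i < k)%N then t ord0 i else 0).
have s0 : s 0%N = 0 by apply/rowP => i; rewrite !mxE.
have sn : s n = t by apply/rowP => i; rewrite !mxE ltn_ord.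
have sS (k : 'I_n) : s k.+1 = s k + t ord0 k *: e_ k.
  apply/rowP => i; rewrite !mxE eqxx /= ltnS leq_eqVlt.
  have [->|ik] := eqVneq i k; first by rewrite eqxx ltnn mulr1 add0r.
  by rewrite (_ : (i : nat) == k = false) ?mulr0 ?addr0//; apply/negbTE.
pose a (k : 'I_n) (x : Rn R n) := phi (x + s k + t ord0 k *: e_ k) - phi (x + s k).
have d k : L2T (fun x => phi (x + t ord0 k *: e_ k) - phi x).
  exact: L2_translateB.
have la k : L2T (a k) by exact: (L2_translate (s k) (d k)).1.
have -> : sqT (fun x => phi (x + t) - phi x) = sqT (fun x => \sum_k a k x).
  congr (sqn _ _ _); rewrite funeqE => x.
  have h N : (N <= n)%N -> phi (x + s N) - phi x = \sum_(k < n | (k < N)%N) a k x.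
    elim: N => [_|N ih Nn]; first by rewrite s0 addr0 subrr big_pred0.
    rewrite (bigD1 (Ordinal Nn)) //= (eq_bigl (fun k : 'I_n => (k < N)%N)); last first.
      move=> k; rewrite ltnS leq_eqVlt -val_eqE /=.
      by case: ltngtP.
    rewrite -ih ?(ltnW Nn)// /a (sS (Ordinal Nn)) addrA; ring.
  by rewrite -{1}sn h//; apply: eq_bigl => k; rewrite ltn_ord.
apply: le_trans (sqn_sum_le la) _; apply: ler_wpM2l => //.
apply: ler_sum => k _; rewrite (L2_translate (s k) (d k)).2.
exact: translate_axis.
Qed.

Lemma translate_limit (f : Rn R n -> R) (D : 'I_n -> Rn R n -> R) (phi : nat -> V -> R) (t : V) :
  L2T f -> (forall i, L2T (D i)) -> (forall m, C1c (phi m)) ->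
  (fun m => sqT (fun x => phi m x - f x)) @ \oo --> (0 : R) ->
  (forall i, (fun m => sqT (fun x => partial i (phi m) x - D i x)) @ \oo --> (0 : R)) ->
  sqT (fun x => f (x + t) - f x) <= n%:R * \sum_i (t ord0 i) ^+ 2 * sqT (D i).
Proof.
move=> lf lD cphi pf pD.
have l1 m := (C1c_L2 (cphi m)).1; have l2 m := (C1c_L2 (cphi m)).2.
have lt (g : Rn R n -> R) : L2T g -> L2T (fun x => g (x + t)) by move=> /(L2_translate t)[].
have c1 : (fun m => sqT (fun x => phi m (x + t) - phi m x)) @ \oo --> sqT (fun x => f (x + t) - f x).
  have h : (fun m => sqT (fun x => phi m (x + t) - f (x + t))) @ \oo --> (0 : R).
    have -> : (fun m => sqT (fun x => phi m (x + t) - f (x + t))) = fun m => sqT (fun x => phi m x - f x).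
      by rewrite funeqE => m; rewrite -(L2_translate t (L2B measurableT (l1 m) lf)).2.
    exact: pf.
  exact: (sqnB_cvg measurableT (fun m => lt _ (l1 m)) l1 (lt _ lf) lf h pf).
have c2 : (fun m => n%:R * \sum_i (t ord0 i) ^+ 2 * sqT (partial i (phi m))) @ \oo -->
    n%:R * \sum_i (t ord0 i) ^+ 2 * sqT (D i).
  apply: cvgMr; apply: cvg_sum_seq => i; apply: cvgMr.
  exact: (sqn_cvg measurableT (fun m => l2 m i) (lD i) (pD i)).
apply: ler_cvg_to c1 c2 _; apply: nearW => m; exact: translate_vec.
Qed.
End translation_bounds.

(** * Convergence of dyadic averages in L^2 *)

Section dyadic_density.
Context {R : realType} {n : nat}.
Local Notation V := 'rV[R]_n.
Local Notation mu := (@leb R n).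
Hypothesis leb_neq0 : mu setT != 0%E.
Local Notation L2T := (L2 mu setT).
Local Notation sqT := (sqn mu setT).
Local Notation cell j c := (dyidx j @^-1` [set c]).

Lemma cell_close j (x y : V) : dyidx j y = dyidx j x ->
  forall i, `|y ord0 i - x ord0 i| <= 2^-1 ^+ j.
Proof.
move=> e i; have hx := (cellP j _ x).1 erefl i; have hy := (cellP j _ y).1 e i.
move: hx hy; rewrite mulrBl mul1r exprVn => /andP[h1 h2] /andP[h3 h4].
rewrite ler_norml; apply/andP; split; lra.
Qed.

Lemma dyavg_bound j (f : Rn R n -> R) x (a C : R) : L1 mu (cell j (dyidx j x)) f ->
  (forall y, dyidx j y = dyidx j x -> `|f y - a| <= C) -> `|dyavg j f x - a| <= C.
Proof.
move=> lf h; have v0 := dyvol_gt0 leb_neq0 j.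
have lc (k : R) := L1_cell_cst (measurable_cell j) (leb_cell j) (dyidx j x) k.
have ic (k : R) := int_cell_cst (measurable_cell j) (leb_cell j) (dyidx j x) k.
have mc : measurable (cell j (dyidx j x) : set (Rn R n)) by exact: measurable_cell.
have -> : dyavg j f x - a = (@dyvol R n j)^-1 * Int mu (cell j (dyidx j x)) (fun y => f y - a).
  rewrite (intB mc lf (lc a)) ic mulrBr [a * _]mulrC mulKf ?gt_eqF//.
have lB := L1B mc lf (lc a).
rewrite normrM ger0_norm ?invr_ge0 ?(ltW v0)// ler_pdivrMl// mulrC -ic.
exact: (int_abs_le mc lB (lc C) (aeP _ h)).
Qed.

Lemma dyavg_cvg_continuous (phi : V -> R) x : continuous phi -> L2T phi ->
  (fun j => dyavg j phi x) @ \oo --> phi x.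
Proof.
move=> cphi [mphi lphi]; apply: eps_cvg => e e0.
have /nbhs_ballP[d /= d0 hd] : \forall y \near x, `|phi x - phi y| < e.
  by have /cvgrPdist_lt := cphi x; apply.
have [N hN] := cvg0_eps (@exp_half_cvg0 R) d0.
exists N => j Nj; apply: dyavg_bound => [|y e_y].
  exact: (L1_cell_sqr (measurable_cell j) (leb_cell j) _ mphi lphi).
rewrite distrC; apply/ltW/hd; split => // i0 i; have -> : i0 = ord0 by exact: ord1.
rewrite /ball /= distrC; apply: le_lt_trans (cell_close e_y i) _.
by apply: le_lt_trans (hN j Nj); exact: ler_norm.
Qed.

Lemma dyavg_L2 j (f : Rn R n -> R) : L2T f -> L2T (dyavg j f) /\ sqT (dyavg j f) <= sqT f.
Proof.
move=> [mf lf].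
have [l i] := avg_contract (measurable_cell j) (leb_cell j) (dyvol_gt0 leb_neq0 j) mf lf.
exact: (conj (conj (measurable_dyavg j f) l) i).
Qed.

Lemma dyavg_sub j (f g : Rn R n -> R) : L2T f -> L2T g ->
  dyavg j (fun x => f x - g x) = (fun x => dyavg j f x - dyavg j g x).
Proof.
move=> [mf lf] [mg lg]; rewrite funeqE => x; apply: avgB; first exact: measurable_cell.
  exact: (L1_cell_sqr (measurable_cell j) (leb_cell j) _ mf lf).
exact: (L1_cell_sqr (measurable_cell j) (leb_cell j) _ mg lg).
Qed.

Lemma C1c_dyavg (phi : V -> R) : C1c phi ->
  (fun j => sqT (fun x => dyavg j phi x - phi x)) @ \oo --> (0 : R).
Proof.
move=> cphi; have [lphi _] := C1c_L2 cphi; have [c _ _ [K [cK K0]]] := cphi.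
have [C C0 hC] := continuous_csupp_bounded cK c K0.
have [B [_ hB]] := compact_bounded cK.
(* Cells have side at most 1. Outside the cube of this size a point and its whole cell avoid K, so
   both phi and its average vanish there. *)
pose M := `|B| + 1 + 1 + 1.
have [mS Sfin] := @measurable_ball0 R n M.
set S := [set x : V | _] in mS Sfin.
have off (x : V) : ~ S x -> forall y : V, (forall i, `|y ord0 i - x ord0 i| <= 1) -> phi y = 0.
  move=> Sx y yx; apply: K0 => Ky; apply: Sx => i; rewrite mxE subr0.
  have h1 : `|y| <= `|B| + 1 by apply: (hB (`|B| + 1)) => //; rewrite ltr_pwDr// ler_norm.
  have h2 := ler_coord_norm y i; have h3 := yx i.
  have : `|x ord0 i| <= `|y ord0 i| + `|y ord0 i - x ord0 i|.
    rewrite [`|y ord0 i - _|]distrC; have := ler_normD (y ord0 i) (x ord0 i - y ord0 i).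
    by rewrite addrC subrK.
  rewrite /M; lra.
have bd j x : (dyavg j phi x - phi x) ^+ 2 <= ((fun=> (2 * C) ^+ 2) \_ S) x.
  have lc := L1_cell_sqr (measurable_cell j) (leb_cell j) (dyidx j x) lphi.1 lphi.2.
  rewrite /patch; case: ifPn => [_|/negP xS].
    rewrite -real_normK ?num_real// ler_sqr ?nnegrE//; last by rewrite mulr_ge0.
    apply: dyavg_bound => // y _; apply: le_trans (ler_normB _ _) _.
    by have := hC y; have := hC x; lra.
  have Sx : ~ S x by move=> Sx; apply: xS; exact: mem_set.
  have p0 : phi x = 0 by apply: (off x) => // i; rewrite subrr normr0.
  suff -> : dyavg j phi x - phi x = 0 by rewrite expr0n.
  apply/normr0_eq0/eqP; rewrite eq_le normr_ge0 andbT.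
  apply: dyavg_bound => // y e; rewrite p0 (off x Sx y) ?subr0 ?normr0// => i.
  by apply: le_trans (cell_close e i) _; rewrite exprn_ile1//; lra.
have lS : L1 mu setT ((fun=> (2 * C) ^+ 2) \_ S) by apply: L1_patch => //; exact: L1_cst.
have [_] : L1 mu setT (fun=> 0 : R) /\
  (fun j => Int mu setT (fun x => (dyavg j phi x - phi x) ^+ 2)) @ \oo --> Int mu setT (fun=> 0 : R).
  apply: (@dct _ (Rn R n) R mu setT measurableT (fun j x => (dyavg j phi x - phi x) ^+ 2)
    (fun=> 0) ((fun=> (2 * C) ^+ 2) \_ S)).
  - by move=> j; exact: (L1_meas (L2B measurableT (dyavg_L2 j lphi).1 lphi).2).
  - exact: (L1_meas (L10 mu setT)).
  - exact: lS.
  - apply: aeP => x _; rewrite (_ : 0 = (phi x - phi x) * (phi x - phi x)); last by rewrite subrr mul0r.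
    under eq_fun do rewrite expr2.
    by apply: cvgM; apply: cvgB; [exact: dyavg_cvg_continuous|exact: cvg_cst|exact: dyavg_cvg_continuous|exact: cvg_cst].
  - by move=> j; apply: aeP => x _; rewrite ger0_norm ?sqr_ge0.
by rewrite int0.
Qed.

(** Averaging is a contraction of L^2, so convergence for the [phi m] carries over to their limit.
    Two applications of [sqnD_le] give at most 4/16 + 4/16 + 2/16 < 1 times e. *)
Lemma dyavg_closed (phi : nat -> Rn R n -> R) f : (forall m, L2T (phi m)) -> L2T f ->
  (forall m, (fun j => sqT (fun x => dyavg j (phi m) x - phi m x)) @ \oo --> (0 : R)) ->
  (fun m => sqT (fun x => phi m x - f x)) @ \oo --> (0 : R) ->
  (fun j => sqT (fun x => dyavg j f x - f x)) @ \oo --> (0 : R).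
Proof.
move=> lphi lf hphi pf; apply: eps_cvg => e e0.
have e16 : 0 < e / 16 by lra.
have [m hm] := cvg0_eps pf e16.
have [N hN] := cvg0_eps (hphi m) e16; exists N => j Nj.
rewrite subr0 ger0_norm ?sqn_ge0//.
have lB := L2B measurableT (lphi m) lf.
have [lA hA] := dyavg_L2 j lB.
have lD := L2B measurableT (dyavg_L2 j (lphi m)).1 (lphi m).
have lAD := L2B measurableT lD lA.
have -> : (fun x => dyavg j f x - f x) = fun x => ((dyavg j (phi m) x - phi m x)
   - dyavg j (fun x => phi m x - f x) x) + (phi m x - f x).
  by rewrite funeqE => x; rewrite dyavg_sub//; ring.
have h1 := sqnD_le measurableT lAD lB.
have h2 := sqnD_le measurableT lD (L2Z measurableT (-1) lA).
have e2 : sqT (fun x => (dyavg j (phi m) x - phi m x) + -1 * dyavg j (fun x => phi m x - f x) x) =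
  sqT (fun x => (dyavg j (phi m) x - phi m x) - dyavg j (fun x => phi m x - f x) x).
  by apply: eq_int => x _; rewrite mulN1r.
rewrite e2 sqnZ// sqrrN expr1n mul1r in h2.
have h3 : sqT (fun x => phi m x - f x) < e / 16 by apply: le_lt_trans (hm m (leqnn _)); exact: ler_norm.
have h4 : sqT (fun x => dyavg j (phi m) x - phi m x) < e / 16 by apply: le_lt_trans (hN j Nj); exact: ler_norm.
lra.
Qed.
End dyadic_density.

(** * Extension by zero and membership in L^1 and L^2 *)

Section zero_extension.
Context d (T : measurableType d) (R : realType).
Variables (mu : {measure set T -> \bar R}) (D : set T) (mD : measurable D).
Implicit Types f g : T -> R.

Lemma L2_patch f : L2 mu D f <-> L2 mu setT (f \_ D).
Proof.
have e : (fun x => (f \_ D) x ^+ 2) = (fun x => f x ^+ 2) \_ D.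
  by rewrite funeqE => x; rewrite /patch; case: ifP => // _; rewrite expr0n.
rewrite /L2 e; split=> [[mf lf]|[mf lf]]; split.
- by apply/(measurable_restrictT f mD).
- exact: L1_patch.
- by apply/(measurable_restrictT f mD).
- by move: lf; rewrite /L1 (integrable_mkcond _ mD) restrict_EFin.
Qed.

Lemma sqn_patch f : sqn mu setT (f \_ D) = sqn mu D f.
Proof.
rewrite /sqn -[RHS]int_patch; apply: eq_int => x _.
by rewrite /patch; case: ifP => // _; rewrite expr0n.
Qed.

Lemma Lfun2P f : f \in Lfun mu 2%:E <-> L2 mu setT f.
Proof.
split=> [h|[mf lf]].
  split; last exact: Lfun2_integrable_sqr.
  by move: h; rewrite inE => /andP[]; rewrite inE.
rewrite inE; apply/andP; split; rewrite inE//=.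
rewrite /finite_norm unlock poweR_lty//.
have : (\int[mu]_x (f x ^+ 2)%:E < +oo)%E by rewrite L1_EFin// ltry.
apply: le_lt_trans; rewrite le_eqVlt; apply/orP; left; apply/eqP.
by apply: eq_integral => x _ /=; rewrite powR_mulrn// real_normK// num_real.
Qed.

Lemma Lfun1P f : f \in Lfun mu 1 <-> L1 mu setT f.
Proof. exact: Lfun1_integrable. Qed.
End zero_extension.

(** * Orthonormal systems *)

Section orthonormal_system.
Context d (T : measurableType d) (R : realType).
Variables (mu : {measure set T -> \bar R}) (D : set T) (mD : measurable D).
Variable z : nat -> T -> R.
Local Notation L2 := (L2 mu D).
Local Notation ip := (ip mu D).
Local Notation sqn := (sqn mu D).
Local Notation ae := (ae mu D).
Hypothesis lz : forall k, L2 (z k).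
Hypothesis oz : forall j k, ip (z j) (z k) = (j == k)%:R.
Implicit Types (a b c : nat -> R) (f g h : T -> R).

Definition psum a N x := \sum_(k < N) a k * z k x.
Definition expn a f := L2 f /\ (fun N => sqn (fun x => psum a N x - f x)) @ \oo --> (0 : R).

Lemma psum_L2 a N : L2 (psum a N).
Proof. by apply: L2_sum => // k; exact: L2Z. Qed.

Lemma ip_psum a N k : ip (psum a N) (z k) = if (k < N)%N then a k else 0.
Proof.
rewrite /psum ip_suml//; last by move=> j; exact: L2Z.
under eq_bigr => j _ do rewrite ipZl// oz.
case: ifPn => [kN|kN].
  rewrite (bigD1 (Ordinal kN)) //= eqxx mulr1 big1 ?addr0// => j jk.
  rewrite (_ : (j : nat) == k = false) ?mulr0//; apply/negbTE.
  by apply: contra jk => /eqP e; apply/eqP/val_inj.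
rewrite big1// => j _; rewrite (_ : (j : nat) == k = false) ?mulr0//.
by apply/negbTE; apply: contra kN => /eqP <-.
Qed.

Lemma ip_psum2 a b M N : (M <= N)%N -> ip (psum a N) (psum b M) = \sum_(k < M) a k * b k.
Proof.
move=> MN; rewrite ipC /psum ip_suml; [|exact: mD|by move=> j; exact: L2Z|exact: psum_L2].
apply: eq_bigr => j _; rewrite ipZl; [|exact: mD|exact: lz|exact: psum_L2].
by rewrite ipC ip_psum (leq_trans (ltn_ord j) MN) mulrC.
Qed.

Lemma sqn_psum a N : sqn (psum a N) = \sum_(k < N) a k ^+ 2.
Proof. by rewrite -ip_self ip_psum2//; apply: eq_bigr => k _; rewrite expr2. Qed.

Lemma sqn_psum_diff a M N : (M <= N)%N ->
  sqn (fun x => psum a N x - psum a M x) = \sum_(k < N) a k ^+ 2 - \sum_(k < M) a k ^+ 2.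
Proof.
move=> MN; have l1 := psum_L2 a N; have l2 := psum_L2 a M.
have -> : sqn (fun x => psum a N x - psum a M x) = sqn (fun x => psum a N x + -1 * psum a M x).
  by apply: eq_int => x _; rewrite mulN1r.
rewrite sqnD//; last exact: L2Z.
rewrite ipC ipZl// sqnZ// (ipC _ _ (psum a M)) ip_psum2// !sqn_psum.
under [in X in 2 * (-1 * X)]eq_bigr do rewrite -expr2.
by ring.
Qed.

(** Riesz-Fischer: by Pythagoras, in the form of [sqn_psum_diff], the partial sums are a Cauchy
    sequence. *)
Lemma expn_ex a C : (forall N, \sum_(k < N) a k ^+ 2 <= C) -> exists f, expn a f.
Proof.
move=> aC; pose s := series (fun k => a k ^+ 2).
have sE N : s N = \sum_(k < N) a k ^+ 2 by rewrite /s /series /= big_mkord.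
have /cauchy_cvgP/cauchy_seriesP sc : cvgn s.
  exact: (bounded_sum_cvg (fun k => sqr_ge0 (a k)) aC).
have [|||f [mf lf hf]] := @L2_complete _ _ _ mu D mD (psum a).
- by move=> n; case: (psum_L2 a n).
- by move=> n; case: (psum_L2 a n).
- move=> e e0.
  have /cvg_ex[l sl] : cvgn s by exact: (bounded_sum_cvg (fun k => sqr_ge0 (a k)) aC).
  have e2 : 0 < e / 2 by lra.
  have [N hN] := cvg_eps sl e2; exists N.
  have key m n : (N <= m)%N -> (N <= n)%N -> (m <= n)%N ->
      sqn (fun x => psum a n x - psum a m x) <= e.
    move=> Nm Nn mn; rewrite sqn_psum_diff// -!sE.
    by have := hN _ Nm; have := hN _ Nn; rewrite !ltr_distl => /andP[h1 h2] /andP[h3 h4]; lra.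
  move=> m n Nm Nn; have [mn|/ltnW nm] := leqP m n; last exact: key.
  rewrite -/(sqn (fun x => psum a m x - psum a n x)) sqnB_sym; exact: key.
by exists f; split.
Qed.

Lemma expn_coef a f k : expn a f -> ip f (z k) = a k.
Proof.
move=> [lf hf].
have c1 : (fun N => ip (psum a N) (z k)) @ \oo --> ip f (z k).
  apply: (ip_cvg mD (fun N => psum_L2 a N) (fun=> lz k) lf (lz k) hf).
  rewrite (_ : (fun n => _) = cst 0); first exact: cvg_cst.
  rewrite funeqE => n /=; rewrite -[RHS](int0 mu D); apply: eq_int => x _.
  by rewrite subrr expr0n.
have c2 : (fun N => ip (psum a N) (z k)) @ \oo --> a k.
  apply: (@cvg_trans _ ((fun=> a k) @ \oo)); last exact: cvg_cst.
  by apply: near_eq_cvg; exists k.+1 => // N /= kN; rewrite ip_psum kN.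
exact: (cvg_unique _ c1 c2).
Qed.

Lemma expn_sqn a f : expn a f -> (fun N => \sum_(k < N) a k ^+ 2) @ \oo --> sqn f.
Proof.
move=> [lf hf]; have := sqn_cvg mD (fun N => psum_L2 a N) lf hf.
by under eq_fun do rewrite sqn_psum.
Qed.

Lemma expn_le a f N : expn a f -> \sum_(k < N) a k ^+ 2 <= sqn f.
Proof.
move=> /expn_sqn c; rewrite -(cvg_lim _ c)//.
apply: (@nondecreasing_cvgn_le _ (fun N => \sum_(k < N) a k ^+ 2)); last by apply/cvg_ex; eexists; exact: c.
apply/nondecreasing_seqP => n; rewrite big_ord_recr /= lerDl; exact: sqr_ge0.
Qed.

Lemma sqn_le_of_coef a f C : expn a f -> (forall N, \sum_(k < N) a k ^+ 2 <= C) -> sqn f <= C.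
Proof.
move=> /expn_sqn c aC; rewrite -(cvg_lim _ c)//; apply: limr_le.
  by apply/cvg_ex; eexists; exact: c.
exact: nearW.
Qed.

Lemma sqn0_ae f : L2 f -> sqn f = 0 -> ae (fun x => f x = 0).
Proof.
move=> [mf lf] f0.
have h : (\int[mu]_(x in D) `|(f x ^+ 2)%:E| = 0)%E.
  transitivity (\int[mu]_(x in D) (f x ^+ 2)%:E)%E; last by rewrite L1_EFin// -/(sqn f) f0.
  by apply: eq_integral => x _ /=; rewrite ger0_norm ?sqr_ge0.
have : ae_eq mu D (fun x => (f x ^+ 2)%:E) (cst 0%E).
  by apply/ae_eq_integral_abs => //; apply/measurable_EFinP; exact: L1_meas lf.
apply: ae_mp => x _ /= [] /eqP; by rewrite sqrf_eq0 => /eqP.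
Qed.

Lemma expn_uniq a f g : expn a f -> expn a g -> ae (fun x => f x = g x).
Proof.
move=> [lf hf] [lg hg]; have lB := L2B mD lf lg.
suff : sqn (fun x => f x - g x) = 0.
  by move=> /(sqn0_ae lB); apply: ae_mp => x _ /eqP; rewrite subr_eq0 => /eqP.
have c1 := sqnB_cvg mD (psum_L2 a) (psum_L2 a) lf lg hf hg.
have c2 : (fun N => sqn (fun x => psum a N x - psum a N x)) @ \oo --> (0 : R).
  rewrite (_ : (fun n => _) = cst 0); first exact: cvg_cst.
  rewrite funeqE => n /=; rewrite -[RHS](int0 mu D); apply: eq_int => x _.
  by rewrite subrr expr0n.
exact: (cvg_unique _ c1 c2).
Qed.

Lemma expnD a b f g : expn a f -> expn b g -> expn (fun k => a k + b k) (fun x => f x + g x).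
Proof.
move=> [lf hf] [lg hg]; split; first exact: L2D.
have := sqnD_cvg0 mD (psum_L2 a) (psum_L2 b) lf lg hf hg.
apply: cvg_trans; apply: near_eq_cvg; apply: nearW => N.
apply: eq_int => x _; congr ((_ - _) ^+ 2); rewrite /psum -big_split /=.
by apply: eq_bigr => k _; rewrite mulrDl.
Qed.

Lemma expnZ t a f : expn a f -> expn (fun k => t * a k) (fun x => t * f x).
Proof.
move=> [lf hf]; split; first exact: L2Z.
have := @sqnZ_cvg0 _ _ _ _ _ mD t _ _ (psum_L2 a) lf hf.
apply: cvg_trans; apply: near_eq_cvg; apply: nearW => N.
apply: eq_int => x _; congr ((_ - _) ^+ 2); rewrite /psum mulr_sumr.
by apply: eq_bigr => k _; rewrite mulrA.
Qed.

Lemma expnB a b f g : expn a f -> expn b g -> expn (fun k => a k - b k) (fun x => f x - g x).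
Proof.
move=> ef eg; have := expnD ef (expnZ (-1) eg).
have -> : (fun k => a k + -1 * b k) = (fun k => a k - b k) by rewrite funeqE => k; rewrite mulN1r.
by have -> : (fun x => f x + -1 * g x) = (fun x => f x - g x) by rewrite funeqE => k; rewrite mulN1r.
Qed.

Lemma bessel g N : L2 g -> \sum_(k < N) ip g (z k) ^+ 2 <= sqn g.
Proof.
move=> lg; set c := fun k => ip g (z k).
have lp := psum_L2 c N.
have := sqn_ge0 mu D (fun x => g x + -1 * psum c N x).
rewrite sqnD//; last exact: L2Z.
rewrite ipC ipZl// sqnZ// sqn_psum.
have -> : ip (psum c N) g = \sum_(k < N) c k ^+ 2.
  rewrite /psum ip_suml//; last by move=> k; exact: L2Z.
  by apply: eq_bigr => k _; rewrite ipZl// ipC expr2.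
rewrite /c; set S := \sum_(k < N) _; lra.
Qed.

Section weak_convergence.
Variables (A : nat -> nat -> R) (F : nat -> T -> R) (a : nat -> R) (f : T -> R) (C : R).
Hypothesis eF : forall i, expn (A i) (F i).
Hypothesis ef : expn a f.
Hypothesis FC : forall i, sqn (F i) <= C.
Hypothesis Aa : forall k, (fun i => A i k) @ \oo --> a k.

(* Only the projection of g on the span of z matters. *)
Lemma weak_ip_cvg g : L2 g -> (fun i => ip (F i) g) @ \oo --> ip f g.
Proof.
move=> lg; pose c k := ip g (z k).
have [h eh] := expn_ex (fun N => bessel N lg : \sum_(k < N) c k ^+ 2 <= sqn g).
have lh : L2 h by case: eh.
(* h is the projection of g on the closed span of the system, so elements of that span do not
   distinguish g from h. *)
have proj b u : expn b u -> ip u g = ip u h.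
  move=> [lu hu].
  have cst0 v : (fun n : nat => sqn (fun x => v x - v x)) @ \oo --> (0 : R).
    rewrite (_ : (fun n => _) = cst 0); first exact: cvg_cst.
    rewrite funeqE => n /=; rewrite -[RHS](int0 mu D); apply: eq_int => x _.
    by rewrite subrr expr0n.
  have c1 := ip_cvg mD (psum_L2 b) (fun=> lg) lu lg hu (cst0 g).
  have c2 := ip_cvg mD (psum_L2 b) (fun=> lh) lu lh hu (cst0 h).
  have e : (fun n => ip (psum b n) g) = (fun n => ip (psum b n) h).
    rewrite funeqE => N; rewrite /psum !ip_suml//; try by move=> k; exact: L2Z.
    by apply: eq_bigr => k _; rewrite !ipZl// (ipC _ _ _ h) (ipC _ _ _ g) (expn_coef k eh).
  by rewrite e in c1; exact: (cvg_unique _ c1 c2).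
rewrite (proj _ _ ef); under eq_fun => i do rewrite (proj _ _ (eF i)).
have C0 : 0 <= C by apply: le_trans (FC 0%N); exact: sqn_ge0.
have fC : sqn f <= C.
  apply: (sqn_le_of_coef ef) => N.
  have cA : (fun i => \sum_(k < N) A i k ^+ 2) @ \oo --> \sum_(k < N) a k ^+ 2.
    apply: (@cvg_sum_seq _ _ _ (fun (k : 'I_N) i => A i k ^+ 2) (fun k => a k ^+ 2)) => k.
    by under eq_fun do rewrite expr2; rewrite expr2; apply: cvgM.
  rewrite -(cvg_lim _ cA)//; apply: limr_le; first by apply/cvg_ex; eexists; exact: cA.
  by apply: nearW => i; apply: le_trans (expn_le N (eF i)) (FC i).
(* Only the remainder of the expansion of h enters, so the tail is small uniformly over all u of
   squared norm at most C. *)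
have tail b u N : expn b u -> sqn u <= C ->
   `|ip u h - \sum_(k < N) b k * c k| <= Num.sqrt C * Num.sqrt (sqn (fun x => psum c N x - h x)).
  move=> eu uC; have lu : L2 u by case: eu.
  have lp := psum_L2 c N.
  have -> : ip u h - \sum_(k < N) b k * c k = ip u (fun x => h x - psum c N x).
    have -> : \sum_(k < N) b k * c k = ip u (psum c N).
      rewrite ipC /psum ip_suml//; last by move=> k; exact: L2Z.
      by apply: eq_bigr => k _; rewrite ipZl// ipC (expn_coef k eu) mulrC.
    by rewrite /ip -intB//; [apply: eq_int => x _; rewrite mulrBr|exact: L2M|exact: L2M].
  apply: le_trans (cauchy_schwarz mD lu (L2B mD lh lp)) _.
  rewrite (sqnB_sym _ _ h); apply: ler_wpM2r; first exact: sqrtr_ge0.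
  exact: ler_wsqrtr.
apply: eps_cvg => e e0.
have t0 : (fun N => Num.sqrt C * Num.sqrt (sqn (fun x => psum c N x - h x))) @ \oo --> (0 : R).
  rewrite -(mulr0 (Num.sqrt C)); apply: cvgMr; rewrite -[X in _ --> X]sqrtr0.
  by apply: continuous_cvg eh.2; exact: sqrt_continuous.
have e3 : 0 < e / 3 by lra.
have [N hN] := cvg0_eps t0 e3; have {}hN := hN N (leqnn _).
have s0 : (fun i => \sum_(k < N) A i k * c k) @ \oo --> \sum_(k < N) a k * c k.
  apply: (@cvg_sum_seq _ _ _ (fun (k : 'I_N) i => A i k * c k) (fun k => a k * c k)) => k.
  exact: cvgMl.
have [I0 hI] := cvg_eps s0 e3; exists I0 => i Ii.
have h1 := tail _ _ N (eF i) (FC i); have h2 := tail _ _ N ef fC; have h3 := hI i Ii.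
have := le_lt_trans (ler_norm _) hN.
set t := Num.sqrt C * _ => ht; rewrite -/t in h1 h2.
move: h1 h2 h3; rewrite !ler_distl ltr_distl => /andP[a1 a2] /andP[a3 a4] /andP[a5 a6].
by apply/andP; split; lra.
Qed.
End weak_convergence.
End orthonormal_system.

(** * The Dirichlet spectrum *)

Section dirichlet_spectrum.
Context {R : realType} {n : nat}.
Local Notation V := 'rV[R]_n.
Local Notation mu := (@leb R n).
Variables (Omega : set V) (z : nat -> V -> R) (rho : nat -> R).
Hypothesis oOmega : open Omega.
Hypothesis bOmega : bounded_set Omega.
Hypothesis hz : dirichlet_eigensystem Omega z rho.
Local Notation D := (Omega : set (Rn R n)).
Local Notation L2T := (L2 mu setT).
Local Notation L2O := (L2 mu D).
Local Notation sqT := (sqn mu setT).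
Local Notation sqO := (sqn mu D).
Local Notation ipO := (ip mu D).

Lemma mOmega : measurable D.
Proof. exact: open_Rn_measurable. Qed.

Lemma muOmega : (mu D < +oo)%E.
Proof. exact: leb_bounded. Qed.

Lemma Lp2P (f : V -> R) : Lp Omega 2%:E f <-> L2O f.
Proof.
split=> [h|h]; first by apply/(L2_patch mu mOmega)/Lfun2P.
by apply/Lfun2P/(L2_patch mu mOmega).
Qed.

Lemma L2_cvgP (F : nat -> V -> R) (f : V -> R) : (forall N, L2O (F N)) -> L2O f ->
  L2_cvg Omega F f <-> (fun N => sqO (fun x => F N x - f x)) @ \oo --> (0 : R).
Proof.
move=> lF lf.
have -> : L2_cvg Omega F f <-> (fun N => (sqO (fun x => F N x - f x))%:E) @ \oo --> 0%E.
  rewrite /L2_cvg; have -> // : (fun N => \int[mu]_(x in D) ((F N x - f x) ^+ 2)%:E)%E =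
    (fun N => (sqO (fun x => F N x - f x))%:E).
  by rewrite funeqE => N; rewrite (L1_EFin mOmega (L2B mOmega (lF N) lf).2).
split=> [h|h]; last exact: (cvg_EFin_seq h).
exact: (fine_cvg h).
Qed.

Lemma L2O_of_T (f : V -> R) : L2T f -> L2O f.
Proof.
move=> [mf lf]; split; first exact: (measurable_funS measurableT _ mf).
by apply: (integrableS measurableT mOmega _ lf).
Qed.

Definition zeroext (f : V -> R) : Rn R n -> R := f \_ D.

Lemma zeroext_L2 f : L2O f -> L2T (zeroext f).
Proof. by move=> h; apply/(L2_patch mu mOmega). Qed.

Lemma H10_approx f (Df : 'I_n -> V -> R) : H10 Omega f Df -> exists phi : nat -> V -> R,
  [/\ forall m, test_function Omega (phi m), forall m, C1c (phi m),
    (fun m => sqO (fun x => phi m x - f x)) @ \oo --> (0 : R),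
    forall i, (fun m => sqO (fun x => partial i (phi m) x - Df i x)) @ \oo --> (0 : R) &
    (fun m => sqT (fun x => phi m x - zeroext f x)) @ \oo --> (0 : R) /\
    forall i, (fun m => sqT (fun x => partial i (phi m) x - zeroext (Df i) x)) @ \oo --> (0 : R)].
Proof.
move=> [/Lp2P lf lD [phi [tphi pf pD]]].
have lD' i : L2O (Df i) by apply/Lp2P; exact: lD.
have cphi m := test_C1c (tphi m).
have [l1 l2] : (forall m, L2T (phi m)) /\ (forall m i, L2T (partial i (phi m))).
  by split=> m; have [] := C1c_L2 (cphi m).
have off m x : ~ Omega x -> phi m x = 0 /\ forall i, partial i (phi m) x = 0.
  have [_ [K [cK KO K0]]] := tphi m => xO.
  have xK : ~ K x by move=> /KO.
  by split; [exact: K0|move=> i; exact: (partial_csupp i cK K0)].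
have h1 : (fun m => sqO (fun x => phi m x - f x)) @ \oo --> (0 : R).
  exact: ((L2_cvgP (fun m => L2O_of_T (l1 m)) lf).1 pf).
have h2 i : (fun m => sqO (fun x => partial i (phi m) x - Df i x)) @ \oo --> (0 : R).
  exact: ((L2_cvgP (fun m => L2O_of_T (l2 m i)) (lD' i)).1 (pD i)).
exists phi; split => //; split.
  apply: cvg_trans h1; apply: near_eq_cvg; apply: nearW => m.
  rewrite -(sqn_patch mu D); congr (sqn mu setT _); rewrite funeqE => x; rewrite /zeroext /patch.
  by case: ifPn => // /negP xO; rewrite (off m x _).1 ?subr0// => ?; apply: xO; exact: mem_set.
move=> i; apply: cvg_trans (h2 i); apply: near_eq_cvg; apply: nearW => m.
rewrite -(sqn_patch mu D); congr (sqn mu setT _); rewrite funeqE => x; rewrite /zeroext /patch.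
by case: ifPn => // /negP xO; rewrite (off m x _).2 ?subr0// => ?; apply: xO; exact: mem_set.
Qed.

Lemma z_L2 k : L2O (z k).
Proof. by have [h _ _ _] := hz; have [E [/Lp2P]] := h k. Qed.

Lemma z_ortho j k : ipO (z j) (z k) = (j == k)%:R.
Proof. by have [_ h _ _] := hz; exact: h. Qed.

(** A normalised eigenfunction cannot live on a null space. This takes the place of a lower bound on
    the volumes of covers. *)
Lemma leb_neq0 : mu setT != 0%E.
Proof.
apply/eqP => m0; have := z_ortho 0 0; rewrite eqxx ip_self.
suff -> : sqO (z 0) = 0 by move/eqP; rewrite eq_sym oner_eq0.
rewrite -(sqn_patch mu D) /sqn -(int0 mu setT); apply: eq_int_ae.
- exact: measurableT.
- exact: L1_meas (zeroext_L2 (z_L2 0)).2.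
- exact: measurable_cst.
- exists setT; split; [exact: measurableT|exact: m0|by []].
Qed.

(** The weak equation of [z j] is tested with approximants of [z k], and the limit is taken in H^1:
    the gradients are orthogonal too, with squared norm rho k. *)
Lemma energy : exists2 E : nat -> 'I_n -> V -> R, forall k, H10 Omega (z k) (E k) &
  forall j k, \sum_i ipO (E j i) (E k i) = rho j * (j == k)%:R.
Proof.
have [h _ _ _] := hz.
have /choice[E hE] : forall k, exists E, H10 Omega (z k) E /\ forall phi, test_function Omega phi ->
    \sum_i integ Omega (fun x => E i x * partial i phi x) = rho k * integ Omega (fun x => z k x * phi x).
  by move=> k; have [E H1 H2] := h k; exists E.
exists E => [k|j k]; first exact: (hE k).1.
have lE a i : L2O (E a i) by have [[_ + _] _] := hE a; move=> /(_ i) /Lp2P.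
have [phi [tphi cphi p1 p2 _]] := H10_approx (hE k).1.
have l1 m : L2O (phi m) by apply: L2O_of_T; have [] := C1c_L2 (cphi m).
have l2 m i : L2O (partial i (phi m)) by apply: L2O_of_T; have [] := C1c_L2 (cphi m).
have cst0 v : (fun n : nat => sqO (fun x => v x - v x)) @ \oo --> (0 : R).
  rewrite (_ : (fun n => _) = cst 0); first exact: cvg_cst.
  rewrite funeqE => N /=; rewrite -[RHS](int0 mu D); apply: eq_int => x _.
  by rewrite subrr expr0n.
have c1 : (fun m => \sum_i ipO (E j i) (partial i (phi m))) @ \oo --> \sum_i ipO (E j i) (E k i).
  apply: cvg_sum_seq => i.
  exact: (ip_cvg mOmega (fun=> lE j i) (fun m => l2 m i) (lE j i) (lE k i) (cst0 (E j i)) (p2 i)).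
have c2 : (fun m => rho j * ipO (z j) (phi m)) @ \oo --> rho j * ipO (z j) (z k).
  by apply: cvgMr; exact: (ip_cvg mOmega (fun=> z_L2 j) l1 (z_L2 j) (z_L2 k) (cst0 (z j)) p1).
rewrite z_ortho in c2.
have e : (fun m => \sum_i ipO (E j i) (partial i (phi m))) = (fun m => rho j * ipO (z j) (phi m)).
  by rewrite funeqE => m; exact: ((hE j).2 (phi m) (tphi m)).
by rewrite e in c1; exact: (cvg_unique _ c1 c2).
Qed.

Lemma rho_ge0 k : 0 <= rho k.
Proof.
have [E _ hE] := energy; have := hE k k; rewrite eqxx mulr1 => <-.
by apply: sumr_ge0 => i _; rewrite ip_self; exact: sqn_ge0.
Qed.

(* A square root of the energy form on the span of the eigenfunctions with index in P. *)
Lemma translate_span (P : pred nat) (a : nat -> R) N (tau : R) (t : V) : (forall i, `|t ord0 i| <= tau) ->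
  sqT (fun x => zeroext (fun y => \sum_(k < N | P k) a k * z k y) (x + t) -
                zeroext (fun y => \sum_(k < N | P k) a k * z k y) x)
    <= n%:R * (tau ^+ 2 * \sum_(k < N | P k) a k ^+ 2 * rho k).
Proof.
move=> ttau; have [E hH hE] := energy.
have lE k i : L2O (E k i) by have [_ + _] := hH k; move=> /(_ i) /Lp2P.
have /choice[phi hphi] := fun k => H10_approx (hH k).
(* Coefficients extended by 0 off P, so that all sums run over the same index set. *)
pose b k := if P k then a k else 0.
have bE (G : nat -> V -> R) y : \sum_(k < N | P k) a k * G k y = \sum_(k < N) b k * G k y.
  by rewrite big_mkcond; apply: eq_bigr => k _; rewrite /b; case: ifP => // _; rewrite mul0r.
have -> : (fun y => \sum_(k < N | P k) a k * z k y) = (fun y => \sum_(k < N) b k * z k y).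
  by rewrite funeqE => y; exact: (bE z).
have ze (G : 'I_N -> V -> R) : zeroext (fun y => \sum_(k < N) b k * G k y) =
    fun y => \sum_(k < N) b k * zeroext (G k) y.
  rewrite funeqE => y; rewrite /zeroext /patch; case: ifP => // _.
  by rewrite big1// => k _; rewrite mulr0.
pose DD i := zeroext (fun y => \sum_(k < N) b k * E k i y).
have lz' k : L2T (zeroext (z k)) by apply: zeroext_L2; exact: z_L2.
have lE' k i : L2T (zeroext (E k i)) by apply: zeroext_L2; exact: lE.
have lDD i : L2T (DD i) by apply: zeroext_L2; apply: (L2_sum mOmega) => k; exact: (L2Z mOmega).
have cph k m : C1c (phi k m) by case: (hphi k).
have cS m := C1c_sum (index_enum 'I_N) (fun k : 'I_N => b k) (fun k : 'I_N => cph k m).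
have lphi (k : 'I_N) m : L2T (phi k m) by case: (C1c_L2 (cph k m)).
have lpart (k : 'I_N) m i : L2T (partial i (phi k m)) by case: (C1c_L2 (cph k m)).
apply: le_trans (@translate_limit R n _ DD (fun m x => \sum_(k < N) b k * phi k m x) t _ lDD (fun m => (cS m).1) _ _) _.
- by apply: zeroext_L2; apply: (L2_sum mOmega) => k; apply: (L2Z mOmega); exact: z_L2.
- rewrite ze; apply: (@sqn_sum_cvg0 _ _ _ mu setT measurableT 'I_N (index_enum 'I_N) (fun k => b k)
    (fun k m => phi k m) (fun k => zeroext (z k))); [exact: lphi|by move=> k; exact: lz'|].
  by move=> k; case: (hphi k) => _ _ _ _ [].
- move=> i; under eq_fun => m do under eq_fun => x do rewrite (cS m).2.
  rewrite /DD ze; apply: (@sqn_sum_cvg0 _ _ _ mu setT measurableT 'I_N (index_enum 'I_N) (fun k => b k)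
    (fun k m => partial i (phi k m)) (fun k => zeroext (E k i)));
    [by move=> k m; exact: lpart|by move=> k; exact: lE'|].
  by move=> k; case: (hphi k) => _ _ _ _ [_]; apply.
apply: ler_wpM2l => //.
have sqDD i : sqT (DD i) = \sum_(k < N) \sum_(l < N) b k * b l * ipO (E k i) (E l i).
  have lbE (k : 'I_N) := L2Z mOmega (b k) (lE k i).
  have lsE := L2_sum mOmega (index_enum 'I_N) lbE.
  rewrite /DD /zeroext (sqn_patch mu D) -ip_self (ip_suml mOmega _ lbE lsE).
  apply: eq_bigr => k _; rewrite (ipZl mOmega _ (lE k i) lsE) ipC (ip_suml mOmega _ lbE (lE k i)).
  by rewrite mulr_sumr; apply: eq_bigr => l _; rewrite (ipZl mOmega _ (lE l i) (lE k i)) ipC; ring.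
apply: (@le_trans _ _ (tau ^+ 2 * \sum_i sqT (DD i))).
  rewrite mulr_sumr; apply: ler_sum => i _; apply: ler_wpM2r; first exact: sqn_ge0.
  by rewrite -real_normK ?num_real// ler_sqr ?nnegrE// (le_trans _ (ttau i)).
apply: ler_wpM2l; first exact: sqr_ge0.
rewrite le_eqVlt; apply/orP; left; apply/eqP.
(* Once the coordinates are summed, orthogonality of the gradients leaves only the diagonal of the
   double sum. *)
under eq_bigr do rewrite sqDD.
rewrite exchange_big /= big_mkcond [RHS]big_mkcond /=; apply: eq_bigr => k _.
rewrite exchange_big /=.
under eq_bigr do rewrite -mulr_sumr hE.
rewrite (bigD1 k) //= eqxx mulr1 big1 ?addr0.
  by rewrite /b; case: ifP => _; rewrite ?expr2// mul0r mul0r.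
move=> l lk; rewrite (_ : (k : nat) == l = false) ?mulr0//.
by apply/negbTE; apply: contra lk => /eqP e; apply/eqP/esym/val_inj.
Qed.
End dirichlet_spectrum.

Lemma powR_le_id (R : realType) (x s : R) : 0 <= x <= 1 -> 0 <= s <= 1 -> x <= x `^ s.
Proof.
move=> /andP[x0 x1] /andP[s0 s1]; have [->|xn] := eqVneq x 0; first exact: powR_ge0.
have xp : 0 < x by rewrite lt_neqAle eq_sym xn.
rewrite -[leLHS]powRr1//; apply: ger_powR => //; by rewrite xp.
Qed.

Lemma powR_ge1 (R : realType) (x s : R) : 1 <= x -> 0 <= s -> 1 <= x `^ s.
Proof. by move=> x1 s0; rewrite -[leLHS](powRr0 x); apply: ler_powR. Qed.

Lemma powR2_lt1 (R : realType) (x : R) : x < 0 -> 2 `^ x < 1.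
Proof.
move=> x0; rewrite -(opprK x) powRN invf_lt1 ?powR_gt0//.
have e : 1 `^ (- x) = 1 :> R by rewrite powR1.
by rewrite -[ltLHS]e; apply: gt0_ltr_powR; rewrite ?oppr_gt0 ?nnegrE// ltr1n.
Qed.

Lemma powR_norm_split (R : realType) (u d r : R) : 1 <= r ->
  `|u| `^ r <= 2 `^ r * (`|u - d| `^ r + `|d| `^ r).
Proof.
move=> r1; apply: le_trans (powRD_le r1 (normr_ge0 _) (normr_ge0 _)).
apply: ge0_ler_powR; rewrite ?nnegrE ?addr_ge0//; first exact: le_trans r1.
by have := ler_normD (u - d) d; rewrite subrK.
Qed.

(** * The compact embedding of the fractional space *)

Section fractional_embedding.
Context {R : realType} {n : nat}.
Local Notation V := 'rV[R]_n.
Local Notation mu := (@leb R n).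
Variables (Omega : set V) (z : nat -> V -> R) (rho : nat -> R) (alpha : Real.sort R).
Hypothesis n_gt0 : (0 < n)%N.
Hypothesis oOmega : open Omega.
Hypothesis bOmega : bounded_set Omega.
Hypothesis hz : dirichlet_eigensystem Omega z rho.
Hypothesis alpha_gt0 : 0 < alpha.
Hypothesis alpha_lt2 : alpha < 2.
Hypothesis alphan : alpha < n%:R.
Local Notation D := (Omega : set (Rn R n)).
Local Notation L2T := (L2 mu setT).
Local Notation L2O := (L2 mu D).
Local Notation sqT := (sqn mu setT).
Local Notation sqO := (sqn mu D).
Local Notation ipO := (ip mu D).
Local Notation ze := (zeroext Omega).
Local Notation psm := (psum (T := Rn R n) z).
Local Notation expnO := (expn mu D z).
Let mO : measurable D := mOmega oOmega.
Let lz := z_L2 oOmega hz.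
Let oz : forall j k, ipO (z j) (z k) = (j == k)%:R := z_ortho hz.

Lemma translate_zeroext f t : L2O f ->
  L2T (fun x => ze f (x + t) - ze f x) /\ sqT (fun x => ze f (x + t) - ze f x) <= 4 * sqO f.
Proof.
move=> lf; have lT := zeroext_L2 oOmega lf.
have [l1 e1] := L2_translate t lT.
split; first exact: (L2B measurableT l1 lT).
have := sqnD_le measurableT l1 (L2Z measurableT (-1) lT).
have -> : sqT (fun x => ze f (x + t) + -1 * ze f x) = sqT (fun x => ze f (x + t) - ze f x).
  by apply: eq_int => x _; rewrite mulN1r.
rewrite (sqnZ measurableT _ lT) e1 -(sqn_patch mu D f) -/(ze f); lra.
Qed.

(* Low frequencies are controlled by their gradient, high frequencies by their norm. *)
Lemma translate_psum (a : nat -> R) N (tau : R) (t : V) : 0 < tau -> (forall i, `|t ord0 i| <= tau) ->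
  sqT (fun x => ze (psm a N) (x + t) - ze (psm a N) x)
    <= (2 * n%:R + 8) * tau `^ alpha * \sum_(k < N) a k ^+ 2 * rho k `^ (alpha / 2).
Proof.
(* The threshold serves the comparison with (rho k tau^2)^(alpha/2): a number in [0, 1] is at most
   its power with exponent alpha/2, and above 1 that power is at least 1. In the final constant, 2n
   belongs to the low frequencies and 8 = 2 * 4 to the high ones. *)
move=> t0 ttau; pose P k := rho k * tau ^+ 2 <= 1.
pose lo k := if P k then a k else 0; pose hi k := if P k then 0 else a k.
have llo := psum_L2 mO lz lo N; have lhi := psum_L2 mO lz hi N.
have [l1 _] := translate_zeroext t llo; have [l2 e2] := translate_zeroext t lhi.
have e : (fun x => ze (psm a N) (x + t) - ze (psm a N) x) =
  (fun x => (ze (psm lo N) (x + t) - ze (psm lo N) x) + (ze (psm hi N) (x + t) - ze (psm hi N) x)).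
  have h x : ze (psm a N) x = ze (psm lo N) x + ze (psm hi N) x.
    rewrite /zeroext /patch; case: ifP => _; last by rewrite addr0.
    rewrite /psum -big_split /=; apply: eq_bigr => k _; rewrite /lo /hi.
    by case: ifP => _; rewrite mul0r ?addr0 ?add0r.
  by rewrite funeqE => x; rewrite !h; ring.
rewrite e; apply: le_trans (sqnD_le measurableT l1 l2) _.
have h1 : sqT (fun x => ze (psm lo N) (x + t) - ze (psm lo N) x) <=
    n%:R * (tau ^+ 2 * \sum_(k < N | P k) a k ^+ 2 * rho k).
  have := translate_span oOmega hz P a N ttau.
  have -> // : (fun y : V => \sum_(k < N | P k) a k * z k y) = psm lo N.
  rewrite funeqE => y; rewrite /psum big_mkcond; apply: eq_bigr => k _.
  by rewrite /lo; case: ifP => // _; rewrite mul0r.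
rewrite (sqn_psum mO lz oz) in e2.
have s01 : 0 <= alpha / 2 <= 1 by have a1 := alpha_gt0; have a2 := alpha_lt2; apply/andP; split; lra.
have T k : (rho k * tau ^+ 2) `^ (alpha / 2) = tau `^ alpha * rho k `^ (alpha / 2).
  rewrite powRM ?sqr_ge0//; last exact: (rho_ge0 oOmega hz).
  rewrite mulrC; congr (_ * _); rewrite -powR2 ?ltW// -powRrM; congr (_ `^ _); by field.
set S := \sum_(k < N) a k ^+ 2 * rho k `^ (alpha / 2).
have ta0 : 0 <= tau `^ alpha by exact: powR_ge0.
have Slo : tau ^+ 2 * (\sum_(k < N | P k) a k ^+ 2 * rho k) <= tau `^ alpha * S.
  rewrite !mulr_sumr big_mkcond; apply: ler_sum => k _; case: ifP => Pk; last first.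
    by apply: mulr_ge0 => //; apply: mulr_ge0; rewrite ?sqr_ge0 ?powR_ge0.
  rewrite mulrCA [leRHS]mulrCA; apply: ler_wpM2l; first exact: sqr_ge0.
  rewrite -T mulrC; apply: powR_le_id => //; apply/andP; split => //.
  by rewrite mulr_ge0 ?sqr_ge0// (rho_ge0 oOmega hz).
have Shi : \sum_(k < N) hi k ^+ 2 <= tau `^ alpha * S.
  rewrite mulr_sumr; apply: ler_sum => k _; rewrite /hi; case: ifP => Pk.
    by rewrite expr0n/=; apply: mulr_ge0 => //; apply: mulr_ge0; rewrite ?sqr_ge0 ?powR_ge0.
  rewrite mulrCA -[leLHS]mulr1; apply: ler_wpM2l; first exact: sqr_ge0.
  rewrite -T; apply: powR_ge1; last by case/andP: s01.
  by move/negbT: Pk; rewrite -ltNge => /ltW.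
have n0 : (0 : R) <= n%:R by [].
have h3 : n%:R * (tau ^+ 2 * \sum_(k < N | P k) a k ^+ 2 * rho k) <= n%:R * (tau `^ alpha * S).
  exact: ler_wpM2l.
have -> : (2 * n%:R + 8) * tau `^ alpha * S = 2 * (n%:R * (tau `^ alpha * S)) + 8 * (tau `^ alpha * S) by ring.
lra.
Qed.

(** If rho k were 0, [translate_span] would make the zero extension of [z k] invariant under
    translations. But a shift by 3b moves it off its own support, as Omega lies in a ball of radius
    b, and then the difference has squared norm 2. *)
Lemma rho_gt0 k : 0 < rho k.
Proof.
rewrite lt_neqAle eq_sym (rho_ge0 oOmega hz) andbT; apply/negP => /eqP rk.
have [B [_ hB]] := bOmega; pose b := `|B| + 1.
have Ob x : Omega x -> `|x| <= b by apply: hB; rewrite /b ltr_pwDr// ler_norm.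
have b1 : 1 <= b by rewrite /b lerDr.
pose t : V := \row_i (3 * b); pose i0 : 'I_n := Ordinal n_gt0.
have tt i : `|t ord0 i| <= 3 * b by rewrite mxE ger0_norm//; lra.
have := translate_span oOmega hz (pred1 k) (fun=> 1) k.+1 tt.
have -> : (fun y : V => \sum_(j < k.+1 | pred1 k j) 1 * z j y) = z k.
  by rewrite funeqE => y; rewrite (big_pred1 ord_max) ?mul1r.
rewrite (big_pred1 ord_max) ?rk ?mulr0//=.
have lT := zeroext_L2 oOmega (lz k); have [l1 e1] := L2_translate t lT.
have -> : sqT (fun x => ze (z k) (x + t) - ze (z k) x) = sqT (fun x => ze (z k) (x + t) + -1 * ze (z k) x).
  by apply: eq_int => x _; rewrite mulN1r.
rewrite (sqnD measurableT l1 (L2Z measurableT _ lT)) e1 (sqnZ measurableT _ lT).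
have -> : ip mu setT (fun x => ze (z k) (x + t)) (fun x => -1 * ze (z k) x) = 0.
  rewrite -[RHS](int0 mu setT); apply: eq_int => x _; rewrite /zeroext /patch.
  case: ifPn => [/set_mem h2|_]; last by rewrite mul0r.
  case: ifPn => [/set_mem h1|_]; last by rewrite !mulr0.
  exfalso; have := ler_coord_norm (x + t) i0; rewrite !mxE.
  have := ler_coord_norm x i0; have := Ob _ h1; have := Ob _ h2.
  set u := x ord0 i0; move=> q1 q2 q3 q4.
  have : 3 * b <= `|u + 3 * b| + `|u|.
    rewrite -[`|u|]normrN; apply: le_trans (ler_normD _ _).
    by rewrite addrAC subrr add0r ler_norm.
  lra.
rewrite /zeroext (sqn_patch mu D (z k)) -ip_self oz eqxx sqrrN expr1n mulr1n => h; lra.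
Qed.

Lemma rho_mono j k : (j <= k)%N -> rho j <= rho k.
Proof.
have [_ _ h _] := hz; elim: k => [|k ih]; first by rewrite leqn0 => /eqP ->.
by rewrite leq_eqVlt => /predU1P[->//|/ih]; move/le_trans; apply.
Qed.

(** The squared norm in H_0^(alpha/2) is at most C, stated through partial sums so that no infinite
    sum occurs. *)
Definition bounded_energy C a f := expnO a f /\
  forall N, \sum_(k < N) a k ^+ 2 * rho k `^ (alpha / 2) <= C.

Lemma bounded_energy_ge0 C a f : bounded_energy C a f -> 0 <= C.
Proof. by move=> [_ /(_ 0%N)]; rewrite big_ord0. Qed.

(** Poincare's inequality: [rho 0] is the smallest eigenvalue. *)
Lemma energy_sqn C a f : bounded_energy C a f -> sqO f <= C / rho 0 `^ (alpha / 2).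
Proof.
move=> [ef hC]; apply: (sqn_le_of_coef mO lz oz ef) => N.
have r0 : 0 < rho 0 `^ (alpha / 2) by rewrite powR_gt0// rho_gt0.
rewrite ler_pdivlMr// mulr_suml; apply: le_trans (hC N); apply: ler_sum => k _.
apply: ler_wpM2l; first exact: sqr_ge0.
apply: ge0_ler_powR; rewrite ?nnegrE ?(ltW (rho_gt0 _)) ?rho_mono//.
by rewrite divr_ge0// ltW.
Qed.

Lemma translate_energy C a f (tau : R) (t : V) : bounded_energy C a f -> 0 < tau ->
  (forall i, `|t ord0 i| <= tau) ->
  sqT (fun x => ze f (x + t) - ze f x) <= (2 * n%:R + 8) * tau `^ alpha * C.
Proof.
move=> [[lf cf] hC] t0 ttau.
have lp N := zeroext_L2 oOmega (psum_L2 mO lz a N); have lT := zeroext_L2 oOmega lf.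
have zB (g : V -> R) x : ze g x - ze f x = ze (fun y => g y - f y) x.
  by rewrite /zeroext /patch; case: ifP => // _; rewrite subr0.
have c1 : (fun N => sqT (fun x => ze (psm a N) x - ze f x)) @ \oo --> (0 : R).
  apply: cvg_trans cf; apply: near_eq_cvg; apply: nearW => N.
  by rewrite -(sqn_patch mu D); apply: eq_int => x _; rewrite zB.
have c2 : (fun N => sqT (fun x => ze (psm a N) (x + t) - ze f (x + t))) @ \oo --> (0 : R).
  apply: cvg_trans c1; apply: near_eq_cvg; apply: nearW => N.
  by rewrite -(L2_translate t (L2B measurableT (lp N) lT)).2.
have c := sqnB_cvg measurableT (fun N => (L2_translate t (lp N)).1) lp (L2_translate t lT).1 lT c2 c1.
rewrite -(cvg_lim _ c)//; apply: limr_le; first by apply/cvg_ex; eexists; exact: c.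
apply: nearW => N; apply: le_trans (translate_psum a N t0 ttau) _.
by apply: ler_wpM2l (hC N); rewrite mulr_ge0 ?powR_ge0// addr_ge0 ?mulr_ge0.
Qed.

(** Eigenfunctions are limits of test functions, for which the averages converge. The property
    extends to finite sums by induction and to f by [dyavg_closed]. *)
Lemma dyavg_energy C a f : bounded_energy C a f ->
  (fun j => sqT (fun x => dyavg j (ze f) x - ze f x)) @ \oo --> (0 : R).
Proof.
move=> [[lf cf] hC]; have m0 := leb_neq0 oOmega hz.
have lT := zeroext_L2 oOmega lf.
have lzT k := zeroext_L2 oOmega (lz k).
have hzk k : (fun j => sqT (fun x => dyavg j (ze (z k)) x - ze (z k) x)) @ \oo --> (0 : R).
  have [E hE _] := energy oOmega hz; have [phi [_ cphi _ _ [p _]]] := H10_approx oOmega (hE k).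
  apply: (@dyavg_closed _ _ m0 phi) => // m; first by have [] := C1c_L2 (cphi m).
  exact: C1c_dyavg.
have zB (g : V -> R) x : ze g x - ze f x = ze (fun y => g y - f y) x.
  by rewrite /zeroext /patch; case: ifP => // _; rewrite subr0.
have lp N := zeroext_L2 oOmega (psum_L2 mO lz a N).
apply: (@dyavg_closed _ _ m0 (fun N => ze (psm a N))) => //; last first.
  apply: cvg_trans cf; apply: near_eq_cvg; apply: nearW => N.
  by rewrite -(sqn_patch mu D); apply: eq_int => x _; rewrite zB.
elim=> [|N ih].
  have -> : ze (psm a 0) = (fun=> 0 : R).
    by rewrite funeqE => x; rewrite /zeroext /patch /psum big_ord0; case: ifP.
  rewrite (_ : (fun j => _) = cst 0); first exact: cvg_cst.
  rewrite funeqE => j /=; rewrite -[RHS](int0 mu setT); apply: eq_int => x _.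
  rewrite /dyavg /avg (int0 mu _) mulr0 subr0 expr0n//.
have e : ze (psm a N.+1) = fun x => ze (psm a N) x - - a N * ze (z N) x.
  rewrite funeqE => x; rewrite /zeroext /patch; case: ifP => _; last by rewrite mulr0 subr0.
  by rewrite /psum big_ord_recr /= mulNr opprK.
have lZ := L2Z measurableT (- a N) (lzT N).
have dZ j x : dyavg j (fun x => - a N * ze (z N) x) x = - a N * dyavg j (ze (z N)) x.
  rewrite /dyavg /avg intZ; first ring.
    exact: measurable_cell.
  exact: (L1_cell_sqr (measurable_cell j) (leb_cell j) _ (lzT N).1 (lzT N).2).
rewrite e; have ld j h : L2T h -> L2T (dyavg j h) by move=> lh; exact: (dyavg_L2 m0 j lh).1.
have c2 : (fun j => sqT (fun x => a N * (dyavg j (ze (z N)) x - ze (z N) x))) @ \oo --> (0 : R).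
  rewrite -(mulr0 (a N ^+ 2)).
  rewrite (_ : (fun j => _) = fun j => a N ^+ 2 * sqT (fun x => dyavg j (ze (z N)) x - ze (z N) x)).
    by apply: cvgMr; exact: hzk.
  by rewrite funeqE => j; rewrite (sqnZ measurableT _ (L2B measurableT (ld j _ (lzT N)) (lzT N))).
apply: (@squeeze_cvgr _ _ _ _ (cst 0) (fun j =>
  2 * sqT (fun x => dyavg j (ze (psm a N)) x - ze (psm a N) x) +
  2 * sqT (fun x => a N * (dyavg j (ze (z N)) x - ze (z N) x)))).
- apply: nearW => j /=; rewrite sqn_ge0 /=.
  have l1 := L2B measurableT (ld j _ (lp N)) (lp N).
  have l2 := L2Z measurableT (a N) (L2B measurableT (ld j _ (lzT N)) (lzT N)).
  apply: le_trans (sqnD_le measurableT l1 l2).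
  rewrite le_eqVlt; apply/orP; left; apply/eqP; apply: eq_int => x _.
  by rewrite (dyavg_sub j (lp N) lZ) dZ; congr (_ ^+ 2); ring.
- exact: cvg_cst.
- rewrite (_ : 0 = 2 * 0 + 2 * 0); last by rewrite !mulr0 addr0.
  by apply: cvgD; apply: cvgMr.
Qed.
(** [b] is the gain in |t|^alpha when the scale is halved. Sibling shifts between cubes of scale j +
    1 have size 2^-(j+1), hence the extra factor [b] in [kap]. *)
Local Notation b := (2^-1 `^ alpha).
Local Notation kap C := ((2 * n%:R + 8) * C * b).

Let b_gt0 : 0 < b. Proof. by rewrite powR_gt0// invr_gt0. Qed.

Lemma kap_ge0 C : 0 <= C -> 0 <= kap C.
Proof. by move=> C0; rewrite !mulr_ge0 ?powR_ge0// addr_ge0 ?mulr_ge0. Qed.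

Lemma dyshift_energy C a f j p : bounded_energy C a f ->
  Int mu setT (fun x => (ze f x - ze f (x + dyshift j.+1 p)) ^+ 2) <= kap C * b ^+ j.
Proof.
move=> e; have t0 : (0 : R) < 2^-1 ^+ j.+1 by rewrite exprn_gt0// invr_gt0.
have := translate_energy e t0 (t := dyshift j.+1 p); rewrite powRX_nat ?invr_ge0//.
have -> : (2 * n%:R + 8) * b ^+ j.+1 * C = kap C * b ^+ j by rewrite exprS; ring.
move=> h; apply: le_trans (h _).
  by rewrite le_eqVlt; apply/orP; left; apply/eqP; apply: eq_int => x _; rewrite -sqrrN opprB.
move=> i; rewrite /dyshift /dyvec mxE ffunE; move: p {h} => [p q] /=.
rewrite normrM normfV [`|2 ^+ _|]ger0_norm ?exprn_ge0// exprVn ler_piMl ?invr_ge0 ?exprn_ge0//.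
by case: (p i); case: (q i); rewrite //= ?normr0 ?ler01// ?subrr ?normr0// ?normrN normr1.
Qed.

Section subcritical.
Variable r : R.
Hypothesis r2 : 2 <= r.
Hypothesis rsub : r < 2 * n%:R / (n%:R - alpha).
Local Notation q := (dyq (n := n) r b).
Let r1 : 1 <= r. Proof. by apply: le_trans r2; rewrite ler1n. Qed.

Lemma dyq_gt0 : 0 < q.
Proof. by rewrite /dyq mulr_gt0// powR_gt0// mulr_gt0// exprn_gt0. Qed.

(** The ratio is 2 to the power - alpha + (n - alpha)(r - 2)/2, and this exponent is negative
    exactly for r < 2n/(n - alpha). *)
Lemma dyq_lt1 : q < 1.
Proof.
have p2 : (0 : R) < 2 by [].
have -> : q = 2 `^ (- alpha + (n%:R - alpha) * ((r - 2) / 2)).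
  have b2 : b = 2 `^ (- alpha) by rewrite -powR_inv1// -powRrM mulN1r.
  rewrite /dyq b2 -powR_mulrn// -powRD; last by rewrite pnatr_eq0 implybT.
  rewrite -powRrM -powRD; last by rewrite pnatr_eq0 implybT.
  by rewrite [- alpha + n%:R]addrC.
apply: powR2_lt1.
move: rsub; rewrite ltr_pdivlMr ?subr_gt0//; have h := alpha_gt0.
set s := n%:R - alpha; have -> : r * s = s * (r - 2) + 2 * n%:R - 2 * alpha by rewrite /s; ring.
rewrite mulrA; set w := s * (r - 2); lra.
Qed.

Definition tail_const C := geo_const r q * dyA (n := n) r (kap C).

Lemma tail_const_ge0 C : 0 <= C -> 0 <= tail_const C.
Proof.
move=> C0; rewrite /tail_const /geo_const /dyA !mulr_ge0 ?powR_ge0 ?kap_ge0// ?ler0n//.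
by rewrite invr_ge0 subr_ge0 -[leRHS]sqrtr1 ler_wsqrtr// ltW// dyq_lt1.
Qed.

Lemma dyadic_tail C a f j : bounded_energy C a f ->
  L1 mu D (fun x => `|f x - dyavg j (ze f) x| `^ r) /\
  Int mu D (fun x => `|f x - dyavg j (ze f) x| `^ r) <= tail_const C * q ^+ j.
Proof.
move=> e; have lT := zeroext_L2 oOmega e.1.1; have C0 := bounded_energy_ge0 e.
have [l i] := dyadic_embedding (leb_neq0 oOmega hz) r2 b_gt0 dyq_lt1 lT.1 lT.2
  (kap_ge0 C0) (fun j p => dyshift_energy j p e) (dyavg_energy e) j.
have h x : D x -> ze f x = f x by move=> Dx; rewrite /zeroext /patch mem_set.
have lD : L1 mu D (fun x => `|ze f x - dyavg j (ze f) x| `^ r).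
  exact: (integrableS measurableT mO _ l).
split; first by apply: (eq_L1 mO _ lD) => x Dx; rewrite h.
apply: le_trans i; rewrite -int_patch; apply: (le_int measurableT) => //.
  by apply: (L1_patch mO); apply: (eq_L1 mO _ lD) => x Dx; rewrite h.
move=> x _; rewrite /patch; case: ifPn => [/set_mem Dx|_]; last exact: powR_ge0.
by rewrite h.
Qed.

(** An average is an inner product with the indicator of a cell, so weak convergence gives pointwise
    convergence of the averages. *)
Lemma dyavg_ip j f x : L2O f -> dyavg j (ze f) x =
  (@dyvol R n j)^-1 * ipO f (\1_(dyidx j @^-1` [set dyidx j x]) : Rn R n -> R).
Proof.
move=> lf; rewrite /dyavg /avg; congr (_ * _).
rewrite -int_patch /ip -[RHS]int_patch; apply: eq_int => y _.
rewrite /zeroext /patch indicE; case: ifP; case: ifP; rewrite ?mulr1 ?mulr0//.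
Qed.

Lemma dyavg_sqr_bound C a f j x : bounded_energy C a f ->
  `|dyavg j (ze f) x| ^+ 2 <= (@dyvol R n j)^-1 * (C / rho 0 `^ (alpha / 2)).
Proof.
move=> e; have lT := zeroext_L2 oOmega e.1.1; have m0 := leb_neq0 oOmega hz.
rewrite real_normK ?num_real//.
apply: le_trans (avg_sqr_le (measurable_cell j) (leb_cell j) (dyvol_gt0 m0 j) x lT.1 lT.2) _.
apply: le_trans (avg_le (measurable_cell j) (dyvol_gt0 m0 j) x _ lT.2) _.
  by move=> y; exact: sqr_ge0.
apply: ler_wpM2l; first by rewrite invr_ge0 ltW// dyvol_gt0.
by apply: le_trans (energy_sqn e); rewrite -(sqn_patch mu D f).
Qed.

(** The summand 1 comes from u <= u^2 + 1, which avoids a square root. *)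
Definition sup_const C j := (@dyvol R n j)^-1 * (C / rho 0 `^ (alpha / 2)) + 1.

Lemma dyavg_bound_powR C a f j x : bounded_energy C a f ->
  `|dyavg j (ze f) x| `^ r <= sup_const C j `^ r.
Proof.
move=> e; apply: ge0_ler_powR; rewrite ?nnegrE ?normr_ge0//; first by apply: le_trans r2.
  by apply: le_trans (_ : _ <= 1) _; rewrite // /sup_const lerDr; apply: le_trans (dyavg_sqr_bound j 0 e); exact: sqr_ge0.
have := dyavg_sqr_bound j x e; set u := `|_|; rewrite /sup_const.
have u0 : 0 <= u := normr_ge0 _; have := sqr_ge0 (u - 1); rewrite sqrrB expr1n; lra.
Qed.

(** f splits into its averages over the cubes of scale 0, which are bounded, and the dyadic tail
    from that scale on. *)
Lemma energy_Lr C : exists B, forall a f, bounded_energy C a f ->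
  L1 mu D (fun x => `|f x| `^ r) /\ Int mu D (fun x => `|f x| `^ r) <= B.
Proof.
exists (2 `^ r * (tail_const C + Int mu D (fun=> sup_const C 0 `^ r))) => a f e.
have [l i] := dyadic_tail 0 e; rewrite expr0 mulr1 in i.
have lc : L1 mu D (fun=> sup_const C 0 `^ r) by apply: L1_cst => //; exact: muOmega.
have bd x : D x -> `|f x| `^ r <= 2 `^ r * (`|f x - dyavg 0 (ze f) x| `^ r + sup_const C 0 `^ r).
  move=> _; apply: le_trans (powR_norm_split _ (dyavg 0 (ze f) x) r1) _.
  apply: ler_wpM2l; first exact: powR_ge0.
  by apply: lerD => //; exact: (dyavg_bound_powR 0 x e).
have lS := L1Z mO (2 `^ r) (L1D mO l lc).
have lf : L1 mu D (fun x => `|f x| `^ r).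
  apply: (L1_dom mO _ lS); last by apply: aeP => x Dx; rewrite ger0_norm ?powR_ge0// bd.
  by apply: (@measurableT_comp _ _ _ _ _ _ (fun y : R => `|y| `^ r)); [apply: (@measurableT_comp _ _ _ _ _ _ (@powR R ^~ r)) => //; exact: measurable_powR|exact: e.1.1.1].
split => //; apply: le_trans (le_int mO lf lS bd) _.
rewrite (intZ mO _ (L1D mO l lc)) (intD mO l lc); apply: ler_wpM2l; first exact: powR_ge0.
exact: lerD.
Qed.

(* Rellich: the averages at a fixed scale converge pointwise, and the dyadic tails are uniformly small. *)
Lemma energy_compact0 C (A : nat -> nat -> R) (F : nat -> V -> R) :
  (forall i, bounded_energy C (A i) (F i)) -> (forall k, (fun i => A i k) @ \oo --> (0 : R)) ->
  (fun i => Int mu D (fun x => `|F i x| `^ r)) @ \oo --> (0 : R).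
Proof.
move=> eF A0; have C0 := bounded_energy_ge0 (eF 0).
have q0 := dyq_gt0; have q1 := dyq_lt1.
have lF i : L1 mu D (fun x => `|F i x| `^ r) by have [B hB] := energy_Lr C; have [] := hB _ _ (eF i).
have r0 : 0 < r by apply: lt_le_trans r2.
have m0 := leb_neq0 oOmega hz.
have cav j : (fun i => Int mu D (fun x => `|dyavg j (ze (F i)) x| `^ r)) @ \oo --> (0 : R).
  have : L1 mu D (fun=> 0 : R) /\
     (fun i => Int mu D (fun x => `|dyavg j (ze (F i)) x| `^ r)) @ \oo --> Int mu D (fun=> 0 : R).
    apply: (@dct _ (Rn R n) R mu D mO (fun i x => `|dyavg j (ze (F i)) x| `^ r) (fun=> 0)
       (fun=> sup_const C j `^ r)).
    - move=> i; apply: (@measurableT_comp _ _ _ _ _ _ (fun y : R => `|y| `^ r)).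
        by apply: (@measurableT_comp _ _ _ _ _ _ (@powR R ^~ r)) => //; exact: measurable_powR.
      exact: (measurable_funS measurableT _ (measurable_dyavg j (ze (F i)))).
    - exact: measurable_cst.
    - by apply: L1_cst => //; exact: muOmega.
    - apply: aeP => x _.
      rewrite (_ : 0 = `|0 : R| `^ r); last by rewrite normr0 powR0// gt_eqF.
      apply: powR_cvg => //; apply: cvg_norm.
      under eq_fun => i do rewrite (dyavg_ip j x (eF i).1.1).
      set g := \1_ _; have lg : L2O g.
        have mg : measurable (dyidx j @^-1` [set dyidx j x] : set (Rn R n)) by exact: measurable_cell.
        split; first exact: measurable_indic.
        apply: (L1_dom mO (g := fun=> 1)); last apply: aeP => y _.
        + by apply: measurable_funX; exact: measurable_indic.
        + by apply: L1_cst => //; exact: muOmega.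
        + by rewrite /g indicE; case: (_ \in _); rewrite ?expr1n ?expr0n/= ?normr1 ?normr0.
      rewrite -(mulr0 (@dyvol R n j)^-1); apply: cvgMr.
      have e0 : expnO (fun=> 0) (fun=> 0).
        split; first exact: L20.
        rewrite (_ : (fun N => _) = cst 0); first exact: cvg_cst.
        rewrite funeqE => N /=; rewrite -[RHS](int0 mu D); apply: eq_int => y _.
        by rewrite /psum big1 ?subr0 ?expr0n// => k _; rewrite mul0r.
      have := weak_ip_cvg mO lz oz (fun i => (eF i).1) e0 (fun i => energy_sqn (eF i)) A0 lg.
      suff -> : ipO (fun=> 0) g = 0 by [].
      by rewrite /ip -[RHS](int0 mu D); apply: eq_int => y _; rewrite mul0r.
    - by move=> i; apply: aeP => x _; rewrite ger0_norm ?powR_ge0//; exact: (dyavg_bound_powR j x (eF i)).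
  by rewrite int0 => -[].
apply: eps_cvg => e e0.
have K0 := tail_const_ge0 C0.
have t2 : (0 : R) < 2 `^ r by rewrite powR_gt0.
have : (fun j => tail_const C * q ^+ j) @ \oo --> (0 : R).
  by rewrite -(mulr0 (tail_const C)); apply: cvgMr; apply: cvg_expr; rewrite ger0_norm ?ltW.
have e1 : 0 < e / 2 / 2 `^ r by rewrite !divr_gt0.
move=> /cvg0_eps/(_ _ e1)[j /(_ j (leqnn _)) hj].
have [N hN] := cvg0_eps (cav j) e1; exists N => i /hN hi.
rewrite subr0 ger0_norm; last by apply: Rintegral_ge0 => x _; exact: powR_ge0.
have [l1 i1] := dyadic_tail j (eF i).
have l2 : L1 mu D (fun x => `|dyavg j (ze (F i)) x| `^ r).
  apply: (L1_dom mO (g := fun=> sup_const C j `^ r)).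
  - apply: (@measurableT_comp _ _ _ _ _ _ (fun y : R => `|y| `^ r)).
      by apply: (@measurableT_comp _ _ _ _ _ _ (@powR R ^~ r)) => //; exact: measurable_powR.
    exact: (measurable_funS measurableT _ (measurable_dyavg j (ze (F i)))).
  - by apply: L1_cst => //; exact: muOmega.
  - by apply: aeP => x _; rewrite ger0_norm ?powR_ge0//; exact: (dyavg_bound_powR j x (eF i)).
apply: (@le_trans _ _ (2 `^ r * (Int mu D (fun x => `|F i x - dyavg j (ze (F i)) x| `^ r)
    + Int mu D (fun x => `|dyavg j (ze (F i)) x| `^ r)))).
  rewrite -(intD mO l1 l2) -(intZ mO _ (L1D mO l1 l2)).
  apply: (le_int mO (lF i) (L1Z mO _ (L1D mO l1 l2))) => x _.
  exact: powR_norm_split.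
have h1 := le_lt_trans (ler_norm _) hj; have h2 := le_lt_trans (ler_norm _) hi.
rewrite mulrC -ler_pdivlMr//; have -> : e / 2 `^ r = e / 2 / 2 `^ r + e / 2 / 2 `^ r by field; rewrite gt_eqF.
by apply: lerD; [apply: le_trans i1 (ltW h1)|exact: ltW].
Qed.

Lemma bounded_energyB C C' a f a' f' : bounded_energy C a f -> bounded_energy C' a' f' ->
  bounded_energy (2 * C + 2 * C') (fun k => a k - a' k) (fun x => f x - f' x).
Proof.
move=> [e h] [e' h']; split; first exact: (expnB mO lz e e').
move=> N; apply: (@le_trans _ _ (2 * (\sum_(k < N) a k ^+ 2 * rho k `^ (alpha / 2)) +
   2 * (\sum_(k < N) a' k ^+ 2 * rho k `^ (alpha / 2)))); last first.
  by apply: lerD; apply: ler_wpM2l.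
rewrite !mulr_sumr -big_split /=; apply: ler_sum => k _; rewrite !mulrA -mulrDl.
apply: ler_wpM2r; first exact: powR_ge0.
by have := sqrD_le2 (a k) (- a' k); rewrite sqrrN !expr2 !mulrA.
Qed.

Lemma bounded_energy_lim C (A : nat -> nat -> R) (F : nat -> V -> R) a f :
  (forall i, bounded_energy C (A i) (F i)) -> (forall k, (fun i => A i k) @ \oo --> a k) ->
  expnO a f -> bounded_energy C a f.
Proof.
move=> eF Aa ef; split => // N.
have c : (fun i => \sum_(k < N) A i k ^+ 2 * rho k `^ (alpha / 2)) @ \oo -->
    \sum_(k < N) a k ^+ 2 * rho k `^ (alpha / 2).
  apply: (@cvg_sum_seq _ _ _ (fun (k : 'I_N) i => A i k ^+ 2 * rho k `^ (alpha / 2))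
     (fun k : 'I_N => a k ^+ 2 * rho k `^ (alpha / 2))) => k.
  by apply: cvgMl; under eq_fun do rewrite expr2; rewrite expr2; apply: cvgM.
rewrite -(cvg_lim _ c)//; apply: limr_le; first by apply/cvg_ex; eexists; exact: c.
by apply: nearW => i; exact: (eF i).2.
Qed.

Lemma energy_compact C (A : nat -> nat -> R) (F : nat -> V -> R) a f :
  (forall i, bounded_energy C (A i) (F i)) -> (forall k, (fun i => A i k) @ \oo --> a k) ->
  expnO a f -> (fun i => Int mu D (fun x => `|F i x - f x| `^ r)) @ \oo --> (0 : R).
Proof.
move=> eF Aa ef; have e := bounded_energy_lim eF Aa ef.
apply: (@energy_compact0 (2 * C + 2 * C) (fun i k => A i k - a k)) => [i|k].
  exact: (bounded_energyB (eF i) e).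
by rewrite -(subrr (a k)); apply: cvgB => //; exact: cvg_cst.
Qed.
End subcritical.
End fractional_embedding.

(** * Saddle points in l^2 *)

Section square_summable.
Context {R : realType}.
Implicit Types (x y : nat -> R) (X Y : nat -> nat -> R).

Definition ps x N := \sum_(k < N) x k ^+ 2.
Definition l2 x := exists C, forall N, ps x N <= C.
Definition nsq x : R := limn (ps x).
Definition comb (s t : R) x y : nat -> R := fun k => s * x k + t * y k.
Definition bounded_seq X := exists C, forall i N, ps (X i) N <= C.
Definition wcvg X x := bounded_seq X /\ forall k, (fun i => X i k) @ \oo --> x k.

Lemma ps_nd x : nondecreasing_seq (ps x).
Proof. by apply/nondecreasing_seqP => N; rewrite /ps big_ord_recr /= lerDl sqr_ge0. Qed.

Lemma ps_cvg x : l2 x -> ps x @ \oo --> nsq x.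
Proof.
move=> [C hC]; suff : cvgn (ps x) by [].
by apply: nondecreasing_is_cvgn; [exact: ps_nd|exists C => _ [N _ <-]].
Qed.

Lemma ps_le_nsq x N : l2 x -> ps x N <= nsq x.
Proof. by move=> lx; apply: nondecreasing_cvgn_le; [exact: ps_nd|apply/cvg_ex; eexists; exact: ps_cvg]. Qed.

Lemma nsq_le x C : (forall N, ps x N <= C) -> nsq x <= C.
Proof.
move=> h; apply: limr_le; last exact: nearW.
by apply/cvg_ex; eexists; apply: ps_cvg; exists C.
Qed.

Lemma nsq_ge0 x : l2 x -> 0 <= nsq x.
Proof. by move=> lx; have := ps_le_nsq 0 lx; rewrite {1}/ps big_ord0. Qed.

Lemma ps_comb s t x y N : ps (comb s t x y) N <= 2 * s ^+ 2 * ps x N + 2 * t ^+ 2 * ps y N.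
Proof.
rewrite /ps !mulr_sumr -big_split /=; apply: ler_sum => k _.
by apply: le_trans (sqrD_le2 _ _) _; rewrite !exprMn !mulrA.
Qed.

Lemma l2_comb s t x y : l2 x -> l2 y -> l2 (comb s t x y).
Proof.
move=> [C hC] [C' hC']; exists (2 * s ^+ 2 * C + 2 * t ^+ 2 * C') => N.
by apply: le_trans (ps_comb _ _ _ _ _) _; apply: lerD; apply: ler_wpM2l => //; rewrite mulr_ge0 ?sqr_ge0.
Qed.

Lemma l2_0 : l2 (fun=> 0).
Proof. by exists 0 => N; rewrite /ps big1// => k _; rewrite expr0n. Qed.

Lemma nsq0 : nsq (fun=> 0) = 0.
Proof.
apply/eqP; rewrite eq_le (nsq_ge0 l2_0) andbT; apply: nsq_le => N.
by rewrite /ps big1// => k _; rewrite expr0n.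
Qed.

(** Convexity of the squared norm in quantitative form: the last term yields both the uniqueness of
    regularized maximizers and the passage from weak to strong convergence. *)
Lemma nsq_comb t x y : l2 x -> l2 y ->
  nsq (comb (1 - t) t x y) = (1 - t) * nsq x + t * nsq y - t * (1 - t) * nsq (comb 1 (-1) x y).
Proof.
move=> lx ly; have c1 := ps_cvg lx; have c2 := ps_cvg ly.
have c3 := ps_cvg (l2_comb 1 (-1) lx ly); have c4 := ps_cvg (l2_comb (1 - t) t lx ly).
apply: (cvg_unique _ c4) => //.
have -> : ps (comb (1 - t) t x y) = fun N => (1 - t) * ps x N + t * ps y N - t * (1 - t) * ps (comb 1 (-1) x y) N.
  rewrite funeqE => N; rewrite /ps !mulr_sumr -big_split/= -sumrB; apply: eq_bigr => k _.
  by rewrite /comb; ring.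
by apply: cvgB; [apply: cvgD; apply: cvgMr|apply: cvgMr].
Qed.

Lemma nsq_eq0 x : l2 x -> nsq x = 0 -> x = fun=> 0.
Proof.
move=> lx x0; rewrite funeqE => k; apply/eqP; rewrite -sqrf_eq0 eq_le sqr_ge0 andbT.
have := ps_le_nsq k.+1 lx; rewrite x0 /ps big_ord_recr /=; apply: le_trans.
by rewrite lerDr; apply: sumr_ge0 => j _; exact: sqr_ge0.
Qed.

Lemma wcvg_bound X x C : wcvg X x -> (forall i N, ps (X i) N <= C) -> forall N, ps x N <= C.
Proof.
move=> [_ h] hC N; have c : (fun i => ps (X i) N) @ \oo --> ps x N.
  apply: (@cvg_sum_seq _ _ _ (fun (k : 'I_N) i => X i k ^+ 2) (fun k : 'I_N => x k ^+ 2)) => k.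
  by under eq_fun do rewrite expr2; rewrite expr2; apply: cvgM.
rewrite -(cvg_lim _ c)//; apply: limr_le; first by apply/cvg_ex; eexists; exact: c.
exact: nearW.
Qed.

Lemma wcvg_l2 X x : wcvg X x -> l2 x.
Proof. by move=> w; have [[C hC] _] := w; exists C; exact: wcvg_bound w hC. Qed.

Lemma wcvg_l2i X x i : wcvg X x -> l2 (X i).
Proof. by move=> [[C hC] _]; exists C. Qed.

Lemma wcvg_sub X x s : strictly_inc s -> wcvg X x -> wcvg (X \o s) x.
Proof.
move=> si [[C hC] h]; split; first by exists C => i; exact: hC.
by move=> k; exact: (cvg_sub si (h k)).
Qed.

Lemma wcvg_cst x : l2 x -> wcvg (fun=> x) x.
Proof. by move=> [C hC]; split; [exists C|move=> k; exact: cvg_cst]. Qed.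

Lemma wcvg_comb s t X x Y y : wcvg X x -> wcvg Y y -> wcvg (fun i => comb s t (X i) (Y i)) (comb s t x y).
Proof.
move=> [[C hC] hX] [[C' hC'] hY]; split; last by move=> k; apply: cvgD; apply: cvgMr.
exists (2 * s ^+ 2 * C + 2 * t ^+ 2 * C') => i N.
by apply: le_trans (ps_comb _ _ _ _ _) _; apply: lerD; apply: ler_wpM2l => //; rewrite mulr_ge0 ?sqr_ge0.
Qed.

Lemma bounded_seq_nsq X C : (forall i, l2 (X i)) -> (forall i, nsq (X i) <= C) -> bounded_seq X.
Proof. by move=> lX hC; exists C => i N; exact: le_trans (ps_le_nsq _ (lX i)) (hC i). Qed.

Lemma nsq_wlsc X x : wcvg X x -> forall e, 0 < e ->
  exists N, forall i, (N <= i)%N -> nsq x <= nsq (X i) + e.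
Proof.
move=> w e e0; have lx := wcvg_l2 w; have e2 : 0 < e / 2 by lra.
have [N /(_ N (leqnn _)) hN] := cvg_eps (ps_cvg lx) e2.
have c : (fun i => ps (X i) N) @ \oo --> ps x N.
  apply: (@cvg_sum_seq _ _ _ (fun (k : 'I_N) i => X i k ^+ 2) (fun k : 'I_N => x k ^+ 2)) => k.
  by under eq_fun do rewrite expr2; rewrite expr2; apply: cvgM; exact: w.2.
have [M hM] := cvg_eps c e2; exists M => i /hM h.
have := ps_le_nsq N (wcvg_l2i i w).
move: hN h; rewrite !ltr_distl => /andP[a1 a2] /andP[a3 a4]; lra.
Qed.

(** The midpoints of X i and x also converge weakly to x, so by lower semicontinuity their norms
    cannot stay below that of x; [nsq_comb] then squeezes the distance. *)
Lemma wcvg_strong X x : wcvg X x -> (fun i => nsq (X i)) @ \oo --> nsq x ->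
  (fun i => nsq (comb 1 (-1) (X i) x)) @ \oo --> (0 : R).
Proof.
move=> w h; have lx := wcvg_l2 w; have lX i := wcvg_l2i i w.
have wm := wcvg_comb (1 - 2^-1) 2^-1 w (wcvg_cst lx).
have me : comb (1 - 2^-1) 2^-1 x x = x by rewrite funeqE => k; rewrite /comb; field.
rewrite me in wm.
apply: eps_cvg => e e0; have e8 : 0 < e / 8 by lra.
have [N hN] := nsq_wlsc wm e8; have [M hM] := cvg_eps h e8.
exists (maxn N M) => i; rewrite geq_max => /andP[/hN h1 /hM].
rewrite ltr_distl => /andP[h2 h3].
rewrite subr0 ger0_norm; last by apply: nsq_ge0; exact: l2_comb.
rewrite nsq_comb// in h1; move: h1; set u := nsq (comb 1 (-1) _ _).
lra.
Qed.

Lemma bounded_extract (u : nat -> R) C : (forall i, `|u i| <= C) ->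
  exists s, strictly_inc s /\ cvgn (fun i => u (s i)).
Proof.
move=> hC; have [|f fi fc] := @bolzano_weierstrass R u.
  by exists C; split; [exact: num_real|move=> M CM i _ /=; exact: le_trans (hC i) (ltW CM)].
exists f; split => // i; rewrite ltnNge -leEnat.
by rewrite (fi i.+1 i) /= ltnn.
Qed.

Lemma strictly_inc_id : strictly_inc id.
Proof. by move=> n. Qed.

Lemma wcvg_extract X : bounded_seq X -> exists s x, strictly_inc s /\ wcvg (X \o s) x.
Proof.
move=> [C hC]; have C0 : 0 <= C by have := hC 0%N 0%N; rewrite /ps big_ord0.
have bk i k : `|X i k| <= Num.sqrt C.
  rewrite -sqrtr_sqr; apply: ler_wsqrtr; apply: le_trans (hC i k.+1).
  by rewrite /ps big_ord_recr /= lerDr; apply: sumr_ge0 => j _; exact: sqr_ge0.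
have /choice[T hT] : forall sk : {s : nat -> nat | strictly_inc s} * nat,
    exists t, strictly_inc t /\ cvgn (fun i => X (sval sk.1 (t i)) sk.2).
  by move=> [[s hs] k]; exact: (bounded_extract (fun i => bk (s i) k)).
pose next (s : {s : nat -> nat | strictly_inc s}) k : {s : nat -> nat | strictly_inc s} :=
  exist strictly_inc (sval s \o T (s, k)) (strictly_inc_comp (svalP s) (hT (s, k)).1).
pose S := fix S k := if k is k'.+1 then next (S k') k' else exist strictly_inc id strictly_inc_id.
pose d i := sval (S i) i.
(* Every [S (k + j)] is a subsequence of [S k]. From index k + 1 on, the diagonal therefore runs
   through [S k.+1], along which coordinate k converges. *)
have tail k j : exists r, strictly_inc r /\ forall i, sval (S (k + j)%N) i = sval (S k) (r i).
  elim: j => [|j [r [ri rE]]]; first by exists id; rewrite addn0; split; [exact: strictly_inc_id|].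
  exists (r \o T (S (k + j)%N, (k + j)%N)); split; last by move=> i; rewrite addnS /= rE.
  by apply: strictly_inc_comp => //; exact: (hT _).1.
have di : strictly_inc d.
  move=> i; rewrite /d /=; set t := T _; have ti : strictly_inc t by exact: (hT _).1.
  have : forall a b, (a < b)%N -> (sval (S i) a < sval (S i) b)%N.
    move=> a; elim=> [//|b ih]; rewrite ltnS leq_eqVlt => /predU1P[->|/ih ab]; first exact: (svalP (S i)).
    exact: ltn_trans ab (svalP (S i) b).
  by apply; exact: strictly_inc_ge.
have /choice[x hx] : forall k, exists l : R, (fun i => X (d i) k) @ \oo --> l.
  move=> k; have /cvg_ex[l hl] := (hT (S k, k)).2; exists l.
  apply: eps_cvg => e e0; have [N hN] := cvg_eps hl e0.
  exists (maxn N k.+1) => i; rewrite geq_max => /andP[Ni ki].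
  have [r [ri rE]] := tail k.+1 (i - k.+1)%N; rewrite subnKC// in rE.
  rewrite /d rE; apply/ltW/hN; exact: leq_trans Ni (strictly_inc_ge ri i).
by exists d, x; split => //; split => //; exists C => i N; exact: hC.
Qed.

Definition wlsc (f : (nat -> R) -> R) := forall X x, wcvg X x -> forall e, 0 < e ->
  exists N, forall i, (N <= i)%N -> f x <= f (X i) + e.

Lemma wlsc_frequently f X x C : wlsc f -> wcvg X x ->
  (forall N, exists i, (N <= i)%N /\ f (X i) <= C + 2^-1 ^+ N) -> f x <= C.
Proof.
move=> wf w h; apply/ler_addgt0Pr => e e0; have e2 : 0 < e / 2 by lra.
have [N hN] := wf _ _ w _ e2; have [M hM] := cvg0_eps (@exp_half_cvg0 R) e2.
have [i [Ni hi]] := h (maxn N M).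
have := hN i (leq_trans (leq_maxl _ _) Ni).
have := le_lt_trans (ler_norm _) (hM _ (leq_maxr N M)); lra.
Qed.

Lemma direct_method f dlt C : 0 < dlt -> wlsc f ->
  (forall x, l2 x -> dlt * nsq x - C <= f x) -> exists x, l2 x /\ forall y, l2 y -> f x <= f y.
Proof.
move=> d0 wf co; pose S := [set f x | x in l2].
have lbS : lbound S (- C).
  move=> _ [x lx <-]; apply: le_trans (co x lx); rewrite lerBrDr addNr mulr_ge0 ?nsq_ge0//.
  exact: ltW.
have S0 : S !=set0 by exists (f (fun=> 0)), (fun=> 0) => //; exact: l2_0.
have hi : has_inf S by split => //; exists (- C).
have /choice[X hX] : forall i, exists x, l2 x /\ f x <= inf S + 2^-1 ^+ i.
  move=> i; have e0 : 0 < (2^-1 : R) ^+ i by rewrite exprn_gt0// invr_gt0.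
  by have [_ [x lx <-] h] := inf_adherent e0 hi; exists x; split => //; exact: ltW.
have [|s [x [si w]]] := @wcvg_extract X.
  apply: (@bounded_seq_nsq _ ((inf S + 1 + C) / dlt)) => i; first exact: (hX i).1.
  rewrite ler_pdivlMr// mulrC -lerBlDr; apply: le_trans (co _ (hX i).1) _.
  by apply: le_trans (hX i).2 _; rewrite lerD2l exprn_ile1//; lra.
exists x; split; first exact: wcvg_l2 w.
move=> y ly; apply: le_trans (_ : inf S <= _); last by apply: ge_inf; [exists (- C)|exists y].
apply: (wlsc_frequently wf w) => N; exists N; split => //; apply: le_trans (hX _).2 _.
rewrite lerD2l; have := strictly_inc_ge si N; move: (s N) => m Nm.
by apply: ler_wiXn2l => //; lra.
Qed.

(** * Existence of a saddle point *)

Section saddle_point.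
Variable Psi : (nat -> R) -> (nat -> R) -> R.
Hypothesis Psi_cvg : forall X x Y y, wcvg X x -> wcvg Y y ->
  (fun i => Psi (X i) (Y i)) @ \oo --> Psi x y.

Definition energy_fun e x y := 2^-1 * nsq y - (2^-1 + e) * nsq x + Psi x y.
Local Notation E := energy_fun.

Hypothesis concave_l : forall t x x' y, l2 x -> l2 x' -> l2 y -> 0 <= t <= 1 ->
  (1 - t) * E 0 x y + t * E 0 x' y <= E 0 (comb (1 - t) t x x') y.
Hypothesis convex_r : forall t x y y', l2 x -> l2 y -> l2 y' -> 0 <= t <= 1 ->
  E 0 x (comb (1 - t) t y y') <= (1 - t) * E 0 x y + t * E 0 x y'.
Hypothesis coercive_l : forall y, l2 y -> exists d C, 0 < d /\ forall x, l2 x -> E 0 x y <= C - d * nsq x.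
Variables (d0 C0 : R).
Hypothesis d0_gt0 : 0 < d0.
Hypothesis coercive_r : forall y, l2 y -> d0 * nsq y - C0 <= E 0 (fun=> 0) y.

Let EE e x y : E e x y = E 0 x y - e * nsq x.
Proof. by rewrite /E; ring. Qed.

(* The term [- e * nsq x] makes the maximizer in x unique, so that the maximizers
   for y0 + t (y' - y0) converge weakly to the one for y0 as t tends to 0. *)
Section regularized.
Variable e : R.
Hypothesis e0 : 0 < e.

(** Concavity at the midpoint, plus the gain that [nsq_comb] gives at t = 1/2 for the term in e. *)
Let strict x x' y : l2 x -> l2 x' -> l2 y ->
  2^-1 * E e x y + 2^-1 * E e x' y + e / 4 * nsq (comb 1 (-1) x x') <= E e (comb (1 - 2^-1) 2^-1 x x') y.
Proof.
move=> lx lx' ly; have t01 : 0 <= (2^-1 : R) <= 1 by apply/andP; split; lra.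
have := concave_l lx lx' ly t01; rewrite !(EE e) nsq_comb//.
set u := nsq (comb 1 (-1) x x'); set v := E 0 (comb _ _ _ _) y.
have -> : (1 - 2^-1 : R) = 2^-1 by field.
have -> : 2^-1 * (2^-1 : R) = 4^-1 by field.
have q := e0; move: (e) q => e' q.
rewrite !mulrBr !mulrDr => h.
have -> : e' * (2^-1 * nsq x) = 2^-1 * (e' * nsq x) by ring.
have -> : e' * (2^-1 * nsq x') = 2^-1 * (e' * nsq x') by ring.
have -> : e' * (4^-1 * u) = e' / 4 * u by ring.
lra.
Qed.

Let wlsc_l y : l2 y -> wlsc (fun x => - E e x y).
Proof.
move=> ly X x w r r0; have c := Psi_cvg w (wcvg_cst ly).
have r2 : 0 < r / 2 by lra.
have p : 0 < 2^-1 + e by have := e0; lra.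
have [N hN] := cvg_eps c r2; have [M hM] := nsq_wlsc w (divr_gt0 r2 p).
exists (maxn N M) => i; rewrite geq_max => /andP[/hN h1 /hM h2].
rewrite /E; move: h1; rewrite ltr_distl => /andP[h1 h1'].
have := ler_wpM2l (ltW p) h2; rewrite mulrDr mulrCA mulfV ?gt_eqF// mulr1.
lra.
Qed.

Let maxi y : l2 y -> exists x, l2 x /\ forall x', l2 x' -> E e x' y <= E e x y.
Proof.
move=> ly; have [d [C [dp hC]]] := coercive_l ly.
have [|x [lx hx]] := direct_method dp (wlsc_l ly) (C := C).
  move=> x lx; rewrite lerNr opprB EE; apply: le_trans (hC x lx).
  by rewrite gerBl mulr_ge0 ?nsq_ge0// ltW.
by exists x; split => // x' lx'; rewrite -lerN2 hx.
Qed.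

Let uniq x u y : l2 x -> l2 u -> l2 y -> (forall x', l2 x' -> E e x' y <= E e x y) ->
  E e x y <= E e u y -> u = x.
Proof.
move=> lx lu ly hx hu; have := strict lu lx ly.
have := hx _ (l2_comb (1 - 2^-1) 2^-1 lu lx); have := nsq_ge0 (l2_comb 1 (-1) lu lx).
have e4 : 0 < e / 4 by have := e0; lra.
set n := nsq _ => n0 h1 h2.
have nz : e / 4 * n = 0.
  apply/eqP; rewrite eq_le (mulr_ge0 (ltW e4) n0) andbT.
  move: h1 h2; set m := E e (comb _ _ _ _) _; have := hx _ lu; lra.
have {}nz : n = 0 by move/eqP: nz; rewrite mulf_eq0 gt_eqF//= => /eqP.
have := nsq_eq0 (l2_comb 1 (-1) lu lx) nz; rewrite /comb => h.
rewrite funeqE => k; have := congr1 (fun f => f k) h; lra.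
Qed.

(** The candidate is a minimizer y0 of phi y, the maximum over x of E e x y, together with its
    maximizer U y0. Minimality of y0 for E e (U y0) is tested along y k = (1 - t k) y0 + t k y'. At
    the maximizer u k for y k one has phi y0 <= E e (u k) (y k), and convexity in y with E e (u k)
    y0 <= phi y0 turns this into phi y0 <= E e (u k) y', where k may tend to infinity. *)
Lemma regularized_saddle : exists x y, [/\ l2 x, l2 y &
  forall x' y', l2 x' -> l2 y' -> E e x' y <= E e x y'].
Proof.
have /choice[U hU] : forall y, exists x, l2 y -> l2 x /\ forall x', l2 x' -> E e x' y <= E e x y.
  move=> y; have [ly|nly] := pselect (l2 y); last by exists y.
  by have [x hx] := maxi ly; exists x.
pose phi y := E e (U y) y.
(* A supremum of lower semicontinuous functions; testing with the maximizer of the limit is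
   enough. *)
have wphi : wlsc phi.
  move=> Y y w r r0; have ly := wcvg_l2 w; have [lU hUy] := hU y ly.
  have r2 : 0 < r / 2 by lra.
  have c := Psi_cvg (wcvg_cst lU) w.
  have [N hN] := cvg_eps c r2; have [M hM] := nsq_wlsc w r2.
  exists (maxn N M) => i; rewrite geq_max => /andP[/hN h1 /hM h2].
  apply: le_trans (_ : E e (U y) (Y i) + r <= _); last first.
    by rewrite lerD2r; exact: (hU (Y i) (wcvg_l2i i w)).2.
  by rewrite /phi /E; move: h1; rewrite ltr_distl => /andP[h1 h1']; lra.
have [|y0 [ly0 hy0]] := direct_method d0_gt0 wphi (C := C0).
  move=> y ly; apply: le_trans (coercive_r ly) _.
  have := (hU y ly).2 _ l2_0; by rewrite {1}EE nsq0 mulr0 subr0.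
have [lu0 hu0] := hU y0 ly0; exists (U y0), y0; split => // x' y' lx' ly'.
apply: le_trans (hu0 x' lx') _; rewrite -/(phi y0).
pose t (k : nat) : R := 2^-1 ^+ k; pose y k := comb (1 - t k) (t k) y0 y'.
have t0 k : 0 < t k by rewrite exprn_gt0// invr_gt0.
have t1 k : t k <= 1 by rewrite exprn_ile1//; lra.
have ly k : l2 (y k) by exact: l2_comb.
have ct : t @ \oo --> (0 : R) by exact: exp_half_cvg0.
have wy : wcvg y y0.
  split.
    apply: (@bounded_seq_nsq _ (nsq y0 + nsq y')) => // k; rewrite nsq_comb//.
    have := nsq_ge0 ly0; have := nsq_ge0 ly'; have := nsq_ge0 (l2_comb 1 (-1) ly0 ly').
    have := t0 k; have := t1 k; move: (t k) (nsq _) (nsq _) (nsq _) => s A B C *.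
    have : 0 <= s * (1 - s) * C by rewrite !mulr_ge0// ?subr_ge0// ltW.
    have : s * A <= A by rewrite ler_piMl.
    have : 0 <= s * B by rewrite mulr_ge0// ltW.
    by nra.
  move=> k; rewrite /y /comb.
  rewrite [X in _ --> X](_ : y0 k = (1 - 0) * y0 k + 0 * y' k); last by ring.
  apply: cvgD; apply: cvgMl => //; apply: cvgB => //; exact: cvg_cst.
have cny : (fun k => nsq (y k)) @ \oo --> nsq y0.
  rewrite (_ : (fun k => _) = fun k => (1 - t k) * nsq y0 + t k * nsq y' - t k * (1 - t k) * nsq (comb 1 (-1) y0 y')); last first.
    by rewrite funeqE => k; rewrite nsq_comb.
  rewrite [X in _ --> X](_ : nsq y0 = (1 - 0) * nsq y0 + 0 * nsq y' - 0 * (1 - 0) * nsq (comb 1 (-1) y0 y')); last by ring.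
  apply: cvgB; first by apply: cvgD; apply: cvgMl => //; apply: cvgB => //; exact: cvg_cst.
  by apply: cvgMl; apply: cvgM => //; apply: cvgB => //; exact: cvg_cst.
pose u k := U (y k); have lu k : l2 (u k) by exact: (hU _ (ly k)).1.
have key k : phi y0 <= E e (u k) y'.
  have h1 : phi y0 <= E e (u k) (y k) by exact: hy0.
  have h2 : E e (u k) (y k) <= (1 - t k) * E e (u k) y0 + t k * E e (u k) y'.
    rewrite !(EE e); have := convex_r (lu k) ly0 ly' (_ : 0 <= t k <= 1).
    rewrite t1 ltW// => /(_ isT); rewrite -/(y k); lra.
  have h3 : (1 - t k) * E e (u k) y0 <= (1 - t k) * phi y0.
    by apply: ler_wpM2l; rewrite ?subr_ge0//; exact: hu0.
  have : t k * phi y0 <= t k * E e (u k) y' by lra.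
  by rewrite ler_pM2l.
have [d [C [dp hC]]] := coercive_l ly'.
have [|s [x [si w]]] := @wcvg_extract u.
  apply: (@bounded_seq_nsq _ ((C - phi y0) / d)) => // k.
  rewrite ler_pdivlMr// mulrC.
  have := key k; have := hC _ (lu k); rewrite (EE e).
  have := mulr_ge0 (ltW e0) (nsq_ge0 (lu k)); lra.
have lx := wcvg_l2 w; have wys := wcvg_sub si wy.
(* A weak limit of the u k maximizes E e in x at y0, hence equals U y0 by uniqueness. *)
have xm x2 : l2 x2 -> E e x2 y0 <= E e x y0.
  move=> lx2; apply/ler_addgt0Pr => r r0; have r4 : 0 < r / 4 by lra.
  have p : 0 < 2^-1 + e by have := e0; lra.
  have [N1 h1] := cvg_eps (Psi_cvg w wys) r4.
  have [N2 h2] := cvg_eps (Psi_cvg (wcvg_cst lx2) wys) r4.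
  have [N3 h3] := nsq_wlsc w (divr_gt0 r4 p).
  pose i := maxn N1 (maxn N2 N3).
  have {}h1 := h1 i (leq_maxl _ _).
  have {}h2 := h2 i (leq_trans (leq_maxl _ _) (leq_maxr _ _)).
  have {}h3 := h3 i (leq_trans (leq_maxr _ _) (leq_maxr _ _)).
  have h5 := (hU _ (ly (s i))).2 _ lx2.
  have := ler_wpM2l (ltW p) h3; rewrite mulrDr mulrCA mulfV ?gt_eqF// mulr1.
  move: h1 h2 h5; rewrite /E !ltr_distl /= -/(u (s i)) => /andP[a1 a2] /andP[a3 a4] h5 h6.
  lra.
have xE : x = U y0 by apply: (uniq lu0 lx ly0 hu0); exact: xm.
have := wlsc_frequently (wlsc_l ly') w (C := - phi y0); rewrite xE => h.
rewrite -lerN2; apply: h => N; exists N; split => //.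
have := key (s N); rewrite /= -/(u (s N)) => h; rewrite -lerN2 opprD opprK.
by rewrite [leRHS]opprK; apply: le_trans h; rewrite gerBl exprn_ge0.
Qed.
End regularized.

(** Comparison with (0, 0) bounds the regularized saddle points independently of e k, since the
    extra term only lowers the energy. In the limit the two sides of the saddle inequality are
    semicontinuous in the right directions, and e k * nsq x' tends to 0. *)
Lemma saddle_exists : exists x y, [/\ l2 x, l2 y &
  forall x' y', l2 x' -> l2 y' -> E 0 x' y <= E 0 x y'].
Proof.
pose e (k : nat) : R := 2^-1 ^+ k.
have e0 k : 0 < e k by rewrite exprn_gt0// invr_gt0.
have ce : e @ \oo --> (0 : R) by exact: exp_half_cvg0.
have /choice[X hX] := fun k => regularized_saddle (e0 k).
have /choice[Y hY] := hX.
have lX k : l2 (X k) by case: (hY k).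
have lY k : l2 (Y k) by case: (hY k).
have sad k x' y' : l2 x' -> l2 y' -> E (e k) x' (Y k) <= E (e k) (X k) y'.
  by case: (hY k) => _ _; apply.
have [d [C [dp hC]]] := coercive_l l2_0.
have bd k : d0 * nsq (Y k) + d * nsq (X k) <= C + C0.
  have := sad k _ _ l2_0 l2_0; have := hC _ (lX k); have := coercive_r (lY k).
  rewrite !(EE (e k)) nsq0; have := mulr_ge0 (ltW (e0 k)) (nsq_ge0 (lX k)); lra.
have d0p := d0_gt0.
have [|s [x [si wx]]] := @wcvg_extract X.
  apply: (@bounded_seq_nsq _ ((C + C0) / d)) => // k; rewrite ler_pdivlMr// mulrC.
  have := bd k; have := mulr_ge0 (ltW d0p) (nsq_ge0 (lY k)); lra.
have [|s' [y [si' wy]]] := @wcvg_extract (Y \o s).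
  apply: (@bounded_seq_nsq _ ((C + C0) / d0)) => [k|k]; first exact: lY.
  rewrite ler_pdivlMr// mulrC.
  have := bd (s k); have := mulr_ge0 (ltW dp) (nsq_ge0 (lX (s k))) => /=; lra.
have {}wx := wcvg_sub si' wx.
exists x, y; split; [exact: wcvg_l2 wx|exact: wcvg_l2 wy|move=> x' y' lx' ly'].
have ces : (fun i => e (s (s' i))) @ \oo --> (0 : R) by exact: (cvg_sub si' (cvg_sub si ce)).
apply/ler_addgt0Pr => r r0; have r5 : 0 < r / 5 by lra.
have [N1 h1] := cvg_eps (Psi_cvg (wcvg_cst lx') wy) r5.
have [N2 h2] := cvg_eps (Psi_cvg wx (wcvg_cst ly')) r5.
have [N3 h3] := nsq_wlsc wx r5.
have [N4 h4] := nsq_wlsc wy r5.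
have q1 : 0 < r / 5 / (nsq x' + 1) by rewrite divr_gt0// ltr_wpDl// nsq_ge0.
have [N5 h5] := cvg0_eps ces q1.
pose i := maxn (maxn N1 N2) (maxn N3 (maxn N4 N5)).
have {}h1 := h1 i (leq_trans (leq_maxl _ _) (leq_maxl _ _)).
have {}h2 := h2 i (leq_trans (leq_maxr _ _) (leq_maxl _ _)).
have {}h3 := h3 i (leq_trans (leq_maxl _ _) (leq_maxr _ _)).
have {}h4 := h4 i (leq_trans (leq_maxl _ _) (leq_trans (leq_maxr _ _) (leq_maxr _ _))).
have {}h5 := h5 i (leq_trans (leq_maxr _ _) (leq_trans (leq_maxr _ _) (leq_maxr _ _))).
have h6 := sad (s (s' i)) _ _ lx' ly'.
have h7 := mulr_ge0 (ltW (e0 (s (s' i)))) (nsq_ge0 (lX (s (s' i)))).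
have h8 : e (s (s' i)) * nsq x' <= r / 5.
  rewrite ger0_norm ?(ltW (e0 _))// in h5; move/ltW: h5; rewrite ler_pdivlMr ?ltr_wpDl ?nsq_ge0//.
  by rewrite mulrDr mulr1; have := e0 (s (s' i)); lra.
move: h1 h2 h3 h4 h6 h7 h8; rewrite !(EE (e _)) /E /= !ltr_distl addr0.
move=> /andP[a1 a2] /andP[a3 a4]; lra.
Qed.
End saddle_point.
End square_summable.

(** * Superposition operators *)

Section superposition.
Context d (T : measurableType d) (R : realType).
Variables (mu : {measure set T -> \bar R}) (D : set T) (mD : measurable D).
Hypothesis mu_complete : measure_is_complete mu.

(** The limit is known only almost everywhere; completeness of the measure absorbs the exceptional
    set. *)
Lemma measurable_ae_lim (F : nat -> T -> R) (f : T -> R) : (forall n, measurable_fun D (F n)) ->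
  ae mu D (fun x => F ^~ x @ \oo --> f x) -> measurable_fun D f.
Proof.
move=> mF Ff; pose g x := fine (limn_esup (fun n => (F n x)%:E)).
have mg : measurable_fun D g.
  rewrite /g; apply: measurableT_comp => //.
  apply: (@measurable_fun_limn_esup _ _ _ _ (fun n x => (F n x)%:E)) => n.
  by apply/measurable_EFinP.
have e : ae_eq mu D (EFin \o g) (EFin \o f).
  apply: ae_mp Ff => x Dx h.
  by rewrite /g /= (cvg_limn_einf_sup (cvg_EFin_seq h)).2.
by apply/measurable_EFinP; apply: (ae_measurable_fun mu_complete e); exact/measurable_EFinP.
Qed.

(* f is approximated by the countably valued functions [a j (idx j x)]. *)
Lemma measurable_superposition (E : Type) (I : countType) (g : T -> E -> R) (f : T -> E)
    (idx : nat -> T -> I) (a : nat -> I -> E) :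
  (forall j i, measurable (D `&` idx j @^-1` [set i])) ->
  (forall j i, measurable_fun D (fun x => g x (a j i))) ->
  ae mu D (fun x => (fun j => g x (a j (idx j x))) @ \oo --> g x (f x)) ->
  measurable_fun D (fun x => g x (f x)).
Proof.
move=> midx ma; apply: measurable_ae_lim => j _ Y mY.
have -> : D `&` (fun x => g x (a j (idx j x))) @^-1` Y =
    \bigcup_(i in [set: I]) ((D `&` idx j @^-1` [set i]) `&` (D `&` (fun x => g x (a j i)) @^-1` Y)).
  rewrite eqEsubset; split=> [x [Dx Yx]|x [i _ [[Dx <-] [_ Yx]]]] //.
  by exists (idx j x).
apply: countable_bigcupT_measurable => // i.
apply: measurableI; first exact: midx.
exact: ma.
Qed.
End superposition.

(** The bound is asked only on a ball containing the segment, because the derivatives it is meant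
    for grow at infinity. *)
Lemma mean_value_le (R : realType) (g dg : R -> R) (L a b : R) :
  (forall x, is_derive x (1:R) g (dg x)) -> (forall x, `|x| <= `|a| + `|b| -> `|dg x| <= L) ->
  `|g b - g a| <= L * `|b - a|.
Proof.
move=> dgx dL; have cg : continuous g.
  by move=> x; apply/differentiable_continuous/derivable1_diffP; exact: (@ex_derive _ _ _ _ _ _ _ (dgx x)).
have key a' b' : a' <= b' -> (forall x, `|x| <= `|a'| + `|b'| -> `|dg x| <= L) ->
    `|g b' - g a'| <= L * `|b' - a'|.
  move=> ab h; have [c cab ->] := @MVT_segment R g dg a' b' ab (fun x _ => dgx x) (continuous_subspaceT cg).
  rewrite normrM; apply: ler_wpM2r => //; apply: h.
  move: cab; rewrite in_itv /= => /andP[ac cb].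
  have := ler_norm b'; have := ler_norm (- a'); rewrite normrN => h1 h2.
  have := normr_ge0 a'; have := normr_ge0 b'; rewrite ler_norml => *.
  by apply/andP; split; lra.
have [/key|/ltW /key] := leP a b; first exact.
by rewrite distrC [`|a - b|]distrC addrC; apply.
Qed.

Lemma difference_quotient_cvg (R : realType) (f : R -> R) (u df g : R) (t : nat -> R) :
  is_derive u (1 : R) f df -> t @ \oo --> (0 : R) -> (forall k, t k != 0) ->
  (fun k => (f (u + t k * g) - f u) / t k) @ \oo --> df * g.
Proof.
move=> [dfu <-] t0 tn; have [->|gn] := eqVneq g 0.
  rewrite mulr0 (_ : (fun k => _) = cst 0); first exact: cvg_cst.
  by rewrite funeqE => k /=; rewrite mulr0 addr0 subrr mul0r.
have c : (fun k => t k * g) @ \oo --> (0 : R)^'.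
  move=> B hB; have h : (fun k => t k * g) @ \oo --> (0 : R) by rewrite -(mul0r g); apply: cvgMl.
  have hh : \forall k \near \oo, t k * g != 0 -> B (t k * g) by exact: (h (fun y : R => y != 0 -> B y) hB).
  change (\forall k \near \oo, B (t k * g)).
  by apply: filterS hh => k; apply; rewrite mulf_neq0.
have h0 := cvg_comp _ _ c dfu.
pose q k := (t k * g)^-1 *: ((f \o shift u) ((t k * g) *: (1 : R)) - f u) : R.
have h : (fun k => q k * g) @ \oo --> 'D_1 f u * g by apply: cvgMl; exact: h0.
apply: cvg_trans h; apply: near_eq_cvg; apply: nearW => k /=.
rewrite /q /= (_ : (t k * g) *: (1 : R) + u = u + t k * g); last by rewrite addrC /GRing.scale /= mulr1.
set A := f _ - f u; have -> : (t k * g)^-1 *: A = (t k * g)^-1 * A by [].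
rewrite invfM; field.
by rewrite tn gn.
Qed.

(** * Integral functionals whose integrand has derivatives of growth r - 1 *)

Section nemytskii.
Context d (T : measurableType d) (R : realType).
Variables (mu : {measure set T -> \bar R}) (D : set T) (mD : measurable D).
Hypothesis muD : (mu D < +oo)%E.
Local Notation L1 := (L1 mu D).
Local Notation Int := (Int mu D).
Local Notation ae := (ae mu D).
Variables (c r : Real.sort R).
Hypothesis c0 : 0 <= c.
Hypothesis r1 : 1 < r.
Implicit Types (h hu hv : T -> R -> R -> R) (u v g : T -> R).

Definition superposable h := forall u v, measurable_fun D u -> measurable_fun D v ->
  measurable_fun D (fun x => h x (u x) (v x)).

(** The partial derivatives are explicit arguments, so that exchanging the variables and changing
    the sign stay within the class. *)
Definition nem h hu hv := [/\ superposable h, superposable hu, superposable hv &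
  ae (fun x => forall a b, [/\ is_derive a (1:R) (fun t => h x t b) (hu x a b),
    is_derive b (1:R) (h x a) (hv x a b),
    `|hu x a b| <= c * (1 + `|a| `^ (r - 1) + `|b| `^ (r - 1)) &
    `|hv x a b| <= c * (1 + `|a| `^ (r - 1) + `|b| `^ (r - 1))])].

(** Together with [nemN], this lets maximization in the first variable be treated as minimization in
    the second. *)
Lemma nem_swap h hu hv : nem h hu hv ->
  nem (fun x a b => h x b a) (fun x a b => hv x b a) (fun x a b => hu x b a).
Proof.
move=> [h1 h2 h3 h4]; split; [by move=> u v mu' mv; exact: h1|by move=> u v mu' mv; exact: h3|
  by move=> u v mu' mv; exact: h2|].
by apply: ae_mp h4 => x _ k a b; have [k1 k2 k3 k4] := k b a; split => //; rewrite addrAC.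
Qed.

Lemma nemN h hu hv : nem h hu hv ->
  nem (fun x a b => - h x a b) (fun x a b => - hu x a b) (fun x a b => - hv x a b).
Proof.
move=> [h1 h2 h3 h4]; split; [by move=> u v mu' mv; exact/measurable_funN/h1|
  by move=> u v mu' mv; exact/measurable_funN/h2|by move=> u v mu' mv; exact/measurable_funN/h3|].
apply: ae_mp h4 => x _ k a b; have [k1 k2 k3 k4] := k a b; rewrite !normrN; split => //.
- exact: is_deriveN.
- exact: is_deriveN.
Qed.

(** Dominates the arguments at both ends and between them; being at least 1, it also absorbs the
    constant in the growth condition. *)
Definition dom u u' v v' x := 1 + `|u x| + `|u' x| + `|v x| + `|v' x|.

Lemma dom_ge1 u u' v v' x : 1 <= dom u u' v v' x.
Proof. by rewrite /dom -!addrA lerDl !addr_ge0. Qed.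

Lemma nem_growth (a b A s : R) : 1 <= A -> `|a| <= A -> `|b| <= A ->
  s <= c * (1 + `|a| `^ (r - 1) + `|b| `^ (r - 1)) -> s <= 3 * c * A `^ (r - 1).
Proof.
move=> A1 aA bA; have r0 : 0 <= r - 1 by rewrite subr_ge0 ltW.
have A0 : 0 <= A by exact: le_trans A1.
have h1 : `|a| `^ (r - 1) <= A `^ (r - 1) by apply: ge0_ler_powR => //; rewrite nnegrE.
have h2 : `|b| `^ (r - 1) <= A `^ (r - 1) by apply: ge0_ler_powR => //; rewrite nnegrE.
have h3 := powR_ge1 A1 r0; move=> h; apply: le_trans h _.
have cc := c0; rewrite -mulrA mulrCA; apply: ler_wpM2l => //; lra.
Qed.

Lemma nem_lip h hu hv x u u' v v' :
  (forall a b, [/\ is_derive a (1:R) (fun t => h x t b) (hu x a b),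
    is_derive b (1:R) (h x a) (hv x a b),
    `|hu x a b| <= c * (1 + `|a| `^ (r - 1) + `|b| `^ (r - 1)) &
    `|hv x a b| <= c * (1 + `|a| `^ (r - 1) + `|b| `^ (r - 1))]) ->
  `|h x (u x) (v x) - h x (u' x) (v' x)| <=
    3 * c * (dom u u' v v' x `^ (r - 1) * (`|u x - u' x| + `|v x - v' x|)).
Proof.
move=> k; set A := dom u u' v v' x; have A1 : 1 <= A := dom_ge1 u u' v v' x.
have n1 := normr_ge0 (u x); have n2 := normr_ge0 (u' x); have n3 := normr_ge0 (v x); have n4 := normr_ge0 (v' x).
have AE : A = 1 + `|u x| + `|u' x| + `|v x| + `|v' x| by [].
have e1 : `|h x (u x) (v x) - h x (u' x) (v x)| <= 3 * c * A `^ (r - 1) * `|u x - u' x|.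
  apply: (@mean_value_le _ (fun t => h x t (v x)) (fun t => hu x t (v x))) => [t|t tb]; first by case: (k t (v x)).
  by case: (k t (v x)) => _ _ hb _; apply: (nem_growth _ _ _ hb) => //; rewrite AE; lra.
have e2 : `|h x (u' x) (v x) - h x (u' x) (v' x)| <= 3 * c * A `^ (r - 1) * `|v x - v' x|.
  apply: (@mean_value_le _ (h x (u' x)) (fun t => hv x (u' x) t)) => [t|t tb]; first by case: (k (u' x) t).
  by case: (k (u' x) t) => _ _ _ hb; apply: (nem_growth _ _ _ hb) => //; rewrite AE; lra.
have -> : h x (u x) (v x) - h x (u' x) (v' x) = (h x (u x) (v x) - h x (u' x) (v x)) +
  (h x (u' x) (v x) - h x (u' x) (v' x)) by ring.
by apply: le_trans (ler_normD _ _) _; rewrite mulrA mulrDr; exact: lerD.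
Qed.

Definition Lr u := measurable_fun D u /\ L1 (fun x => `|u x| `^ r).

Let r0 : 0 <= r. Proof. by apply: le_trans (ltW r1). Qed.

Lemma measurable_powR_norm u : measurable_fun D u -> measurable_fun D (fun x => `|u x| `^ r).
Proof.
move=> mu'; apply: (@measurableT_comp _ _ _ _ _ _ (fun y : R => `|y| `^ r)) => //.
by apply: (@measurableT_comp _ _ _ _ _ _ (@powR R ^~ r)) => //; exact: measurable_powR.
Qed.

Lemma LrD u v : Lr u -> Lr v -> Lr (fun x => u x + v x).
Proof.
move=> [mu' lu] [mv lv]; have m := measurable_funD mu' mv; split => //.
apply: (L1_dom mD (measurable_powR_norm m) (L1Z mD (2 `^ r) (L1D mD lu lv))).
apply: aeP => x _; rewrite ger0_norm ?powR_ge0//.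
apply: le_trans (_ : (`|u x| + `|v x|) `^ r <= _); last by apply: powRD_le => //; exact: ltW.
by apply: ge0_ler_powR; rewrite ?nnegrE ?addr_ge0// ler_normD.
Qed.

Lemma LrZ k u : Lr u -> Lr (fun x => k * u x).
Proof.
move=> [mu' lu]; split; first exact: measurable_funM.
apply: (eq_L1 mD _ (L1Z mD (`|k| `^ r) lu)) => x _.
by rewrite normrM powRM.
Qed.

Lemma LrB u v : Lr u -> Lr v -> Lr (fun x => u x - v x).
Proof.
move=> lu lv; have := LrD lu (LrZ (-1) lv).
by rewrite (_ : (fun x => _ + _) = (fun x => u x - v x))// funeqE => x; rewrite mulN1r.
Qed.

Lemma Lr_abs u : Lr u -> Lr (fun x => `|u x|).
Proof.
move=> [mu' lu]; split; first exact: measurableT_comp.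
by apply: (eq_L1 mD _ lu) => x _; rewrite normr_id.
Qed.

Lemma Lr_cst k : Lr (fun=> k).
Proof. by split => //; exact: L1_cst. Qed.

Lemma Lr_dom u u' v v' : Lr u -> Lr u' -> Lr v -> Lr v' -> Lr (dom u u' v v').
Proof. by move=> *; rewrite /dom; do ?apply: LrD; do ?exact: Lr_abs; exact: Lr_cst. Qed.

Lemma Lr_young u g : Lr u -> Lr g -> L1 (fun x => `|u x| `^ (r - 1) * `|g x|).
Proof.
move=> [mu' lu] [mg lg]; have mm : measurable_fun D (fun x => `|u x| `^ (r - 1) * `|g x|).
  apply: measurable_funM; last exact: measurableT_comp.
  apply: (@measurableT_comp _ _ _ _ _ _ (fun y : R => `|y| `^ (r - 1))) => //.
  by apply: (@measurableT_comp _ _ _ _ _ _ (@powR R ^~ (r - 1))) => //; exact: measurable_powR.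
apply: (L1_dom mD mm (L1D mD lu lg)); apply: aeP => x _.
rewrite ger0_norm ?mulr_ge0 ?powR_ge0//.
have := @young_eps R `|u x| `|g x| r 1 r1 (normr_ge0 _) (normr_ge0 _) ltr01.
by rewrite mul1r powR1 invr1 mul1r.
Qed.

(* Only the derivatives of h have controlled growth, so h x 0 0 need not be integrable. *)
Definition Psi h u v := Int (fun x => h x (u x) (v x) - h x 0 0).

Lemma superposableB h u u' v v' : superposable h -> Lr u -> Lr u' -> Lr v -> Lr v' ->
  measurable_fun D (fun x => h x (u x) (v x) - h x (u' x) (v' x)).
Proof. by move=> sh [m1 _] [m2 _] [m3 _] [m4 _]; apply: measurable_funB; exact: sh. Qed.

Lemma nem_L1 h hu hv u u' v v' : nem h hu hv -> Lr u -> Lr u' -> Lr v -> Lr v' ->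
  L1 (fun x => h x (u x) (v x) - h x (u' x) (v' x)).
Proof.
move=> [sh _ _ k] lu lu' lv lv'; have lA := Lr_dom lu lu' lv lv'.
have lw := LrD (Lr_abs (LrB lu lu')) (Lr_abs (LrB lv lv')).
apply: (L1_dom mD (superposableB sh lu lu' lv lv') (L1Z mD (3 * c) (Lr_young lA lw))).
apply: ae_mp k => x _ /(nem_lip u u' v v').
by rewrite (ger0_norm (addr_ge0 (normr_ge0 _) (normr_ge0 _))) (ger0_norm (le_trans ler01 (dom_ge1 _ _ _ _ _))).
Qed.

Lemma Psi_diff h hu hv u u' v v' : nem h hu hv -> Lr u -> Lr u' -> Lr v -> Lr v' ->
  Psi h u v - Psi h u' v' = Int (fun x => h x (u x) (v x) - h x (u' x) (v' x)).
Proof.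
move=> k lu lu' lv lv'; have l0 := Lr_cst 0.
rewrite /Psi -(intB mD (nem_L1 k lu l0 lv l0) (nem_L1 k lu' l0 lv' l0)).
by apply: eq_int => x _; ring.
Qed.

Definition Nr u := Int (fun x => `|u x| `^ r).

(** Young's inequality with a free weight l separates the factor that is merely bounded from the
    increments, which are to tend to 0. *)
Lemma Psi_diff_le h hu hv u u' v v' l : 0 < l -> nem h hu hv -> Lr u -> Lr u' -> Lr v -> Lr v' ->
  `|Psi h u v - Psi h u' v'| <= 3 * c * (l * Nr (dom u u' v v') +
     (l `^ (r - 1))^-1 * (2 `^ r * (Nr (fun x => u x - u' x) + Nr (fun x => v x - v' x)))).
Proof.
move=> l0 k lu lu' lv lv'; rewrite (Psi_diff k lu lu' lv lv').
have lA := Lr_dom lu lu' lv lv'; have l1 := LrB lu lu'; have l2 := LrB lv lv'.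
have lS := L1D mD (L1Z mD l lA.2) (L1Z mD (l `^ (r - 1))^-1 (L1Z mD (2 `^ r) (L1D mD l1.2 l2.2))).
have -> : 3 * c * (l * Nr (dom u u' v v') +
     (l `^ (r - 1))^-1 * (2 `^ r * (Nr (fun x => u x - u' x) + Nr (fun x => v x - v' x)))) =
   Int (fun x => 3 * c * (l * `|dom u u' v v' x| `^ r +
     (l `^ (r - 1))^-1 * (2 `^ r * (`|u x - u' x| `^ r + `|v x - v' x| `^ r)))).
  rewrite (intZ mD _ lS) (intD mD (L1Z mD l lA.2)); last first.
    exact: (L1Z mD (l `^ (r - 1))^-1 (L1Z mD (2 `^ r) (L1D mD l1.2 l2.2))).
  rewrite (intZ mD _ lA.2) (intZ mD _ (L1Z mD (2 `^ r) (L1D mD l1.2 l2.2))).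
  by rewrite (intZ mD _ (L1D mD l1.2 l2.2)) (intD mD l1.2 l2.2).
apply: (int_abs_le mD (nem_L1 k lu lu' lv lv') (L1Z mD (3 * c) lS)).
case: k => _ _ _; apply: ae_mp => x _ /(nem_lip u u' v v') hh; apply: le_trans hh _.
have cc := c0; apply: ler_wpM2l; first by rewrite mulr_ge0.
have A0 : 0 <= dom u u' v v' x := le_trans ler01 (dom_ge1 _ _ _ _ _).
apply: le_trans (young_eps r1 A0 (addr_ge0 (normr_ge0 _) (normr_ge0 _)) l0) _.
rewrite (ger0_norm A0); apply: lerD => //; apply: ler_wpM2l; first by rewrite invr_ge0 powR_ge0.
by apply: powRD_le => //; exact: ltW.
Qed.

Lemma Nr_ge0 u : 0 <= Nr u.
Proof. by apply: Rintegral_ge0 => x _; exact: powR_ge0. Qed.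

Lemma NrD u v : Lr u -> Lr v -> Nr (fun x => u x + v x) <= 2 `^ r * (Nr u + Nr v).
Proof.
move=> lu lv; have l := L1D mD lu.2 lv.2.
rewrite /Nr -(intD mD lu.2 lv.2) -(intZ mD _ l); apply: (le_int mD (LrD lu lv).2 (L1Z mD _ l)) => x _.
apply: le_trans (_ : (`|u x| + `|v x|) `^ r <= _); last by apply: powRD_le => //; exact: ltW.
by apply: ge0_ler_powR; rewrite ?nnegrE ?addr_ge0// ler_normD.
Qed.

Lemma Nr_abs u : Nr (fun x => `|u x|) = Nr u.
Proof. by apply: eq_int => x _; rewrite normr_id. Qed.

Lemma Nr_dom_le B : exists K, forall u u' v v', Lr u -> Lr u' -> Lr v -> Lr v' ->
  Nr u <= B -> Nr u' <= B -> Nr v <= B -> Nr v' <= B -> Nr (dom u u' v v') <= K.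
Proof.
pose k := 2 `^ r; have k0 : 0 <= k by exact: powR_ge0.
exists (k * (k * (k * (k * (Nr (fun=> 1) + B) + B) + B) + B)) => u u' v v' lu lu' lv lv' b1 b2 b3 b4.
have a1 := Lr_abs lu; have a2 := Lr_abs lu'; have a3 := Lr_abs lv; have a4 := Lr_abs lv'.
have s1 := LrD (Lr_cst 1) a1; have s2 := LrD s1 a2; have s3 := LrD s2 a3.
apply: le_trans (NrD s3 a4) _; rewrite Nr_abs; apply: ler_wpM2l => //; apply: lerD => //.
apply: le_trans (NrD s2 a3) _; rewrite Nr_abs; apply: ler_wpM2l => //; apply: lerD => //.
apply: le_trans (NrD s1 a2) _; rewrite Nr_abs; apply: ler_wpM2l => //; apply: lerD => //.
apply: le_trans (NrD (Lr_cst 1) a1) _; rewrite Nr_abs; apply: ler_wpM2l => //; exact: lerD.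
Qed.

Local Opaque Nr.

(* The rate does not depend on h. *)
Lemma Psi_strong (U V : nat -> T -> R) u v B : (forall i, Lr (U i)) -> (forall i, Lr (V i)) ->
  Lr u -> Lr v -> (forall i, Nr (U i) <= B) -> (forall i, Nr (V i) <= B) ->
  (fun i => Nr (fun x => U i x - u x)) @ \oo --> (0 : R) ->
  (fun i => Nr (fun x => V i x - v x)) @ \oo --> (0 : R) ->
  forall e, 0 < e -> exists N, forall i, (N <= i)%N -> forall h hu hv, nem h hu hv ->
    `|Psi h (U i) (V i) - Psi h u v| <= e.
Proof.
move=> lU lV lu lv bU bV cU cV e e0.
have [K hK] := Nr_dom_le (`|B| + Nr u + Nr v).
have n0 := normr_ge0 B; have nu := Nr_ge0 u; have nv := Nr_ge0 v; have nB := ler_norm B.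
have {}hK i : Nr (dom (U i) u (V i) v) <= K.
  have hB : B <= `|B| + Nr u + Nr v.
    apply: (le_trans nB); rewrite -addrA lerDl; exact: addr_ge0 nu nv.
  apply: (hK _ _ _ _ (lU i) lu (lV i) lv (le_trans (bU i) hB) _ (le_trans (bV i) hB)).
    by rewrite addrAC lerDr addr_ge0.
  by rewrite lerDr addr_ge0.
have cc : 0 <= 3 * c by rewrite mulr_ge0.
have K0 : 0 <= K by apply: le_trans (hK 0%N); exact: Nr_ge0.
(* Makes the bounded part at most e / 2; the summand 1 in the denominator covers the case 3 * c * K
   = 0. *)
pose l := e / 2 / (3 * c * K + 1).
have den : 0 < 3 * c * K + 1 by rewrite ltr_wpDl// mulr_ge0.
have l0 : 0 < l by rewrite !divr_gt0.
pose Q i := 3 * c * ((l `^ (r - 1))^-1 * (2 `^ r * (Nr (fun x => U i x - u x) + Nr (fun x => V i x - v x)))).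
have cQ : Q @ \oo --> (0 : R).
  rewrite (_ : 0 = 3 * c * ((l `^ (r - 1))^-1 * (2 `^ r * (0 + 0)))); last by rewrite addr0 !mulr0.
  by apply: cvgMr; apply: cvgMr; apply: cvgMr; exact: (cvgD cU cV).
have e2 : 0 < e / 2 by rewrite divr_gt0.
have [N hN] := cvg0_eps cQ e2; exists N => i /hN hi h hu hv k.
apply: le_trans (Psi_diff_le l0 k (lU i) lu (lV i) lv) _.
rewrite mulrDr -/(Q i); have := le_lt_trans (ler_norm _) hi.
have : 3 * c * (l * Nr (dom (U i) u (V i) v)) <= e / 2.
  apply: le_trans (_ : 3 * c * (l * K) <= _).
    by apply: ler_wpM2l => //; apply: ler_wpM2l; [exact: ltW|].
  rewrite mulrCA mulrC /l mulrA ler_pdivrMr// mulrC ler_pM2l// lerDl//.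
by move=> b1 b2; rewrite (splitr e); apply: lerD b1 (ltW b2).
Qed.

Lemma gateaux h hu hv u v g (t : nat -> R) : nem h hu hv -> Lr u -> Lr v -> Lr g ->
  t @ \oo --> (0 : R) -> (forall k, 0 < t k <= 1) ->
  L1 (fun x => hu x (u x) (v x) * g x) /\
  (fun k => (Psi h (fun x => u x + t k * g x) v - Psi h u v) / t k) @ \oo -->
    Int (fun x => hu x (u x) (v x) * g x).
Proof.
move=> n lu lv lg t0 t1; have lt' k : Lr (fun x => u x + t k * g x) by apply: LrD => //; exact: LrZ.
(* As t k is at most 1, this dominates u + t k g together with u and v, so one majorant serves all
   difference quotients. *)
pose A x := dom (fun x => `|u x| + `|g x|) u v v x.
have lA : Lr A by apply: Lr_dom => //; apply: LrD; exact: Lr_abs.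
pose F k x := (h x (u x + t k * g x) (v x) - h x (u x) (v x)) / t k.
have lF k : L1 (F k).
  apply: (eq_L1 mD _ (L1Z mD (t k)^-1 (nem_L1 n (lt' k) lu lv lv))) => x _.
  by rewrite mulrC.
have [sh shu shv hn] := n.
have [l i] : L1 (fun x => hu x (u x) (v x) * g x) /\ (fun k => Int (F k)) @ \oo --> Int (fun x => hu x (u x) (v x) * g x).
  apply: (@dct _ _ _ mu D mD F (fun x => hu x (u x) (v x) * g x) (fun x => 3 * c * (`|A x| `^ (r - 1) * `|g x|))).
  - by move=> k; exact: L1_meas (lF k).
  - by apply: measurable_funM; [apply: shu; [case: lu|case: lv]|case: lg].
  - by apply: L1Z => //; exact: Lr_young.
  - apply: ae_mp hn => x _ k; have [k1 _ _ _] := k (u x) (v x).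
    apply: difference_quotient_cvg k1 t0 _ => j; have /andP[] := t1 j => *.
    by rewrite gt_eqF.
  - move=> j; apply: ae_mp hn => x _ k; have /andP[tp tl] := t1 j.
    have := nem_lip (fun x => u x + t j * g x) u v v k.
    rewrite subrr normr0 addr0 -addrAC subrr add0r normrM (gtr0_norm tp) /F normrM normfV (gtr0_norm tp).
    rewrite ler_pdivrMr// => hh; apply: le_trans hh _.
    have cc := c0; rewrite -[leRHS]mulrA; apply: ler_wpM2l; first by rewrite mulr_ge0.
    rewrite -[leRHS]mulrA [`|g x| * _]mulrC; apply: ler_wpM2r; first by rewrite mulr_ge0// ltW.
    have A1 : 1 <= A x := dom_ge1 _ _ _ _ _.
    rewrite (ger0_norm (le_trans ler01 A1)); apply: ge0_ler_powR.
    + by rewrite subr_ge0 ltW.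
    + by rewrite nnegrE (le_trans ler01 (dom_ge1 _ _ _ _ _)).
    + by rewrite nnegrE (le_trans ler01 A1).
    + rewrite /A /dom !lerD2r lerD2l [X in _ <= X]ger0_norm ?addr_ge0//.
      apply: le_trans (ler_normD _ _) _; rewrite lerD2l normrM (gtr0_norm tp).
      by rewrite ler_piMl.
split => //; apply: cvg_trans i; apply: near_eq_cvg; apply: nearW => k.
rewrite (Psi_diff n (lt' k) lu lv lv) mulrC -(intZ mD _ (nem_L1 n (lt' k) lu lv lv)).
by apply: eq_int => x _; rewrite mulrC.
Qed.
End nemytskii.

Lemma convex_slope (R : realType) (t p p0 p1 : R) :
  p <= (1 - t) * p0 + t * p1 -> p - p0 <= (p1 - p0) * t.
Proof. lra. Qed.

Lemma slope_identity (R : realType) (a b c d e t : R) : t != 0 ->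
  (2^-1 * (a + 2 * t * b + t ^+ 2 * c) + d - (2^-1 * a + e)) / t = b + t / 2 * c + (d - e) / t.
Proof. by move=> t0; field. Qed.

(** * Coordinates in the fractional space *)

Section representation.
Context {R : realType} {n : nat}.
Local Notation V := 'rV[R]_n.
Local Notation mu := (@leb R n).
Variables (Omega : set V) (z : nat -> V -> R) (rho : nat -> R) (alpha : Real.sort R).
Hypothesis n_gt0 : (0 < n)%N.
Hypothesis oOmega : open Omega.
Hypothesis bOmega : bounded_set Omega.
Hypothesis hz : dirichlet_eigensystem Omega z rho.
Hypothesis alpha_gt0 : 0 < alpha.
Hypothesis alpha_lt2 : alpha < 2.
Hypothesis alphan : alpha < n%:R.
Local Notation D := (Omega : set (Rn R n)).
Local Notation L2O := (L2 mu D).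
Local Notation sqO := (sqn mu D).
Local Notation ipO := (ip mu D).
Local Notation aeO := (ae mu D).
Local Notation expnO := (expn mu D z).
Local Notation fl := (frac_laplacian Omega z rho (alpha / 4)).
Let mO : measurable D := mOmega oOmega.
Let lz := z_L2 oOmega hz.
Let oz : forall j k, ipO (z j) (z k) = (j == k)%:R := z_ortho hz.
Let rp := rho_gt0 n_gt0 oOmega bOmega hz.

Lemma eigenP a f : eigen_expansion Omega z a f <-> expnO a f.
Proof.
split=> [[/(Lp2P oOmega) lf cf]|[lf cf]].
  by split => //; apply/(L2_cvgP oOmega (psum_L2 mO lz a) lf).
split; first exact/(Lp2P oOmega).
exact/(L2_cvgP oOmega (psum_L2 mO lz a) lf).
Qed.

Definition pw k := rho k `^ (alpha / 4).

Lemma pw_gt0 k : 0 < pw k.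
Proof. by rewrite powR_gt0. Qed.

Lemma pw_sqr k : pw k ^+ 2 = rho k `^ (alpha / 2).
Proof.
rewrite /pw -powR_mulrn ?powR_ge0// -powRrM; congr (_ `^ _); by field.
Qed.

Definition first_pow := rho 0 `^ (alpha / 2).

Lemma first_pow_gt0 : 0 < first_pow.
Proof. by rewrite powR_gt0. Qed.

Lemma first_pow_le k : first_pow <= rho k `^ (alpha / 2).
Proof.
apply: ge0_ler_powR; rewrite ?nnegrE ?(ltW (rp _)) ?(rho_mono hz)//.
by rewrite divr_ge0// ltW.
Qed.

(* The sequence x consists of the coefficients of (-Delta)^(alpha/4) u. *)
Definition rep x (u : V -> R) := l2 x /\ expnO (fun k => x k / pw k) u.

Lemma rep_energy x u : rep x u -> bounded_energy Omega z rho alpha (nsq x) (fun k => x k / pw k) u.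
Proof.
move=> [lx eu]; split => // N; apply: le_trans (ps_le_nsq N lx).
apply: ler_sum => k _; rewrite -pw_sqr -exprMn divfK//.
by rewrite gt_eqF// pw_gt0.
Qed.

Lemma rep_ex x : l2 x -> exists u, rep x u.
Proof.
move=> lx; have [u hu] : exists u, expnO (fun k => x k / pw k) u.
  apply: (@expn_ex _ _ _ mu D mO z lz oz _ (nsq x / first_pow)) => N.
  rewrite ler_pdivlMr ?first_pow_gt0// mulr_suml; apply: le_trans (ps_le_nsq N lx).
  apply: ler_sum => k _; rewrite exprMn exprVn pw_sqr -mulrA ler_piMr ?sqr_ge0//.
  by rewrite mulrC ler_pdivrMr ?mul1r ?first_pow_le// powR_gt0.
by exists u.
Qed.

Lemma rep_ae x u u' : rep x u -> rep x u' -> aeO (fun y => u y = u' y).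
Proof. by move=> [_ e] [_ e']; exact: (expn_uniq mO lz e e'). Qed.

(** [frac_laplacian] is an arbitrary choice, but the coefficients in any witness are the inner
    products of u with the [z k], so the chosen function has coefficients x. *)
Lemma rep_fl x u : rep x u -> expnO x (fl u).
Proof.
move=> [lx e]; have [g hg] : exists g, expnO x g.
  by apply: (@expn_ex _ _ _ mu D mO z lz oz _ (nsq x)) => N; exact: ps_le_nsq.
have ex : exists g, exists a, eigen_expansion Omega z a u /\
    eigen_expansion Omega z (fun k => a k * rho k `^ (alpha / 4)) g.
  exists g, (fun k => x k / pw k); split; first exact/eigenP.
  apply/eigenP; rewrite (_ : (fun k => _) = x)// funeqE => k.
  by rewrite divfK// gt_eqF// pw_gt0.
have [a [/eigenP ea /eigenP]] := @xgetPex _ (fun=> 0) [set g | exists a, eigen_expansion Omega z a u /\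
    eigen_expansion Omega z (fun k => a k * rho k `^ (alpha / 4)) g] ex.
rewrite -/(fl u) (_ : (fun k => _) = x)// funeqE => k.
by rewrite -(expn_coef mO lz oz k ea) (expn_coef mO lz oz k e) divfK// gt_eqF// pw_gt0.
Qed.

Lemma sqn_expn x f : l2 x -> expnO x f -> sqO f = nsq x.
Proof. by move=> lx /(expn_sqn mO lz oz) c; apply: (cvg_unique _ c (ps_cvg lx)). Qed.

Lemma fl_sqn x u : rep x u -> sqO (fl u) = nsq x.
Proof. by move=> h; apply: sqn_expn (rep_fl h); case: h. Qed.

Lemma rep_comb s t x y u v : rep x u -> rep y v -> rep (comb s t x y) (fun q => s * u q + t * v q).
Proof.
move=> [lx eu] [ly ev]; split; first exact: l2_comb.
have := expnD mO lz (expnZ mO lz s eu) (expnZ mO lz t ev).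
rewrite (_ : (fun k => _ + _) = (fun k => comb s t x y k / pw k))// funeqE => k.
by rewrite /comb mulrDl !mulrA.
Qed.

Lemma HfracP u : Hfrac Omega z rho alpha u <-> exists x, rep x u.
Proof.
split=> [[a [/eigenP ea ca]]|[x h]].
  have E N : ps (fun k => a k * pw k) N = series (fun k => a k ^+ 2 * rho k `^ (alpha / 2)) N.
    by rewrite /ps /series /= big_mkord; apply: eq_bigr => k _; rewrite exprMn pw_sqr.
  exists (fun k => a k * pw k); split.
    exists (limn (series (fun k => a k ^+ 2 * rho k `^ (alpha / 2)))) => N; rewrite E.
    apply: nondecreasing_cvgn_le ca N; apply/nondecreasing_seqP => N.
    by rewrite -!E /ps big_ord_recr /= lerDl sqr_ge0.
  rewrite (_ : (fun k => _) = a)// funeqE => k.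
  by rewrite mulfK// gt_eqF// pw_gt0.
have [[C hC] /eigenP e] := h; exists (fun k => x k / pw k); split => //.
apply: (@bounded_sum_cvg _ _ (nsq x)) => [k|N].
  by rewrite mulr_ge0 ?sqr_ge0 ?powR_ge0.
by have [_] := rep_energy h; apply.
Qed.

Definition lift x : V -> R := xget (fun=> 0) [set u | rep x u].

Lemma repT x : l2 x -> rep x (lift x).
Proof. by move=> /rep_ex; exact: (@xgetPex _ (fun=> 0) [set u | rep x u]). Qed.

Lemma rep_L2 x u : rep x u -> L2O u.
Proof. by move=> [_ []]. Qed.

Lemma rep_sqn x u : rep x u -> sqO u <= nsq x / first_pow.
Proof. by move=> /rep_energy; exact: (energy_sqn n_gt0 oOmega bOmega hz alpha_gt0). Qed.

Section subcritical.
Variable r : Real.sort R.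
Hypothesis r2 : 2 <= r.
Hypothesis rsub : r < 2 * n%:R / (n%:R - alpha).
Local Notation LrO := (Lr mu D r).
Local Notation NrO := (Nr mu D r).

Lemma rep_Lr x u : rep x u -> LrO u.
Proof.
move=> h; have [B hB] := energy_Lr n_gt0 oOmega bOmega hz alpha_gt0 alpha_lt2 alphan r2 rsub (nsq x).
by split; [case: (rep_L2 h)|case: (hB _ _ (rep_energy h))].
Qed.

Lemma bounded_seq_energy X U : bounded_seq X -> (forall i, rep (X i) (U i)) ->
  exists C, forall i, bounded_energy Omega z rho alpha C (fun k => X i k / pw k) (U i).
Proof.
move=> [C hC] hU; exists C => i; have [e b] := rep_energy (hU i); split => // N.
by apply: le_trans (b N) _; exact: nsq_le.
Qed.

Lemma rep_Nr_bound X U : bounded_seq X -> (forall i, rep (X i) (U i)) ->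
  exists B, forall i, NrO (U i) <= B.
Proof.
move=> bX hU; have [C hC] := bounded_seq_energy bX hU.
have [B hB] := energy_Lr n_gt0 oOmega bOmega hz alpha_gt0 alpha_lt2 alphan r2 rsub C.
by exists B => i; case: (hB _ _ (hC i)).
Qed.

Lemma rep_wcvg X x U u : wcvg X x -> (forall i, rep (X i) (U i)) -> rep x u ->
  (fun i => NrO (fun q => U i q - u q)) @ \oo --> (0 : R).
Proof.
move=> [bX hX] hU [_ eu]; have [C hC] := bounded_seq_energy bX hU.
apply: (energy_compact n_gt0 oOmega bOmega hz alpha_gt0 alpha_lt2 alphan r2 rsub hC _ eu) => k.
by apply: cvgMl.
Qed.

Variables (c : Real.sort R) (c0 : 0 <= c).
Local Notation nemO := (nem mu D c r).
Let r1 : 1 < r. Proof. by apply: lt_le_trans r2; rewrite ltr1n. Qed.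
Let fO := muOmega bOmega.

Definition psi h x y := Psi mu D h (lift x) (lift y).

Lemma psiE h x y : psi h x y = Psi mu D h (lift x) (lift y).
Proof. by []. Qed.

(** Functions with the same coefficients agree almost everywhere, so the choice made in [lift] does
    not affect the integral. *)
Lemma psi_rep h hu hv x y u v : nemO h hu hv -> rep x u -> rep y v -> psi h x y = Psi mu D h u v.
Proof.
move=> k hu' hv'; have tx := repT hu'.1; have ty := repT hv'.1; have [sh _ _ _] := k.
have m x' u' : rep x' u' -> measurable_fun D u' by move=> h'; case: (rep_L2 h').
have m0 := sh _ _ (measurable_cst (0 : R)) (measurable_cst (0 : R)).
apply: (eq_int_ae mO).
- exact: (measurable_funB (sh _ _ (m _ _ tx) (m _ _ ty)) m0).
- exact: (measurable_funB (sh _ _ (m _ _ hu') (m _ _ hv')) m0).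
- by apply: ae_mp2 (rep_ae tx hu') (rep_ae ty hv') => q _ -> ->.
Qed.

Lemma psi_strong X x Y y : wcvg X x -> wcvg Y y ->
  forall e, 0 < e -> exists N, forall i, (N <= i)%N -> forall h hu hv, nemO h hu hv ->
    `|psi h (X i) (Y i) - psi h x y| <= e.
Proof.
move=> wX wY e e0; have hX i := repT (wcvg_l2i i wX); have hY i := repT (wcvg_l2i i wY).
have [B1 h1] := rep_Nr_bound wX.1 hX; have [B2 h2] := rep_Nr_bound wY.1 hY.
apply: (@Psi_strong _ _ _ mu D mO fO c r c0 r1 (fun i => lift (X i)) (fun i => lift (Y i)) _ _ (Num.max B1 B2)
  (fun i => rep_Lr (hX i)) (fun i => rep_Lr (hY i)) (rep_Lr (repT (wcvg_l2 wX))) (rep_Lr (repT (wcvg_l2 wY)))) => //.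
- by move=> i; rewrite le_max h1.
- by move=> i; rewrite le_max h2 orbT.
- exact: rep_wcvg wX hX (repT (wcvg_l2 wX)).
- exact: rep_wcvg wY hY (repT (wcvg_l2 wY)).
Qed.

Lemma psi_cvg h hu hv X x Y y : nemO h hu hv -> wcvg X x -> wcvg Y y ->
  (fun i => psi h (X i) (Y i)) @ \oo --> psi h x y.
Proof.
move=> k wX wY; apply: eps_cvg => e /(psi_strong wX wY)[N hN]; exists N => i /hN hi; exact: (hi _ _ _ k).
Qed.

Lemma coercive_bound b (beta gamma : V -> R) : 2 * b < first_pow -> L2O beta -> L1 mu D gamma ->
  exists d C, 0 < d /\ forall y v (phi : V -> R), rep y v -> L1 mu D phi ->
    aeO (fun q => - b * `|v q| ^+ 2 - beta q * v q - gamma q <= phi q) ->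
    d * nsq y - C <= 2^-1 * nsq y + Int mu D phi.
Proof.
move=> hb lb lg; have f0 := first_pow_gt0; have fn : first_pow != 0 by rewrite gt_eqF.
(* The bound of [rep_sqn] is multiplied by this coefficient below, which must therefore be
   nonnegative. *)
pose b' := Num.max b 0; have b'0 : 0 <= b' by rewrite le_max lexx orbT.
have bb' : b <= b' by rewrite le_max lexx.
have hb' : 2 * b' < first_pow by rewrite /b'; case: (leP b 0) => _ //; rewrite mulr0.
(* The product of beta and v costs l v^2 + beta^2 / (4 l). With l = d * first_pow, Poincare's
   inequality bounds (b' + l) |v|_2^2 by (b' / first_pow + d) nsq y, and d is chosen so that this
   equals (1/2 - d) nsq y, leaving d * nsq y. *)
pose d := (first_pow - 2 * b') / (4 * first_pow).
have d0 : 0 < d by rewrite divr_gt0 ?subr_gt0// mulr_gt0.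
pose l := d * first_pow; have l0 : 0 < l by rewrite mulr_gt0.
exists d, ((4 * l)^-1 * sqO beta + Int mu D gamma); split => // y v phi hy lphi hphi.
have lv := rep_L2 hy; have sv := rep_sqn hy.
have L := L1N mO (L1D mO (L1D mO (L1Z mO (b' + l) lv.2) (L1Z mO (4 * l)^-1 lb.2)) lg).
have : Int mu D (fun q => - ((b' + l) * v q ^+ 2 + (4 * l)^-1 * beta q ^+ 2 + gamma q)) <= Int mu D phi.
  apply: (le_int_ae mO L lphi); apply: ae_mp hphi => q _; apply: le_trans.
  rewrite real_normK ?num_real//.
  have h1 : b * v q ^+ 2 <= b' * v q ^+ 2 by apply: ler_wpM2r => //; exact: sqr_ge0.
  have h2 : beta q * v q <= l * v q ^+ 2 + (4 * l)^-1 * beta q ^+ 2.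
    have : 0 <= l * (v q - (2 * l)^-1 * beta q) ^+ 2 by rewrite mulr_ge0 ?sqr_ge0// ltW.
    have -> : l * (v q - (2 * l)^-1 * beta q) ^+ 2 = l * v q ^+ 2 + (4 * l)^-1 * beta q ^+ 2 - beta q * v q.
      by field; rewrite gt_eqF.
    by rewrite subr_ge0.
  rewrite mulrDl; lra.
rewrite (intN mO (L1D mO (L1D mO (L1Z mO (b' + l) lv.2) (L1Z mO (4 * l)^-1 lb.2)) lg)).
rewrite (intD mO (L1D mO (L1Z mO (b' + l) lv.2) (L1Z mO (4 * l)^-1 lb.2)) lg).
rewrite (intD mO (L1Z mO (b' + l) lv.2) (L1Z mO (4 * l)^-1 lb.2)) (intZ mO _ lv.2) (intZ mO _ lb.2).
rewrite -/(sqn mu D v) -/(sqn mu D beta) => h.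
have h3 : (b' + l) * sqO v <= (b' / first_pow + d) * nsq y.
  apply: le_trans (ler_wpM2l _ sv) _; first by rewrite addr_ge0// ltW.
  by rewrite le_eqVlt; apply/orP; left; apply/eqP; rewrite /l; field.
have h4 : b' / first_pow + d = 2^-1 - d by rewrite /d; field.
rewrite h4 in h3; move: h h3; rewrite mulrBl; set s := (b' + l) * _; set p := _ * sqO beta; lra.
Qed.

(** * Critical points and minimizers in the second variable *)

Section criticality.
Variables (h hu hv : V -> R -> R -> R) (k : nemO h hu hv) (x : nat -> R) (u : V -> R) (hx : rep x u).
Local Notation Phi y := (2^-1 * nsq y + psi h x y).

Let Phi_quotient y g v gg : rep y v -> rep g gg ->
  L1 mu D (fun q => hv q (u q) (v q) * gg q) /\
  (fun i => (Phi (comb 1 (2^-1 ^+ i) y g) - Phi y) / 2^-1 ^+ i) @ \oo -->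
     ipO (fl v) (fl gg) + Int mu D (fun q => hv q (u q) (v q) * gg q).
Proof.
move=> hy hg; pose t (i : nat) : R := 2^-1 ^+ i.
have t0 i : 0 < t i by rewrite exprn_gt0// invr_gt0.
have t1 i : 0 < t i <= 1 by rewrite t0 exprn_ile1//; lra.
have ct : t @ \oo --> (0 : R) by exact: exp_half_cvg0.
have [l cg] := gateaux mO fO c0 r1 (nem_swap k) (rep_Lr hy) (rep_Lr hx) (rep_Lr hg) ct t1.
split => //; have E i : (Phi (comb 1 (t i) y g) - Phi y) / t i =
    ipO (fl v) (fl gg) + t i / 2 * nsq g +
    (Psi mu D (fun q a b => h q b a) (fun q => v q + t i * gg q) u - Psi mu D (fun q a b => h q b a) v u) / t i.
  have hc : rep (comb 1 (t i) y g) (fun q => v q + t i * gg q).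
    have := rep_comb 1 (t i) hy hg.
    by rewrite (_ : (fun q => 1 * v q + _) = (fun q => v q + t i * gg q))// funeqE => q; rewrite mul1r.
  have sE w : Psi mu D (fun q a b => h q b a) w u = Psi mu D h u w by [].
  rewrite !sE -(psi_rep k hx hc) -(psi_rep k hx hy).
  have -> : nsq (comb 1 (t i) y g) = nsq y + 2 * t i * ipO (fl v) (fl gg) + t i ^+ 2 * nsq g.
    have e1 := rep_fl hy; have e2 := expnZ mO lz (t i) (rep_fl hg).
    have -> : comb 1 (t i) y g = fun k => y k + t i * g k by rewrite funeqE => j; rewrite /comb mul1r.
    rewrite -(sqn_expn _ (expnD mO lz e1 e2)); last first.
      by have := l2_comb 1 (t i) hy.1 hg.1; rewrite /comb; under eq_fun do rewrite mul1r.
    rewrite (sqnD mO e1.1 e2.1) (fl_sqn hy) (sqnZ mO _ (rep_fl hg).1) (fl_sqn hg).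
    by rewrite [ipO (fl v) (fun _ => _)]ipC (ipZl mO _ (rep_fl hg).1 e1.1) [ipO (fl gg) _]ipC mulrA.
  by apply: slope_identity; rewrite gt_eqF.
rewrite (funext E : (fun i => (Phi (comb 1 (2^-1 ^+ i) y g) - Phi y) / 2^-1 ^+ i) = _).
rewrite [X in _ --> X + _](_ : ipO (fl v) (fl gg) = ipO (fl v) (fl gg) + 0 / 2 * nsq g); last by rewrite !mul0r addr0.
apply: (cvgD _ cg); apply: cvgD; first exact: cvg_cst.
by apply: cvgMl; apply: cvgMl.
Qed.

(** Difference quotients at a minimizer are nonnegative, hence so is the derivative in every
    direction; the direction -g gives the reverse inequality. *)
Lemma critical_of_min y v : rep y v -> (forall y', l2 y' -> Phi y <= Phi y') ->
  forall g gg, rep g gg -> ipO (fl v) (fl gg) + Int mu D (fun q => hv q (u q) (v q) * gg q) = 0.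
Proof.
move=> hy ym; have key g gg : rep g gg ->
    0 <= ipO (fl v) (fl gg) + Int mu D (fun q => hv q (u q) (v q) * gg q).
  move=> hg; have [_ cc] := Phi_quotient hy hg.
  rewrite -(cvg_lim _ cc)//; apply: limr_ge; first by apply/cvg_ex; eexists; exact: cc.
  apply: nearW => i; apply: divr_ge0; last by rewrite exprn_ge0.
  by rewrite subr_ge0 ym//; apply: l2_comb; [case: hy|case: hg].
move=> g gg hg; apply/eqP; rewrite eq_le (key _ _ hg) andbT.
have hN : rep (comb (-1) 0 g g) (fun q => -1 * gg q + 0 * gg q) by exact: rep_comb.
have := key _ _ hN; have [l _] := Phi_quotient hy hg.
(* [fl] is linear only up to null sets, by uniqueness of expansions. *)
have -> : ipO (fl v) (fl (fun q => -1 * gg q + 0 * gg q)) = - ipO (fl v) (fl gg).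
  have e1 := rep_fl hN; have e2 := expnZ mO lz (-1) (rep_fl hg); have lv := (rep_fl hy).1.
  have cE : comb (-1) 0 g g = (fun k => -1 * g k) by rewrite funeqE => j; rewrite /comb mul0r addr0.
  rewrite cE in e1.
  rewrite -[- ipO _ _]mulN1r [ipO (fl v) (fl gg)]ipC -(ipZl mO _ (rep_fl hg).1 lv) ipC.
  apply: (eq_int_ae mO); [exact: (L1_meas (L2M mO e1.1 lv))|exact: (L1_meas (L2M mO e2.1 lv))|].
  by apply: ae_mp (expn_uniq mO lz e1 e2) => q _ ->.
have -> : Int mu D (fun q => hv q (u q) (v q) * (-1 * gg q + 0 * gg q)) =
   - Int mu D (fun q => hv q (u q) (v q) * gg q).
  by rewrite -(intN mO l); apply: eq_int => q _; ring.
rewrite -opprD oppr_ge0; exact.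
Qed.

(** For convex [Phi] the difference quotients in the direction y' - y are at most Phi y' - Phi y,
    and at a critical point they tend to 0. *)
Lemma min_of_critical y v : rep y v ->
  (forall t y', l2 y' -> 0 <= t <= 1 -> Phi (comb (1 - t) t y y') <= (1 - t) * Phi y + t * Phi y') ->
  (forall g gg, rep g gg -> ipO (fl v) (fl gg) + Int mu D (fun q => hv q (u q) (v q) * gg q) = 0) ->
  forall y', l2 y' -> Phi y <= Phi y'.
Proof.
move=> hy cvx crit y' ly'; pose g := comb 1 (-1) y' y.
have lg : l2 g by apply: l2_comb => //; case: hy.
have [_] := Phi_quotient hy (repT lg); rewrite (crit _ _ (repT lg)) => cc.
rewrite -subr_ge0 -(cvg_lim _ cc)//; apply: limr_le; first by apply/cvg_ex; eexists; exact: cc.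
apply: nearW => i; set t := 2^-1 ^+ i.
have t0 : 0 < t by rewrite exprn_gt0// invr_gt0.
have t1 : t <= 1 by rewrite exprn_ile1//; lra.
have -> : comb 1 t y g = comb (1 - t) t y y' by rewrite funeqE => j; rewrite /g /comb; ring.
rewrite ler_pdivrMr//; have := cvx t y' ly'; rewrite t1 (ltW t0) => /(_ isT).
exact: convex_slope.
Qed.
End criticality.
End subcritical.
End representation.

Lemma add3_le (R : realType) (A B A' B' : R) : A <= 1 + A' -> B <= 1 + B' -> 0 <= A' -> 0 <= B' ->
  1 + A + B <= 3 * (1 + A' + B').
Proof. lra. Qed.

(** * Controls *)

Section rounding.
Context {R : realType}.

Definition rnd j (t : R) : R := (Num.ceil (2 ^+ j * t))%:~R / 2 ^+ j.

Lemma rnd_close j t : `|rnd j t - t| <= 2^-1 ^+ j.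
Proof.
have p : (0 : R) < 2 ^+ j by rewrite exprn_gt0.
have /andP[h1 h2] := ceil_itv (2 ^+ j * t); rewrite rmorphB /= in h1.
rewrite -(ler_pM2r p) -{1}(gtr0_norm p) -normrM /rnd mulrBl divfK ?gt_eqF// exprVn mulVf ?gt_eqF//.
rewrite [t * _]mulrC ler_norml; move: h1 h2; rewrite mulr1z.
by set u := _%:~R; set v := 2 ^+ j * t => ? ?; apply/andP; split; lra.
Qed.

Lemma cvg_of_half (u : nat -> R) l C : (forall j, `|u j - l| <= C * 2^-1 ^+ j) -> u @ \oo --> l.
Proof.
move=> h; have c : (fun j => C * (2^-1 : R) ^+ j) @ \oo --> (0 : R).
  by rewrite -(mulr0 C); apply: cvgMr; exact: exp_half_cvg0.
apply: eps_cvg => e e0; have [N hN] := cvg0_eps c e0; exists N => k /hN h'.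
by apply: le_trans (h k) _; apply: le_trans (ler_norm _) (ltW h').
Qed.

Lemma rnd_cvg t : (fun j => rnd j t) @ \oo --> t.
Proof. by apply: (@cvg_of_half _ _ 1) => j; rewrite mul1r rnd_close. Qed.

Lemma measurable_ceil_fiber d (T : measurableType d) (D : set T) (u : T -> R) j i :
  measurable D -> measurable_fun D u ->
  measurable (D `&` [set x | Num.ceil (2 ^+ j * u x) = i]).
Proof.
move=> mD mu'; have p : (0 : R) < 2 ^+ j by rewrite exprn_gt0.
have -> : D `&` [set x | Num.ceil (2 ^+ j * u x) = i] =
    D `&` u @^-1` `](i%:~R - 1) / 2 ^+ j, i%:~R / 2 ^+ j].
  have E (x : T) : Num.ceil (2 ^+ j * u x) = i <-> `](i%:~R - 1) / 2 ^+ j, i%:~R / 2 ^+ j]%classic (u x).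
    rewrite /= in_itv /= ltr_pdivrMr// ler_pdivlMr// [u x * _]mulrC.
    split=> [<-|h]; first by have := ceil_itv (2 ^+ j * u x); rewrite rmorphB /= mulr1z.
    by apply: ceil_def; rewrite rmorphB /= mulr1z.
  by rewrite eqEsubset; split=> x [Dx /E h].
exact: mu'.
Qed.

Lemma cvg_rV m (W : nat -> 'rV[R]_m) (w : 'rV[R]_m) :
  (forall i, (fun j => W j ord0 i) @ \oo --> w ord0 i) -> W @ \oo --> w.
Proof.
move=> h; apply/cvgrPdist_le => e e0; near=> k.
rewrite [leLHS]/Num.Def.normr/= mx_normrE (bigmax_le _ (ltW e0))//= => -[i j] _ /=.
rewrite !mxE (ord1 i) /=; move: j; near: k; apply: filter_forall => j.
exact: ((cvgrPdist_le _ _).1 (h j)).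
Unshelve. all: by end_near. Qed.

Lemma cvg_coord m (W : nat -> 'rV[R]_m) (w : 'rV[R]_m) i : W @ \oo --> w -> (fun j => W j ord0 i) @ \oo --> w ord0 i.
Proof.
move=> h; apply/cvgrPdist_le => e e0; move/cvgrPdist_le : h => /(_ e e0) [N _ hN]; exists N => // k /hN; apply: le_trans.
by have := ler_coord_norm (w - W k) i; rewrite !mxE.
Qed.

Lemma cvg_pair_seq (T U : topologicalType) (u : nat -> T) (v : nat -> U) (a : T) (b : U) :
  u @ \oo --> a -> v @ \oo --> b -> (fun j => (u j, v j)) @ \oo --> (a, b).
Proof.
move=> hu hv A [[B C] [/= hB hC] BC].
have h1 : \forall j \near \oo, B (u j) := hu B hB.
have h2 : \forall j \near \oo, C (v j) := hv C hC.
change (\forall j \near \oo, A (u j, v j)).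
by apply: filterS2 h1 h2 => j Bj Cj; apply: BC.
Qed.

Section dense_sequence.
Variables (m : nat) (M : set 'rV[R]_m) (w0 : 'rV[R]_m).
Hypothesis M0 : M w0.

(* theta is only known to be measurable for controls in M, so a dyadic cell is
   represented by one of its points in M. *)
Definition netpt j (i : {ffun 'I_m -> int}) : 'rV[R]_m := xget w0 [set w | M w /\ dyidx j w = i].

Lemma netpt_in j i : M (netpt j i).
Proof. by rewrite /netpt; case: xgetP => [w -> []|]. Qed.

Lemma netpt_cvg w : M w -> (fun j => netpt j (dyidx j w)) @ \oo --> w.
Proof.
move=> Mw; apply: cvg_rV => i; apply: (@cvg_of_half _ _ 1) => j; rewrite mul1r.
have [Mp e] := @xgetPex _ w0 [set w' | M w' /\ dyidx j w' = dyidx j w] (ex_intro _ w (conj Mw erefl)).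
exact: (cell_close e).
Qed.
End dense_sequence.
End rounding.

(** * The nonlinearity with a frozen control *)

Section frozen_control.
Context {R : realType} {n m : nat}.
Local Notation V := 'rV[R]_n.
Local Notation W := 'rV[R]_m.
Local Notation mu := (@leb R n).
Variables (Omega : set V).
Hypothesis oOmega : open Omega.
Local Notation D := (Omega : set (Rn R n)).
Local Notation aeO := (ae mu D).
Let mO : measurable D := mOmega oOmega.
Let cmu : measure_is_complete mu := @measure_is_complete_caratheodory R _ (@lebesgue_outer R n).

(** Dyadic roundings of (u, v) take countably many values, at which measurability in x is given;
    continuity in (u, v) handles the limit. *)
Lemma caratheodory_superposable g : caratheodory_uv Omega g -> superposable D g.
Proof.
move=> [mg cg] u v mu' mv.
apply: (@measurable_superposition _ (Rn R n) R mu D mO cmu (R * R)%type (int * int)%type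
  (fun x q => g x q.1 q.2) (fun x => (u x, v x))
  (fun j x => (Num.ceil (2 ^+ j * u x), Num.ceil (2 ^+ j * v x)))
  (fun j i => (i.1%:~R / 2 ^+ j, i.2%:~R / 2 ^+ j))).
- move=> j [i1 i2]; have h1 := measurable_ceil_fiber j i1 mO mu'; have h2 := measurable_ceil_fiber j i2 mO mv.
  have -> : D `&` (fun x : Rn R n => (Num.ceil (2 ^+ j * u x), Num.ceil (2 ^+ j * v x))) @^-1` [set (i1, i2)] =
    (D `&` [set x | Num.ceil (2 ^+ j * u x) = i1]) `&` (D `&` [set x | Num.ceil (2 ^+ j * v x) = i2]).
    by rewrite eqEsubset; split=> [x [Dx [<- <-]]|x [[Dx <-] [_ <-]]].
  exact: measurableI h1 h2.
- by move=> j i; exact: mg.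
- apply: ae_mp cg => x _ c /=.
  have h := @cvg_pair_seq R R _ _ _ _ (@rnd_cvg _ (u x)) (@rnd_cvg _ (v x)).
  exact: (cvg_comp _ _ h (c (u x, v x))).
Qed.

(** [controls] without its L^p clause, which the boundedness of M makes automatic. *)
Definition ctrl (M : set W) (w : V -> W) :=
  (forall i, measurable_fun D (fun x : Rn R n => w x ord0 i)) /\ aeO (fun x => M (w x)).

Variables (G1 : V -> R -> R -> R) (G2 : V -> R -> R -> W).
Hypothesis hA1 : A1 Omega G1 G2.
Local Notation G := (Defs.G G1 G2).

Definition Gu (x : V) (a b : R) (w : W) : R := d_u G1 x a b + dot (d_u G2 x a b) w.
Definition Gv (x : V) (a b : R) (w : W) : R := d_v G1 x a b + dot (d_v G2 x a b) w.

Lemma superposable_affine (g1 : V -> R -> R -> R) (g2 : V -> R -> R -> W) (M : set W) w :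
  caratheodory_uv Omega g1 -> caratheodory_uv_vec Omega g2 -> ctrl M w ->
  superposable D (fun x a b => g1 x a b + dot (g2 x a b) (w x)).
Proof.
move=> c1 c2 [mw _] u v mu' mv; apply: measurable_funD; first exact: (caratheodory_superposable c1 mu' mv).
rewrite /dot; apply: measurable_sum => i; apply: measurable_funM; last exact: mw.
exact: (caratheodory_superposable (c2 i) mu' mv).
Qed.

Lemma superposable_G M w : ctrl M w -> superposable D (fun x a b => G x a b (w x)).
Proof. by move=> cw; have [_ _ [c1 _ _] [c2 _ _]] := hA1; exact: (superposable_affine c1 c2 cw). Qed.

Lemma superposable_Gu M w : ctrl M w -> superposable D (fun x a b => Gu x a b (w x)).
Proof. by move=> cw; have [_ _ [_ c1 _] [_ c2 _]] := hA1; exact: (superposable_affine c1 c2 cw). Qed.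

Lemma superposable_Gv M w : ctrl M w -> superposable D (fun x a b => Gv x a b (w x)).
Proof. by move=> cw; have [_ _ [_ _ c1] [_ _ c2]] := hA1; exact: (superposable_affine c1 c2 cw). Qed.

Lemma is_derive_dot (f : R -> W) (a : R) (w : W) : derivable f a 1 ->
  is_derive a (1 : R) (fun t => dot (f t) w) (dot (derive1 f a) w).
Proof.
move=> df; have h i := (derivable_mxP f a 1).1 df ord0 i.
have E : dot (derive1 f a) w = \sum_i (w ord0 i * 'D_1 (fun t => f t ord0 i) a).
  rewrite /dot; apply: eq_bigr => i _; rewrite derive1E (derive_mx df) mxE mulrC //.
rewrite E (_ : (fun t => dot (f t) w) = \sum_i (fun t => w ord0 i * f t ord0 i)); last first.
  by rewrite funeqE => t; rewrite fct_sumE /dot; apply: eq_bigr => i _; rewrite mulrC.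
apply: is_derive_sum => i; have d : is_derive a (1 : R) (fun t => f t ord0 i) ('D_1 (fun t => f t ord0 i) a).
  by split; first exact: h.
exact: (is_deriveZ (w ord0 i) d).
Qed.

Lemma is_derive_G : aeO (fun x => forall (a b : R) w,
  is_derive a (1 : R) (fun t => G x t b w) (Gu x a b w) /\
  is_derive b (1 : R) (fun t => G x a t w) (Gv x a b w)).
Proof.
have [d1 d2 _ _] := hA1; apply: ae_mp2 d1 d2 => x _ k1 k2 a b w.
have [e1 e2] := k1 a b; have [e3 e4] := k2 a b; split; apply: is_deriveD.
- apply: (DeriveDef e1); exact: esym (derive1E _ _).
- exact: (is_derive_dot w e3).
- apply: (DeriveDef e2); exact: esym (derive1E _ _).
- exact: (is_derive_dot w e4).
Qed.

Lemma coord_enorm (v : W) i : `|v ord0 i| <= enorm v.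
Proof.
rewrite /enorm -sqrtr_sqr; apply: ler_wsqrtr; rewrite /dot (bigD1 i) //= expr2 lerDl.
by apply: sumr_ge0 => j _; rewrite -expr2 sqr_ge0.
Qed.

Lemma dot_le (v w : W) K : (forall i, `|w ord0 i| <= K) -> `|dot v w| <= enorm v * (m%:R * K).
Proof.
move=> hK; apply: le_trans (ler_norm_sum _ _ _) _.
apply: le_trans (_ : \sum_(i < m) enorm v * K <= _); last first.
  by rewrite sumr_const card_ord -[leLHS]mulr_natr -mulrA [K * _]mulrC.
by apply: ler_sum => i _; rewrite normrM; apply: ler_pM => //; exact: coord_enorm.
Qed.

Lemma powR_le_add (t e f : R) : 0 <= t -> 0 <= e <= f -> t `^ e <= 1 + t `^ f.
Proof.
move=> t0 /andP[e0 ef]; have [t1|t1] := leP 1 t.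
  by apply: le_trans (ler_powR t1 ef) _; rewrite lerDr.
apply: le_trans (_ : 1 <= _); last by rewrite lerDl powR_ge0.
have [->|tn] := eqVneq t 0.
  have [->|en] := eqVneq e 0; first by rewrite powRr0.
  by rewrite powR0.
have tp : 0 < t by rewrite lt_neqAle eq_sym tn.
by rewrite -[leRHS](powRr0 t); apply: ger_powR => //; rewrite tp ltW.
Qed.

Variables (alpha : Real.sort R) (p : \bar R) (M : set W).
Hypothesis alphan : 0 < alpha < n%:R.
Hypothesis hp : ((2 * n%:R / (n%:R + alpha))%:E < p)%E.
Hypothesis hM : compact M.
Hypothesis hA2 : A2 Omega alpha p G1 G2.

Lemma control_bound : exists2 K : R, 0 <= K & forall w i, M w -> `|w ord0 i| <= K.
Proof.
have [B [_ hB]] := compact_bounded hM; exists (`|B| + 1); first by rewrite addr_ge0.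
move=> w i Mw; apply: le_trans (ler_coord_norm _ _) _; apply: (hB (`|B| + 1)) => //.
by rewrite ltr_pwDr// ler_norm.
Qed.

Lemma p_gt1 (r : R) : p = r%:E -> 1 < r.
Proof.
have /andP[a0 an] := alphan; move: hp => + pr; rewrite pr lte_fin; apply: lt_trans.
by rewrite ltr_pdivlMr ?addr_gt0//; [lra|exact: lt_trans an].
Qed.

(** Merges the two cases of (A2') into one growth exponent s - 1 for the derivatives of G. As M is
    bounded, the exponent e of the part in G2 only has to satisfy 0 <= e <= s - 1. *)
Lemma growth_G : exists s c : R, [/\ 1 < s < @critical_exponent R n alpha, 0 <= c &
  aeO (fun x => forall (a b : R) w, M w ->
    `|Gu x a b w| <= c * (1 + `|a| `^ (s - 1) + `|b| `^ (s - 1)) /\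
    `|Gv x a b w| <= c * (1 + `|a| `^ (s - 1) + `|b| `^ (s - 1)))].
Proof.
have [K K0 hK] := control_bound; have mK : 0 <= m%:R * K by rewrite mulr_ge0.
have [h1 h2] := hA2.
suff [s [c [e [hs c0 hes g1 g2]]]] : exists s c e : R, [/\ 1 < s < @critical_exponent R n alpha, 0 < c,
    0 <= e <= s - 1, growth_uv Omega G1 Num.norm c (s - 1) & growth_uv Omega G2 (@enorm R m) c e].
  have cc := ltW c0.
  exists s, (c + 3 * c * (m%:R * K)); split => //; first by rewrite addr_ge0// mulr_ge0// mulr_ge0.
  have key (t q a b : R) (v w : W) : M w -> `|t| <= c * (1 + `|a| `^ (s - 1) + `|b| `^ (s - 1)) ->
      enorm v <= c * (1 + `|a| `^ e + `|b| `^ e) ->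
      `|t + dot v w| <= (c + 3 * c * (m%:R * K)) * (1 + `|a| `^ (s - 1) + `|b| `^ (s - 1)).
    move=> Mw ht hv; apply: le_trans (ler_normD _ _) _; rewrite mulrDl; apply: lerD => //.
    apply: le_trans (dot_le v (fun i => hK w i Mw)) _.
    rewrite [leRHS]mulrAC; apply: ler_wpM2r => //; apply: le_trans hv _.
    rewrite [3 * c]mulrC -mulrA; apply: ler_wpM2l => //.
    exact: (add3_le (powR_le_add (normr_ge0 a) hes) (powR_le_add (normr_ge0 b) hes) (powR_ge0 _ _) (powR_ge0 _ _)).
  apply: ae_mp2 g1 g2 => x _ k1 k2 a b w Mw.
  by have [? ?] := k1 a b; have [? ?] := k2 a b; split; apply: (key _ 0).
case E : p => [r| |].
- have [s [c [/andP[s1 s2] c0 g1 g2]]] := h1 _ E; have r1 := p_gt1 E.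
  have r0 : 0 < r by exact: lt_trans r1.
  have rm : 0 < r - 1 by rewrite subr_gt0.
  exists s, c, (s - 1 - s / r).
  have s1' : 1 < s by apply: lt_trans s1; rewrite ltrDl invr_gt0.
  split => //; first by rewrite s1'.
  apply/andP; split; last by rewrite gerBl divr_ge0// ltW// (lt_trans ltr01).
  (* Nonnegative because s > 1 + 1/(r - 1) = r/(r - 1). *)
  have -> : s - 1 - s / r = (s * (r - 1) - r) / r by field; rewrite gt_eqF.
  apply: divr_ge0; last exact: ltW.
  have := ler_wpM2r (ltW rm) (ltW s1); rewrite mulrDl mul1r mulVf ?gt_eqF// subrK.
  by rewrite subr_ge0.
- have [s [c [/andP[s1 s2] c0 g1 g2]]] := h2 E; exists s, c, (s - 1); split => //; first by rewrite s1.
  by rewrite lexx andbT subr_ge0 ltW.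
- by move: hp; rewrite E.
Qed.

(** Any r above the growth exponent will do, which later allows a single exponent, at least 2, for
    the nonlinearity and the cost. *)
Lemma nem_G : exists s : R, s < @critical_exponent R n alpha /\ forall r, s <= r -> 1 < r ->
  exists2 c : R, 0 <= c & forall w, ctrl M w ->
    nem mu D c r (fun x a b => G x a b (w x)) (fun x a b => Gu x a b (w x)) (fun x a b => Gv x a b (w x)).
Proof.
have [s [c [/andP[s1 s2] c0 hc]]] := growth_G; exists s; split => // r sr r1.
exists (3 * c) => [|w cw]; first by rewrite mulr_ge0.
split; [exact: superposable_G cw|exact: superposable_Gu cw|exact: superposable_Gv cw|].
have hw : aeO (fun x => M (w x)) by case: cw.
apply: ae_mp2 is_derive_G (_ : aeO (fun x => (forall (a b : R) w, M w ->
    `|Gu x a b w| <= c * (1 + `|a| `^ (s - 1) + `|b| `^ (s - 1)) /\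
    `|Gv x a b w| <= c * (1 + `|a| `^ (s - 1) + `|b| `^ (s - 1))) /\ M (w x))); last first.
  exact: ae_mp2 hc hw.
move=> x _ k1 [k2 Mw] a b; have [e1 e2] := k1 a b (w x); have [g1 g2] := k2 a b _ Mw.
have E : c * (1 + `|a| `^ (s - 1) + `|b| `^ (s - 1)) <= 3 * c * (1 + `|a| `^ (r - 1) + `|b| `^ (r - 1)).
  rewrite [3 * c]mulrC -mulrA; apply: ler_wpM2l => //.
  have he : 0 <= s - 1 <= r - 1 by rewrite subr_ge0 (ltW s1) lerD2r.
  exact: (add3_le (powR_le_add (normr_ge0 a) he) (powR_le_add (normr_ge0 b) he) (powR_ge0 _ _) (powR_ge0 _ _)).
split => //; [exact: le_trans g1 E|exact: le_trans g2 E].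
Qed.
End frozen_control.

Lemma closed_seq (T : topologicalType) (A : set T) (u : nat -> T) (l : T) :
  closed A -> (forall j, A (u j)) -> u @ \oo --> l -> A l.
Proof.
move=> cA Au ul; apply: cA => B /ul [N _ hN]; exists (u N); split; first exact: Au.
exact: hN (leqnn N).
Qed.

Lemma conv_lmodE (R : numDomainType) (E : lmodType R) (a b : E) (s : {i01 R}) :
  @conv R (convex_lmodType E) s a b = s%:num *: a + (1 - s%:num) *: b.
Proof. by []. Qed.

(** * Midpoint combinations of controls *)

Section control_hull.
Context {R : realType} {n m : nat}.
Local Notation V := 'rV[R]_n.
Local Notation W := 'rV[R]_m.
Local Notation mu := (@leb R n).
Variables (Omega : set V) (M : set W).
Hypothesis oOmega : open Omega.
Hypothesis bOmega : bounded_set Omega.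
Hypothesis hM : compact M.
Hypothesis hMconvex : @convex_set R W M.
Local Notation D := (Omega : set (Rn R n)).
Local Notation L2O := (L2 mu D).
Local Notation sqO := (sqn mu D).
Local Notation aeO := (ae mu D).
Local Notation ctrl := (ctrl Omega M).
Let mO : measurable D := mOmega oOmega.
Let fO := muOmega bOmega.
Implicit Types (w f g : V -> W).

Definition mid f g : V -> W := fun x => 2^-1 *: f x + 2^-1 *: g x.

Lemma mid_in (a b : W) : M a -> M b -> M (2^-1 *: a + 2^-1 *: b).
Proof.
move=> Ma Mb; have h0 : 0 <= (2^-1 : R) by []. have h1 : (2^-1 : R) <= 1 by lra.
have e : 2^-1 *: a + 2^-1 *: b = @conv R (convex_lmodType W) (Itv01 h0 h1) a b.
  by rewrite conv_lmodE /=; congr (_ + _ *: _); lra.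
by rewrite e; apply: set_mem; exact: hMconvex (mem_set Ma) (mem_set Mb).
Qed.

Lemma ctrl_mid f g : ctrl f -> ctrl g -> ctrl (mid f g).
Proof.
move=> [mf Mf] [mg Mg]; split; last by apply: ae_mp2 Mf Mg => x _; exact: mid_in.
move=> i; rewrite (_ : (fun x => _) = (fun x => 2^-1 * f x ord0 i + 2^-1 * g x ord0 i)); last first.
  by rewrite funeqE => x; rewrite !mxE.
by apply: measurable_funD; apply: measurable_funM => //; exact: measurable_cst.
Qed.

(* Closure under midpoints is enough for the parallelogram identity in [hull_limit]. *)
Inductive hull (w : nat -> V -> W) (j : nat) : (V -> W) -> Prop :=
| hull_base k : (j <= k)%N -> hull w j (w k)
| hull_mid f g : hull w j f -> hull w j g -> hull w j (mid f g).

Lemma hull_le (w : nat -> V -> W) i j f : (i <= j)%N -> hull w j f -> hull w i f.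
Proof.
move=> ij; elim=> [k jk|f' g' _ h1 _ h2]; last exact: hull_mid.
exact: hull_base (leq_trans ij jk).
Qed.

Lemma hull_ctrl (w : nat -> V -> W) j f : (forall k, ctrl (w k)) -> hull w j f -> ctrl f.
Proof. by move=> cw; elim=> [k _|f' g' _ h1 _ h2]; [exact: cw|exact: ctrl_mid]. Qed.

Lemma ctrl_L2 f i : ctrl f -> L2O (fun x => f x ord0 i).
Proof.
move=> [mf Mf]; have [K K0 hK] := control_bound hM; split; first exact: mf.
apply: (L1_dom mO (measurable_funX 2 (mf i)) (L1_cst (K ^+ 2) mO fO)).
apply: ae_mp Mf => x _ Mf; rewrite normrX ler_sqr ?nnegrE//.
exact: hK.
Qed.

Definition N2 f := \sum_i sqO (fun x => f x ord0 i).
Definition N2d f g := \sum_i sqO (fun x => f x ord0 i - g x ord0 i).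

Lemma N2_ge0 f : 0 <= N2 f.
Proof. by apply: sumr_ge0 => i _; exact: sqn_ge0. Qed.

Lemma N2_mid f g : ctrl f -> ctrl g -> N2 (mid f g) = 2^-1 * N2 f + 2^-1 * N2 g - 4^-1 * N2d f g.
Proof.
move=> cf cg; rewrite /N2 /N2d !mulr_sumr -big_split -sumrB /=; apply: eq_bigr => i _.
have lf := ctrl_L2 i cf; have lg := ctrl_L2 i cg; have lB := L2B mO lf lg.
rewrite /sqn -(intZ mO _ lf.2) -(intZ mO _ lg.2) -(intZ mO _ lB.2).
rewrite -(intD mO (L1Z mO _ lf.2) (L1Z mO _ lg.2)) -(intB mO (L1D mO (L1Z mO _ lf.2) (L1Z mO _ lg.2)) (L1Z mO _ lB.2)).
by apply: eq_int => x _; rewrite /mid !mxE; field.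
Qed.

Lemma N2_bound : exists B, forall f, ctrl f -> N2 f <= B.
Proof.
have [K K0 hK] := control_bound hM; exists (\sum_(i < m) Int mu D (fun=> K ^+ 2)) => f cf.
apply: ler_sum => i _; apply: (le_int_ae mO (ctrl_L2 i cf).2 (L1_cst (K ^+ 2) mO fO)).
case: cf => _; apply: ae_mp => x _ Mf.
by rewrite -real_normK ?num_real// ler_sqr ?nnegrE//; exact: hK.
Qed.

Lemma closed_M : closed M.
Proof. by apply: compact_closed => //; exact: norm_hausdorff. Qed.

(* Elements of almost minimal norm in a decreasing sequence of convex sets form a Cauchy sequence. *)
Lemma hull_limit (w : nat -> V -> W) : (forall k, ctrl (w k)) ->
  exists (f : nat -> V -> W) (g : V -> W), [/\ forall j, hull w j (f j), ctrl g &
    aeO (fun x => (fun j => f j x) @ \oo --> g x)].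
Proof.
move=> cw; have [B hB] := N2_bound.
pose S j := [set N2 f | f in hull w j].
have S0 j : S j !=set0 by exists (N2 (w j)), (w j) => //; exact: hull_base.
have lbS j : lbound (S j) 0 by move=> _ [f _ <-]; exact: N2_ge0.
have iS j : has_inf (S j) by split; [exact: S0|exists 0].
pose I j := inf (S j).
have Ile j f : hull w j f -> I j <= N2 f by move=> h; apply: ge_inf; [exists 0|exists f].
have In i j : (i <= j)%N -> I i <= I j.
  move=> ij; apply: lb_le_inf (S0 j) _ => _ [f hf <-]; apply: Ile; exact: hull_le hf.
have IB j : I j <= B by apply: le_trans (Ile j _ (hull_base w (leqnn j))) (hB _ (cw j)).
have cI : cvgn I by apply: nondecreasing_is_cvgn; [move=> i j ij; exact: In|exists B => _ [j _ <-]].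
have /choice[f hf] : forall j, exists f, hull w j f /\ N2 f <= I j + 2^-1 ^+ j.
  move=> j; have e0 : 0 < (2^-1 : R) ^+ j by rewrite exprn_gt0// invr_gt0.
  by have [_ [f hf <-] h] := inf_adherent e0 (iS j); exists f; split => //; exact: ltW.
have cf j : ctrl (f j) by exact: hull_ctrl cw (hf j).1.
(* The midpoint belongs to the hull of index j, so its squared norm is at least [I j]; the
   parallelogram identity then bounds the squared distance by 2 N2 (f j) + 2 N2 (f k) - 4 I j. *)
have diff j k : (j <= k)%N -> N2d (f j) (f k) <= 2 * (I k - I j) + 4 * 2^-1 ^+ j.
  move=> jk; have h1 := (hf j).2; have h2 := (hf k).2.
  have h3 : I j <= N2 (mid (f j) (f k)) by apply/Ile/hull_mid; [exact: (hf j).1|exact: hull_le jk (hf k).1].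
  rewrite N2_mid// in h3; have h4 : (2^-1 : R) ^+ k <= 2^-1 ^+ j by apply: ler_wiXn2l => //; lra.
  lra.
have comp i j k : sqO (fun x => f j x ord0 i - f k x ord0 i) <= N2d (f j) (f k).
  rewrite /N2d (bigD1 i) //= lerDl; apply: sumr_ge0 => i' _; exact: sqn_ge0.
have cauchy i : forall e, 0 < e -> exists N, forall j k, (N <= j)%N -> (N <= k)%N ->
    Int mu D (fun x => (f j x ord0 i - f k x ord0 i) ^+ 2) <= e.
  move=> e e0; have e8 : 0 < e / 8 by lra.
  have /cvg_ex[l hl] := cI; have [N1 h1] := cvg_eps hl e8.
  have [N2 h2] := cvg0_eps (@exp_half_cvg0 R) e8.
  have key j k : (maxn N1 N2 <= j)%N -> (j <= k)%N -> sqO (fun x => f j x ord0 i - f k x ord0 i) <= e.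
    rewrite geq_max => /andP[j1 j2] jk; apply: le_trans (comp i j k) _; apply: le_trans (diff j k jk) _.
    have := h1 _ j1; have := h1 _ (leq_trans j1 jk); have := le_lt_trans (ler_norm _) (h2 _ j2).
    by rewrite !ltr_distl => ? /andP[? ?] /andP[? ?]; lra.
  exists (maxn N1 N2) => j k Nj Nk; have [jk|/ltnW kj] := leqP j k; first exact: key.
  by rewrite -/(sqn mu D (fun x => f j x ord0 i - f k x ord0 i)) sqnB_sym; exact: key.
have /choice[g hg] : forall i : 'I_m, exists g : V -> R,
    L2O g /\ (fun j => sqO (fun x => f j x ord0 i - g x)) @ \oo --> (0 : R).
  move=> i; have [g [mg lg cg]] := @L2_complete _ _ _ mu D mO (fun j x => f j x ord0 i)
    (fun j => (ctrl_L2 i (cf j)).1) (fun j => (ctrl_L2 i (cf j)).2) (cauchy i).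
  by exists g.
pose Q j x := \sum_i (f j x ord0 i - g i x) ^+ 2.
have lQi j i : L1 mu D (fun x => (f j x ord0 i - g i x) ^+ 2) by exact: (L2B mO (ctrl_L2 i (cf j)) (hg i).1).2.
have lQ j : L1 mu D (Q j) by exact: (L1_sum mO _ (lQi j)).
have cQ : (fun j => Int mu D (Q j)) @ \oo --> (0 : R).
  have -> : (fun j => Int mu D (Q j)) = fun j => \sum_i sqO (fun x => f j x ord0 i - g i x).
    by rewrite funeqE => j; rewrite /Q (int_sum mO _ (lQi j)).
  have e0 : \sum_(i < m) (0 : R) = 0 by rewrite big1.
  rewrite -[X in _ --> X]e0.
  exact: (@cvg_sum_seq _ _ _ (fun i j => sqO (fun x => f j x ord0 i - g i x)) (fun=> 0) (fun i => (hg i).2)).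
have [s [G [si _ _ _ hs]]] := extract_ae mO lQ (fun j x _ => sumr_ge0 _ (fun i _ => sqr_ge0 _)) cQ.
pose gg : V -> W := fun x => \row_i g i x.
have cvgf : aeO (fun x => (fun j => f (s j) x) @ \oo --> gg x).
  apply: ae_mp hs => x _ h; apply: cvg_rV => i; rewrite mxE.
  have h2 : (fun j => (f (s j) x ord0 i - g i x) ^+ 2) @ \oo --> (0 : R).
    apply: (@squeeze_cvgr _ _ _ _ (cst 0) (fun j => Q (s j) x)); [|exact: cvg_cst|exact: h].
    apply: nearW => j; rewrite sqr_ge0 /= /Q (bigD1 i) //= lerDl.
    by apply: sumr_ge0 => i' _; exact: sqr_ge0.
  have h3 : (fun j => Num.sqrt ((f (s j) x ord0 i - g i x) ^+ 2)) @ \oo --> (0 : R).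
    by rewrite -[X in _ --> X]sqrtr0; apply: continuous_cvg h2; exact: sqrt_continuous.
  apply: eps_cvg => e e0; have [N hN] := cvg0_eps h3 e0; exists N => k /hN.
  by rewrite sqrtr_sqr normr_id => /ltW.
exists (fun j => f (s j)), gg; split; [|split|exact: cvgf].
  by move=> j; exact: hull_le (strictly_inc_ge si j) (hf (s j)).1.
  move=> i; rewrite (_ : (fun x => gg x ord0 i) = g i); first exact: (hg i).1.1.
  by rewrite funeqE => x; rewrite mxE.
have hM' : aeO (fun x => forall j, M (f (s j) x)) by apply: ae_all => j; case: (cf (s j)).
by apply: ae_mp2 hM' cvgf => x _ h1 h2; exact: closed_seq closed_M h1 h2.
Qed.
End control_hull.

Lemma cvg_of_powR (R : realType) (t : nat -> R) (e : R) : 0 < e ->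
  (fun k => `|t k| `^ e) @ \oo --> (0 : R) -> t @ \oo --> (0 : R).
Proof.
move=> e0 h; apply: eps_cvg => d d0; have [N hN] := cvg0_eps h (powR_gt0 e d0).
exists N => k /hN; rewrite subr0 ger0_norm ?powR_ge0// => hk.
rewrite leNgt; apply/negP => dk; move: hk; rewrite ltNge => /negP; apply.
by apply: ge0_ler_powR; rewrite ?nnegrE ?(ltW d0)// ltW.
Qed.

Lemma cvg_of_sqr (R : realType) (t : nat -> R) :
  (fun k => t k ^+ 2) @ \oo --> (0 : R) -> t @ \oo --> (0 : R).
Proof.
move=> h; apply: (@cvg_of_powR _ _ 2) => //.
by rewrite (_ : (fun k => _) = (fun k => t k ^+ 2))// funeqE => k; rewrite powR_mulrn// real_normK ?num_real.
Qed.

Lemma cvg_subr0 (R : realType) (u : nat -> R) (l : R) : (fun k => u k - l) @ \oo --> (0 : R) -> u @ \oo --> l.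
Proof. by move=> /cvg0_eps h; apply: eps_cvg => e /h[N hN]; exists N => k /hN /ltW. Qed.

Lemma squeeze0 (R : realType) (u v : nat -> R) : (forall k, 0 <= u k <= v k) ->
  v @ \oo --> (0 : R) -> u @ \oo --> (0 : R).
Proof.
by move=> h hv; apply: (@squeeze_cvgr _ _ _ _ (cst 0) v); [exact: nearW|exact: cvg_cst|exact: hv].
Qed.

Lemma cvg_quad (R : realType) (a b c d : nat -> R) (a' b' c' d' : R) :
  a @ \oo --> a' -> b @ \oo --> b' -> c @ \oo --> c' -> d @ \oo --> d' ->
  (fun k => (a k, b k, c k, d k)) @ \oo --> (a', b', c', d').
Proof.
move=> ha hb hc hd; have h1 := @cvg_pair_seq R R _ _ _ _ ha hb.
have h2 := @cvg_pair_seq (R * R)%type R _ _ _ _ h1 hc.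
exact: (@cvg_pair_seq (R * R * R)%type R _ _ _ _ h2 hd).
Qed.

Lemma compact_extract (R : realType) m (M : set 'rV[R]_m) (X : nat -> 'rV[R]_m) : compact M ->
  (forall j, M (X j)) -> exists s (w : 'rV[R]_m), strictly_inc s /\ (fun j => X (s j)) @ \oo --> w.
Proof.
move=> hM MX; have [K K0 hK] := control_bound hM.
have [s [si hs]] : exists s, strictly_inc s /\ forall i, i \in enum 'I_m -> cvgn (fun j => X (s j) ord0 i).
  elim: (enum 'I_m) => [|i l [s [si hs]]]; first by exists id; split => //; exact: strictly_inc_id.
  have [t [ti ht]] := @bounded_extract _ (fun j => X (s j) ord0 i) K (fun j => hK _ i (MX (s j))).
  exists (s \o t); split; first exact: strictly_inc_comp.
  move=> i'; rewrite in_cons => /predU1P[->//|/hs /cvg_ex[y hy]].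
  by apply/cvg_ex; exists y; exact: (cvg_sub ti hy).
exists s, (\row_i limn (fun j => X (s j) ord0 i)); split => //; apply: cvg_rV => i.
by rewrite mxE; apply: hs; rewrite mem_enum.
Qed.

Lemma powR_le_1D (R : realType) (t e f : R) : 0 < e <= f -> `|t| `^ e <= 1 + `|t| `^ f.
Proof. by move=> /andP[e0 ef]; apply: powR_le_add; rewrite ?normr_ge0// ltW. Qed.

(** Arithmetic for the majorant in [cost_close], with k = 2^r: lower case letters belong to the
    approximating state, primed ones to the limit state, capitals to their difference, and g
    dominates the sum of the capitals. *)
Lemma majorant_sum (R : realType) (k g a a' b b' e e' f f' A B E F : R) : 2 <= k ->
  a <= k * (A + a') -> b <= 2 * B + 2 * b' -> e <= k * (E + e') -> f <= 2 * F + 2 * f' ->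
  0 <= A -> 0 <= B -> 0 <= E -> 0 <= F -> 0 <= a' -> 0 <= b' -> 0 <= e' -> 0 <= f' ->
  A + B + E + F <= g ->
  (3 + a + b + e + f) + (3 + a' + b' + e' + f') <= k * g + (k + 1) * (3 + a' + b' + e' + f') + 3.
Proof.
move=> k2 h1 h2 h3 h4 A0 B0 E0 F0 a0 b0 e0 f0 hg.
have h : k * (A + B + E + F) <= k * g by apply: ler_wpM2l => //; lra.
have hB : 2 * B <= k * B by exact: ler_wpM2r.
have hF : 2 * F <= k * F by exact: ler_wpM2r.
have hb : 2 * b' <= k * b' by exact: ler_wpM2r.
have hf : 2 * f' <= k * f' by exact: ler_wpM2r.
rewrite !mulrDr in h h1 h3; rewrite !mulrDr mulrDl; lra.
Qed.

(** * The cost functional *)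

Section cost.
Context {R : realType} {n m : nat}.
Local Notation V := 'rV[R]_n.
Local Notation W := 'rV[R]_m.
Local Notation mu := (@leb R n).
Variables (Omega : set V) (M : set W) (theta : V -> R -> R -> R -> R -> W -> R).
Variables s c r : Real.sort R.
Hypothesis oOmega : open Omega.
Hypothesis bOmega : bounded_set Omega.
Hypothesis hM0 : M !=set0.
Hypothesis hM : compact M.
Hypothesis hMconvex : @convex_set R W M.
Hypothesis theta_meas : forall u xi v zeta w, M w -> measurable_on Omega (fun x => theta x u xi v zeta w).
Hypothesis theta_cont : ae_on Omega (fun x =>
  {within [set q : R * R * R * R * W | M q.2],
   continuous (fun q => theta x q.1.1.1.1 q.1.1.1.2 q.1.1.2 q.1.2 q.2)}).
Hypothesis theta_convex : forall u xi v zeta, ae_on Omega (fun x =>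
  @convex_function R W M (theta x u xi v zeta)).
Hypothesis s1 : 1 < s.
Hypothesis sr : s <= r.
Hypothesis r2 : 2 <= r.
Hypothesis c0 : 0 < c.
Hypothesis theta_growth : ae_on Omega (fun x => forall u xi v zeta w, M w ->
  `|theta x u xi v zeta w| <= c * (1 + `|u| `^ s + `|xi| ^+ 2 + `|v| `^ s + `|zeta| ^+ 2)).
Local Notation D := (Omega : set (Rn R n)).
Local Notation L1O := (L1 mu D).
Local Notation L2O := (L2 mu D).
Local Notation LrO := (Lr mu D r).
Local Notation IntO := (Int mu D).
Local Notation aeO := (ae mu D).
Local Notation ctrl := (ctrl Omega M).
Let mO : measurable D := mOmega oOmega.
Let fO := muOmega bOmega.
Let cmu : measure_is_complete mu := @measure_is_complete_caratheodory R _ (@lebesgue_outer R n).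
Let r1 : 1 < r. Proof. by apply: lt_le_trans r2; rewrite ltr1n. Qed.
Let r0 : 0 < r. Proof. by apply: lt_trans r1. Qed.

Definition th x (a : R * R * R * R) w := theta x a.1.1.1 a.1.1.2 a.1.2 a.2 w.

(** (A6) gives continuity relative to controls in M, and the limit control lies in M because M is
    closed. *)
Lemma th_cvg : aeO (fun x => forall (A : nat -> R * R * R * R) a (X : nat -> W) w,
  A @ \oo --> a -> (forall j, M (X j)) -> X @ \oo --> w -> (fun j => th x (A j) (X j)) @ \oo --> th x a w).
Proof.
apply: ae_mp theta_cont => x _ /subspace_continuousP k A a X w hA MX hX.
have Mw := closed_seq (closed_M hM) MX hX.
have h := k (a, w) Mw; apply: (cvg_comp (fun j => (A j, X j)) _ _ h).
have hp := @cvg_pair_seq (R * R * R * R)%type W _ _ _ _ hA hX.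
move=> B hB; have h' : \forall j \near \oo, M (A j, X j).2 -> B (A j, X j) := hp _ hB.
change (\forall j \near \oo, B (A j, X j)).
by apply: filterS h' => j; apply; exact: MX.
Qed.

(* The convergence is uniform in the control because M is compact. *)
Lemma th_cvg_unif : aeO (fun x => forall (A : nat -> R * R * R * R) a (X : nat -> W),
  A @ \oo --> a -> (forall j, M (X j)) -> (fun j => th x (A j) (X j) - th x a (X j)) @ \oo --> (0 : R)).
Proof.
apply: ae_mp th_cvg => x _ k A a X hA MX; apply: cvg_subsub => t ti.
have [t' [w [ti' hw]]] := compact_extract hM (fun j => MX (t j)).
exists t'; split => //; have MX' j : M (X (t (t' j))) := MX _.
have h1 := k (fun j => A (t (t' j))) a _ w (cvg_sub ti' (cvg_sub ti hA)) MX' hw.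
have ha : (fun _ : nat => a) @ \oo --> a by exact: cvg_cst.
have h2 := k (fun=> a) a _ w ha MX' hw.
by rewrite -[X in _ --> X](subrr (th x a w)); apply: cvgB h1 h2.
Qed.

(** Discretization as in [caratheodory_superposable], with the control replaced by the points
    [netpt] of M. *)
Lemma measurable_th u xi v ze w : measurable_fun D u -> measurable_fun D xi -> measurable_fun D v ->
  measurable_fun D ze -> ctrl w -> measurable_fun D (fun x => theta x (u x) (xi x) (v x) (ze x) (w x)).
Proof.
move=> m1 m2 m3 m4 [mw Mw]; have [w0 Mw0] := hM0.
apply: (@measurable_superposition _ (Rn R n) R mu D mO cmu (R * R * R * R * W)%type
  (int * int * int * int * {ffun 'I_m -> int})%type
  (fun x q => th x q.1 q.2) (fun x => (u x, xi x, v x, ze x, w x))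
  (fun j x => (Num.ceil (2 ^+ j * u x), Num.ceil (2 ^+ j * xi x), Num.ceil (2 ^+ j * v x),
     Num.ceil (2 ^+ j * ze x), dyidx j (w x)))
  (fun j i => (i.1.1.1.1%:~R / 2 ^+ j, i.1.1.1.2%:~R / 2 ^+ j, i.1.1.2%:~R / 2 ^+ j, i.1.2%:~R / 2 ^+ j,
     netpt M w0 j i.2))).
- move=> j [[[[i1 i2] i3] i4] i5].
  have h1 := measurable_ceil_fiber j i1 mO m1; have h2 := measurable_ceil_fiber j i2 mO m2.
  have h3 := measurable_ceil_fiber j i3 mO m3; have h4 := measurable_ceil_fiber j i4 mO m4.
  have h5 : measurable (\bigcap_(i in [set: 'I_m]) (D `&` [set x : Rn R n | Num.ceil (2 ^+ j * w x ord0 i) = i5 i])).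
    apply: (@fin_bigcap_measurable _ (Rn R n)) => [|i _]; first exact: finite_finset.
    exact: (measurable_ceil_fiber j (i5 i) mO (mw i)).
  set S := (X in measurable X).
  have -> : S = ((((D `&` [set x : Rn R n | Num.ceil (2 ^+ j * u x) = i1]) `&`
     (D `&` [set x : Rn R n | Num.ceil (2 ^+ j * xi x) = i2])) `&`
     (D `&` [set x : Rn R n | Num.ceil (2 ^+ j * v x) = i3])) `&`
     (D `&` [set x : Rn R n | Num.ceil (2 ^+ j * ze x) = i4])) `&`
     (\bigcap_(i in [set: 'I_m]) (D `&` [set x : Rn R n | Num.ceil (2 ^+ j * w x ord0 i) = i5 i])).
    rewrite eqEsubset; split=> [x [Dx e]|x [[[[[Dx e1] [_ e2]] [_ e3]] [_ e4]] h]].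
      case: e => e1 e2 e3 e4 e5.
      split; [split; [split; [split|]|]|];
        [exact: (conj Dx e1)|exact: (conj Dx e2)|exact: (conj Dx e3)|exact: (conj Dx e4)|].
      by move=> i _; split; [exact: Dx|rewrite /= -e5 /dyidx ffunE].
    split; [exact: Dx|]; rewrite -e1 -e2 -e3 -e4 /=; congr (_, _); apply/ffunP => i; rewrite /dyidx ffunE.
    by have [] := h i I.
  by do 4 (apply: measurableI; last by []).
- by move=> j i; apply: theta_meas; exact: netpt_in.
- apply: ae_mp2 Mw th_cvg => x _ Mwx k /=.
  apply: (k _ (u x, xi x, v x, ze x) _ (w x)); last exact: netpt_cvg.
    by apply: cvg_quad; exact: rnd_cvg.
  by move=> j; exact: netpt_in.
Qed.

Definition state u xi v ze := [/\ LrO u, L2O xi, LrO v & L2O ze].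
(** 3 = 1 + 1 + 1: the constant in (A6), and one for each replacement of s by r through |t|^s <= 1 +
    |t|^r. *)
Definition maj (u xi v ze : V -> R) x := 3 + `|u x| `^ r + xi x ^+ 2 + `|v x| `^ r + ze x ^+ 2.

Lemma L1_maj u xi v ze : state u xi v ze -> L1O (maj u xi v ze).
Proof.
move=> [[_ l1] [_ l2] [_ l3] [_ l4]].
exact: (L1D mO (L1D mO (L1D mO (L1D mO (L1_cst 3 mO fO) l1) l2) l3) l4).
Qed.

Lemma th_le : aeO (fun x => forall u xi v ze w, M (w x) ->
  `|theta x (u x) (xi x) (v x) (ze x) (w x)| <= c * maj u xi v ze x).
Proof.
apply: ae_mp theta_growth => x _ k u xi v ze w Mw; apply: le_trans (k _ _ _ _ _ Mw) _.
have s0 : 0 < s <= r by rewrite sr (lt_trans _ s1).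
have h1 := powR_le_1D (u x) s0; have h2 := powR_le_1D (v x) s0.
rewrite !real_normK ?num_real//; apply: ler_wpM2l; first exact: ltW.
rewrite /maj; lra.
Qed.

Definition cost u xi v ze w := IntO (fun x => theta x (u x) (xi x) (v x) (ze x) (w x)).

Lemma L1_th u xi v ze w : state u xi v ze -> ctrl w ->
  L1O (fun x => theta x (u x) (xi x) (v x) (ze x) (w x)).
Proof.
move=> st cw; have [[m1 _] [m2 _] [m3 _] [m4 _]] := st.
apply: (L1_dom mO (measurable_th m1 m2 m3 m4 cw) (L1Z mO c (L1_maj st))).
by apply: ae_mp2 cw.2 th_le => x _ Mw; exact.
Qed.

Lemma cost_le u xi v ze w : state u xi v ze -> ctrl w -> `|cost u xi v ze w| <= c * IntO (maj u xi v ze).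
Proof.
move=> st cw; rewrite -(intZ mO _ (L1_maj st)); apply: (int_abs_le mO (L1_th st cw) (L1Z mO c (L1_maj st))).
by apply: ae_mp2 cw.2 th_le => x _ Mw; exact.
Qed.

Lemma cost_cvg u xi v ze (f : nat -> V -> W) g : state u xi v ze -> (forall j, ctrl (f j)) -> ctrl g ->
  aeO (fun x => (fun j => f j x) @ \oo --> g x) -> (fun j => cost u xi v ze (f j)) @ \oo --> cost u xi v ze g.
Proof.
move=> st cf cg fg.
apply: (dct mO (fun j => L1_meas (L1_th st (cf j))) (L1_meas (L1_th st cg)) (L1Z mO c (L1_maj st)) _ _).2.
  have hM' : aeO (fun x => forall j, M (f j x)) by apply: ae_all => j; case: (cf j).
  apply: ae_mp2 hM' (_ : aeO (fun x => (forall (A : nat -> R * R * R * R) a (X : nat -> W) w,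
    A @ \oo --> a -> (forall j, M (X j)) -> X @ \oo --> w -> (fun j => th x (A j) (X j)) @ \oo --> th x a w)
    /\ (fun j => f j x) @ \oo --> g x)); last exact: ae_mp2 th_cvg fg.
  by move=> x _ h1 [k h2]; exact: (k (fun=> (u x, xi x, v x, ze x)) _ _ _ (cvg_cst _) h1 h2).
by move=> j; apply: ae_mp2 (cf j).2 th_le => x _ Mw; exact.
Qed.

(** In (A6) the null set for convexity may depend on the state arguments. Dyadic arguments share a
    null set, and continuity in the state extends the inequality to all others. Midpoints suffice,
    as they generate [hull]. *)
Lemma th_convex : aeO (fun x => forall a w w', M w -> M w' ->
  th x a (2^-1 *: w + 2^-1 *: w') <= 2^-1 * th x a w + 2^-1 * th x a w').
Proof.
have h : aeO (fun x => forall i : nat * int * int * int * int,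
   @convex_function R W M (theta x (i.1.1.1.2%:~R / 2 ^+ i.1.1.1.1) (i.1.1.2%:~R / 2 ^+ i.1.1.1.1)
      (i.1.2%:~R / 2 ^+ i.1.1.1.1) (i.2%:~R / 2 ^+ i.1.1.1.1))).
  by apply: ae_allc => i; exact: theta_convex.
apply: ae_mp2 h th_cvg => x _ k1 k2 [[[a b] d] e] w w' Mw Mw'.
have Mm := mid_in hMconvex Mw Mw'.
pose A j : R * R * R * R := (rnd j a, rnd j b, rnd j d, rnd j e).
have cA : A @ \oo --> (a, b, d, e) by apply: cvg_quad; exact: rnd_cvg.
have cc : forall w1, M w1 -> (fun j => th x (A j) w1) @ \oo --> th x (a, b, d, e) w1.
  by move=> w1 Mw1; exact: (k2 _ _ (fun=> w1) w1 cA (fun=> Mw1) (cvg_cst _)).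
have ll : (fun j => 2^-1 * th x (A j) w + 2^-1 * th x (A j) w' - th x (A j) (2^-1 *: w + 2^-1 *: w')) @ \oo -->
   2^-1 * th x (a, b, d, e) w + 2^-1 * th x (a, b, d, e) w' - th x (a, b, d, e) (2^-1 *: w + 2^-1 *: w').
  by apply: cvgB (cc _ Mm); apply: cvgD; apply: cvgMr; exact: cc.
rewrite -subr_ge0 -(cvg_lim _ ll)//; apply: limr_ge; first by apply/cvg_ex; eexists; exact: ll.
apply: nearW => j; rewrite subr_ge0.
have h0 : 0 <= (2^-1 : R) by []. have h1 : (2^-1 : R) <= 1 by lra.
have := k1 (j, Num.ceil (2 ^+ j * a), Num.ceil (2 ^+ j * b), Num.ceil (2 ^+ j * d), Num.ceil (2 ^+ j * e))
  (Itv01 h0 h1) w w' (mem_set Mw) (mem_set Mw').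
have half : 1 - 2^-1 = 2^-1 :> R by lra.
have e1 : 2^-1 *: w + 2^-1 *: w' = @conv R (convex_lmodType W) (Itv01 h0 h1) w w'.
  by rewrite conv_lmodE /= half.
rewrite e1 => h2; apply: (le_trans h2).
change (2^-1 * th x (A j) w + (1 - 2^-1) * th x (A j) w' <= 2^-1 * th x (A j) w + 2^-1 * th x (A j) w').
by rewrite half.
Qed.

Lemma cost_mid u xi v ze f g : state u xi v ze -> ctrl f -> ctrl g ->
  cost u xi v ze (mid f g) <= 2^-1 * cost u xi v ze f + 2^-1 * cost u xi v ze g.
Proof.
move=> st cf cg; have lf := L1_th st cf; have lg := L1_th st cg.
rewrite /cost -(intZ mO _ lf) -(intZ mO _ lg) -(intD mO (L1Z mO _ lf) (L1Z mO _ lg)).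
apply: (le_int_ae mO (L1_th st (ctrl_mid hMconvex cf cg)) (L1D mO (L1Z mO _ lf) (L1Z mO _ lg))).
apply: ae_mp2 cf.2 (_ : aeO (fun x => M (g x) /\ forall a w w', M w -> M w' ->
  th x a (2^-1 *: w + 2^-1 *: w') <= 2^-1 * th x a w + 2^-1 * th x a w')); last first.
  by apply: ae_mp2 cg.2 th_convex.
by move=> x _ Mf [Mg k]; exact: (k (u x, xi x, v x, ze x)).
Qed.

(** The controls need not converge. Along a subsequence the states converge almost everywhere under
    an integrable majorant; [th_cvg_unif] makes the difference of the integrands tend to 0 whatever
    the controls do, and [cvg_subsub] returns to the full sequence. *)
Lemma cost_close (U X Z Y : nat -> V -> R) u xi v ze (w : nat -> V -> W) :
  (forall k, state (U k) (X k) (Z k) (Y k)) -> state u xi v ze -> (forall k, ctrl (w k)) ->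
  (fun k => Nr mu D r (fun x => U k x - u x)) @ \oo --> (0 : R) ->
  (fun k => sqn mu D (fun x => X k x - xi x)) @ \oo --> (0 : R) ->
  (fun k => Nr mu D r (fun x => Z k x - v x)) @ \oo --> (0 : R) ->
  (fun k => sqn mu D (fun x => Y k x - ze x)) @ \oo --> (0 : R) ->
  (fun k => cost (U k) (X k) (Z k) (Y k) (w k) - cost u xi v ze (w k)) @ \oo --> (0 : R).
Proof.
move=> stk st cw c1 c2 c3 c4; have [l1 l2 l3 l4] := st.
pose Q k x := `|U k x - u x| `^ r + (X k x - xi x) ^+ 2 + `|Z k x - v x| `^ r + (Y k x - ze x) ^+ 2.
have lU k : L1O (fun x => `|U k x - u x| `^ r) by case: (stk k) => l _ _ _; exact: (LrB mO r1 l l1).2.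
have lX k : L1O (fun x => (X k x - xi x) ^+ 2) by case: (stk k) => _ l _ _; exact: (L2B mO l l2).2.
have lZ k : L1O (fun x => `|Z k x - v x| `^ r) by case: (stk k) => _ _ l _; exact: (LrB mO r1 l l3).2.
have lY k : L1O (fun x => (Y k x - ze x) ^+ 2) by case: (stk k) => _ _ _ l; exact: (L2B mO l l4).2.
have lQ k : L1O (Q k) by exact: (L1D mO (L1D mO (L1D mO (lU k) (lX k)) (lZ k)) (lY k)).
have cQ : (fun k => IntO (Q k)) @ \oo --> (0 : R).
  rewrite (_ : (fun k => _) = (fun k => Nr mu D r (fun x => U k x - u x) + sqn mu D (fun x => X k x - xi x) +
     Nr mu D r (fun x => Z k x - v x) + sqn mu D (fun x => Y k x - ze x))); last first.
    rewrite funeqE => k; rewrite /Q (intD mO (L1D mO (L1D mO (lU k) (lX k)) (lZ k)) (lY k)).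
    by rewrite (intD mO (L1D mO (lU k) (lX k)) (lZ k)) (intD mO (lU k) (lX k)).
  have e0 : (0 : R) = 0 + 0 + 0 + 0 by rewrite !addr0.
  by rewrite [X in _ --> X]e0; exact: (cvgD (cvgD (cvgD c1 c2) c3) c4).
apply: cvg_subsub => t ti.
have Q0 k x : 0 <= Q k x by rewrite /Q !addr_ge0 ?powR_ge0 ?sqr_ge0.
have [t' [g [ti' lg g0 hg hQ]]] := extract_ae mO (fun k => lQ (t k)) (fun k x _ => Q0 (t k) x) (cvg_sub ti cQ).
exists t'; split; first exact: ti'.
pose dd k x := theta x (U k x) (X k x) (Z k x) (Y k x) (w k x) - theta x (u x) (xi x) (v x) (ze x) (w k x).
have ld k : L1O (dd k) by exact: (L1B mO (L1_th (stk k) (cw k)) (L1_th st (cw k))).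
rewrite (_ : (fun k => _) = (fun k => IntO (dd (t (t' k))))); last first.
  by rewrite funeqE => k; rewrite /dd (intB mO (L1_th (stk _) (cw _)) (L1_th st (cw _))).
rewrite -[X in _ --> X](int0 mu D).
pose kk : R := 2 `^ r.
have k2 : 2 <= kk by rewrite -[leLHS](powRr1 (ler0n _ _)); apply: ler_powR; rewrite ?ler1n// ltW.
have lB := L1D mO (L1D mO (L1Z mO kk lg) (L1Z mO (kk + 1) (L1_maj st))) (L1_cst 3 mO fO).
apply: (dct mO (fun k => L1_meas (ld (t (t' k)))) (L1_meas (L10 mu D)) (L1Z mO c lB) _ _).2.
  have hw : aeO (fun x => forall k, M (w k x)) by apply: ae_all => k; exact: (cw k).2.
  apply: ae_mp2 hw (_ : aeO (fun x => (fun k => Q (t (t' k)) x) @ \oo --> (0 : R) /\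
    (forall (A : nat -> R * R * R * R) a (X : nat -> W), A @ \oo --> a -> (forall j, M (X j)) ->
     (fun j => th x (A j) (X j) - th x a (X j)) @ \oo --> (0 : R)))); last exact: ae_mp2 hQ th_cvg_unif.
  move=> x _ Mw [cQx k].
  apply: (k (fun k => (U (t (t' k)) x, X (t (t' k)) x, Z (t (t' k)) x, Y (t (t' k)) x)) (u x, xi x, v x, ze x)
    (fun k => w (t (t' k)) x)); last by move=> j; exact: Mw.
  have p1 k' := powR_ge0 `|U k' x - u x| r; have p2 k' := sqr_ge0 (X k' x - xi x).
  have p3 k' := powR_ge0 `|Z k' x - v x| r; have p4 k' := sqr_ge0 (Y k' x - ze x).
  apply: cvg_quad; apply: cvg_subr0.
  - apply: (cvg_of_powR r0); apply: squeeze0 cQx => k'; rewrite p1 /Q.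
    by have := p2 (t (t' k')); have := p3 (t (t' k')); have := p4 (t (t' k')); lra.
  - apply: cvg_of_sqr; apply: squeeze0 cQx => k'; rewrite p2 /Q.
    by have := p1 (t (t' k')); have := p3 (t (t' k')); have := p4 (t (t' k')); lra.
  - apply: (cvg_of_powR r0); apply: squeeze0 cQx => k'; rewrite p3 /Q.
    by have := p2 (t (t' k')); have := p1 (t (t' k')); have := p4 (t (t' k')); lra.
  - apply: cvg_of_sqr; apply: squeeze0 cQx => k'; rewrite p4 /Q.
    by have := p2 (t (t' k')); have := p3 (t (t' k')); have := p1 (t (t' k')); lra.
move=> k; apply: ae_mp2 hg (_ : aeO (fun x => M (w (t (t' k)) x) /\ forall u xi v ze w, M (w x) ->
  `|theta x (u x) (xi x) (v x) (ze x) (w x)| <= c * maj u xi v ze x)); last exact: ae_mp2 (cw (t (t' k))).2 th_le.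
move=> x _ /(_ k) hgx [Mw kle]; set j := t (t' k) in Mw hgx *.
apply: le_trans (ler_normB _ _) _.
apply: le_trans (lerD (kle (U j) (X j) (Z j) (Y j) (w j) Mw) (kle u xi v ze (w j) Mw)) _.
rewrite -mulrDr; apply: ler_wpM2l; first exact: ltW.
have sq (a b : R) : a ^+ 2 <= 2 * (a - b) ^+ 2 + 2 * b ^+ 2 by have := sqrD_le2 (a - b) b; rewrite subrK.
rewrite /maj; apply: (majorant_sum k2 (powR_norm_split _ _ (ltW r1)) (sq _ _) (powR_norm_split _ _ (ltW r1)) (sq _ _));
  by [exact: powR_ge0|exact: sqr_ge0|exact: hgx].
Qed.
End cost.

(** * Linear inequalities between energies *)

Section real_inequalities.
Context {R : realType}.
Implicit Types (a b c d e t K : R).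

Lemma concave_shift t K a b c :
  - (a + K) <= (1 - t) * - (b + K) + (1 - (1 - t)) * - (c + K) -> (1 - t) * b + t * c <= a.
Proof. lra. Qed.

Lemma convex_shift t K a b c :
  a + K <= (1 - t) * (b + K) + (1 - (1 - t)) * (c + K) -> a <= (1 - t) * b + t * c.
Proof. lra. Qed.

Lemma cancel_mid a b c d e : a - b + c <= d - b + e -> a + c <= d + e.
Proof. lra. Qed.

Lemma cancel_midN a b c d e : a - b + c <= a - d + e -> d + - e <= b + - c.
Proof. lra. Qed.

Lemma convex_cancel t a a0 a1 b c c0 c1 :
  a - b + c <= (1 - t) * (a0 - b + c0) + t * (a1 - b + c1) -> a + c <= (1 - t) * (a0 + c0) + t * (a1 + c1).
Proof. lra. Qed.

Lemma concave_cancel t a a0 a1 b c c0 c1 :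
  (1 - t) * (b - a0 + c0) + t * (b - a1 + c1) <= b - a + c ->
  a + - c <= (1 - t) * (a0 + - c0) + t * (a1 + - c1).
Proof. lra. Qed.

Lemma uncancel_mid a b c d e : a + c <= d + e -> a - b + c <= d - b + e.
Proof. lra. Qed.

Lemma uncancel_midN a b c d e : d + - e <= b + - c -> a - b + c <= a - d + e.
Proof. lra. Qed.
End real_inequalities.

Lemma half_pow_bounds (R : realType) k : 0 < (2^-1 : R) ^+ k <= 1.
Proof. by rewrite exprn_gt0 ?invr_gt0//= exprn_ile1//; lra. Qed.

Lemma conv_funE (R : realType) (T : Type) (f g : T -> R^o) (s : {i01 R}) :
  @conv R (convex_lmodType (T -> R^o)) s f g = fun q => s%:num * f q + (1 - s%:num) * g q.
Proof. by rewrite funeqE. Qed.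

(** * Membership in L^p and the quadratic part of the energy *)

Section Lfun_criteria.
Context d (T : measurableType d) (R : realType) (mu : {measure set T -> \bar R}).
Implicit Types f g h : T -> R.

Lemma Lfun_measurable f q : f \in Lfun mu q -> measurable_fun setT f.
Proof. by rewrite inE => /andP[]; rewrite inE. Qed.

Lemma Lfun_fin f (s : R) : measurable_fun setT f -> L1 mu setT (fun x => `|f x| `^ s) ->
  f \in Lfun mu s%:E.
Proof.
move=> mf l; rewrite inE; apply/andP; split; rewrite inE//=.
rewrite /finite_norm unlock; apply: poweR_lty.
by rewrite (_ : (\int[mu]_x _)%E = (\int[mu]_x (`|f x| `^ s)%:E)%E)// (L1_EFin measurableT l) ltry.
Qed.

Lemma Lfun_infty f K : measurable_fun setT f -> {ae mu, forall x, `|f x| <= K} ->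
  f \in Lfun mu +oo%E.
Proof.
move=> mf bf; rewrite inE; apply/andP; split; rewrite inE//=.
rewrite /finite_norm unlock; case: ifP => _ //; apply: le_lt_trans (ltry K).
by apply/ess_sup_inf.ess_supP; apply: filterS bf => x h /=; rewrite lee_fin.
Qed.

Lemma int_quadratic D f g h : measurable D -> L2 mu D f -> L2 mu D g -> L1 mu D h ->
  Int mu D (fun x => 2^-1 * `|f x| ^+ 2 - 2^-1 * `|g x| ^+ 2 + h x) =
  2^-1 * sqn mu D f - 2^-1 * sqn mu D g + Int mu D h.
Proof.
move=> mD lf lg lh; have l1 := L1Z mD 2^-1 lf.2; have l2 := L1Z mD 2^-1 lg.2.
rewrite /sqn -(intZ mD _ lf.2) -(intZ mD _ lg.2) -(intB mD l1 l2) -(intD mD (L1B mD l1 l2) lh).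
by apply: eq_int => q _; rewrite !real_normK ?num_real.
Qed.
End Lfun_criteria.

(** The way in which upper bounds on functionals that are affine or convex in the control are
    carried from the [w k] to their combinations. *)
Lemma hull_ind_ctrl (R : realType) n m (Omega : set 'rV[R]_n) (M : set 'rV[R]_m) (P : ('rV[R]_n -> 'rV[R]_m) -> Prop)
    (w : nat -> 'rV[R]_n -> 'rV[R]_m) j :
  @convex_set R 'rV[R]_m M -> (forall k, ctrl Omega M (w k)) -> (forall k, (j <= k)%N -> P (w k)) ->
  (forall f g, ctrl Omega M f -> ctrl Omega M g -> P f -> P g -> P (mid f g)) ->
  forall f, hull w j f -> P f.
Proof.
move=> hMc cw hw hP f; elim=> [k jk|f' g' h1 ih1 h2 ih2]; first exact: hw.
exact: (hP _ _ (hull_ctrl hMc cw h1) (hull_ctrl hMc cw h2) ih1 ih2).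
Qed.

Lemma cvg_le_bound (R : realType) (u : nat -> R) (l K : R) N : u @ \oo --> l ->
  (forall k, (N <= k)%N -> u k <= K) -> l <= K.
Proof.
move=> hu h; rewrite -(cvg_lim _ hu)//; apply: limr_le; first by apply/cvg_ex; exists l.
by exists N.
Qed.

Lemma two_sequences_extract (R : realType) (X Y : nat -> nat -> R) C :
  (forall k, l2 (X k) /\ nsq (X k) <= C) -> (forall k, l2 (Y k) /\ nsq (Y k) <= C) ->
  exists s x y (a b : R), [/\ strictly_inc s, wcvg (X \o s) x, wcvg (Y \o s) y,
    (fun k => nsq (X (s k))) @ \oo --> a & (fun k => nsq (Y (s k))) @ \oo --> b].
Proof.
move=> hX hY.
have nb (Z : nat -> nat -> R) : (forall k, l2 (Z k) /\ nsq (Z k) <= C) -> forall k, `|nsq (Z k)| <= C.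
  by move=> hZ k; have [lZ h] := hZ k; rewrite ger0_norm// nsq_ge0.
have [s1 [x [i1 w1]]] := wcvg_extract (bounded_seq_nsq (fun k => (hX k).1) (fun k => (hX k).2)).
have [s2 [y [i2 w2]]] := wcvg_extract (bounded_seq_nsq (fun k => (hY (s1 k)).1) (fun k => (hY (s1 k)).2)).
have [s3 [i3 /cvg_ex[a ha]]] := bounded_extract (fun k => nb X hX (s1 (s2 k))).
have [s4 [i4 /cvg_ex[b hb]]] := bounded_extract (fun k => nb Y hY (s1 (s2 (s3 k)))).
exists (s1 \o (s2 \o (s3 \o s4))), x, y, a, b.
have i34 := strictly_inc_comp i3 i4.
split; [exact: (strictly_inc_comp i1 (strictly_inc_comp i2 i34))| | |exact: (cvg_sub i4 ha)|exact: hb].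
  exact: (wcvg_sub (strictly_inc_comp i2 i34) w1).
exact: (wcvg_sub i34 w2).
Qed.

(** Each of the two integrals contributes an error e and each of the two squared norms e / 2, which
    makes 3 e. *)
Lemma saddle_pass (R : realType) (nx ny nx' ny' a b p1 p2 q1 q2 e : R) :
  2^-1 * ny - 2^-1 * nx' + p1 <= 2^-1 * ny' - 2^-1 * nx + q1 -> `|p1 - p2| <= e -> `|q1 - q2| <= e ->
  `|nx - a| < e -> `|ny - b| < e ->
  p2 - q2 <= 2^-1 * nx' + 2^-1 * ny' - 2^-1 * a - 2^-1 * b + 3 * e.
Proof.
by rewrite !ler_distl !ltr_distl => ? /andP[? ?] /andP[? ?] /andP[? ?] /andP[? ?]; lra.
Qed.

Lemma half_mix_le (R : realType) (a b c d K : R) : a - b <= K -> c - d <= K ->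
  (2^-1 * a + 2^-1 * c) - (2^-1 * b + 2^-1 * d) <= K.
Proof. lra. Qed.

Lemma sum_bound (R : realType) (d d' C C' s t E E' : R) : 0 < d -> 0 < d' -> 0 <= s -> 0 <= t ->
  d * t - C <= E -> E <= E' -> E' <= C' - d' * s ->
  s <= `|C + C'| / d' + `|C + C'| / d /\ t <= `|C + C'| / d' + `|C + C'| / d.
Proof.
move=> d0 d'0 s0 t0 h1 h2 h3; have hC := ler_norm (C + C'); have nC := normr_ge0 (C + C').
have k1 : 0 <= `|C + C'| / d by rewrite divr_ge0 ?(ltW d0).
have k2 : 0 <= `|C + C'| / d' by rewrite divr_ge0 ?(ltW d'0).
have m1 : 0 <= d * t by rewrite mulr_ge0// ltW.
have m2 : 0 <= d' * s by rewrite mulr_ge0// ltW.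
split.
  by apply: le_trans (_ : `|C + C'| / d' <= _); [rewrite ler_pdivlMr// mulrC; lra|rewrite lerDl].
by apply: le_trans (_ : `|C + C'| / d <= _); [rewrite ler_pdivlMr// mulrC; lra|rewrite lerDr].
Qed.

(** * Weak solutions as saddle points *)

Section saddle_problem.
Context {R : realType} {n m : nat}.
Local Notation V := 'rV[R]_n.
Local Notation W := 'rV[R]_m.
Local Notation mu := (@leb R n).
Variables (Omega : set V) (z : nat -> V -> R) (rho : nat -> R) (alpha : Real.sort R).
Variables (p : \bar R) (M : set W) (G1 : V -> R -> R -> R) (G2 : V -> R -> R -> W).
Hypothesis n_gt0 : (0 < n)%N.
Hypothesis oOmega : open Omega.
Hypothesis bOmega : bounded_set Omega.
Hypothesis hz : dirichlet_eigensystem Omega z rho.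
Hypothesis alpha_gt0 : 0 < alpha.
Hypothesis alpha_lt2 : alpha < 2.
Hypothesis alphan : alpha < n%:R.
Hypothesis hp : forall s : R, p = s%:E -> 1 < s.
Hypothesis hpN : p != -oo%E.
Hypothesis hM0 : M !=set0.
Hypothesis hM : compact M.
Hypothesis hA1 : A1 Omega G1 G2.
Hypothesis hA3 : A3 Omega z rho alpha M G1 G2.
Hypothesis hA4 : A4 Omega z rho alpha M G1 G2.
Hypothesis hA5 : A5 Omega z rho alpha p M G1 G2.
Local Notation D := (Omega : set (Rn R n)).
Local Notation L1O := (L1 mu D).
Local Notation L2O := (L2 mu D).
Local Notation IntO := (Int mu D).
Local Notation aeO := (ae mu D).
Local Notation fl := (frac_laplacian Omega z rho (alpha / 4)).
Local Notation H := (Hfrac Omega z rho alpha).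
Local Notation G := (Defs.G G1 G2).
Local Notation rep := (rep Omega z rho alpha).
Local Notation psi := (psi Omega z rho alpha).
Local Notation ctrl := (ctrl Omega M).
Local Notation controls := (controls Omega p M).
Local Notation hw w := (fun x a b => G x a b (w x)).
Local Notation huw w := (fun x a b => Gu G1 G2 x a b (w x)).
Local Notation hvw w := (fun x a b => Gv G1 G2 x a b (w x)).
Let mO : measurable D := mOmega oOmega.
Let fO := muOmega bOmega.
Let cmu : measure_is_complete mu := @measure_is_complete_caratheodory R _ (@lebesgue_outer R n).

Lemma controls_ctrl w : controls w -> ctrl w.
Proof.
move=> [lw Mw]; split; last exact: Mw.
by move=> i; apply/(measurable_restrictT _ mO); exact: (Lfun_measurable (lw i)).
Qed.

Lemma ctrl_controls w : ctrl w -> controls w.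
Proof.
move=> [mw Mw]; split => // i; have [K K0 hK] := control_bound hM.
pose f : Rn R n -> R := (fun x => w x ord0 i) \_ Omega.
have mf : measurable_fun setT f by apply/(measurable_restrictT _ mO).
have bf : {ae mu, forall x, `|f x| <= K}.
  move: Mw; rewrite /ae; apply: filterS => x Mw; rewrite /f /patch; case: ifPn => [/set_mem Dx|_].
    exact: hK (Mw Dx).
  by rewrite normr0.
rewrite /Lp -/f; move: hp hpN; case: p => [s| |] hs // _; last exact: (Lfun_infty mf bf).
have s1 := hs s erefl; apply: (Lfun_fin mf).
have lD : L1O (fun x => `|w x ord0 i| `^ s).
  apply: (L1_dom mO (g := fun=> K `^ s)); first exact: (measurable_powR_norm s (mw i)).
    exact: (L1_cst _ mO fO).
  apply: ae_mp Mw => x _ Mw; rewrite ger0_norm ?powR_ge0//.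
  by apply: ge0_ler_powR; rewrite ?nnegrE ?(hK _ _ Mw)// ltW// (lt_trans ltr01).
have := L1_patch mO lD; congr (L1 mu setT _); rewrite funeqE => x.
by rewrite /f /patch; case: ifP => // _; rewrite normr0 powR0// gt_eqF// (lt_trans ltr01).
Qed.

Variables (r c : Real.sort R).
Hypothesis r2 : 2 <= r.
Hypothesis rsub : r < 2 * n%:R / (n%:R - alpha).
Hypothesis c0 : 0 <= c.
Hypothesis hnem : forall w, ctrl w -> nem mu D c r (hw w) (huw w) (hvw w).
Let r1 : 1 < r. Proof. by apply: lt_le_trans r2; rewrite ltr1n. Qed.
Let rLr := rep_Lr n_gt0 oOmega bOmega hz alpha_gt0 alpha_lt2 alphan r2 rsub.
Let rT := repT n_gt0 oOmega bOmega hz alpha_gt0.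

Lemma G_cvg : aeO (fun x => forall (A B : nat -> R) (X : nat -> W) (a b : R) (w : W),
  A @ \oo --> a -> B @ \oo --> b -> X @ \oo --> w ->
  (fun j => G x (A j) (B j) (X j)) @ \oo --> G x a b w).
Proof.
have [_ _ [[_ g1] _ _] [g2 _ _]] := hA1.
have {}g2 : aeO (fun x => forall i : 'I_m, continuous (fun q : R * R => G2 x q.1 q.2 ord0 i)).
  by apply: ae_allc => i; case: (g2 i).
apply: ae_mp2 g1 g2 => x _ k1 k2 A B X a b w hA hB hX.
have hAB := @cvg_pair_seq R R _ _ _ _ hA hB.
apply: cvgD; first exact: (cvg_comp _ _ hAB (k1 (a, b))).
rewrite /dot; apply: cvg_sum_seq => i; apply: cvgM; last exact: cvg_coord.
exact: (cvg_comp _ _ hAB (k2 i (a, b))).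
Qed.

Let w0 : W := sval (cid hM0).
Let Mw0 : M w0 := svalP (cid hM0).

(* The null sets in (A3) and (A4) depend on the real argument and on the control;
   continuity yields a common one. *)
Lemma ae_dense (s : bool) (P : V -> R) (u : V -> R) (Q : V -> R -> R) :
  (forall (v : R) w, M w -> aeO (fun x => 0 <= Q x v + (if s then G x (u x) v w else - G x v (u x) w))) ->
  (forall x, continuous (Q x)) ->
  aeO (fun x => forall (v : R) w, M w -> 0 <= Q x v + (if s then G x (u x) v w else - G x v (u x) w)).
Proof.
move=> h cQ.
have h' : aeO (fun x => forall t : nat * int * {ffun 'I_m -> int},
    0 <= Q x (t.1.2%:~R / 2 ^+ t.1.1) + (if s then G x (u x) (t.1.2%:~R / 2 ^+ t.1.1) (netpt M w0 t.1.1 t.2)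
      else - G x (t.1.2%:~R / 2 ^+ t.1.1) (u x) (netpt M w0 t.1.1 t.2))).
  by apply: ae_allc => -[[j k] i] /=; apply: h; exact: netpt_in.
apply: ae_mp2 h' G_cvg => x _ k1 k2 v w Mw.
have cv := @rnd_cvg _ v; have cw := netpt_cvg w0 Mw.
have cq : (fun j => Q x (rnd j v)) @ \oo --> Q x v by exact: (cvg_comp _ _ cv (cQ x v)).
have cu : (fun _ : nat => u x) @ \oo --> u x by exact: cvg_cst.
have cc : (fun j => Q x (rnd j v) + (if s then G x (u x) (rnd j v) (netpt M w0 j (dyidx j w))
      else - G x (rnd j v) (u x) (netpt M w0 j (dyidx j w)))) @ \oo -->
   Q x v + (if s then G x (u x) v w else - G x v (u x) w).
  by case: (s); apply: cvgD => //; [exact: k2|apply: cvgN; exact: k2].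
rewrite -(cvg_lim _ cc)//; apply: limr_ge; first by apply/cvg_ex; eexists; exact: cc.
by apply: nearW => j; exact: (k1 (j, Num.ceil (2 ^+ j * v), dyidx j w)).
Qed.

Lemma quad_continuous (b beta gamma : R) : continuous (fun v : R => b * v ^+ 2 + beta * v + gamma).
Proof.
move=> v; apply: cvgD; last exact: cvg_cst.
apply: cvgD; apply: cvgM; try exact: cvg_cst; last exact: cvg_id.
by under eq_fun do rewrite expr2; rewrite expr2; apply: cvgM; exact: cvg_id.
Qed.

Lemma Lp1P (f : V -> R) : Lp Omega 1%:E f -> L1O f.
Proof.
move=> /Lfun1P; rewrite /L1 => h; rewrite (integrable_mkcond _ mO).
by move: h; rewrite restrict_EFin.
Qed.

Lemma A3_ae x u : rep x u -> exists b (beta gamma : V -> R),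
  [/\ 2 * b < first_pow rho alpha, L2O beta, L1O gamma &
    aeO (fun q => forall (v : R) w, M w -> - b * `|v| ^+ 2 - beta q * v - gamma q <= G q (u q) v w)].
Proof.
move=> hx; have Hu : H u by apply/(HfracP alpha n_gt0 oOmega bOmega hz); exists x.
have [b [beta [gamma [h1 /(Lp2P oOmega) h2 /Lp1P h3 h4]]]] := hA3 Hu.
exists b, beta, gamma; split => //.
have E (q : V) (v t : R) : (0 <= b * v ^+ 2 + beta q * v + gamma q + t) = (- b * `|v| ^+ 2 - beta q * v - gamma q <= t).
  rewrite real_normK ?num_real// -[RHS]subr_ge0.
  by rewrite (_ : t - _ = b * v ^+ 2 + beta q * v + gamma q + t)//; ring.
have := @ae_dense true (fun=> 0) u (fun q v => b * v ^+ 2 + beta q * v + gamma q) _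
  (fun q => @quad_continuous b (beta q) (gamma q)).
move=> h; apply: ae_mp (h _) => [q _ k v w Mw|v w Mw]; first by rewrite -E; exact: k.
by apply: ae_mp (h4 v w Mw) => q _; rewrite -E.
Qed.

Lemma A4_ae y v : rep y v -> exists b (beta gamma : V -> R),
  [/\ 2 * b < first_pow rho alpha, L2O beta, L1O gamma &
    aeO (fun q => forall (u : R) w, M w -> - b * `|u| ^+ 2 - beta q * u - gamma q <= - G q u (v q) w)].
Proof.
move=> hy; have Hv : H v by apply/(HfracP alpha n_gt0 oOmega bOmega hz); exists y.
have [b [beta [gamma [h1 /(Lp2P oOmega) h2 /Lp1P h3 h4]]]] := hA4 Hv.
exists b, beta, gamma; split => //.
have E (q : V) (u t : R) : (0 <= b * u ^+ 2 + beta q * u + gamma q + - t) = (- b * `|u| ^+ 2 - beta q * u - gamma q <= - t).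
  rewrite real_normK ?num_real// -[RHS]subr_ge0.
  by rewrite (_ : - t - _ = b * u ^+ 2 + beta q * u + gamma q + - t)//; ring.
have E' (q : V) (u t : R) : (0 <= b * u ^+ 2 + beta q * u + gamma q + - t) = (t <= b * `|u| ^+ 2 + beta q * u + gamma q).
  by rewrite real_normK ?num_real// subr_ge0.
have := @ae_dense false (fun=> 0) v (fun q u => b * u ^+ 2 + beta q * u + gamma q) _
  (fun q => @quad_continuous b (beta q) (gamma q)).
move=> h; apply: ae_mp (h _) => [q _ k u w Mw|u w Mw]; first by rewrite -E; exact: k.
by apply: ae_mp (h4 u w Mw) => q _; rewrite -E'.
Qed.

Lemma rep0 : rep (fun=> 0) (fun=> 0).
Proof.
split; first exact: l2_0.
rewrite (_ : (fun k => _) = fun=> 0); last by rewrite funeqE => k; rewrite mul0r.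
split; first exact: L20.
rewrite (_ : (fun N => _) = cst 0); first exact: cvg_cst.
rewrite funeqE => N /=; rewrite -[RHS](int0 mu D); apply: eq_int => y _.
by rewrite /psum big1 ?subr0 ?expr0n// => k _; rewrite mul0r.
Qed.

(** At the state (0, 0), the conditions (A3) with v = 0 and (A4) with u = 0 put G between -gamma_1
    and gamma_2 for all controls. This supplies the integrability that growth bounds on the
    derivatives leave open. *)
Lemma base_bound : exists C, forall w, ctrl w -> L1O (fun q => G q 0 0 (w q)) /\ `|IntO (fun q => G q 0 0 (w q))| <= C.
Proof.
have [b1 [be1 [g1 [_ _ l1 h1]]]] := A3_ae rep0.
have [b2 [be2 [g2 [_ _ l2 h2]]]] := A4_ae rep0.
have l := L1D mO (L1_abs mO l1) (L1_abs mO l2).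
exists (IntO (fun q => `|g1 q| + `|g2 q|)) => w cw.
have bd : aeO (fun q => `|G q 0 0 (w q)| <= `|g1 q| + `|g2 q|).
  have hw : aeO (fun q => M (w q)) by case: cw.
  apply: ae_mp2 hw (_ : aeO (fun q => (forall (v : R) w, M w -> - b1 * `|v| ^+ 2 - be1 q * v - g1 q <= G q 0 v w) /\
     (forall (u : R) w, M w -> - b2 * `|u| ^+ 2 - be2 q * u - g2 q <= - G q u 0 w))); last exact: ae_mp2 h1 h2.
  move=> q _ Mw [k1 k2]; have := k1 0 _ Mw; have := k2 0 _ Mw.
  rewrite normr0 expr0n /= !mulr0 !subr0 !sub0r lerN2.
  have := ler_norm (g1 q); have := ler_norm (g2 q); have := normr_ge0 (g1 q); have := normr_ge0 (g2 q).
  by rewrite ler_norml => *; apply/andP; split; lra.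
have lG : L1O (fun q => G q 0 0 (w q)).
  apply: (L1_dom mO _ l bd).
  by have := superposable_G oOmega hA1 cw (measurable_cst (0 : R)) (measurable_cst (0 : R)).
by split => //; exact: (int_abs_le mO lG l bd).
Qed.

(** F_w in l^2 coordinates, up to a constant depending on w only, see [F_rep]. *)
Definition Ew w := energy_fun (psi (hw w)) 0.

Lemma EwE w x y : Ew w x y = 2^-1 * nsq y - 2^-1 * nsq x + psi (hw w) x y.
Proof. by rewrite /Ew /energy_fun addr0. Qed.

Lemma psi_int w x y u v : ctrl w -> rep x u -> rep y v ->
  L1O (fun q => G q (u q) (v q) (w q)) /\
  IntO (fun q => G q (u q) (v q) (w q)) = psi (hw w) x y + IntO (fun q => G q 0 0 (w q)).
Proof.
move=> cw hx hy; have [C hC] := base_bound; have [l0 _] := hC w cw.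
have k := hnem cw; have z0 := Lr_cst mO fO r 0.
have l := nem_L1 mO fO c0 r1 k (rLr hx) z0 (rLr hy) z0.
have E q : G q (u q) (v q) (w q) = (G q (u q) (v q) (w q) - G q 0 0 (w q)) + G q 0 0 (w q) by rewrite subrK.
split; first by apply: (eq_L1 mO _ (L1D mO l l0)) => q _; rewrite -E.
rewrite (psi_rep n_gt0 oOmega bOmega hz alpha_gt0 k hx hy) /Psi -(intD mO l l0).
by apply: eq_int => q _; rewrite -E.
Qed.

Lemma F_rep w x y u v : ctrl w -> rep x u -> rep y v ->
  F Omega z rho alpha G1 G2 u v w = Ew w x y + IntO (fun q => G q 0 0 (w q)).
Proof.
move=> cw hx hy; have [l e] := psi_int cw hx hy.
have [lu _] := rep_fl n_gt0 oOmega bOmega hz hx; have [lv _] := rep_fl n_gt0 oOmega bOmega hz hy.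
rewrite EwE -addrA -e -(fl_sqn n_gt0 oOmega bOmega hz hx) -(fl_sqn n_gt0 oOmega bOmega hz hy).
exact: (int_quadratic mO lv lu l).
Qed.

Lemma concave_E w t x x' y : ctrl w -> l2 x -> l2 x' -> l2 y -> 0 <= t <= 1 ->
  (1 - t) * Ew w x y + t * Ew w x' y <= Ew w (comb (1 - t) t x x') y.
Proof.
move=> cw lx lx' ly /andP[t0 t1]; have hx := rT lx; have hx' := rT lx'; have hy := rT ly.
have Hr x'' u : rep x'' u -> H u by move=> h; apply/(HfracP alpha n_gt0 oOmega bOmega hz); exists x''.
have s0 : 0 <= 1 - t by rewrite subr_ge0. have s1 : 1 - t <= 1 by rewrite gerBl.
(* [conv] puts the weight of its parameter on the first point, hence the parameter 1 - t. *)
have := (hA5 (ctrl_controls cw)).1 _ (Hr _ _ hy) (Itv01 s0 s1) _ _ (mem_set (Hr _ _ hx)) (mem_set (Hr _ _ hx')).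
have hc := rep_comb oOmega hz (1 - t) t hx hx'.
set uu := conv _ _ _; have -> : uu = (fun q => (1 - t) * lift Omega z rho alpha x q + t * lift Omega z rho alpha x' q).
  by rewrite /uu conv_funE funeqE => q /=; rewrite subKr.
rewrite (F_rep cw hc hy) (F_rep cw hx hy) (F_rep cw hx' hy).
set ff := conv _ _ _.
have -> : ff = (1 - t) * - (Ew w x y + IntO (fun q => G q 0 0 (w q))) +
  (1 - (1 - t)) * - (Ew w x' y + IntO (fun q => G q 0 0 (w q))) by [].
exact: concave_shift.
Qed.

Lemma convex_E w t x y y' : ctrl w -> l2 x -> l2 y -> l2 y' -> 0 <= t <= 1 ->
  Ew w x (comb (1 - t) t y y') <= (1 - t) * Ew w x y + t * Ew w x y'.
Proof.
move=> cw lx ly ly' /andP[t0 t1]; have hx := rT lx; have hy' := rT ly'; have hy := rT ly.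
have Hr x'' u : rep x'' u -> H u by move=> h; apply/(HfracP alpha n_gt0 oOmega bOmega hz); exists x''.
have s0 : 0 <= 1 - t by rewrite subr_ge0. have s1 : 1 - t <= 1 by rewrite gerBl.
have := (hA5 (ctrl_controls cw)).2 _ (Hr _ _ hx) (Itv01 s0 s1) _ _ (mem_set (Hr _ _ hy)) (mem_set (Hr _ _ hy')).
have hc := rep_comb oOmega hz (1 - t) t hy hy'.
set uu := conv _ _ _; have -> : uu = (fun q => (1 - t) * lift Omega z rho alpha y q + t * lift Omega z rho alpha y' q).
  by rewrite /uu conv_funE funeqE => q /=; rewrite subKr.
rewrite (F_rep cw hx hc) (F_rep cw hx hy) (F_rep cw hx hy').
set ff := conv _ _ _.
have -> : ff = (1 - t) * (Ew w x y + IntO (fun q => G q 0 0 (w q))) +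
  (1 - (1 - t)) * (Ew w x y' + IntO (fun q => G q 0 0 (w q))) by [].
exact: convex_shift.
Qed.

(** The functions in (A3) do not depend on the control, so d and C are uniform in w; this is what
    bounds all saddle points at once. *)
Lemma coercive_E_r x : l2 x -> exists d C, 0 < d /\ forall w y, ctrl w -> l2 y -> d * nsq y - C <= Ew w x y.
Proof.
move=> lx; have hx := rT lx; have [b [beta [gamma [h1 h2 h3 h4]]]] := A3_ae hx.
have [d [C [d0 hC]]] := coercive_bound n_gt0 oOmega bOmega hz alpha_gt0 h1 h2 h3.
have [C0 hC0] := base_bound.
exists d, (C + C0 + 2^-1 * nsq x); split => // w y cw ly; have hy := rT ly.
have [l e] := psi_int cw hx hy.
have hw : aeO (fun q => M (w q)) by case: cw.
have := hC _ _ (fun q => G q (lift Omega z rho alpha x q) (lift Omega z rho alpha y q) (w q)) hy l.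
have a : aeO (fun q => - b * `|lift Omega z rho alpha y q| ^+ 2 - beta q * lift Omega z rho alpha y q - gamma q <=
  G q (lift Omega z rho alpha x q) (lift Omega z rho alpha y q) (w q)).
  by apply: ae_mp2 hw h4 => q _ Mw k; exact: k.
move=> /(_ a); rewrite e EwE; have := (hC0 w cw).2; rewrite ler_norml => /andP[_].
set K := IntO _; set P := psi _ _ _; clearbody K P; lra.
Qed.

Lemma coercive_E_l y : l2 y -> exists d C, 0 < d /\ forall w x, ctrl w -> l2 x -> Ew w x y <= C - d * nsq x.
Proof.
move=> ly; have hy := rT ly; have [b [beta [gamma [h1 h2 h3 h4]]]] := A4_ae hy.
have [d [C [d0 hC]]] := coercive_bound n_gt0 oOmega bOmega hz alpha_gt0 h1 h2 h3.
have [C0 hC0] := base_bound.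
exists d, (C + C0 + 2^-1 * nsq y); split => // w x cw lx; have hx := rT lx.
have [l e] := psi_int cw hx hy.
have hw : aeO (fun q => M (w q)) by case: cw.
have := hC _ _ (fun q => - G q (lift Omega z rho alpha x q) (lift Omega z rho alpha y q) (w q)) hx (L1N mO l).
have a : aeO (fun q => - b * `|lift Omega z rho alpha x q| ^+ 2 - beta q * lift Omega z rho alpha x q - gamma q <=
  - G q (lift Omega z rho alpha x q) (lift Omega z rho alpha y q) (w q)).
  by apply: ae_mp2 hw h4 => q _ Mw k; exact: k.
move=> /(_ a); rewrite (intN mO l) e EwE; have := (hC0 w cw).2; rewrite ler_norml => /andP[+ _].
set K := IntO _; set P := psi _ _ _; clearbody K P; lra.
Qed.

Definition saddle w x y := [/\ l2 x, l2 y &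
  forall x' y', l2 x' -> l2 y' -> Ew w x' y <= Ew w x y'].

Lemma saddle_ex w : ctrl w -> exists x y, saddle w x y.
Proof.
move=> cw; have [d [C [d0 hC]]] := coercive_E_r l2_0.
apply: (@saddle_exists R (psi (hw w)) _ _ _ _ d C d0).
- move=> X x Y y wX wY.
  exact: (psi_cvg n_gt0 oOmega bOmega hz alpha_gt0 alpha_lt2 alphan r2 rsub c0 (hnem cw) wX wY).
- by move=> t x x' y lx lx' ly t01; exact: concave_E.
- by move=> t x y y' lx ly ly' t01; exact: convex_E.
- move=> y ly; have [d' [C' [d'0 hC']]] := coercive_E_l ly; exists d', C'; split => // x lx; exact: hC'.
- by move=> y ly; exact: hC.
Qed.

(** For integrands written with [derive1], which agree with the explicit derivatives only almost
    everywhere: completeness provides their measurability. *)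
Lemma eq_int_complete (f g : V -> R) : measurable_fun D (f : Rn R n -> R) -> aeO (fun x => f x = g x) ->
  IntO f = IntO g.
Proof.
move=> mf fg; apply: (eq_int_ae mO) => //; apply/measurable_EFinP.
have e : ae_eq mu D (EFin \o f) (EFin \o g) by apply: ae_mp fg => x _ /= ->.
by apply: (ae_measurable_fun cmu e); exact/measurable_EFinP.
Qed.

Lemma derive1_G w u v : ctrl w ->
  aeO (fun x => derive1 (fun t => G x t (v x) (w x)) (u x) = Gu G1 G2 x (u x) (v x) (w x)) /\
  aeO (fun x => derive1 (fun t => G x (u x) t (w x)) (v x) = Gv G1 G2 x (u x) (v x) (w x)).
Proof.
move=> cw; split; apply: ae_mp (is_derive_G hA1) => x _ /(_ (u x) (v x) (w x))[[d1 e1] [d2 e2]].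
  exact: etrans (derive1E _ _) e1.
exact: etrans (derive1E _ _) e2.
Qed.

Let rmeas x u : rep x u -> measurable_fun D u. Proof. by move=> [_ [[]]]. Qed.

Lemma weak_derivatives w u v x y g gg : ctrl w -> rep x u -> rep y v -> rep g gg ->
  integ Omega (fun q => derive1 (fun t => G q t (v q) (w q)) (u q) * gg q) =
    IntO (fun q => Gu G1 G2 q (u q) (v q) (w q) * gg q) /\
  integ Omega (fun q => derive1 (fun t => G q (u q) t (w q)) (v q) * gg q) =
    IntO (fun q => Gv G1 G2 q (u q) (v q) (w q) * gg q).
Proof.
move=> cw hx hy hg; have [e1 e2] := derive1_G u v cw; have [_ su sv _] := hnem cw.
split; apply: esym; apply: eq_int_complete.
- by apply: measurable_funM; [exact: su (rmeas hx) (rmeas hy)|exact: rmeas hg].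
- by apply: ae_mp e1 => q _ ->.
- by apply: measurable_funM; [exact: sv (rmeas hx) (rmeas hy)|exact: rmeas hg].
- by apply: ae_mp e2 => q _ ->.
Qed.

Lemma psi_neg_swap w x y : ctrl w -> l2 x -> l2 y ->
  psi (fun q a b => - G q b a (w q)) y x = - psi (hw w) x y.
Proof.
move=> cw lx ly; have hx := rT lx; have hy := rT ly; have z0 := Lr_cst mO fO r 0.
have l := nem_L1 mO fO c0 r1 (hnem cw) (rLr hx) z0 (rLr hy) z0.
by rewrite !psiE /Psi -(intN mO l); apply: eq_int => q _; ring.
Qed.

Let nemS w (cw : ctrl w) := nemN (nem_swap (hnem cw)).

(** A saddle point minimizes the energy in y and, after a change of sign and an exchange of the
    variables, also in x. [critical_of_min] applies to both, with [nemS] for the second. *)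
Lemma saddle_weak w x y u v : ctrl w -> saddle w x y -> rep x u -> rep y v ->
  weak_solution Omega z rho alpha G1 G2 u v w.
Proof.
move=> cw [lx ly sad] hx hy.
have HH x'' f : rep x'' f -> H f by move=> h; apply/(HfracP alpha n_gt0 oOmega bOmega hz); exists x''.
split; [exact: HH hx|exact: HH hy|move=> g h /(HfracP alpha n_gt0 oOmega bOmega hz)[xg hg]
  /(HfracP alpha n_gt0 oOmega bOmega hz)[xh hh]].
have [dg _] := weak_derivatives cw hx hy hg; have [_ dh] := weak_derivatives cw hx hy hh.
rewrite dg dh; split; last first.
  apply: (critical_of_min n_gt0 oOmega bOmega hz alpha_gt0 alpha_lt2 alphan r2 rsub c0 (hnem cw) hx hy _ hh).
  by move=> y' ly'; have := sad x y' lx ly'; rewrite !EwE; exact: cancel_mid.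
have := critical_of_min n_gt0 oOmega bOmega hz alpha_gt0 alpha_lt2 alphan r2 rsub c0 (nemS cw) hy hx _ hg.
have -> : IntO (fun q => - Gu G1 G2 q (u q) (v q) (w q) * g q) = - IntO (fun q => Gu G1 G2 q (u q) (v q) (w q) * g q).
  have [l _] := gateaux mO fO c0 r1 (hnem cw) (rLr hx) (rLr hy) (rLr hg) (@exp_half_cvg0 R) (@half_pow_bounds R).
  by rewrite -(intN mO l); apply: eq_int => q _; rewrite mulNr.
move=> h0; apply/eqP; rewrite -oppr_eq0 opprD opprK; apply/eqP; apply: h0 => x' lx'.
rewrite (psi_neg_swap cw lx ly) (psi_neg_swap cw lx' ly).
by have := sad x' y lx' ly; rewrite !EwE; exact: cancel_midN.
Qed.

(** Each of the two equations becomes an extremality property through convexity or concavity;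
    combined, they form the saddle inequality. *)
Lemma weak_saddle w u v : ctrl w -> weak_solution Omega z rho alpha G1 G2 u v w ->
  exists x y, [/\ rep x u, rep y v & saddle w x y].
Proof.
move=> cw [/(HfracP alpha n_gt0 oOmega bOmega hz)[x hx] /(HfracP alpha n_gt0 oOmega bOmega hz)[y hy] ws].
have lx : l2 x := hx.1; have ly : l2 y := hy.1.
have HH x'' f : rep x'' f -> H f by move=> h; apply/(HfracP alpha n_gt0 oOmega bOmega hz); exists x''.
have k1 y' : l2 y' -> Ew w x y <= Ew w x y'.
  move=> ly'; rewrite !EwE; apply: uncancel_mid.
  apply: (min_of_critical n_gt0 oOmega bOmega hz alpha_gt0 alpha_lt2 alphan r2 rsub c0 (hnem cw) hx hy _ _ ly').
    move=> t y2 ly2 t01; have := convex_E cw lx ly ly2 t01; rewrite !EwE; exact: convex_cancel.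
  move=> xg g hg; have [_] := ws g g (HH _ _ hg) (HH _ _ hg).
  by have [_ ->] := weak_derivatives cw hx hy hg.
have k2 x' : l2 x' -> Ew w x' y <= Ew w x y.
  move=> lx'; rewrite !EwE; apply: uncancel_midN.
  suff : 2^-1 * nsq x + psi (fun q a b => - G q b a (w q)) y x <= 2^-1 * nsq x' + psi (fun q a b => - G q b a (w q)) y x'.
    by rewrite (psi_neg_swap cw lx ly) (psi_neg_swap cw lx' ly).
  apply: (min_of_critical n_gt0 oOmega bOmega hz alpha_gt0 alpha_lt2 alphan r2 rsub c0 (nemS cw) hy hx _ _ lx').
    move=> t x2 lx2 t01; rewrite (psi_neg_swap cw lx ly) (psi_neg_swap cw lx2 ly).
    rewrite (psi_neg_swap cw (l2_comb (1 - t) t lx lx2) ly).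
    by have := concave_E cw lx lx2 ly t01; rewrite !EwE; exact: concave_cancel.
  move=> xg g hg; have [+ _] := ws g g (HH _ _ hg) (HH _ _ hg).
  have [-> _] := weak_derivatives cw hx hy hg.
  have -> : IntO (fun q => - Gu G1 G2 q (u q) (v q) (w q) * g q) = - IntO (fun q => Gu G1 G2 q (u q) (v q) (w q) * g q).
    have [l _] := gateaux mO fO c0 r1 (hnem cw) (rLr hx) (rLr hy) (rLr hg) (@exp_half_cvg0 R) (@half_pow_bounds R).
    by rewrite -(intN mO l); apply: eq_int => q _; rewrite mulNr.
  move=> h0; apply/eqP; rewrite -oppr_eq0 opprD opprK; exact/eqP.
exists x, y; split; [exact: hx|exact: hy|split; [exact: lx|exact: ly|]].
by move=> x' y' lx' ly'; exact: le_trans (k2 x' lx') (k1 y' ly').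
Qed.

Lemma admissible_saddle u v w : admissible Omega z rho alpha p M G1 G2 u v w <->
  ctrl w /\ exists x y, [/\ rep x u, rep y v & saddle w x y].
Proof.
split=> [[/controls_ctrl cw ws]|[cw [x [y [hx hy hs]]]]]; first by split; [exact: cw|exact: weak_saddle].
by split; [exact: ctrl_controls|exact: saddle_weak hs hx hy].
Qed.

Hypothesis hMconvex : @convex_set R W M.

(** * Passage to the limit *)

Lemma dot_mid (v f g : W) : dot v (2^-1 *: f + 2^-1 *: g) = 2^-1 * dot v f + 2^-1 * dot v g.
Proof.
rewrite /dot !mulr_sumr -big_split /=; apply: eq_bigr => i _; rewrite !mxE; ring.
Qed.

Lemma psi_mid f g x y : ctrl f -> ctrl g -> l2 x -> l2 y ->
  psi (hw (mid f g)) x y = 2^-1 * psi (hw f) x y + 2^-1 * psi (hw g) x y.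
Proof.
move=> cf cg lx ly; have z0 := Lr_cst mO fO r 0.
have lf := nem_L1 mO fO c0 r1 (hnem cf) (rLr (rT lx)) z0 (rLr (rT ly)) z0.
have lg := nem_L1 mO fO c0 r1 (hnem cg) (rLr (rT lx)) z0 (rLr (rT ly)) z0.
rewrite !psiE /Psi -(intZ mO _ lf) -(intZ mO _ lg) -(intD mO (L1Z mO _ lf) (L1Z mO _ lg)).
by apply: eq_int => q _; rewrite /Defs.G /mid !dot_mid; field.
Qed.

Lemma psi_ctrl_cvg (f : nat -> V -> W) g x y : (forall j, ctrl (f j)) -> ctrl g ->
  aeO (fun q => (fun j => f j q) @ \oo --> g q) -> l2 x -> l2 y ->
  (fun j => psi (hw (f j)) x y) @ \oo --> psi (hw g) x y.
Proof.
move=> cf cg fg lx ly; have z0 := Lr_cst mO fO r 0; have lu := rLr (rT lx); have lv := rLr (rT ly).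
pose u : Rn R n -> R := lift Omega z rho alpha x; pose v : Rn R n -> R := lift Omega z rho alpha y.
rewrite -/u in lu; rewrite -/v in lv.
have l w (cw : ctrl w) := nem_L1 mO fO c0 r1 (hnem cw) lu z0 lv z0.
have lA := Lr_dom mO fO r1 lu z0 lv z0.
have lw := LrD mO r1 (Lr_abs mO (LrB mO r1 lu z0)) (Lr_abs mO (LrB mO r1 lv z0)).
apply: (dct mO (fun j => L1_meas (l _ (cf j))) (L1_meas (l _ cg)) (L1Z mO (3 * c) (Lr_young mO r1 lA lw)) _ _).2.
  apply: ae_mp2 G_cvg fg => q _ k h.
  have cst (t : R) : (fun _ : nat => t) @ \oo --> t by exact: cvg_cst.
  by apply: cvgB; apply: k => //.
move=> j; case: (hnem (cf j)) => _ _ _; apply: ae_mp => q _ k.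
have := @nem_lip _ (Rn R n) R c r c0 r1 (hw (f j)) (huw (f j)) (hvw (f j)) q u (fun=> 0) v (fun=> 0) k.
by rewrite (ger0_norm (addr_ge0 (normr_ge0 _) (normr_ge0 _))) (ger0_norm (le_trans ler01 (dom_ge1 _ _ _ _ _))).
Qed.

(** Comparison with (0, 0): d nsq y - C <= Ew w 0 y <= Ew w x 0 <= C' - d' nsq x, with constants
    independent of w. *)
Lemma saddle_bound : exists C, forall w x y, ctrl w -> saddle w x y -> nsq x <= C /\ nsq y <= C.
Proof.
have [d [C [d0 h]]] := coercive_E_r (@l2_0 R); have [d' [C' [d'0 h']]] := coercive_E_l (@l2_0 R).
exists (`|C + C'| / d' + `|C + C'| / d) => w x y cw [lx ly sad].
exact: (sum_bound d0 d'0 (nsq_ge0 lx) (nsq_ge0 ly) (h w y cw ly) (sad _ _ (@l2_0 R) (@l2_0 R)) (h' w x cw lx)).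
Qed.

Section limit.
Variables (w : nat -> V -> W) (X Y : nat -> nat -> R) (x y : nat -> R) (a b : Real.sort R).
Hypothesis cw : forall k, ctrl (w k).
Hypothesis hs : forall k, saddle (w k) (X k) (Y k).
Hypothesis wX : wcvg X x.
Hypothesis wY : wcvg Y y.
Hypothesis nX : (fun k => nsq (X k)) @ \oo --> a.
Hypothesis nY : (fun k => nsq (Y k)) @ \oo --> b.
Variables (f : nat -> V -> W) (g : V -> W).
Hypothesis hf : forall j, hull w j (f j).
Hypothesis cg : ctrl g.
Hypothesis fg : aeO (fun q => (fun j => f j q) @ \oo --> g q).
Let cf j : ctrl (f j) := hull_ctrl hMconvex cw (hf j).
Let lx : l2 x := wcvg_l2 wX.
Let ly : l2 y := wcvg_l2 wY.

(* The saddle inequality is affine in the control, so it passes from the controls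
   w k to their midpoint hull and then to g. *)
Lemma limit_inequality x' y' : l2 x' -> l2 y' ->
  psi (hw g) x' y - psi (hw g) x y' <= 2^-1 * nsq x' + 2^-1 * nsq y' - 2^-1 * a - 2^-1 * b.
Proof.
move=> lx' ly'; set K := _ - _ - _; apply/ler_addgt0Pr => e e0; have e3 : 0 < e / 3 by rewrite divr_gt0.
have ps := psi_strong n_gt0 oOmega bOmega hz alpha_gt0 alpha_lt2 alphan r2 rsub c0.
(* N1 and N2 serve all the controls [w k] at once, because the rate in [psi_strong] is uniform over
   the integrands. *)
have [N1 h1] := ps _ _ _ _ (wcvg_cst lx') wY _ e3; have [N2 h2] := ps _ _ _ _ wX (wcvg_cst ly') _ e3.
have [N3 h3] := cvg_eps nX e3; have [N4 h4] := cvg_eps nY e3.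
pose N := maxn (maxn N1 N2) (maxn N3 N4).
have key k : (N <= k)%N -> psi (hw (w k)) x' y - psi (hw (w k)) x y' <= K + e.
  rewrite /N !geq_max => /andP[/andP[k1 k2] /andP[k3 k4]].
  have [_ _ /(_ x' y' lx' ly')] := hs k; rewrite !EwE => hk.
  have := saddle_pass hk (h1 _ k1 _ _ _ (hnem (cw k))) (h2 _ k2 _ _ _ (hnem (cw k))) (h3 _ k3) (h4 _ k4).
  by rewrite (_ : 3 * (e / 3) = e)//; field.
have khull := hull_ind_ctrl (P := fun w' => psi (hw w') x' y - psi (hw w') x y' <= K + e) hMconvex cw key.
have cc : (fun j => psi (hw (f j)) x' y - psi (hw (f j)) x y') @ \oo --> psi (hw g) x' y - psi (hw g) x y'.
  exact: (cvgB (psi_ctrl_cvg cf cg fg lx' ly) (psi_ctrl_cvg cf cg fg lx ly')).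
apply: (cvg_le_bound (N := N) cc) => j Nj; apply: khull; last exact: hull_le Nj (hf j).
by move=> f1 f2 c1 c2; rewrite (psi_mid c1 c2 lx' ly) (psi_mid c1 c2 lx ly'); exact: half_mix_le.
Qed.

Let nsq_limit Z (q : nat -> R) (l : Real.sort R) : wcvg Z q -> (fun k => nsq (Z k)) @ \oo --> l -> nsq q <= l.
Proof.
move=> wZ nZ; apply/ler_addgt0Pr => e e0; have [N hN] := nsq_wlsc wZ e0.
have cc : (fun k => - (nsq (Z k) + e)) @ \oo --> - (l + e).
  by apply: cvgN; apply: cvgD nZ _; exact: cvg_cst.
rewrite -lerN2; apply: (cvg_le_bound (N := N) cc) => k /hN; by rewrite lerN2.
Qed.

(* The choice x' = x and y' = y in [limit_inequality] forces the norms to converge. *)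
Lemma saddle_limit : [/\ saddle g x y, a = nsq x & b = nsq y].
Proof.
have h1 := nsq_limit wX nX; have h2 := nsq_limit wY nY; have := limit_inequality lx ly; rewrite subrr => h3.
have ea : a = nsq x by apply/eqP; rewrite eq_le h1 andbT; lra.
have eb : b = nsq y by apply/eqP; rewrite eq_le h2 andbT; lra.
split; [split; [exact: lx|exact: ly|]|exact: ea|exact: eb].
move=> x' y' lx' ly'; have := limit_inequality lx' ly'; rewrite !EwE ea eb.
set P := psi _ _ _; set Q := psi _ _ _; clearbody P Q; lra.
Qed.
End limit.

Variable theta : V -> R -> R -> R -> R -> W -> R.
Hypothesis theta_meas : forall u xi v zeta w, M w -> measurable_on Omega (fun x => theta x u xi v zeta w).
Hypothesis theta_cont : ae_on Omega (fun x =>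
  {within [set q : R * R * R * R * W | M q.2],
   continuous (fun q => theta x q.1.1.1.1 q.1.1.1.2 q.1.1.2 q.1.2 q.2)}).
Hypothesis theta_convex : forall u xi v zeta, ae_on Omega (fun x =>
  @convex_function R W M (theta x u xi v zeta)).
Variables s c' : Real.sort R.
Hypothesis s1 : 1 < s.
Hypothesis sr : s <= r.
Hypothesis c'0 : 0 < c'.
Hypothesis theta_growth : ae_on Omega (fun x => forall u xi v zeta w, M w ->
  `|theta x u xi v zeta w| <= c' * (1 + `|u| `^ s + `|xi| ^+ 2 + `|v| `^ s + `|zeta| ^+ 2)).
Local Notation cost := (cost Omega theta).
Local Notation JJ := (Defs.J Omega z rho alpha theta).
Local Notation adm := (admissible Omega z rho alpha p M G1 G2).

Lemma rep_state x y u v : rep x u -> rep y v -> state Omega r u (fl u) v (fl v).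
Proof.
move=> hx hy; split; [exact: rLr hx|exact: (rep_fl n_gt0 oOmega bOmega hz hx).1|exact: rLr hy|].
exact: (rep_fl n_gt0 oOmega bOmega hz hy).1.
Qed.

(** The states of admissible triples are saddle points, hence bounded in norm and, by the embedding,
    in L^r; the growth bound in (A6) then bounds J. *)
Lemma J_lower_bound : exists B, forall u v w, adm u v w -> B <= JJ u v w.
Proof.
have [C hC] := saddle_bound.
have [B hB] := energy_Lr n_gt0 oOmega bOmega hz alpha_gt0 alpha_lt2 alphan r2 rsub C.
exists (- (c' * (IntO (fun=> 3) + B + C + B + C))) => u v w /admissible_saddle[cw [x [y [hx hy sad]]]].
have st := rep_state hx hy; have [nx ny] := hC w x y cw sad.
have bb x' u' : rep x' u' -> nsq x' <= C -> Nr mu D r u' <= B.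
  move=> hx' nx'; have [e b'] := rep_energy n_gt0 oOmega bOmega hz hx'.
  by have [] := hB _ _ (conj e (fun N => le_trans (b' N) nx')).
have [[_ l1] [_ l2] [_ l3] [_ l4]] := st; have l0 := L1_cst (3 : R) mO fO.
have := cost_le oOmega bOmega hM0 hM theta_meas theta_cont s1 sr c'0 theta_growth st cw.
rewrite ler_norml => /andP[+ _]; apply: le_trans; rewrite lerN2; apply: ler_wpM2l; first exact: ltW.
rewrite /maj (intD mO (L1D mO (L1D mO (L1D mO l0 l1) l2) l3) l4) (intD mO (L1D mO (L1D mO l0 l1) l2) l3).
rewrite (intD mO (L1D mO l0 l1) l2) (intD mO l0 l1).
have e1 := fl_sqn n_gt0 oOmega bOmega hz hx; have e2 := fl_sqn n_gt0 oOmega bOmega hz hy.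
rewrite -[X in _ + X + _ + _ <= _]/(sqn mu D (fl u)) -[X in _ + X <= _]/(sqn mu D (fl v)) e1 e2.
exact: (lerD (lerD (lerD (lerD (lexx _) (bb _ _ hx nx)) nx) (bb _ _ hy ny)) ny).
Qed.

Lemma optimal_triple : exists u v w, adm u v w /\ forall u' v' w', adm u' v' w' -> JJ u v w <= JJ u' v' w'.
Proof.
(* The minimization runs over tuples that carry the coordinates along with the functions, so one
   application of [choice] yields all the data of the minimizing sequence. *)
pose T := ((nat -> R) * (nat -> R) * (V -> R) * (V -> R) * (V -> W))%type.
pose good (t : T) := [/\ ctrl t.2, rep t.1.1.1.1 t.1.1.2, rep t.1.1.1.2 t.1.2 & saddle t.2 t.1.1.1.1 t.1.1.1.2].
pose val (t : T) := JJ t.1.1.2 t.1.2 t.2.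
pose S := [set val t | t in good].
have [B hB] := J_lower_bound.
have goodA t : good t -> adm t.1.1.2 t.1.2 t.2.
  by move=> [h1 h2 h3 h4]; apply/admissible_saddle; split; [|exists t.1.1.1.1, t.1.1.1.2].
have lbS : lbound S B by move=> _ [t ht <-]; exact: hB (goodA t ht).
have S0 : S !=set0.
  have [w1 Mw1] := hM0; have c00 : ctrl (fun=> w1) by split; [by move=> i; exact: measurable_cst|exact: aeP].
  have [x [y sad]] := saddle_ex c00; have [lx ly _] := sad.
  pose t0 : T := (x, y, lift Omega z rho alpha x, lift Omega z rho alpha y, fun=> w1).
  have g0 : good t0 by split; [exact: c00|exact: rT|exact: rT|exact: sad].
  exact: (ex_intro _ (val t0) (ex_intro2 _ _ t0 g0 erefl)).
have hS : has_inf S by split; [exact: S0|exists B; exact: lbS].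
pose I := inf S.
have hI u v w : adm u v w -> I <= JJ u v w.
  move=> /admissible_saddle[cw [x [y [hx hy sad]]]]; apply: ge_inf; first by exists B.
  by exists (x, y, u, v, w).
have /choice[t ht] : forall k : nat, exists t : T, good t /\ val t <= I + 2^-1 ^+ k.
  move=> k; have e0 : 0 < (2^-1 : R) ^+ k by rewrite exprn_gt0// invr_gt0.
  by have [_ [t ht <-] h] := inf_adherent e0 hS; exists t; split => //; exact: ltW.
have [C hC] := saddle_bound.
have bX k : l2 (t k).1.1.1.1 /\ nsq (t k).1.1.1.1 <= C.
  by have [[h1 h2 h3 h4] _] := ht k; have [? ? _] := h4; split => //; have [] := hC _ _ _ h1 h4.
have bY k : l2 (t k).1.1.1.2 /\ nsq (t k).1.1.1.2 <= C.
  by have [[h1 h2 h3 h4] _] := ht k; have [? ? _] := h4; split => //; have [] := hC _ _ _ h1 h4.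
have [sg [x [y [a [b [si wX wY nX nY]]]]]] := two_sequences_extract bX bY.
pose w k := (t (sg k)).2; pose X k := (t (sg k)).1.1.1.1; pose Y k := (t (sg k)).1.1.1.2.
pose U k := (t (sg k)).1.1.2; pose Z k := (t (sg k)).1.2.
have cw k : ctrl (w k) by case: (ht (sg k)) => -[].
have sk k : saddle (w k) (X k) (Y k) by case: (ht (sg k)) => -[].
have hU k : rep (X k) (U k) by case: (ht (sg k)) => -[].
have hZ k : rep (Y k) (Z k) by case: (ht (sg k)) => -[].
have [f [g [hf cg fg]]] := hull_limit oOmega bOmega hM hMconvex cw.
have [sad ea eb] := saddle_limit cw sk wX wY nX nY hf cg fg.
have lx := wcvg_l2 wX; have ly := wcvg_l2 wY; have hx := rT lx; have hy := rT ly.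
set u := lift Omega z rho alpha x in hx; set v := lift Omega z rho alpha y in hy.
exists u, v, g; split; first by apply/admissible_saddle; split => //; exists x, y.
move=> u' v' w' /hI; apply: le_trans.
have st := rep_state hx hy.
(* The norms converge by [saddle_limit], so the coefficients converge strongly, and with them the
   functions [fl]. *)
have strong (Q : nat -> nat -> R) q (F : nat -> V -> R) h : wcvg Q q -> (fun k => nsq (Q k)) @ \oo --> nsq q ->
    (forall k, rep (Q k) (F k)) -> rep q h -> (fun k => sqn mu D (fun x => fl (F k) x - fl h x)) @ \oo --> (0 : R).
  move=> wQ nQ hF hh; have := wcvg_strong wQ nQ.
  rewrite (_ : (fun k => nsq _) = (fun k => sqn mu D (fun x => fl (F k) x - fl h x)))// funeqE => k.
  have e1 := rep_fl n_gt0 oOmega bOmega hz (hF k); have e2 := rep_fl n_gt0 oOmega bOmega hz hh.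
  have e3 := expnB mO (z_L2 oOmega hz) e1 e2.
  rewrite (sqn_expn oOmega hz _ e3); last first.
    have := l2_comb 1 (-1) (hF k).1 hh.1; rewrite (_ : comb _ _ _ _ = (fun j => Q k j - q j))//.
    by rewrite funeqE => j; rewrite /comb mul1r mulN1r.
  by congr nsq; rewrite funeqE => j; rewrite /comb mul1r mulN1r.
rewrite ea in nX; rewrite eb in nY.
have rw := rep_wcvg n_gt0 oOmega bOmega hz alpha_gt0 alpha_lt2 alphan r2 rsub.
have cl := cost_close oOmega bOmega hM0 hM theta_meas theta_cont s1 sr r2 c'0 theta_growth
  (fun k => rep_state (hU k) (hZ k)) st cw (rw _ _ _ _ wX hU hx) (strong _ _ _ _ wX nX hU hx)
  (rw _ _ _ _ wY hZ hy) (strong _ _ _ _ wY nY hZ hy).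
apply/ler_addgt0Pr => e e0; have e2 : 0 < e / 2 by rewrite divr_gt0.
have [N1 h1] := cvg0_eps cl e2; have [N2 h2] := cvg0_eps (@exp_half_cvg0 R) e2.
pose N := maxn N1 N2.
(* The states are replaced by their limit while the controls are still the [w k]; convexity in the
   control can then be used at a fixed state. *)
have key k : (N <= k)%N -> cost u (fl u) v (fl v) (w k) <= I + e.
  rewrite geq_max => /andP[k1 k2]; have := h1 _ k1; rewrite ltr_norml => /andP[+ _].
  have := (ht (sg k)).2; rewrite -[val _]/(cost (U k) (fl (U k)) (Z k) (fl (Z k)) (w k)).
  have := le_lt_trans (ler_norm _) (h2 _ (leq_trans k2 (strictly_inc_ge si k))).
  by set A := cost _ _ _ _ _; set A' := cost _ _ _ _ _; clearbody A A'; lra.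
have khull := hull_ind_ctrl (P := fun w' => cost u (fl u) v (fl v) w' <= I + e) hMconvex cw key.
have cc := cost_cvg oOmega bOmega hM0 hM theta_meas theta_cont s1 sr c'0 theta_growth st
  (fun j => hull_ctrl hMconvex cw (hf j)) cg fg.
apply: (cvg_le_bound (N := N) cc) => j Nj; apply: khull; last exact: hull_le Nj (hf j).
move=> f1 f2 c1 c2 b1 b2.
apply: le_trans (cost_mid oOmega bOmega hM0 hM hMconvex theta_meas theta_cont theta_convex s1 sr c'0 theta_growth st c1 c2) _.
by move: b1 b2; set A := cost _ _ _ _ _; set A' := cost _ _ _ _ _; clearbody A A'; lra.
Qed.
End saddle_problem.

Theorem theorem2 (R : realType) (n m : nat) (Omega : set 'rV[R]_n)
    (z : nat -> 'rV[R]_n -> R) (rho : nat -> R) (alpha : R) (p : \bar R)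
    (M : set 'rV[R]_m)
    (G1 : 'rV[R]_n -> R -> R -> R) (G2 : 'rV[R]_n -> R -> R -> 'rV[R]_m)
    (theta : 'rV[R]_n -> R -> R -> R -> R -> 'rV[R]_m -> R)
    (hn : (3 <= n)%N)
    (hOmega : bounded_domain Omega) (hLip : lipschitz_boundary Omega)
    (hz : dirichlet_eigensystem Omega z rho)
    (halpha : 1 < alpha < 2)
    (hp : ((2 * n%:R / (n%:R + alpha))%:E < p)%E)
    (hM0 : M !=set0) (hMcompact : compact M)
    (hMconvex : @convex_set R 'rV[R]_m M)
    (hA1 : A1 Omega G1 G2)
    (hA2 : A2 Omega alpha p G1 G2)
    (hA3 : A3 Omega z rho alpha M G1 G2)
    (hA4 : A4 Omega z rho alpha M G1 G2)
    (hA5 : A5 Omega z rho alpha p M G1 G2)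
    (hA6 : A6 Omega alpha M theta)
    (hA7 : A7 Omega M theta) :
  exists u v w, admissible Omega z rho alpha p M G1 G2 u v w /\
    forall u' v' w', admissible Omega z rho alpha p M G1 G2 u' v' w' ->
      J Omega z rho alpha theta u v w <= J Omega z rho alpha theta u' v' w'.
Proof.
have [_ oOmega _ bOmega] := hOmega; have /andP[alpha_gt1 alpha_lt2] := halpha.
have n_gt0 : (0 < n)%N by apply: leq_trans hn.
have alpha_gt0 : 0 < alpha by apply: lt_trans alpha_gt1.
have alphan : alpha < n%:R by apply: lt_trans alpha_lt2 _; rewrite ltr_nat.
have alpha0n : 0 < alpha < n%:R by rewrite alpha_gt0.
have hpN : p != -oo%E by apply: contraTneq hp => ->; rewrite -leNgt leNye.
have [s [sc hs]] := nem_G oOmega hA1 alpha0n hp hMcompact hA2.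
have [t_meas t_cont t_convex [s' [c' [/andP[s'1 s'c] c'0 t_growth]]]] := hA6.
(* The dyadic estimates require an exponent of at least 2, and 2n/(n - alpha) > 2 leaves room for
   one. *)
have crit2 : 2 < @critical_exponent R n alpha.
  by rewrite /critical_exponent ltr_pdivlMr ?subr_gt0//; lra.
(* A single subcritical exponent for the embedding, for G and for theta. *)
pose r := Num.max 2 (Num.max s s').
have r2 : 2 <= r by rewrite le_max lexx.
have sr : s <= r by rewrite !le_max lexx orbT.
have s'r : s' <= r by rewrite !le_max lexx !orbT.
have rc : r < @critical_exponent R n alpha by rewrite !gt_max crit2 sc.
have r1 : 1 < r by apply: lt_le_trans r2; rewrite ltr1n.
have [c c0 hnem] := hs r sr r1.
exact: (optimal_triple n_gt0 oOmega bOmega hz alpha_gt0 alpha_lt2 alphan (p_gt1 alpha0n hp) hpN hM0 hMcompact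
  hA1 hA3 hA4 hA5 r2 rc c0 hnem hMconvex t_meas t_cont t_convex s'1 s'r c'0 t_growth).
Qed.
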